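(* Let $\alpha\in(0,+\infty)$ be fixed and let $\beta$ vary in a bounded subset of $(0,+\infty)$ having $0$ as an accumulation point. Assume: $\gamma\subseteq\mathbb{R}\times\mathbb{R}$ is a maximal monotone graph with $\gamma(0)\ni 0$; $\phi:\mathbb{R}\to[0,+\infty]$ is convex and lower semicontinuous with $\phi(0)=0$ and $\partial\phi=\gamma$; $g:\mathbb{R}\to\mathbb{R}$ is Lipschitz-continuous; $f\in L^2(0,T;H^1(\Omega)')+L^1(0,T;L^2(\Omega))$, $w_0\in H^1(\Omega)$, $v_0\in L^2(\Omega)$, $u_0\in L^2(\Omega)$, $\phi(u_0)\in L^1(\Omega)$; and, for each $\beta$, $f_\beta\in L^2(0,T;H^1(\Omega)')+L^1(0,T;L^2(\Omega))$, $w_{0,\beta}\in H^1(\Omega)$, $v_{0,\beta}\in L^2(\Omega)$, $u_{0,\beta}\in L^2(\Omega)$, $\phi(u_{0,\beta})\in L^1(\Omega)$. Suppose that, as $\beta\searrow 0$, $$f_\beta\rightharpoonup f\quad\text{in } L^2(0,T;H^1(\Omega)')+L^1(0,T;L^2(\Omega)),$$ $$w_{0,\beta}\rightharpoonup w_0\ \text{ in } H^1(\Omega),\qquad v_{0,\beta}\rightharpoonup v_0,\quad u_{0,\beta}\rightharpoonup u_0\ \text{ in } L^2(\Omega),$$ and that, for some constant $c$ independent of $\beta$, $$\|f_\beta-f\|_{L^2(0,T;H^1(\Omega)')+L^1(0,T;L^2(\Omega))}\le c\,\beta,$$ $$\|w_{0,\beta}-w_0\|_{H^1(\Omega)}+\|v_{0,\beta}-v_0\|_{H^1(\Omega)'}+\|u_{0,\beta}-u_0\|_{L^2(\Omega)}\le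 c\,\beta.$$ Let $(w_\beta,u_\beta,\xi_\beta)$ be the solution of Problem $(\mathbf{P}_{\alpha,\beta})$ with data $f_\beta,w_{0,\beta},v_{0,\beta},u_{0,\beta}$, and let $(w,u,\xi)$ be the solution of Problem $(\mathbf{P}_{\alpha})$ with data $f,w_0,v_0,u_0$. Then there is a constant $c$, not depending on $\beta$, such that $$\|w_\beta-w\|_{H^1(0,T;L^2(\Omega))\cap L^\infty(0,T;H^1(\Omega))}+\|u_\beta-u\|_{L^\infty(0,T;L^2(\Omega))\cap L^2(0,T;H^1(\Omega))}\le c\,\beta.$$
   Context: $\Omega\subseteq\mathbb{R}^3$ is a bounded smooth domain with boundary $\Gamma=\partial\Omega$, $T>0$, and $Q=\Omega\times(0,T)$. $L^2(\Omega)$ is embedded in $H^1(\Omega)'$ by $\langle y,v\rangle=(y,v)_{L^2(\Omega)}$ for $y\in L^2(\Omega)$, $v\in H^1(\Omega)$, where $\langle\cdot,\cdot\rangle$ is the duality pairing between $H^1(\Omega)'$ and $H^1(\Omega)$. $D(\gamma)$ denotes the effective domain of $\gamma$, and subscripts $t$ denote time derivatives. The symbol $\rightharpoonup$ denotes weak convergence. Sums and intersections of Banach spaces carry their usual norms. For a parameter $\beta>0$, Problem $(\mathbf{P}_{\alpha,\beta})$ with data $f,w_0,v_0,u_0$ is: find $(w,u,\xi)$ satisfying (i) $w\in W^{1,\infty}(0,T;L^2(\Omega))\cap H^1(0,T;H^1(\Omega))$ and $w_{tt}\in L^1(0,T;H^1(\Omega)')$; (ii) $u\in H^1(0,T;H^1(\Omega)')\cap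 C^0([0,T];L^2(\Omega))\cap L^2(0,T;H^1(\Omega))$; (iii) $\xi\in L^2(Q)$, $u\in D(\gamma)$ and $\xi\in\gamma(u)$ a.e. in $Q$; (iv) $\langle w_{tt}(t),v\rangle+\alpha(\nabla w_t(t),\nabla v)_{L^2(\Omega)}+\beta(\nabla w(t),\nabla v)_{L^2(\Omega)}+\langle u_t(t),v\rangle=\langle f(t),v\rangle$ for all $v\in H^1(\Omega)$ and a.a. $t\in(0,T)$; (v) $\langle u_t(t),v\rangle+(\nabla u(t),\nabla v)_{L^2(\Omega)}+(\xi(t),v)_{L^2(\Omega)}+(g(u)(t),v)_{L^2(\Omega)}=(w_t(t),v)_{L^2(\Omega)}$ for all $v\in H^1(\Omega)$ and a.a. $t\in(0,T)$; (vi) $w(0)=w_0$ in $H^1(\Omega)$, $w_t(0)=v_0$ in $H^1(\Omega)'$, $u(0)=u_0$ in $L^2(\Omega)$. Problem $(\mathbf{P}_{\alpha})$ with data $f,w_0,v_0,u_0$ is the same problem with $\beta=0$ in (iv), i.e. without the term $\beta(\nabla w(t),\nabla v)_{L^2(\Omega)}$. Under the hypotheses of the claim both problems have a unique solution for the respective data. *)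

(* Defs.v *)
From HB Require Import structures.
From mathcomp Require Import all_boot all_order all_algebra.
From mathcomp Require Export all_classical all_reals all_analysis.

Set Implicit Arguments.
Unset Strict Implicit.
Unset Printing Implicit Defensive.

Import Order.TTheory GRing.Theory Num.Theory.
Import numFieldNormedType.Exports.

Local Open Scope classical_set_scope.
Local Open Scope ring_scope.

(* A normed function space inside an ambient vector space V.  Elements of [dom]
   are representatives, [nrm] is the norm of their class: two representatives
   are identified when their difference has norm 0.  [nrm] is only meaningful
   on [dom]. *)
Record nspace (R : realType) (V : lmodType R) :=
  NSpace { dom : set V ; nrm : V -> \bar R }.

Section nspaces.
Context {R : realType}.

Definition capS (V : lmodType R) (X Y : nspace V) : nspace V :=
  {| dom := dom X `&` dom Y ; nrm := fun x => (nrm X x + nrm Y x)%E |}.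

(* X + Y, where Y is carried into the ambient space of X by the embedding j *)
Definition sumS (V W : lmodType R) (X : nspace V) (Y : nspace W) (j : W -> V) :
    nspace V :=
  {| dom := [set z | exists x y, [/\ dom X x, dom Y y & z = x + j y]] ;
     nrm := fun z => ereal_inf [set r | exists x y,
       [/\ dom X x, dom Y y, z = x + j y & r = (nrm X x + nrm Y y)%E]] |}.

Definition dualS (V : lmodType R) (X : nspace V) : nspace (V -> R^o) :=
  {| dom := [set l : V -> R^o |
       (forall (a : R) (x y : V), dom X x -> dom X y ->
          l (a *: x + y) = a * l x + l y) /\
       (exists M : R, forall x, dom X x -> (`|l x|%:E <= M%:E * nrm X x)%E)] ;
     nrm := fun l => ereal_sup [set r | exists x,
       [/\ dom X x, (nrm X x <= 1)%E & r = `|l x|%:E]] |}.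

Definition weak_cvg (V : lmodType R) (X : nspace V) (I : Type)
    (F : set_system I) (xs : I -> V) (x : V) : Prop :=
  forall l, dom (dualS X) l -> (l (xs i) : R) @[i --> F] --> (l x : R).

End nspaces.

Section spatial.
Context {R : realType}.

Definition space3 : Type :=
  (measurableTypeR R * measurableTypeR R * measurableTypeR R)%type.

Definition leb1 : {measure set (measurableTypeR R) -> \bar R} :=
  @lebesgue_measure R.

Definition leb3 : {measure set space3 -> \bar R} := (leb1 \x leb1 \x leb1)%E.

Definition leb4 : {measure set (space3 * measurableTypeR R) -> \bar R} :=
  (leb3 \x leb1)%E.

Definition basis3 (i : 'I_3) : space3 :=
  ((i == 0%N :> nat)%:R, (i == 1%N :> nat)%:R, (i == 2%N :> nat)%:R).

Definition pderiv (i : 'I_3) (f : space3 -> R) : space3 -> R :=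
  fun x => 'D_(basis3 i) f x.

(* partial derivatives of all orders exist and are continuous *)
Definition smooth3 (f : space3 -> R) : Prop :=
  forall (s : seq 'I_3), continuous (foldr pderiv f s) /\
    forall (i : 'I_3) x, derivable (foldr pderiv f s) x (basis3 i).

(* The boundary is smooth: near each boundary point, Om is the set where a
   smooth function with nonzero gradient is negative. *)
Definition bounded_smooth_domain (Om : set space3) : Prop :=
  [/\ open Om, connected Om, Om !=set0, bounded_set Om &
    forall x0, (closure Om `\` Om) x0 -> exists rho : space3 -> R,
      [/\ smooth3 rho, exists i, pderiv i rho x0 != 0 &
          \forall x \near x0, Om x <-> rho x < 0]].

Definition test3 (Om : set space3) (phi : space3 -> R) : Prop :=
  [/\ smooth3 phi, compact (closure [set x | phi x != 0]) &
      closure [set x | phi x != 0] `<=` Om].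

(* L^p(D); functions are extended by 0 outside D in the norm, and only their
   values on D matter *)
Definition LpS d (S : measurableType d) (mu : {measure set S -> \bar R})
    (D : set S) (p : \bar R) : nspace (S -> R^o) :=
  let n (f : S -> R^o) := Lnorm mu p ((fun x => (f x : R)%:E) \_ D) in
  {| dom := [set f : S -> R^o | measurable_fun D (f : S -> R) /\ (n f < +oo)%E] ;
     nrm := n |}.

Context (Om : set space3).

Definition L2 : nspace (space3 -> R^o) := LpS leb3 Om 2%:E.

Definition ip (y v : space3 -> R) : R := \int[leb3]_(x in Om) (y x * v x).

Definition is_weak_pderiv (i : 'I_3) (v h : space3 -> R) : Prop :=
  forall phi, test3 Om phi -> ip v (pderiv i phi) = - ip h phi.

(* the weak derivative is unique up to a null set; xget picks a representative *)
Definition weak_pderiv (i : 'I_3) (v : space3 -> R^o) : space3 -> R^o :=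
  xget 0 [set h | dom L2 h /\ is_weak_pderiv i v h].

Definition H1 : nspace (space3 -> R^o) :=
  {| dom := [set v | dom L2 v /\
       forall i, exists h, dom L2 h /\ is_weak_pderiv i v h] ;
     nrm := fun v => sqrte (nrm L2 v ^+ 2
       + \sum_(i < 3) nrm L2 (weak_pderiv i v) ^+ 2)%E |}.

Definition ip_grad (y v : space3 -> R) : R :=
  \sum_(i < 3) ip (weak_pderiv i y) (weak_pderiv i v).

Definition H1' : nspace ((space3 -> R^o) -> R^o) := dualS H1.

(* the embedding of L^2 into the dual of H^1: <y,v> = (y,v)_{L^2} *)
Definition emb (y : space3 -> R^o) : (space3 -> R^o) -> R^o := fun v => ip y v.

End spatial.
Arguments space3 R : clear implicits.

Section bochner.
Context {R : realType} (T : R) (V : lmodType R) (X : nspace V).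

Definition ae_time (P : R -> Prop) : Prop :=
  {ae (@leb1 R), forall t : R, 0 < t < T -> P t}.

(* sum of step_val i on step_set i *)
Record step := Step {
  step_n : nat ;
  step_set : 'I_step_n -> set R ;
  step_val : 'I_step_n -> V }.

Definition step_fun (s : step) : R -> V :=
  fun t => \sum_(i < step_n s) (\1_(step_set i) t : R) *: step_val i.

Definition step_int (s : step) : V :=
  \sum_(i < step_n s) fine (leb1 (step_set i `&` `]0, T[)) *: step_val i.

Definition is_step (s : step) : Prop := forall i,
  measurable (@step_set s i) /\ dom X (@step_val s i).

Definition strongly_measurable (f : R -> V) : Prop :=
  exists s : nat -> step, (forall k, is_step (s k)) /\
    ae_time (fun t => nrm X (step_fun (s k) t - f t) @[k --> \oo] --> 0%E).

(* x is the Bochner integral of f over (0,T) *)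
Definition is_bochner_int (f : R -> V) (x : V) : Prop :=
  dom X x /\ exists s : nat -> step,
  [/\ forall k, is_step (s k),
      ae_time (fun t => nrm X (step_fun (s k) t - f t) @[k --> \oo] --> 0%E),
      (\int[leb1]_(t in `]0%R, T[%classic) nrm X (step_fun (s k) t - f t)%R)%E
        @[k --> \oo] --> 0%E &
      nrm X (step_int (s k) - x) @[k --> \oo] --> 0%E].

(* L^p(0,T;X) *)
Definition LpT (p : \bar R) : nspace (R -> V) :=
  let n (f : R -> V) := Lnorm leb1 p ((fun t => nrm X (f t)) \_ `]0, T[) in
  {| dom := [set f | [/\ ae_time (fun t => dom X (f t)),
                         strongly_measurable f & (n f < +oo)%E]] ;
     nrm := n |}.

Definition test1 (phi : R -> R) : Prop :=
  [/\ forall n x, derivable (derive1n n phi) x 1,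
      compact (closure [set t | phi t != 0]) &
      closure [set t | phi t != 0] `<=` `]0, T[].

(* g is the distributional derivative of f on (0,T), with values in X *)
Definition is_tderiv (f g : R -> V) : Prop := forall phi, test1 phi ->
  exists2 x, is_bochner_int (fun t => derive1 phi t *: f t) x &
             is_bochner_int (fun t => phi t *: g t) (- x).

Definition tderiv (f : R -> V) : R -> V :=
  xget 0 [set g | dom (LpT 1%E) g /\ is_tderiv f g].

(* W^{1,p}(0,T;X) *)
Definition W1pT (p : \bar R) : set (R -> V) :=
  [set f | dom (LpT p) f /\ exists g, dom (LpT p) g /\ is_tderiv f g].

(* H^1(0,T;X) *)
Definition H1T : nspace (R -> V) :=
  {| dom := W1pT 2%:E ;
     nrm := fun f => sqrte (nrm (LpT 2%:E) f ^+ 2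
                            + nrm (LpT 2%:E) (tderiv f) ^+ 2)%E |}.

(* C^0([0,T];X) *)
Definition C0T : set (R -> V) := [set f | forall t : R, 0 <= t <= T ->
  dom X (f t) /\
  nrm X (f s - f t) @[s --> within `[0, T] (nbhs t)] --> 0%E].

(* the continuous representative of f takes the value x0 at t = 0 *)
Definition initial_value (f : R -> V) (x0 : V) : Prop :=
  exists fc, [/\ C0T fc, ae_time (fun t => nrm X (fc t - f t) = 0%E) &
                 nrm X (fc 0 - x0) = 0%E].

End bochner.

Section graphs.
Context {R : realType}.

Definition monotone_graph (G : set (R * R)) : Prop :=
  forall p q, G p -> G q -> 0 <= (p.2 - q.2) * (p.1 - q.1).

Definition maximal_monotone (G : set (R * R)) : Prop :=
  monotone_graph G /\
  forall G' : set (R * R), monotone_graph G' -> G `<=` G' -> G' `<=` G.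

(* values in [0,+oo] are intended, with the convention 0 * +oo = 0 *)
Definition convex_ereal (phi : R -> \bar R) : Prop :=
  forall x y t : R, 0 <= t <= 1 ->
  (phi (t * x + (1 - t) * y)%R <= t%:E * phi x + (1 - t)%:E * phi y)%E.

(* graph of the subdifferential of a proper phi *)
Definition subdifferential (phi : R -> \bar R) : set (R * R) :=
  [set p | forall z : R, (phi p.1 + (p.2 * (z - p.1))%:E <= phi z)%E].

Definition graph_dom (G : set (R * R)) : set R := [set x | exists y, G (x, y)].

End graphs.

Section problem.
Context {R : realType} (Om : set (space3 R)) (T : R).

(* L^2(0,T;H^1(Om)') + L^1(0,T;L^2(Om)) *)
Definition source_space : nspace (R -> (space3 R -> R^o) -> R^o) :=
  sumS (LpT T (H1' Om) 2%:E) (LpT T (L2 Om) 1%E) (fun h t => emb Om (h t)).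

Definition cylinder : set (space3 R * measurableTypeR R) := Om `*` `]0, T[.

Definition L2Q : nspace (space3 R * measurableTypeR R -> R^o) :=
  LpS leb4 cylinder 2%:E.

(* The problem P_{alpha,beta}; beta = 0 gives P_alpha.  In the inclusion, the
   null set excluded from the cylinder makes the condition meaningful whether
   or not the representative t |-> u t is jointly measurable; every solution
   class has a representative for which it is.  The time derivatives are
   classes modulo null sets of times, selected by [tderiv]. *)
Definition solution (alpha beta : R) (gamma : set (R * R)) (g : R -> R)
    (f : R -> (space3 R -> R^o) -> R^o) (w0 v0 u0 : space3 R -> R^o)
    (w u : R -> space3 R -> R^o)
    (xi : space3 R * measurableTypeR R -> R^o) : Prop :=
  let wt := tderiv T (H1 Om) w in
  let wtt := tderiv T (H1' Om) (fun t => emb Om (wt t)) in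
  let ut := tderiv T (H1' Om) (fun t => emb Om (u t)) in
  [/\ [/\ W1pT T (L2 Om) +oo%E w, dom (H1T T (H1 Om)) w &
          W1pT T (H1' Om) 1%E (fun t => emb Om (wt t))],
      [/\ dom (H1T T (H1' Om)) (fun t => emb Om (u t)), C0T T (L2 Om) u &
          dom (LpT T (H1 Om) 2%:E) u],
      dom L2Q xi /\
      {ae leb4, forall z, cylinder z ->
         graph_dom gamma (u z.2 z.1) /\ gamma (u z.2 z.1, xi z)},
      (forall v, dom (H1 Om) v -> ae_time T (fun t =>
         wtt t v + alpha * ip_grad Om (wt t) v + beta * ip_grad Om (w t) v
         + ut t v = f t v)) /\
      (forall v, dom (H1 Om) v -> ae_time T (fun t =>
         ut t v + ip_grad Om (u t) v + ip Om (fun x => xi (x, t)) v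
         + ip Om (fun x => g (u t x)) v = ip Om (wt t) v)) &
      [/\ initial_value T (H1 Om) w w0,
          initial_value T (H1' Om) (fun t => emb Om (wt t)) (emb Om v0) &
          nrm (L2 Om) (u 0 - u0) = 0%E]].

End problem.

(* Main.v *)
(* Subtract the two problems and put W = w_beta - w, U = u_beta - u.  Integrated in
   time, the first equation reads (W', v) + alpha (grad W, grad v) + (U, v) = Lambda(t) v,
   where Lambda collects the errors of the initial data and of the source and the
   term beta grad w_beta, all of size O(beta) (1 + |W|).  Testing it with W' and the
   second equation with U, the coupling terms (U, W') cancel, monotonicity of gamma
   discards xi_beta - xi, and Lambda(W') is integrated by parts in time; Gronwall's
   lemma bounds alpha/2 |grad W|^2 + |U|^2/2 + int |W'|^2 + int |grad U|^2 by O(beta^2).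
   The chain rule for |U|^2 is replaced by a comparison of two nearby times: U(t) lies
   in H^1 for almost every t and is a legitimate frozen test function, and approximating
   U by step functions in L^2(0,T;H^1) makes the resulting error in the gradient term
   vanish in the mean as the time step tends to 0. *)

Require Import Defs.
From HB Require Import structures.
From mathcomp Require Import all_boot all_order all_algebra.
From mathcomp Require Import all_classical all_reals all_analysis.
From mathcomp Require Import measurable_realfun ring lra.

Set Implicit Arguments.
Unset Strict Implicit.
Unset Printing Implicit Defensive.

Import Order.TTheory GRing.Theory Num.Theory.
Import numFieldNormedType.Exports.

Local Open Scope classical_set_scope.
Local Open Scope ring_scope.


(** * Seminormed spaces and Bochner integrals *)

(** For each test function v the equations hold off a null set of times depending on v, while W'(t)
    and U(t) are test functions that vary with t. Integration in time removes this dependence: the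
    integrated equations hold at all times for every v simultaneously, and only then are they tested
    with functions of t. The values of W' lie in H1, so the first equation can be tested at almost
    every time. U, however, has a time derivative only in the dual of H1, which is the obstacle to
    differentiating |U|^2 directly. Elements are representatives, norms are meaningful only on
    [dom], and time derivatives are chosen by [xget], so t |-> |f(t)| need not be measurable.
    Time-dependent objects are therefore replaced by everywhere strongly measurable representatives,
    and vector identities are reduced to scalar ones by continuous functionals. The source error is
    merely integrable in time, with integral O(beta). To keep the final bound linear in beta, its
    density divided by beta is put in the exponent of Gronwall's lemma, where its integral stays
    bounded. *)

Section integral_ae.
Context d (S : measurableType d) {R : realType} (mu : {measure set S -> \bar R}).
Import HBNNSimple.
Local Open Scope ereal_scope.

(* No measurability of the dominating function is assumed: the integral of a
   nonnegative function is a supremum over simple functions below it. *)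
Lemma ae_ge0_le_integral_nonmeas (D : set S) (f1 f2 : S -> \bar R) :
  measurable D -> measurable_fun D f1 ->
  (forall x, D x -> 0 <= f1 x) -> (forall x, D x -> 0 <= f2 x) ->
  {ae mu, forall x, D x -> f1 x <= f2 x} ->
  \int[mu]_(x in D) f1 x <= \int[mu]_(x in D) f2 x.
Proof.
move=> mD mf1 f10 f20 [N [mN N0 sub]].
rewrite (ge0_negligible_integral mN mD mf1 f10 N0).
rewrite [leLHS]ge0_integralE; last by move=> x [/f10].
rewrite [leRHS]ge0_integralE//; apply: le_ereal_sup => _ [h hf <-]; exists h => // x.
apply: (le_trans (hf x)); rewrite /patch.
case: ifPn => [|_]; last first.
  by case: ifPn => // /[!inE] /f20.
rewrite inE => -[Dx Nx]; rewrite mem_set//.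
by apply: contrapT => f12; apply: Nx; apply: sub => /(_ Dx)/f12.
Qed.

(** Only [g] is measurable. A simple function below [f] on D is almost everywhere below [g], so the
    supremum defining the integral of [f] cannot exceed the integral of [g]. This allows the norm of
    an arbitrary representative to be integrated. *)
Lemma ae_ge0_eq_integral_nonmeas (D : set S) (f g : S -> \bar R) :
  measurable D -> measurable_fun D g ->
  (forall x, D x -> 0 <= f x) -> (forall x, D x -> 0 <= g x) ->
  {ae mu, forall x, D x -> f x = g x} ->
  \int[mu]_(x in D) f x = \int[mu]_(x in D) g x.
Proof.
move=> mD mg f0 g0 fg; apply/eqP; rewrite eq_le; apply/andP; split; last first.
  by apply: ae_ge0_le_integral_nonmeas => //; apply: filterS fg => x fg /fg ->.
rewrite [leLHS]ge0_integralE//; apply: ge_ereal_sup => _ [h hf <-].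
(* Off D the restricted [f] is 0, so [h], lying between 0 and it, vanishes there. *)
have hD : h \_ D = h.
  apply/funext => x; rewrite /patch; case: ifPn => // xD.
  have := hf x; rewrite /patch (negbTE xD) lee_fin => h0.
  by apply/eqP; rewrite eq_le h0 fun_ge0.
rewrite -hD -integral_nnsfun//.
apply: ae_ge0_le_integral => //.
- by move=> x _; rewrite lee_fin fun_ge0.
- by apply/measurable_EFinP; exact: measurable_funTS.
- apply: filterS fg => x fg Dx; rewrite -(fg Dx).
  by have := hf x; rewrite /patch mem_set.
Qed.

End integral_ae.

(* The norm need not separate points of [dom X]. *)
Record snormed (R : realType) (V : lmodType R) (X : nspace V) : Prop := Snormed {
  sn_dom0 : dom X 0 ;
  sn_domP : forall (a : R) x y, dom X x -> dom X y -> dom X (a *: x + y) ;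
  sn_ge0 : forall x, (0 <= nrm X x)%E ;
  sn_fin : forall x, dom X x -> nrm X x \is a fin_num ;
  sn_triangle : forall x y, dom X x -> dom X y -> (nrm X (x + y) <= nrm X x + nrm X y)%E ;
  sn_homo : forall a x, dom X x -> (nrm X (a *: x) = `|a|%:E * nrm X x)%E }.

Definition fnrm (R : realType) (V : lmodType R) (X : nspace V) (x : V) : R :=
  fine (nrm X x).

Section snormed_theory.
Context {R : realType} {V : lmodType R} (X : nspace V) (sX : snormed X).

Lemma dom_add x y : dom X x -> dom X y -> dom X (x + y).
Proof. by move=> dx dy; rewrite -[x]scale1r; apply: (sn_domP sX). Qed.

Lemma dom_scale a x : dom X x -> dom X (a *: x).
Proof. by move=> dx; rewrite -[_ *: _]addr0; apply: (sn_domP sX) => //; exact: sn_dom0. Qed.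

Lemma dom_opp x : dom X x -> dom X (- x).
Proof. by move=> dx; rewrite -scaleN1r; exact: dom_scale. Qed.

Lemma dom_sub x y : dom X x -> dom X y -> dom X (x - y).
Proof. by move=> dx dy; apply: dom_add => //; exact: dom_opp. Qed.

Lemma dom_sum I (r : seq I) (P : pred I) (F : I -> V) :
  (forall i, P i -> dom X (F i)) -> dom X (\sum_(i <- r | P i) F i).
Proof.
by move=> dF; elim/big_rec: _ => [|i x Pi dx]; [exact: sn_dom0|apply: dom_add => //; exact: dF].
Qed.

Lemma nrmE x : dom X x -> nrm X x = (fnrm X x)%:E.
Proof. by move=> dx; rewrite /fnrm fineK//; exact: sn_fin. Qed.

Lemma fnrm_ge0 x : 0 <= fnrm X x.
Proof. by rewrite fine_ge0//; exact: sn_ge0. Qed.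

Lemma fnrmZ a x : dom X x -> fnrm X (a *: x) = `|a| * fnrm X x.
Proof. by move=> dx; rewrite /fnrm sn_homo// nrmE. Qed.

Lemma fnrm0 : fnrm X 0 = 0.
Proof. by rewrite -(scale0r (0 : V)) fnrmZ ?normr0 ?mul0r//; exact: sn_dom0. Qed.

Lemma fnrmN x : dom X x -> fnrm X (- x) = fnrm X x.
Proof. by move=> dx; rewrite -scaleN1r fnrmZ// normrN normr1 mul1r. Qed.

Lemma fnrmD x y : dom X x -> dom X y -> fnrm X (x + y) <= fnrm X x + fnrm X y.
Proof.
move=> dx dy; rewrite -lee_fin EFinD -!nrmE//; first exact: sn_triangle.
exact: dom_add.
Qed.

Lemma fnrmB x y : dom X x -> dom X y -> fnrm X (x - y) <= fnrm X x + fnrm X y.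
Proof. by move=> dx dy; rewrite -[in leRHS](fnrmN dy); apply: fnrmD => //; exact: dom_opp. Qed.

Lemma fnrmBC x y : dom X x -> dom X y -> fnrm X (x - y) = fnrm X (y - x).
Proof. by move=> dx dy; rewrite -[in LHS]opprB fnrmN//; exact: dom_sub. Qed.

Lemma ler_dist_fnrm x y : dom X x -> dom X y -> `|fnrm X x - fnrm X y| <= fnrm X (x - y).
Proof.
move=> dx dy; rewrite ler_norml; apply/andP; split.
  rewrite lerNl opprB lerBlDr -(fnrmBC dy dx) -[in leLHS](subrK x y).
  by apply: fnrmD => //; exact: dom_sub.
by rewrite lerBlDr -[in leLHS](subrK y x); apply: fnrmD => //; exact: dom_sub.
Qed.

Lemma cvg_nrm_fnrm (I : Type) (F : set_system I) (FF : Filter F) (x : I -> V) :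
  (forall i, dom X (x i)) -> nrm X (x i) @[i --> F] --> 0%E ->
  fnrm X (x i) @[i --> F] --> 0.
Proof.
move=> dx; under eq_fun do rewrite nrmE//.
by move=> /fine_cvgP[].
Qed.

Section functional.
Context (l : V -> R^o) (dl : dom (dualS X) l).

Lemma functP (a : R) x y : dom X x -> dom X y -> l (a *: x + y) = a * l x + l y.
Proof. by case: dl => + _; apply. Qed.

Lemma funct0 : l 0 = 0.
Proof.
have d0 := sn_dom0 sX.
have := @functP 1 0 0 d0 d0; rewrite scale1r addr0 mul1r => /eqP.
by rewrite -subr_eq0 opprD addNKr oppr_eq0 => /eqP.
Qed.

Lemma functD x y : dom X x -> dom X y -> l (x + y) = l x + l y.
Proof. by move=> dx dy; rewrite -[x]scale1r functP// mul1r scale1r. Qed.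

Lemma functZ a x : dom X x -> l (a *: x) = a * l x.
Proof. by move=> dx; rewrite -[_ *: _]addr0 functP ?funct0 ?addr0//; exact: sn_dom0. Qed.

Lemma functN x : dom X x -> l (- x) = - l x.
Proof. by move=> dx; rewrite -scaleN1r functZ// mulN1r. Qed.

Lemma functB x y : dom X x -> dom X y -> l (x - y) = l x - l y.
Proof. by move=> dx dy; rewrite functD// ?functN//; exact: dom_opp. Qed.

Lemma funct_sum I (r : seq I) (P : pred I) (F : I -> V) :
  (forall i, P i -> dom X (F i)) ->
  l (\sum_(i <- r | P i) F i) = \sum_(i <- r | P i) l (F i).
Proof.
move=> dF.
suff [] : dom X (\sum_(i <- r | P i) F i) /\
    l (\sum_(i <- r | P i) F i) = \sum_(i <- r | P i) l (F i) by [].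
elim/big_rec2: _ => [|i y x Pi [dx <-]]; first by split; [exact: sn_dom0|exact: funct0].
by split; [apply: dom_add => //; exact: dF|rewrite functD//; exact: dF].
Qed.

Lemma funct_bounded : exists2 M : R, 0 <= M & forall x, dom X x -> `|l x| <= M * fnrm X x.
Proof.
case: dl => _ [M HM]; exists `|M| => // x dx.
have := HM x dx; rewrite nrmE// -EFinM lee_fin => /le_trans; apply.
by rewrite ler_wpM2r ?fnrm_ge0 ?ler_norm.
Qed.

End functional.

Lemma snormed_dual : snormed (dualS X).
Proof.
have bnd l x : dom (dualS X) l -> dom X x -> (nrm X x <= 1)%E -> exists2 M : R,
    0 <= M & forall x, dom X x -> (nrm X x <= 1)%E -> `|l x| <= M.
  move=> dl dx nx; have [M M0 HM] := funct_bounded dl; exists M => // y dy ny.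
  apply: (le_trans (HM _ dy)); rewrite ler_piMr//.
  by rewrite -lee_fin -nrmE.
have n01 : (nrm X 0%R <= 1)%E by rewrite (nrmE (sn_dom0 sX)) fnrm0 lee_fin.
have ge0 l : (0 <= nrm (dualS X) l)%E.
  apply: (@le_trans _ _ `|l 0|%:E); first by rewrite lee_fin.
  by apply: ereal_sup_ubound; exists 0; split => //; exact: sn_dom0.
have fin l : dom (dualS X) l -> nrm (dualS X) l \is a fin_num.
  move=> dl; rewrite ge0_fin_numE//.
  have [M M0 HM] := bnd l 0 dl (sn_dom0 sX) n01.
  apply: (@le_lt_trans _ _ M%:E); last by rewrite ltry.
  by apply: ge_ereal_sup => _ [x [dx nx ->]]; rewrite lee_fin HM.
split => //.
- split=> [a x y dx dy|]; first by rewrite /= mulr0 addr0.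
  by exists 0 => x dx; rewrite normr0 mul0e.
- move=> a l l' dl dl'.
  have lE z : (a *: l + l') z = a * l z + l' z by [].
  split=> [b x y dx dy|]; first by rewrite !lE (functP dl)// (functP dl')//; ring.
  have [M M0 HM] := funct_bounded dl; have [M' M0' HM'] := funct_bounded dl'.
  exists (`|a| * M + M') => x dx; rewrite (nrmE dx) -EFinM lee_fin.
  rewrite lE; apply: (le_trans (ler_normD _ _)); rewrite mulrDl lerD ?HM'//.
  by rewrite normrM -mulrA ler_wpM2l ?HM.
- move=> l l' dl dl'; apply: ge_ereal_sup => _ [x [dx nx ->]].
  apply: (@le_trans _ _ (`|l x|%:E + `|l' x|%:E)%E).
    by rewrite -EFinD lee_fin ler_normD.
  by apply: leeD; apply: ereal_sup_ubound; exists x.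
- move=> a l dl.
  have [->|a0] := eqVneq a 0.
    rewrite normr0 mul0e; apply/eqP; rewrite eq_le ge0 andbT.
    by apply: ge_ereal_sup => _ [x [dx nx ->]]; rewrite scale0r normr0.
  rewrite [in RHS]/= -ereal_sup_pZl ?normr_gt0//.
  rewrite /=; congr ereal_sup; apply/seteqP; split.
    move=> _ [x [dx nx ->]]; exists `|l x|%:E; first by exists x.
    by rewrite -EFinM -normrM.
  by move=> _ [_ [x [dx nx ->]] <-]; exists x; split => //; rewrite -EFinM -normrM.
Qed.

Lemma dual_le l x : dom (dualS X) l -> dom X x ->
  `|l x| <= fnrm (dualS X) l * fnrm X x.
Proof.
move=> dl dx; have sd := snormed_dual.
(* A vector of seminorm 0 cannot be normalised to the unit sphere; boundedness of [l] makes [l x]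
   vanish in that case. *)
have [x0|x0] := eqVneq (fnrm X x) 0.
  have [M M0 HM] := funct_bounded dl.
  by apply: (le_trans (HM _ dx)); rewrite x0 !mulr0.
have xp : 0 < fnrm X x by rewrite lt_neqAle eq_sym x0 fnrm_ge0.
rewrite -ler_pdivrMr// -lee_fin.
rewrite /fnrm fineK; last exact: (sn_fin sd).
apply: ereal_sup_ubound; exists ((fnrm X x)^-1 *: x); split.
- exact: dom_scale.
- rewrite nrmE; last exact: dom_scale.
  by rewrite fnrmZ// gtr0_norm ?invr_gt0// mulVf.
- rewrite (functZ dl)// normrM gtr0_norm ?invr_gt0// mulrC; by [].
Qed.

Lemma dual_fnrm_le l (M : R) : dom (dualS X) l -> 0 <= M ->
  (forall x, dom X x -> `|l x| <= M * fnrm X x) -> fnrm (dualS X) l <= M.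
Proof.
move=> dl M0 HM; rewrite /fnrm -lee_fin fineK; last exact: (sn_fin snormed_dual).
apply: ge_ereal_sup => _ [x [dx nx ->]]; rewrite lee_fin.
apply: (le_trans (HM _ dx)); rewrite ler_piMr// -lee_fin -nrmE//.
Qed.

End snormed_theory.

(** Evaluations at fixed vectors are the functionals by which functions with values in the dual are
    tested, so results about functionals also serve for derivatives taken in [H1']. *)
Lemma eval_dual (R : realType) (V : lmodType R) (X : nspace V) (x : V) :
  snormed X -> dom X x -> dom (dualS (dualS X)) (fun l => l x).
Proof.
move=> sX dx; split => [a l l' dl dl' //|].
exists (fnrm X x) => l dl; rewrite (nrmE (snormed_dual sX) dl) -EFinM lee_fin mulrC.
exact: dual_le.
Qed.

Lemma cvg_dist_le (R : realType) (I : Type) (F : set_system I) (FF : Filter F)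
  (a c : I -> R) (b : R) :
  (\forall k \near F, `|a k - b| <= c k) -> c k @[k --> F] --> 0 ->
  a k @[k --> F] --> b.
Proof.
move=> H c0; apply/cvgrPdist_lt => e e0.
have := (@cvgrPdist_lt _ _ _ F FF c 0).1 c0 e e0.
apply: filterS2 H => k; rewrite distrC sub0r normrN => h1 h2.
by apply: (le_lt_trans h1); apply: (le_lt_trans (ler_norm _)).
Qed.

Section ae_time_theory.
Context {R : realType} (T : R).

Lemma ae_timeW (P : R -> Prop) : (forall t : R, 0 < t < T -> P t) -> ae_time T P.
Proof. by move=> PQ; apply: aeW => t /PQ. Qed.

Lemma ae_timeS (P Q : R -> Prop) :
  (forall t : R, 0 < t < T -> P t -> Q t) -> ae_time T P -> ae_time T Q.
Proof. rewrite /ae_time => PQ aP; apply: (@filterS _ (almost_everywhere leb1) _ _ _ _ aP) => t + tT => /(_ tT); exact: PQ. Qed.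

Lemma ae_timeS2 (P1 P2 Q : R -> Prop) :
  (forall t : R, 0 < t < T -> P1 t -> P2 t -> Q t) ->
  ae_time T P1 -> ae_time T P2 -> ae_time T Q.
Proof.
rewrite /ae_time => PQ aP1 aP2; apply: (@filterS2 _ (almost_everywhere leb1) _ _ _ _ _ aP1 aP2) => t + + tT => /(_ tT) + /(_ tT); exact: PQ.
Qed.

Lemma ae_time_forall_nat (P : nat -> R -> Prop) :
  (forall n, ae_time T (P n)) -> ae_time T (fun t => forall n, P n t).
Proof. by rewrite /ae_time => aP; apply: (@filterS _ (almost_everywhere leb1) _ _ _ _ (ae_foralln aP)) => t aPt tT n; exact: aPt. Qed.

End ae_time_theory.

Lemma leb1_itv (R : realType) (a b : R) b0 b1 : a <= b ->
  leb1 [set` Interval (BSide b0 a) (BSide b1 b)] = (b - a)%:E.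
Proof.
move=> ab; rewrite [LHS](lebesgue_measure_itv (Interval (BSide b0 a) (BSide b1 b)))/=.
rewrite lte_fin; case: ltP => // ba.
by have -> : a = b; [apply/le_anti/andP|rewrite subrr].
Qed.

Lemma measurable_EFin_comp (R : realType) (D : set (measurableTypeR R)) (f : R -> R) :
  measurable_fun D f -> measurable_fun D (fun t => (f t)%:E).
Proof. by move/measurable_EFinP. Qed.

(** * Step functions and their integrals *)

Section steps.
Context {R : realType} {V : lmodType R} (X : nspace V) (sX : snormed X).

(** A step function takes finitely many values, each on a measurable set, so [F] may be arbitrary.
    The sets may overlap; the induction on their number therefore passes to [F] translated by the
    last value. *)
Lemma measurable_fun_comp_step (F : V -> \bar R) (s : step V) : is_step X s ->
  measurable_fun setT (F \o step_fun s).
Proof.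
case: s => n A v ss; rewrite /comp /step_fun/=.
have mA i : measurable (A i) by case: (ss i).
move: {ss}F; elim: n A v mA => [|n IH] A v mA F.
  by under eq_fun do rewrite big_ord0; exact: measurable_cst.
rewrite (_ : (fun x => _) = (fun x => if x \in A ord_max
    then F (\sum_(i < n) (\1_(A (widen_ord (leqnSn n) i)) x : R) *:
                v (widen_ord (leqnSn n) i) + v ord_max)
    else F (\sum_(i < n) (\1_(A (widen_ord (leqnSn n) i)) x : R) *:
                v (widen_ord (leqnSn n) i)))); last first.
  apply/funext => x; rewrite big_ord_recr/= indicE.
  by case: (x \in _); rewrite ?scale1r// scale0r addr0.
apply: measurable_fun_ifT.
- apply: (@measurable_fun_bool _ _ _ _ true); rewrite setTI (_ : _ @^-1` _ = A ord_max)//.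
  by apply/seteqP; split=> x /=; [move/set_mem|move/mem_set].
- exact: (IH _ (fun i => v (widen_ord (leqnSn n) i)) _ (fun y => F (y + v ord_max))).
- exact: IH.
Qed.

Lemma dom_step_fun (s : step V) t : is_step X s -> dom X (step_fun s t).
Proof.
move=> ss; apply: (dom_sum sX) => i _; apply: (dom_scale sX).
by case: (ss i).
Qed.

Definition step_restrict (E : set R) (s : step V) : step V :=
  Step (fun i => step_set i `&` E) (@step_val _ _ s).

Lemma is_step_restrict E s : measurable E -> is_step X s -> is_step X (step_restrict E s).
Proof. by move=> mE ss i; have [ms ds] := ss i; split => //; exact: measurableI. Qed.

Lemma step_fun_restrict E s t : step_fun (step_restrict E s) t = (\1_E t : R) *: step_fun s t.
Proof.
rewrite /step_fun scaler_sumr; apply: eq_bigr => i _ /=.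
by rewrite indicI/= scalerA mulrC.
Qed.

Definition step_scale (a : R) (s : step V) : step V :=
  Step (@step_set _ _ s) (fun i => a *: step_val i).

Lemma is_step_scale a s : is_step X s -> is_step X (step_scale a s).
Proof. by move=> ss i; have [ms ds] := ss i; split => //; exact: dom_scale. Qed.

Lemma step_fun_scale a s t : step_fun (step_scale a s) t = a *: step_fun s t.
Proof.
rewrite /step_fun scaler_sumr; apply: eq_bigr => i _ /=.
by rewrite !scalerA mulrC.
Qed.

Lemma step_int_scale T a s : step_int T (step_scale a s) = a *: step_int T s.
Proof.
rewrite /step_int scaler_sumr; apply: eq_bigr => i _ /=.
by rewrite !scalerA mulrC.
Qed.

Definition step_add (s1 s2 : step V) : step V :=
  @Step _ _ (step_n s1 + step_n s2)
   (fun i => match fintype.split i with inl j => step_set j | inr j => step_set j end)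
   (fun i => match fintype.split i with inl j => step_val j | inr j => step_val j end).

Lemma is_step_add s1 s2 : is_step X s1 -> is_step X s2 -> is_step X (step_add s1 s2).
Proof. by move=> h1 h2 i /=; case: (fintype.split i) => j; [exact: h1|exact: h2]. Qed.

Lemma step_fun_add s1 s2 t : step_fun (step_add s1 s2) t = step_fun s1 t + step_fun s2 t.
Proof.
rewrite /step_fun big_split_ord/=; congr +%R; apply: eq_bigr => i _.
  by rewrite -/(unsplit (inl i)) unsplitK.
by rewrite -/(unsplit (inr i)) unsplitK.
Qed.

Lemma step_int_add T s1 s2 : step_int T (step_add s1 s2) = step_int T s1 + step_int T s2.
Proof.
rewrite /step_int big_split_ord/=; congr +%R; apply: eq_bigr => i _.
  by rewrite -/(unsplit (inl i)) unsplitK.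
by rewrite -/(unsplit (inr i)) unsplitK.
Qed.

Lemma funct_step l s t : dom (dualS X) l -> is_step X s ->
  l (step_fun s t) = \sum_i \1_(@step_set _ _ s i) t * l (step_val i).
Proof.
move=> dl ss; rewrite (funct_sum sX dl); last first.
  by move=> i _; apply: (dom_scale sX); case: (ss i).
by apply: eq_bigr => i _; rewrite (functZ sX dl)//; case: (ss i).
Qed.

Lemma integrable_funct_step (T : R) l s : 0 < T -> dom (dualS X) l -> is_step X s ->
  leb1.-integrable `]0, T[ (fun t => (l (step_fun s t))%:E) /\
  \int[leb1]_(t in `]0, T[) l (step_fun s t) = l (step_int T s).
Proof.
move=> T0 dl ss.
have mT : measurable (`]0, T[%classic : set (measurableTypeR R)) by exact: measurable_itv.
have fT : (leb1 (`]0%R, T[%classic : set (measurableTypeR R)) < +oo)%E.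
  by rewrite leb1_itv ?ltry// ltW.
have mi i : leb1.-integrable `]0, T[
    (fun t => (\1_(@step_set _ _ s i) t)%:E).
  apply: measurable_bounded_integrable => //.
    by apply: measurable_indic; case: (ss i).
  exists 1; split; first exact: num_real.
  by move=> x x1 t _; rewrite /= indicE; case: (_ \in _); rewrite ?normr1 ?normr0 ltW// (lt_trans _ x1).
have lE : (fun t : measurableTypeR R => (l (step_fun s t))%:E) =
    (fun t => (\sum_i (\1_(@step_set _ _ s i) t * l (step_val i))%:E)%E).
  by apply/funext => t; rewrite sumEFin (funct_step _ dl ss).
have mj i : leb1.-integrable `]0, T[
    (fun t => (\1_(@step_set _ _ s i) t * l (step_val i))%:E).
  exact: (integrableZr mT _ (mi i)).
split; first by rewrite lE; exact: integrable_sum.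
rewrite (funct_sum sX dl); last by move=> i _; apply: (dom_scale sX); case: (ss i).
rewrite /Rintegral lE.
rewrite integral_sum// -[RHS]/(fine (_%:E)) -sumEFin; congr fine; apply: eq_bigr => i _.
under eq_integral do rewrite EFinM.
rewrite integralZr// integral_indic//; last by case: (ss i).
rewrite (functZ sX dl); last by case: (ss i).
rewrite EFinM fineK//.
by rewrite ge0_fin_numE// (le_lt_trans _ fT)// le_measure// ?inE//; apply: measurableI => //; case: (ss i).
Qed.

End steps.

(** * Everywhere strongly measurable representatives *)

Section everywhere_strongly_measurable.
Context {R : realType} {V : lmodType R} (X : nspace V) (sX : snormed X).

(* Replacing a strongly measurable function by 0 on a null set of times turns
   the almost everywhere limit of step functions into an everywhere limit. *)
Definition smeas (f : R -> V) : Prop := (forall t, dom X (f t)) /\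
  exists s : nat -> step V, (forall k, is_step X (s k)) /\
    forall t, fnrm X (step_fun (s k) t - f t) @[k --> \oo] --> 0.

Lemma smeas_of T f : strongly_measurable T X f -> ae_time T (fun t => dom X (f t)) ->
  exists2 f', smeas f' & ae_time T (fun t => f' t = f t).
Proof.
move=> [s [ss sf]] df.
have [N [mN N0 Nsub]] : ae_time T (fun t => dom X (f t) /\
    nrm X (step_fun (s k) t - f t) @[k --> \oo] --> 0%E).
  by apply: ae_timeS2 df sf => t tT h1 h2.
have mE : measurable (`]0, T[ `\` N).
  by apply: measurableD => //; exact: measurable_itv.
have HE (t : R) : (`]0, T[ `\` N) t -> dom X (f t) /\
    nrm X (step_fun (s k) t - f t) @[k --> \oo] --> 0%E.
  move=> [/=]; rewrite in_itv/= => tT Nt.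
  by apply: contrapT => H; apply: Nt; apply: Nsub => /(_ tT).
exists (fun t => (\1_(`]0, T[ `\` N) t : R) *: f t).
  split=> [t|].
    rewrite indicE; have [/set_mem/HE[+ _]|_] := boolP (t \in _); first by rewrite scale1r.
    by rewrite scale0r; exact: (sn_dom0 sX).
  exists (fun k => step_restrict (`]0, T[ `\` N) (s k)); split.
    by move=> k; apply: is_step_restrict.
  move=> t; under eq_fun do rewrite step_fun_restrict -scalerBr indicE.
  have [/set_mem/HE[dt ct]|_] := boolP (t \in _).
    under eq_fun do rewrite scale1r.
    apply: (cvg_nrm_fnrm sX) => // k; apply: (dom_sub sX) => //.
    exact: (dom_step_fun sX).
  under eq_fun do rewrite scale0r (fnrm0 sX); exact: cvg_cst.
exists N; split => // t /= Ht; apply: contrapT => Nt; apply: Ht => tT.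
by rewrite indicE mem_set ?scale1r//; split => //=; rewrite in_itv.
Qed.

Lemma smeas_strong T f : smeas f -> strongly_measurable T X f.
Proof.
move=> [df [s [ss sf]]]; exists s; split => //; apply: ae_timeW => t _.
have -> : (fun k => nrm X (step_fun (s k) t - f t)) =
    EFin \o (fun k => fnrm X (step_fun (s k) t - f t)).
  apply/funext => k /=; apply: (nrmE sX); apply: (dom_sub sX) => //.
  exact: (dom_step_fun sX).
exact: cvg_comp (sf t) _.
Qed.

Lemma smeas_measurable_fnrm f : smeas f -> measurable_fun setT (fun t => fnrm X (f t)).
Proof.
move=> [df [s [ss sf]]].
apply: (@measurable_realfun.measurable_fun_cvg _ _ _ setT (fun k t => fnrm X (step_fun (s k) t))) => [k|t _].
  apply/measurable_EFinP.
  exact: (measurable_fun_comp_step (fun v => (fnrm X v)%:E) (ss k)).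
apply: cvg_dist_le (sf t); apply: nearW => k.
by apply: (ler_dist_fnrm sX) => //; exact: (dom_step_fun sX).
Qed.

Lemma funct_cvg l f (s : nat -> V) : dom (dualS X) l -> dom X f -> (forall k, dom X (s k)) ->
  fnrm X (s k - f) @[k --> \oo] --> 0 -> (l (s k) : R) @[k --> \oo] --> (l f : R).
Proof.
move=> dl df ds sf; have [M M0 HM] := funct_bounded sX dl.
apply: (@cvg_dist_le _ _ _ _ _ (fun k => M * fnrm X (s k - f))).
  apply: nearW => k; rewrite -(functB sX dl)//; apply: HM; exact: (dom_sub sX).
by rewrite -[X in _ --> X](mulr0 M); exact: cvgMr.
Qed.

Lemma smeas_measurable_funct l f : dom (dualS X) l -> smeas f ->
  measurable_fun setT (fun t => l (f t) : R).
Proof.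
move=> dl [df [s [ss sf]]].
apply: (@measurable_realfun.measurable_fun_cvg _ _ _ setT (fun k t => l (step_fun (s k) t))) => [k|t _].
  apply/measurable_EFinP.
  exact: (measurable_fun_comp_step (fun v => (l v : R)%:E) (ss k)).
by apply: funct_cvg => // k; exact: (dom_step_fun sX).
Qed.

Lemma smeasD f g : smeas f -> smeas g -> smeas (fun t => f t + g t).
Proof.
move=> [df [s [ss sf]]] [dg [r [rs rg]]]; split=> [t|]; first exact: (dom_add sX).
exists (fun k => step_add (s k) (r k)); split=> [k|t]; first exact: is_step_add.
apply: (@cvg_dist_le _ _ _ _ _ (fun k => fnrm X (step_fun (s k) t - f t) +
   fnrm X (step_fun (r k) t - g t))).
  apply: nearW => k; rewrite subr0 ger0_norm ?(fnrm_ge0 sX)// step_fun_add opprD addrACA.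
  by apply: (fnrmD sX); apply: (dom_sub sX) => //; exact: (dom_step_fun sX).
by rewrite -[X in _ --> X](addr0 0); apply: cvgD.
Qed.

Lemma smeasZ a f : smeas f -> smeas (fun t => a *: f t).
Proof.
move=> [df [s [ss sf]]]; split=> [t|]; first exact: (dom_scale sX).
exists (fun k => step_scale a (s k)); split=> [k|t]; first exact: is_step_scale.
have -> : (fun k => fnrm X (step_fun (step_scale a (s k)) t - a *: f t)) =
   (fun k => `|a| * fnrm X (step_fun (s k) t - f t)).
  apply/funext => k; rewrite step_fun_scale -scalerBr (fnrmZ sX)//.
  by apply: (dom_sub sX) => //; exact: (dom_step_fun sX).
by rewrite -[X in _ --> X](mulr0 `|a|); exact: cvgMr.
Qed.

Lemma smeasB f g : smeas f -> smeas g -> smeas (fun t => f t - g t).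
Proof.
move=> sf sg; have := smeasD sf (smeasZ (-1) sg).
by under eq_fun do rewrite scaleN1r.
Qed.

Lemma smeas_step s : is_step X s -> smeas (step_fun s).
Proof.
move=> ss; split=> [t|]; first exact: (dom_step_fun sX).
exists (fun=> s); split => // t; under eq_fun do rewrite subrr (fnrm0 sX).
exact: cvg_cst.
Qed.

Lemma dom_step_int (T : R) s : is_step X s -> dom X (step_int T s).
Proof. by move=> ss; apply: (dom_sum sX) => i _; apply: (dom_scale sX); case: (ss i). Qed.

(** A bounded functional commutes with the Bochner integral because |l(s_k) - l(F)| is at most M
    |s_k - F|. This one bound yields both the integrability of [h] and the convergence of the
    integrals. *)
Lemma bochner_funct (T : R) F x l (h : R -> R) : 0 < T -> is_bochner_int T X F x ->
  ae_time T (fun t => dom X (F t)) ->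
  dom (dualS X) l -> measurable_fun `]0, T[ h -> ae_time T (fun t => l (F t) = h t) ->
  leb1.-integrable `]0, T[ (EFin \o h) /\ \int[leb1]_(t in `]0, T[) h t = l x.
Proof.
move=> T0 [dx [s [ss sF intF sx]]] dF dl mh lF.
have mT : measurable (`]0, T[%classic : set (measurableTypeR R)) by exact: measurable_itv.
have [M M0 HM] := funct_bounded sX dl.
have [F' smF FF'] : exists2 F', smeas F' & ae_time T (fun t => F' t = F t).
  by apply: smeas_of => //; exists s.
pose n k t := fnrm X (step_fun (s k) t - F' t).
have mn k : measurable_fun `]0, T[ (n k).
  by apply: measurable_funTS; apply: smeas_measurable_fnrm; apply: smeasB => //; exact: smeas_step.
(* The defining integrals involve [F], whose norm need not be measurable; they have the same values
   as the integrals for the representative [F']. *)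
pose I k := (\int[leb1]_(t in `]0%R, T[%classic) (n k t)%:E)%E.
have I0 : I k @[k --> \oo] --> 0%E.
  rewrite (_ : I = fun k => (\int[leb1]_(t in `]0%R, T[%classic) nrm X (step_fun (s k) t - F t)%R)%E)//.
  apply/funext => k; apply/esym; apply: ae_ge0_eq_integral_nonmeas => //.
  - apply: measurable_EFin_comp; exact: mn.
  - by move=> t _; exact: sn_ge0.
  - by move=> t _; rewrite lee_fin fnrm_ge0.
  - apply: (ae_timeS _ FF') => t tT <-; rewrite (nrmE sX)//.
    by apply: (dom_sub sX) => //; [exact: (dom_step_fun sX)|case: smF].
have mls k : measurable_fun `]0, T[ (fun t => l (step_fun (s k) t) : R).
  by apply: measurable_funTS; apply: smeas_measurable_funct => //; exact: smeas_step.
have hI k : (\int[leb1]_(t in `]0%R, T[%classic) `|h t - l (step_fun (s k) t)|%:E <= M%:E * I k)%E.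
  rewrite -ge0_integralZl//; [|apply: measurable_EFin_comp; exact: mn|by move=> t _; rewrite lee_fin (fnrm_ge0 sX)].
  apply: ae_ge0_le_integral => //.
  - apply: measurable_EFin_comp; apply: measurableT_comp => //.
    by apply: measurable_funB => //; exact: mls.
  - by move=> t _; rewrite mule_ge0 ?lee_fin// (fnrm_ge0 sX).
  - by apply: measurable_funeM; apply: measurable_EFin_comp; exact: mn.
  - apply: (ae_timeS2 _ FF' lF) => t tT eF lFt.
    rewrite -EFinM lee_fin -lFt -eF distrC -(functB sX dl)//; last 2 first.
    + exact: (dom_step_fun sX).
    + by case: smF.
    apply: HM; apply: (dom_sub sX); [exact: (dom_step_fun sX)|by case: smF].
have iI k : (I k < +oo)%E -> leb1.-integrable `]0, T[ (fun t => (h t - l (step_fun (s k) t))%:E).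
  move=> Ik; apply/integrableP; split.
    by apply: measurable_EFin_comp; apply: measurable_funB => //; exact: mls.
  apply: (le_lt_trans (hI k)).
  have Ik0 : (0 <= I k)%E by apply: integral_ge0 => t _; rewrite lee_fin (fnrm_ge0 sX).
  by rewrite -(fineK (_ : I k \is a fin_num)) -?EFinM ?ltry// ge0_fin_numE.
(* The integrals tend to 0, hence are eventually finite; a single finite one already makes [h]
   integrable. *)
have Inear : \forall k \near \oo, (I k < +oo)%E.
  have [+ _] := (fine_cvgP _ _).1 I0.
  by apply: filterS => k; rewrite ge0_fin_numE//; apply: integral_ge0 => t _; rewrite lee_fin (fnrm_ge0 sX).
have ih : leb1.-integrable `]0, T[ (EFin \o h).
  have [k _ /(_ k (leqnn k)) Ik] := Inear.
  have [il _] := integrable_funct_step sX T0 dl (ss k).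
  apply: eq_integrable (integrableD mT (iI _ Ik) il) => // t _.
  by rewrite /= -EFinD subrK.
split => //.
have l1 : (l (step_int T (s k)) : R) @[k --> \oo] --> (l x : R).
  apply: funct_cvg => // [k|]; first exact: dom_step_int.
  apply: cvg_nrm_fnrm => // k; apply: (dom_sub sX) => //; exact: dom_step_int.
have l2 : (l (step_int T (s k)) : R) @[k --> \oo] --> \int[leb1]_(t in `]0, T[) h t.
  apply: (@cvg_dist_le _ _ _ _ _ (fun k => M * fine (I k))).
    apply: filterS Inear => k Ik.
    have [il <-] := integrable_funct_step sX T0 dl (ss k).
    rewrite distrC -RintegralB//.
    apply: le_trans (le_normr_Rintegral mT (iI _ Ik)) _.
    rewrite -lee_fin EFinM.
    have Ik0 : (0 <= I k)%E by apply: integral_ge0 => t _; rewrite lee_fin (fnrm_ge0 sX).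
    rewrite (@fineK _ (I k)) ?ge0_fin_numE//; apply: le_trans (hI k).
    rewrite /Rintegral fineK//; apply: integrable_fin_num => //.
    exact: (integrable_abse (iI _ Ik)).
  rewrite -[X in _ --> X](mulr0 M); apply: cvgMr.
  by have [_] := (fine_cvgP _ _).1 I0.
exact: (cvg_unique _ l2 l1).
Qed.

End everywhere_strongly_measurable.

(** * Smooth functions of one variable *)

Section smooth_functions.
Context {R : realType}.
Implicit Types f g : R -> R.

Variant smooth1 f : Prop := Smooth1 of forall n x, derivable (derive1n n f) x 1.

Lemma smooth1P f n (x : R) : smooth1 f -> derivable (derive1n n f) x 1.
Proof. by case. Qed.

Lemma is_derive1Z f (c x df : R) : is_derive x 1 f df -> is_derive x 1 (fun y => c * f y) (c * df).
Proof. by move=> d; exact: (is_deriveZ c d). Qed.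

Lemma is_derive1D f g (x df dg : R) : is_derive x 1 f df -> is_derive x 1 g dg ->
  is_derive x 1 (fun y => f y + g y) (df + dg).
Proof. by move=> d1 d2; exact: (is_deriveD d1 d2). Qed.

Lemma is_derive1M f g (x df dg : R) : is_derive x 1 f df -> is_derive x 1 g dg ->
  is_derive x 1 (fun y => f y * g y) (df * g x + f x * dg).
Proof.
move=> d1 d2; have d3 : is_derive x 1 (f * g) (f x *: dg + g x *: df) := is_deriveM d1 d2.
by rewrite addrC [df * _]mulrC; exact: d3.
Qed.

Lemma derive1_is_derive f f' : (forall x : R, is_derive x 1 f (f' x)) -> (derive1 f) = f'.
Proof. by move=> ff'; apply/funext => x; rewrite derive1E derive_val. Qed.

(** A class of functions closed under differentiation consists of smooth functions. Smoothness of
    products, affine substitutions and flat functions is proved by exhibiting such a class, without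
    formulas for higher derivatives. *)
Lemma smooth1_class (C : set (R -> R)) :
  (forall f, C f -> exists2 f', C f' & forall x : R, is_derive x 1 f (f' x)) ->
  forall f, C f -> smooth1 f.
Proof.
move=> HC f Cf; constructor=> n.
have : C (derive1n n f).
  elim: n => [//|n IH]; rewrite derive1nS; have [f' Cf' /derive1_is_derive ->//] := HC _ IH.
by move=> /HC[f' _ ff'] x; apply: ex_derive.
Qed.

Lemma smooth1_is_derive f (x : R) : smooth1 f -> is_derive x 1 f ((derive1 f) x).
Proof. by move=> sf; apply: DeriveDef; [exact: (@smooth1P _ 0%N _ sf)|rewrite derive1E]. Qed.

Lemma smooth1_derive f : smooth1 f -> smooth1 (derive1 f).
Proof. by move=> sf; constructor=> n x; have := @smooth1P _ n.+1 x sf; rewrite /derive1n iterSr. Qed.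

Lemma smooth1_continuous f : smooth1 f -> continuous f.
Proof. by move=> sf x; apply: differentiable_continuous; apply/derivable1_diffP; exact: (@smooth1P _ 0%N _ sf). Qed.

Lemma smooth1_primitive F f : (forall x : R, is_derive x 1 F (f x)) -> smooth1 f -> smooth1 F.
Proof.
move=> Ff sf; constructor=> -[|n] x; first exact: ex_derive.
by rewrite /derive1n iterSr (derive1_is_derive Ff); exact: smooth1P.
Qed.

Lemma smooth1B f g : smooth1 f -> smooth1 g -> smooth1 (fun x => f x - g x).
Proof.
move=> sf sg.
apply: (@smooth1_class [set h | exists2 a, smooth1 a & exists2 b, smooth1 b & h = (fun x => a x - b x)]).
  move=> _ [a sa [b sb ->]]; exists (fun x => (derive1 a) x - (derive1 b) x).
    by exists (derive1 a); [exact: smooth1_derive|exists (derive1 b) => //; exact: smooth1_derive].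
  by move=> x; apply: is_deriveB; exact: smooth1_is_derive.
by exists f => //; exists g.
Qed.

Lemma smooth1_affine f (a b : R) : smooth1 f -> smooth1 (fun x => f (a * x + b)).
Proof.
move=> sf.
apply: (@smooth1_class [set h | exists2 f0, smooth1 f0 & exists c : R, h = (fun x => c * f0 (a * x + b))]).
  move=> _ [f0 sf0 [c ->]]; exists (fun x => (c * a) * (derive1 f0) (a * x + b)).
    by exists (derive1 f0); [exact: smooth1_derive|exists (c * a)].
  move=> x.
  have d1 : is_derive x 1 (fun y : R => a * y + b) a.
    by apply: is_derive_eq; rewrite scaler1 addr0.
  have d2 := @is_derive1_comp _ f0 (fun y : R => a * y + b) x _ _
    (smooth1_is_derive (a * x + b) sf0) d1.
  have d3 := is_derive1Z c d2; apply: (is_derive_eq d3).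
  by rewrite /=; ring.
by exists f => //; exists 1; apply/funext => x; rewrite mul1r.
Qed.

Lemma smooth1M f g : smooth1 f -> smooth1 g -> smooth1 (fun x => f x * g x).
Proof.
move=> sf sg.
(* Single products are not closed under differentiation; finite sums of products are, by the Leibniz
   rule. *)
pose C := [set h : R -> R | exists s : seq ((R -> R) * (R -> R)),
  (forall p, List.In p s -> smooth1 p.1 /\ smooth1 p.2) /\
  h = (fun x => \sum_(p <- s) p.1 x * p.2 x)].
apply: (@smooth1_class C).
  move=> _ [s [Hs ->]].
  elim: s Hs => [|p s IH] Hs.
    exists (fun=> 0); first by exists [::]; split => //; apply/funext => x; rewrite big_nil.
    by move=> x; under eq_fun do rewrite big_nil; exact: is_derive_cst.
  have [|h' [s' [Hs' ->]] dh'] := IH.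
    by move=> q qs; apply: Hs; right.
  have [sp1 sp2] : smooth1 p.1 /\ smooth1 p.2 by apply: Hs; left.
  exists (fun x => (derive1 p.1) x * p.2 x + (p.1 x * (derive1 p.2) x + \sum_(q <- s') q.1 x * q.2 x)).
    exists [:: ((derive1 p.1), p.2), (p.1, (derive1 p.2)) & s']; split.
      by move=> q [<-|[<-|/Hs'//]]; split => //; exact: smooth1_derive.
    by apply/funext => x; rewrite !big_cons.
  move=> x; under eq_fun do rewrite big_cons.
  have d1 := smooth1_is_derive x sp1; have d2 := smooth1_is_derive x sp2.
  have d3 := is_derive1D (is_derive1M d1 d2) (dh' x).
  apply: (is_derive_eq d3).
  by rewrite /=; ring.
exists [:: (f, g)]; split; first by move=> p [<-|[]].
by apply/funext => x; rewrite big_seq1.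
Qed.

(** The classical flat function exp(-1/x) multiplied by a polynomial in 1/x: the polynomial factor
    makes the family closed under differentiation. *)
Definition flat_fun (p : {poly R}) (x : R) := if 0 < x then p.[x^-1] * expR (- x^-1) else 0.

(** With y = 1/x >= 1, the polynomial is at most S y^n and e^y is at least y^(n+2)/(n+2)!. The
    exponent n + 2 leaves exactly the factor x^2 that forces derivative 0 at the origin. *)
Lemma flat_fun_bound (p : {poly R}) : exists2 K : R, 0 <= K &
  forall x : R, 0 < x <= 1 -> `|flat_fun p x| <= K * x ^+ 2.
Proof.
pose n := size p; pose S : R := \sum_(i < n) `|p`_i|.
have S0 : 0 <= S by apply: sumr_ge0.
exists (S * (n.+2)`!%:R); first by rewrite mulr_ge0.
move=> x /andP[x0 x1]; rewrite /flat_fun x0 normrM [`|expR _|]gtr0_norm ?expR_gt0//.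
have [y yE] : exists y : R, x^-1 = y by exists x^-1.
rewrite yE; have y1 : 1 <= y by rewrite -yE invf_ge1.
have y0 : 0 < y by rewrite -yE invr_gt0.
have py : `|p.[y]| <= S * y ^+ n.
  rewrite horner_coef mulr_suml; apply: (le_trans (ler_norm_sum _ _ _)).
  apply: ler_sum => i _; rewrite normrM ler_wpM2l// normrX gtr0_norm//.
  by rewrite ler_weXn2l// ltnW.
rewrite expRN; have ey : y ^+ n.+2 / (n.+2)`!%:R <= expR y.
  by apply: le_trans (expR_ge1Dxn n.+1 (ltW y0)); rewrite lerDr.
have eyV : (expR y)^-1 <= (n.+2)`!%:R / y ^+ n.+2.
  rewrite -[leRHS]invrK lef_pV2 ?posrE ?expR_gt0 ?invr_gt0 ?divr_gt0 ?exprn_gt0 ?ltr0n ?fact_gt0//.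
  by rewrite invf_div.
apply: (@le_trans _ _ (S * y ^+ n * ((n.+2)`!%:R / y ^+ n.+2))).
  by apply: ler_pM => //; rewrite invr_ge0 expR_ge0.
have -> : x = y^-1 by rewrite -yE invrK.
have z0 : y ^+ n != 0 by rewrite expf_neq0// gt_eqF.
have yn0 : y != 0 by rewrite gt_eqF.
rewrite le_eqVlt; apply/orP; left; apply/eqP.
have -> : y ^+ n.+2 = y ^+ 2 * y ^+ n by rewrite -exprD.
rewrite invfM exprVn; move: (y ^+ n) z0 ((y ^+ 2)^-1) ((n.+2)`!%:R : R) => z z0 a F.
have -> : S * z * (F * (a * z^-1)) = S * F * a * (z / z) by ring.
by rewrite divff// mulr1.
Qed.

Lemma is_derive1_quadratic f (x K : R) : f x = 0 ->
  (forall h : R, `|h| <= 1 -> `|f (h + x)| <= K * h ^+ 2) -> is_derive x 1 f 0.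
Proof.
move=> fx0 fK.
have K0 : 0 <= K.
  have := fK 1; rewrite normr1 expr1n mulr1 => /(_ (lexx _)); exact: le_trans.
have c : h^-1 *: ((f \o shift x) (h *: (1:R)) - f x) @[h --> (0:R)^'] --> (0 : R).
  apply: (@cvg_dist_le _ _ _ _ _ (fun h => K * `|h|)).
    near=> h; rewrite subr0 fx0 subr0 /= /GRing.scale/= mulr1 normrM normfV.
    have h0 : h != 0 by near: h; exact: nbhs_dnbhs_neq.
    rewrite ler_pdivrMl ?normr_gt0//.
    have h1 : `|h| <= 1.
      near: h; apply/nbhs_dnbhs; apply/nbhs_ballP; exists 1 => //= z.
      by rewrite /ball/= sub0r normrN => /ltW.
    apply: le_trans (fK _ h1) _; rewrite -[h ^+ 2]real_normK ?num_real// expr2.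
    by rewrite mulrA mulrC.
  rewrite -[X in _ --> X](mulr0 K); apply: cvgMr.
  rewrite -[X in _ --> X](@normr0 _ R); apply: cvg_norm.
  exact: nbhs_dnbhs.
apply: DeriveDef; first by apply/cvg_ex; exists 0.
by apply/cvg_lim.
Unshelve. all: by end_near. Qed.

(** For x > 0 put y = 1/x: the derivative of p(y) e^(-y) in x is y^2 (p(y) - p'(y)) e^(-y). At 0 the
    quadratic bound gives derivative 0, which matches the default value. *)
Lemma is_derive_flat_fun (p : {poly R}) (x : R) :
  is_derive x 1 (flat_fun p) (flat_fun ('X^2 * (p - deriv p)) x).
Proof.
have [x0|x0|->] := ltgtP x 0.
- have -> : flat_fun ('X^2 * (p - deriv p)) x = 0 by rewrite /flat_fun ltNge (ltW x0).
  apply: (@near_eq_is_derive _ _ _ (fun=> 0 : R)).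
    by near=> y; rewrite /flat_fun ifF//; apply/negbTE; rewrite -leNgt ltW//; near: y; exact: lt_nbhsl.
- apply: (@near_eq_is_derive _ _ _ (fun y : R => p.[y^-1] * expR (- y^-1))).
    by near=> y; rewrite /flat_fun ifT//; near: y; exact: lt_nbhsr.
  have xn0 : x != 0 by rewrite gt_eqF.
  have dV : is_derive x 1 (fun y : R => y^-1) (- x ^- 2).
    have := @is_deriveV R id x 1 1 xn0 (is_derive_id _ _).
    by move=> d; apply: (is_derive_eq d); rewrite /GRing.scale/= mulr1.
  have dVN : is_derive x 1 (fun y : R => - y^-1) (x ^- 2).
    by have d := is_derive1Z (-1) dV; under eq_fun do rewrite -mulN1r; apply: (is_derive_eq d); rewrite mulN1r opprK.
  have d1 := @is_derive1_comp _ (horner p) (fun y : R => y^-1) x _ _ (is_derive_poly p x^-1) dV.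
  have d2 := @is_derive1_comp _ expR (fun y : R => - y^-1) x _ _ (is_derive_expR (- x^-1)) dVN.
  apply: (is_derive_eq (is_derive1M d1 d2)).
  by rewrite /flat_fun x0 /= !hornerE/= exprVn; ring.
- have -> : flat_fun ('X^2 * (p - deriv p)) 0 = 0 by rewrite /flat_fun ltxx.
  have [K K0 HK] := flat_fun_bound p.
  apply: (@is_derive1_quadratic _ _ K); first by rewrite /flat_fun ltxx.
  move=> h h1; rewrite addr0; have [h0|h0] := ltP 0 h.
    by apply: HK; rewrite h0 -(ger0_norm (ltW h0)).
  by rewrite /flat_fun ltNge h0/= normr0 mulr_ge0// sqr_ge0.
Unshelve. all: by end_near. Qed.

Lemma smooth1_flat_fun (p : {poly R}) : smooth1 (flat_fun p).
Proof.
apply: (@smooth1_class [set h | exists q, h = flat_fun q]); last by exists p.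
move=> _ [q ->]; exists (flat_fun ('X^2 * (q - deriv q))); first by exists ('X^2 * (q - deriv q)).
exact: is_derive_flat_fun.
Qed.

End smooth_functions.

(** * A smooth monotone transition from 0 to 1 *)

Section mollified_step.
Context {R : realType}.

Lemma smooth1Z (f : R -> R) (c : R) : smooth1 f -> smooth1 (fun x => c * f x).
Proof.
move=> sf; apply: (@smooth1_class _ [set h | exists2 f0, smooth1 f0 & h = (fun x => c * f0 x)]).
  move=> _ [f0 sf0 ->]; exists (fun x => c * derive1 f0 x).
    by exists (derive1 f0) => //; exact: smooth1_derive.
  by move=> x; apply: is_derive1Z; exact: smooth1_is_derive.
by exists f.
Qed.

Definition eta : R -> R := flat_fun (1 : {poly R}).

Lemma etaE x : eta x = if 0 < x then expR (- x^-1) else 0.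
Proof. by rewrite /eta /flat_fun hornerC mul1r. Qed.

Lemma smooth1_eta : smooth1 eta. Proof. exact: smooth1_flat_fun. Qed.

Lemma eta_gt0 x : 0 < x -> 0 < eta x. Proof. by move=> x0; rewrite etaE x0 expR_gt0. Qed.

Lemma eta_eq0 x : x <= 0 -> eta x = 0. Proof. by move=> x0; rewrite etaE ltNge x0. Qed.

Lemma eta_ge0 x : 0 <= eta x.
Proof. by rewrite etaE; case: ifP => // _; exact: expR_ge0. Qed.

Lemma eta_le1 x : eta x <= 1.
Proof.
rewrite etaE; case: ifPn => // x0; rewrite -[leRHS]expR0 ler_expR.
by rewrite oppr_le0 invr_ge0 ltW.
Qed.

Definition bump (a b : R) (x : R) := eta (x - a) * eta (b - x).

Lemma smooth1_bump a b : smooth1 (bump a b).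
Proof.
have h1 := smooth1_affine 1 (- a) smooth1_eta.
have h2 := smooth1_affine (-1) b smooth1_eta.
have := smooth1M h1 h2.
by congr smooth1; apply/funext => x; rewrite /bump mul1r mulN1r [- x + b]addrC.
Qed.

Lemma bump_ge0 a b x : 0 <= bump a b x.
Proof. by rewrite mulr_ge0 ?eta_ge0. Qed.

Lemma bump_gt0 a b x : a < x < b -> 0 < bump a b x.
Proof. by move=> /andP[ax xb]; rewrite mulr_gt0 ?eta_gt0 ?subr_gt0. Qed.

Lemma bump_eq0 a b x : ~~ (a < x < b) -> bump a b x = 0.
Proof.
rewrite negb_and -!leNgt /bump => /orP[h|h]; first by rewrite eta_eq0 ?mul0r// subr_le0.
by rewrite [X in _ * X]eta_eq0 ?mulr0// subr_le0.
Qed.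

(** The normalised primitive of a bump supported in [-1, 1]. The derivatives of its rescaled
    translates are the mollifiers used below. *)
Lemma smooth_step : exists B : R -> R, [/\ smooth1 B,
  forall x : R, x <= -1 -> B x = 0, forall x : R, 1 <= x -> B x = 1,
  forall x, 0 <= derive1 B x & forall x, 0 <= B x <= 1].
Proof.
pose b := bump (-1) 1.
have cb : continuous b by apply: smooth1_continuous; exact: smooth1_bump.
(* Starting at -2 keeps every x >= -1 in the interior of the interval, where the fundamental theorem
   of calculus applies; further left [F] is locally 0. *)
pose F (x : R) := \int[lebesgue_measure]_(t in `[-2, x]) b t.
have F0 (x : R) : x <= -1 -> F x = 0.
  move=> x1; rewrite /F /Rintegral integral0_eq// => t /=; rewrite in_itv/= => /andP[_ tx].
  by rewrite /b bump_eq0// negb_and -leNgt (le_trans tx x1).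
have dF (x : R) : is_derive x 1 F (b x).
  have [x2|x2] := ltP x (-1).
    have -> : b x = 0 by rewrite /b bump_eq0// negb_and -leNgt ltW.
    apply: (@near_eq_is_derive _ _ _ (fun=> 0 : R)).
    by near=> y; rewrite F0// ltW//; near: y; exact: lt_nbhsl.
  have ib : lebesgue_measure.-integrable [set` Interval (BLeft (-2)) (BRight (x + 1))] (EFin \o b).
    apply: continuous_compact_integrable; first exact: segment_compact.
    exact: continuous_subspaceT.
  have [||//|d1 d2] := @continuous_FTC1 R b (BLeft (-2)) x (x + 1) _ ib.
  - by rewrite ltrDl.
  - by rewrite lte_fin; apply: lt_le_trans x2; lra.
  - exact: cb.
  - by rewrite derive1E in d2; exact (DeriveDef d1 d2).
have mvt (x y : R) : x < y -> exists2 z, z \in `]x, y[ & F y - F x = b z * (y - x).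
  move=> xy; apply: MVT => //.
  apply: continuous_subspaceT => z; apply: differentiable_continuous.
  by apply/derivable1_diffP; exact: (@ex_derive _ _ _ _ _ _ _ (dF z)).
have Fnd (x y : R) : x <= y -> F x <= F y.
  rewrite le_eqVlt => /predU1P[->//|xy]; have [z _ E] := mvt _ _ xy.
  by rewrite -subr_ge0 E mulr_ge0 ?bump_ge0// subr_ge0 ltW.
have F1 (x : R) : 1 <= x -> F x = F 1.
  rewrite le_eqVlt => /predU1P[->//|x1]; have [z + E] := mvt _ _ x1.
  rewrite in_itv/= => /andP[z1 _].
  apply/eqP; rewrite -subr_eq0 E /b bump_eq0 ?mul0r//.
  by rewrite negb_and -!leNgt (ltW z1) orbT.
have F1gt0 : 0 < F 1.
  have [z + E] := mvt 0 1 ltr01; rewrite in_itv/= => /andP[z0 z1].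
  have F00 : F (-1) <= F 0 by apply: Fnd; rewrite lerN10.
  rewrite (F0 _ (lexx _)) in F00.
  apply: (le_lt_trans F00); rewrite -subr_gt0 E subr0 mulr1; apply: bump_gt0; rewrite z1 andbT (lt_trans _ z0)// ltrN10.
pose B x := (F 1)^-1 * F x.
have dB (x : R) : is_derive x 1 B ((F 1)^-1 * b x) by exact: is_derive1Z.
exists B; split.
- by apply: (smooth1_primitive dB); apply: smooth1Z; exact: smooth1_bump.
- by move=> x x1; rewrite /B (F0 _ x1) mulr0.
- by move=> x x1; rewrite /B (F1 _ x1) mulVf// gt_eqF.
- by move=> x; rewrite (derive1_is_derive dB) mulr_ge0 ?bump_ge0// invr_ge0 ltW.
- move=> x; rewrite /B; apply/andP; split.
    rewrite mulr_ge0 ?invr_ge0 ?(ltW F1gt0)//.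
    by rewrite /F Rintegral_ge0// => t _; exact: bump_ge0.
  rewrite ler_pdivrMl// mulr1; have [x1|x1] := leP x 1; first exact: Fnd.
  by rewrite F1// ltW.
Unshelve. all: by end_near. Qed.

End mollified_step.

Lemma Rintegral_dominated_cvg d (S : measurableType d) (R : realType)
  (mu : {measure set S -> \bar R}) (D : set S) (f_ : nat -> S -> R) (f g : S -> R) :
  measurable D -> (forall n, measurable_fun D (f_ n)) -> measurable_fun D f ->
  {ae mu, forall x, D x -> f_ n x @[n --> \oo] --> f x} ->
  mu.-integrable D (EFin \o g) ->
  {ae mu, forall x, D x -> forall n, `|f_ n x| <= g x} ->
  mu.-integrable D (EFin \o f) /\
  \int[mu]_(x in D) f_ n x @[n --> \oo] --> \int[mu]_(x in D) f x.
Proof.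
move=> mD mf_ mf cf ig fg.
have [||||//|if_ _ c] := @dominated_convergence _ _ _ mu D mD (fun n => EFin \o f_ n) (EFin \o f) (EFin \o g).
- by move=> n; exact/measurable_EFinP.
- exact/measurable_EFinP.
- apply: filterS cf => x + Dx => /(_ Dx) cx.
  exact: cvg_comp cx _.
- exact: ig.
- by apply: filterS fg => x + n Dx => /(_ Dx n); rewrite /= lee_fin.
split => //; apply: fine_cvg; rewrite /Rintegral fineK; first exact: c.
exact: integrable_fin_num.
Qed.

Lemma within_continuousM (R : realType) (A : set R) (f g : R -> R) :
  {within A, continuous f} -> {within A, continuous g} ->
  {within A, continuous (fun x => f x * g x)}.
Proof. by move=> cf cg x; exact: (continuousM (cf x) (cg x)). Qed.

(** * From distributional derivatives to increments of continuous functions *)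

Section du_bois_reymond.
Context {R : realType} (T : R) (T0 : 0 < T).
Local Notation mu := (@leb1 R).

Let mT : measurable (`]0, T[%classic : set (measurableTypeR R)).
Proof. exact: measurable_itv. Qed.

Lemma within_cst (g : R -> R) (c : R) : {within `[0, T], continuous g} ->
  (forall s : R, 0 < s < T -> g s = c) -> forall s : R, 0 <= s <= T -> g s = c.
Proof.
move=> cg gc s sT.
have sI : `[0, T]%classic s by rewrite /= in_itv.
have cgs : g x @[x --> within `[0, T] (nbhs s)] --> g s.
  by have /continuous_within_itvP := cg; move/subspace_continuousP : cg => /(_ _ sI).
apply/eqP; rewrite -subr_eq0 -normr_le0; apply/ler_addgt0Pr => e e0; rewrite add0r.
have := (@cvgrPdist_lt _ _ _ _ _ g (g s)).1 cgs e e0.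
rewrite near_withinE => -[/= d d0 /= H].
suff [y [yT yd]] : exists y : R, 0 < y < T /\ `|s - y| < d.
  rewrite -(gc y yT); apply/ltW; apply: H => //.
  by rewrite in_itv/=; case/andP: yT => /ltW -> /ltW ->.
(* A move by a quarter of [Num.min d T] towards the midpoint stays within distance d and lands
   strictly inside the interval, also when s is an endpoint. *)
pose y := s + (Num.min d T / 4) * (if s < T / 2 then 1 else -1).
have m0 : 0 < Num.min d T by rewrite lt_min d0.
have md : Num.min d T <= d by rewrite ge_min lexx.
have mT' : Num.min d T <= T by rewrite ge_min lexx orbT.
exists y; rewrite /y; move: sT m0 md mT'; move: (Num.min d T) => m /andP[s0 s1] m0 md mT'.
have [sT|sT] := ltP s (T / 2).
  split; first by apply/andP; split; lra.
  rewrite ltr_distlC; apply/andP; split; lra.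
split; first by apply/andP; split; lra.
rewrite ltr_distlC; apply/andP; split; lra.
Qed.

Variables (B : R -> R) (sB : smooth1 B) (Bl : forall x : R, x <= -1 -> B x = 0)
  (Br : forall x : R, 1 <= x -> B x = 1) (dB0 : forall x, 0 <= derive1 B x)
  (B01 : forall x, 0 <= B x <= 1).

(** Rises from 0 to 1 across [s - e, s + e]; its derivative is an approximate Dirac mass at s. *)
Definition cutoff (e s : R) (x : R) := B (e^-1 * x - e^-1 * s).

Lemma smooth1_cutoff e s : smooth1 (cutoff e s).
Proof. exact: (smooth1_affine e^-1 (- (e^-1 * s)) sB). Qed.

Lemma cutoff_l e s x : 0 < e -> x <= s - e -> cutoff e s x = 0.
Proof.
move=> e0 xse; apply: Bl; rewrite -mulrBr mulrC ler_pdivrMr//; lra.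
Qed.

Lemma cutoff_r e s x : 0 < e -> s + e <= x -> cutoff e s x = 1.
Proof.
move=> e0 xse; apply: Br; rewrite -mulrBr mulrC ler_pdivlMr//; lra.
Qed.

Lemma derive1_cutoff_ge0 (e s x : R) : 0 < e -> 0 <= derive1 (cutoff e s) x.
Proof.
move=> e0.
have d1 : is_derive x 1 (fun y : R => e^-1 * y - e^-1 * s) e^-1.
  by apply: is_derive_eq; rewrite subr0 scaler1.
have d2 := @is_derive1_comp _ B _ x _ _ (smooth1_is_derive _ sB) d1.
rewrite derive1E (@derive_val _ _ _ _ _ _ _ d2).
by rewrite mulr_ge0// invr_ge0 ltW.
Qed.

Lemma derive1_cutoff_eq0 e s x : 0 < e -> e < `|x - s| -> derive1 (cutoff e s) x = 0.
Proof.
move=> e0 xs; rewrite derive1E.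
have [xls|xls] := leP x s.
  rewrite (@near_eq_derive _ _ _ _ (fun=> 0 : R)) ?derive_cst//.
  near=> y; apply: cutoff_l => //; apply/ltW; near: y; apply: lt_nbhsl.
  by move: xs; rewrite distrC ger0_norm ?subr_ge0//; lra.
rewrite (@near_eq_derive _ _ _ _ (fun=> 1 : R)) ?derive_cst//.
near=> y; apply: cutoff_r => //; apply/ltW; near: y; apply: lt_nbhsr.
by move: xs; rewrite gtr0_norm ?subr_gt0//; lra.
Unshelve. all: by end_near. Qed.

Lemma smooth1_integrable (f : R -> R) : smooth1 f -> mu.-integrable `[0, T] (EFin \o f).
Proof.
move=> sf; apply: continuous_compact_integrable; first exact: segment_compact.
by apply: continuous_subspaceT; exact: smooth1_continuous.
Qed.

Lemma integrable_oc (f : R -> R) : mu.-integrable `[0, T] (EFin \o f) ->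
  mu.-integrable `]0, T[ (EFin \o f).
Proof.
by apply: integrableS => //; exact: subset_itv_oo_cc.
Qed.

Lemma Rintegral_derive1_cutoff (e s : R) : 0 < e -> e <= s -> s + e <= T ->
  \int[mu]_(x in `]0, T[) derive1 (cutoff e s) x = 1.
Proof.
move=> e0 es se.
have sc := smooth1_cutoff e s.
rewrite Rintegral_itv_obnd_cbnd; last first.
  by apply: integrable_oc; apply: smooth1_integrable; exact: smooth1_derive.
rewrite Rintegral_itv_bndo_bndc; last first.
  by apply: (integrableS _ _ _ (smooth1_integrable (smooth1_derive sc))) => //; exact: subset_itv_co_cc.
rewrite /Rintegral (@continuous_FTC2 _ _ (cutoff e s))//.
- by rewrite -EFinB/= cutoff_r// cutoff_l ?subr0// subr_ge0.
- by apply: continuous_subspaceT; apply: smooth1_continuous; exact: smooth1_derive.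
- split.
  + by move=> x _; exact: (@smooth1P _ _ 0%N).
  + by apply: cvg_at_right_filter; exact: smooth1_continuous.
  + by apply: cvg_at_left_filter; exact: smooth1_continuous.
Qed.

Lemma within_integrable (f : R -> R) : {within `[0, T], continuous f} ->
  mu.-integrable `]0, T[ (EFin \o f).
Proof.
move=> cf; apply: integrable_oc.
by apply: continuous_compact_integrable => //; exact: segment_compact.
Qed.

Lemma within_derive1_cutoffM e s (m : R -> R) : {within `[0, T], continuous m} ->
  {within `[0, T], continuous (fun x => derive1 (cutoff e s) x * m x)}.
Proof.
move=> cm; apply: within_continuousM => //; apply: continuous_subspaceT.
by apply: smooth1_continuous; apply: smooth1_derive; exact: smooth1_cutoff.
Qed.

(** The derivatives are nonnegative, of mass 1 and concentrated within [e n] of s, so the weighted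
    mean of [m] tends to its value at the continuity point s. *)
Lemma derive1_cutoff_cvg (m : R -> R) (s : R) (e : nat -> R) :
  {within `[0, T], continuous m} -> 0 < s < T ->
  (forall n, [/\ 0 < e n, e n <= s & s + e n <= T]) -> e n @[n --> \oo] --> 0 ->
  \int[mu]_(x in `]0, T[) (derive1 (cutoff (e n) s) x * m x) @[n --> \oo] --> m s.
Proof.
move=> cm /andP[s0 sT] He e0; apply/cvgrPdist_le => d d0.
have sI : `[0, T]%classic s by rewrite /= in_itv/= (ltW s0) (ltW sT).
have cms : m x @[x --> within `[0, T] (nbhs s)] --> m s.
  by move/subspace_continuousP : cm => /(_ _ sI).
have := (@cvgrPdist_le _ _ _ _ _ m (m s)).1 cms d d0.
rewrite near_withinE => -[/= r r0 /= H].
have ecvg : \forall n \near \oo, `|0 - e n| < r by move/cvgrPdist_lt : e0; exact.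
near=> n; have : `|0 - e n| < r by near: n.
have [en0 ens enT] := He n; rewrite sub0r normrN gtr0_norm// => enr.
pose rho : R -> R := derive1 (cutoff (e n) s); rewrite -/rho.
have srho : smooth1 rho by apply: smooth1_derive; exact: smooth1_cutoff.
have irho : mu.-integrable `]0, T[ (EFin \o rho).
  by apply: integrable_oc; exact: smooth1_integrable.
have irhom := within_integrable (@within_derive1_cutoffM (e n) s _ cm).
have E : m s = \int[mu]_(x in `]0, T[) (rho x * m s).
  by rewrite RintegralZr// Rintegral_derive1_cutoff// mul1r.
have irhos : mu.-integrable `]0, T[ (EFin \o (fun x => rho x * m s)).
  exact: (integrableZr mT _ irho).
rewrite [X in X - _]E -RintegralB//.
have iD := integrableB mT irhos irhom.
apply: (le_trans (le_normr_Rintegral mT iD)).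
have -> : d = \int[mu]_(x in `]0, T[) (rho x * d).
  by rewrite RintegralZr// Rintegral_derive1_cutoff// mul1r.
apply: le_Rintegral => //.
- exact: (integrable_abse iD).
- exact: (integrableZr mT _ irho).
- move=> x; rewrite /= in_itv/= => /andP[x0 xT].
  rewrite -mulrBr normrM (ger0_norm (derive1_cutoff_ge0 _ _ en0)).
  have [xs|xs] := ltP `|s - x| r.
    rewrite ler_wpM2l ?derive1_cutoff_ge0//; apply: H => //.
    by rewrite in_itv/= (ltW x0) (ltW xT).
  by rewrite /rho derive1_cutoff_eq0 ?mul0r// distrC (lt_le_trans enr).
Unshelve. all: by end_near. Qed.

(** A single cutoff equals 1 up to T; subtracting a later one restores compact support. *)
Lemma cutoffB_test1 (e s t : R) : 0 < e -> e < s -> s <= t -> t + e < T ->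
  test1 T (fun x => cutoff e s x - cutoff e t x).
Proof.
move=> e0 es st te.
have sub : closure [set x | cutoff e s x - cutoff e t x != 0] `<=` `[s - e, t + e].
  rewrite (closure_id `[s - e, t + e]).1; last exact: itv_closed.
  apply: closure_subset => x /=; apply: contraNT => /=.
  rewrite in_itv/= negb_and -!ltNge => /orP[xse|xte].
    by rewrite !cutoff_l ?subrr//; lra.
  by rewrite !cutoff_r ?subrr//; lra.
split.
- have : smooth1 (fun x => cutoff e s x - cutoff e t x).
    by apply: smooth1B; exact: smooth1_cutoff.
  by case.
- apply: subclosed_compact sub => //; [exact: closed_closure|exact: segment_compact].
- apply: subset_trans sub _ => x /=; rewrite !in_itv/= => /andP[h1 h2].
  by apply/andP; split; lra.
Qed.

(** The test functions are differences of cutoffs at s and t: they tend to the indicator of the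
    interval, and their derivatives to the Dirac mass at s minus that at t. *)
Lemma weak_derivative_integral_oo (m k : R -> R) : {within `[0, T], continuous m} ->
  mu.-integrable `]0, T[ (EFin \o k) ->
  (forall phi, test1 T phi -> \int[mu]_(x in `]0, T[) (derive1 phi x * m x) =
    - \int[mu]_(x in `]0, T[) (phi x * k x)) ->
  forall s t : R, 0 < s -> s < t -> t < T -> m t - m s = \int[mu]_(x in `]s, t[) k x.
Proof.
move=> cm ik Hphi s t s0 st tT.
(* Half the distance from s and t to the ends of (0, T) keeps the supports inside, and 1/(n+1) makes
   the widths vanish. *)
pose e n : R := Num.min s (T - t) / 2 * n.+1%:R^-1.
have m0 : 0 < Num.min s (T - t) by rewrite lt_min s0 subr_gt0.
have He n : [/\ 0 < e n, e n < s & t + e n < T].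
  have e0 : 0 < e n by rewrite mulr_gt0 ?invr_gt0// divr_gt0.
  have eh : e n <= Num.min s (T - t) / 2.
    by rewrite /e ler_piMr ?divr_ge0 ?(ltW m0)// invf_le1// ler1n.
  have ms : Num.min s (T - t) <= s by rewrite ge_min lexx.
  have mt : Num.min s (T - t) <= T - t by rewrite ge_min lexx orbT.
  move: (Num.min s (T - t)) m0 eh ms mt => z z0 eh ms mt; split => //; lra.
have e0 : e n @[n --> \oo] --> 0.
  rewrite -[X in _ --> X](mulr0 (Num.min s (T - t) / 2)); apply: cvgMr.
  exact: cvg_harmonic.
have He' n : [/\ 0 < e n, e n <= s & s + e n <= T].
  by have [h1 h2 h3] := He n; split => //; lra.
have He'' n : [/\ 0 < e n, e n <= t & t + e n <= T].
  by have [h1 h2 h3] := He n; split => //; lra.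
have s0T : 0 < s < T by apply/andP; split; lra.
have t0T : 0 < t < T by apply/andP; split; lra.
have cs := derive1_cutoff_cvg cm s0T He' e0.
have ct := derive1_cutoff_cvg cm t0T He'' e0.
pose phi n x := cutoff (e n) s x - cutoff (e n) t x.
have tphi n : test1 T (phi n).
  by have [h1 h2 h3] := He n; apply: cutoffB_test1 => //; exact: ltW.
have c1 : \int[mu]_(x in `]0, T[) (derive1 (phi n) x * m x) @[n --> \oo] --> m s - m t.
  rewrite [X in X @ _ --> _](_ : _ = fun n =>
    \int[mu]_(x in `]0, T[) (derive1 (cutoff (e n) s) x * m x) -
    \int[mu]_(x in `]0, T[) (derive1 (cutoff (e n) t) x * m x)); first exact: cvgB.
  apply/funext => n; rewrite -RintegralB//; try exact: within_integrable (within_derive1_cutoffM cm).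
  apply: eq_Rintegral => x _; rewrite -mulrBl; congr (_ * _).
  have d1 := smooth1_is_derive x (smooth1_cutoff (e n) s).
  have d2 := smooth1_is_derive x (smooth1_cutoff (e n) t).
  have d3 := is_deriveB d1 d2.
  by rewrite [LHS]derive1E; exact: (@derive_val _ _ _ _ _ _ _ d3).
have mk : measurable_fun (`]0, T[%classic : set (measurableTypeR R)) k.
  by apply/measurable_EFinP; case/integrableP : ik.
pose kst x := (\1_(`]s, t[%classic : set R) x : R) * k x.
have [_ c2] : mu.-integrable `]0, T[ (EFin \o kst) /\
    \int[mu]_(x in `]0, T[) (phi n x * k x) @[n --> \oo] --> \int[mu]_(x in `]0, T[) kst x.
  apply: (@Rintegral_dominated_cvg _ _ R mu `]0, T[%classic (fun n x => phi n x * k x) kst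
    (fun x => `|k x|)) => //.
  - move=> n; apply: measurable_funM => //; apply: measurable_funTS.
    apply: continuous_measurable_fun; apply: smooth1_continuous.
    by apply: smooth1B; exact: smooth1_cutoff.
  - by apply: measurable_funM => //; apply: measurable_funTS; apply: measurable_indic.
  (* At s and t the cutoffs centred there have the same value for all n, which need not be that of
     the indicator; these two points form the exceptional null set. *)
  - exists [set s; t]; split.
    + by apply: measurableU; exact: measurable_set1.
    + apply/eqP; rewrite -measure_le0; apply: le_trans (measureU2 _ _ _) _; try exact: measurable_set1.
      by rewrite [X in (X + _)%E]lebesgue_measure_set1 [X in (_ + X)%E]lebesgue_measure_set1 adde0.
    + move=> x /= Hx; apply: contrapT => xst; apply: Hx => _.
      have lim1 (a : R) : x != a -> cutoff (e n) a x @[n --> \oo] --> ((a < x)%R%:R : R).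
        move=> xa; apply: cvg_near_cst.
        have ecvg : \forall n \near \oo, `|0 - e n| < `|x - a|.
          by move/cvgrPdist_lt : e0; apply; rewrite normr_gt0 subr_eq0.
        near=> n; have : `|0 - e n| < `|x - a| by near: n.
        have [en0 _ _] := He n; rewrite sub0r normrN gtr0_norm//.
        have [xla|xla|xea] := ltgtP a x; last by rewrite xea eqxx in xa.
          by rewrite gtr0_norm ?subr_gt0// => h; rewrite cutoff_r//; lra.
        by rewrite ltr0_norm ?subr_lt0// => h; rewrite cutoff_l//; lra.
      have xs : x != s by apply/eqP => xs; apply: xst; left.
      have xt : x != t by apply/eqP => xt; apply: xst; right.
      rewrite /kst; apply: cvgMl.
      rewrite [X in _ --> X](_ : _ = (s < x)%R%:R - (t < x)%R%:R); first exact: cvgB (lim1 _ xs) (lim1 _ xt).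
      rewrite indicE mem_setE in_itv/=.
      have [xs'|xs'] := ltP s x; have [xt'|xt'] := ltP t x => /=; rewrite ?subr0 ?subrr//.
      * by rewrite ltNge (ltW xt').
      * by rewrite lt_neqAle xt xt'.
      * by lra.
  - by exact: integrable_norm.
  - apply: aeW => x _ n; rewrite normrM ler_piMl//.
    have /andP[h1 h2] := B01 ((e n)^-1 * x - (e n)^-1 * s).
    have /andP[h3 h4] := B01 ((e n)^-1 * x - (e n)^-1 * t).
    by rewrite /phi /cutoff ler_norml; apply/andP; split; lra.
have ck : \int[mu]_(x in `]0, T[) kst x = \int[mu]_(x in `]s, t[) k x.
  rewrite -[in RHS](_ : `]0, T[ `&` `]s, t[ = `]s, t[)%classic.
    rewrite Rintegral_mkcondr; apply: eq_Rintegral => x _.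
    by rewrite /kst patchE indicE; case: ifP => _; rewrite ?mul1r ?mul0r.
  apply/seteqP; split=> [x []//|x xst]; split => //; move: xst.
  by rewrite /= !in_itv/= => /andP[h1 h2]; apply/andP; split; lra.
have c3 : \int[mu]_(x in `]0, T[) (derive1 (phi n) x * m x) @[n --> \oo] -->
    - \int[mu]_(x in `]s, t[) k x.
  under eq_fun do rewrite Hphi//.
  by rewrite -ck; exact: cvgN.
by rewrite -(opprB (m s)) (cvg_unique _ c1 c3) ?opprK.
Unshelve. all: by end_near. Qed.

End du_bois_reymond.

(** * Integrals over time intervals *)

Section interval_integrals.
Context {R : realType}.
Implicit Types (k : R -> R) (T r s t : R).

Definition itg k s t : R := \int[leb1]_(x in `]s, t[) k x.

Definition intg T k := leb1.-integrable `]0, T[ (EFin \o k).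

Lemma intg_sub T k s t : 0 <= s -> t <= T -> intg T k -> leb1.-integrable `]s, t[ (EFin \o k).
Proof.
move=> s0 tT; apply: integrableS => //.
by apply: subset_itv; rewrite bnd_simp.
Qed.

Lemma intgD T k1 k2 : intg T k1 -> intg T k2 -> intg T (fun t => k1 t + k2 t).
Proof. by move=> i1 i2; apply: (integrableD _ i1 i2). Qed.

Lemma intgB T k1 k2 : intg T k1 -> intg T k2 -> intg T (fun t => k1 t - k2 t).
Proof. by move=> i1 i2; apply: (integrableB _ i1 i2). Qed.

Lemma intgZ T c k : intg T k -> intg T (fun t => c * k t).
Proof. by move=> i1; apply: (integrableZl _ c i1). Qed.

Lemma intg_cst T c : 0 <= T -> intg T (fun=> c).
Proof.
move=> T0; apply: measurable_bounded_integrable => //.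
  by have h := leb1_itv false true T0; rewrite [X in (X < _)%E]h ltry.
exists `|c|; split; first exact: num_real.
by move=> x cx t _; exact: ltW.
Qed.

Lemma intg_measurable T k : intg T k -> measurable_fun (`]0, T[ : set (measurableTypeR R)) k.
Proof. by move=> /measurable_int/measurable_EFinP. Qed.

Lemma intg_le T (k1 k2 : R -> R) : measurable_fun (`]0, T[ : set (measurableTypeR R)) k1 ->
  (forall t, 0 < t < T -> `|k1 t| <= k2 t) -> intg T k2 -> intg T k1.
Proof.
move=> m1 k12; apply: le_integrable => //; first exact: measurable_EFin_comp.
move=> x; rewrite /= in_itv/= => /k12 h; rewrite lee_fin (le_trans h)// ler_norm//.
Qed.

Lemma itg_split T k r s t : 0 <= r -> r <= s -> s <= t -> t <= T -> intg T k ->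
  itg k r t = itg k r s + itg k s t.
Proof.
move=> r0 rs st tT ik; rewrite /itg.
have [<-|rns] := eqVneq r s.
  by rewrite [X in X + _](_ : _ = 0) ?add0r// set_itvoo0 ?Rintegral_set0//.
have rs' : r < s by rewrite lt_neqAle rns.
have ik1 : leb1.-integrable `]r, t[ (EFin \o k) by exact: intg_sub ik.
have [->|snt] := eqVneq s t.
  by rewrite [X in _ + X](_ : _ = 0) ?addr0// set_itvoo0 ?Rintegral_set0.
have st' : s < t by rewrite lt_neqAle snt.
rewrite -(@Rintegral_itvB _ k (BRight r) (BLeft t) s)//.
rewrite -Rintegral_itv_bndo_bndc; last by apply: intg_sub ik => //; exact: le_trans tT.
by rewrite addrC subrK.
Qed.

Lemma itgxx k s : itg k s s = 0.
Proof. by rewrite /itg set_itvoo0 ?Rintegral_set0. Qed.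

Lemma itgD T k1 k2 s t : 0 <= s -> t <= T -> intg T k1 -> intg T k2 ->
  itg (fun x => k1 x + k2 x) s t = itg k1 s t + itg k2 s t.
Proof. by move=> s0 tT i1 i2; apply: RintegralD => //; [exact: intg_sub i1|exact: intg_sub i2]. Qed.

Lemma itgB T k1 k2 s t : 0 <= s -> t <= T -> intg T k1 -> intg T k2 ->
  itg (fun x => k1 x - k2 x) s t = itg k1 s t - itg k2 s t.
Proof. by move=> s0 tT i1 i2; apply: RintegralB => //; [exact: intg_sub i1|exact: intg_sub i2]. Qed.

Lemma itgZ T c k s t : 0 <= s -> t <= T -> intg T k ->
  itg (fun x => c * k x) s t = c * itg k s t.
Proof. by move=> s0 tT i1; apply: RintegralZl => //; exact: intg_sub i1. Qed.

Lemma itg_cst c s t : s <= t -> itg (fun=> c) s t = c * (t - s).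
Proof.
move=> st; rewrite /itg Rintegral_cst//.
by have h := leb1_itv false true st; rewrite [X in fine X]h.
Qed.

Lemma itg_ae_le_on T k1 k2 s t : 0 <= s -> t <= T -> intg T k1 -> intg T k2 ->
  ae_time T (fun x => s < x < t -> k1 x <= k2 x) -> itg k1 s t <= itg k2 s t.
Proof.
move=> s0 tT i1 i2 k12.
have j1 := intg_sub s0 tT i1; have j2 := intg_sub s0 tT i2.
rewrite -subr_ge0 -RintegralB//.
(* Replacing the difference by its positive part changes it only on a null set and makes it
   nonnegative everywhere. *)
have -> : \int[leb1]_(x in `]s, t[) (k2 x - k1 x) = \int[leb1]_(x in `]s, t[) Num.max 0 (k2 x - k1 x).
  congr fine; apply: ae_eq_integral => //.
  - by apply: measurable_int; exact: (integrableB _ j2 j1).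
  - apply: measurable_EFin_comp; apply: measurable_maxr => //; apply/measurable_EFinP.
    by apply: measurable_int; exact: (integrableB _ j2 j1).
  - apply: (@filterS _ (almost_everywhere leb1) _ _ _ _ k12) => x + /=.
    rewrite in_itv/= => h /andP[sx xt].
    rewrite max_r// subr_ge0; apply: h; rewrite ?sx//; by rewrite (le_lt_trans s0 sx) (lt_le_trans xt tT).
by apply: Rintegral_ge0 => x _; rewrite le_max lexx.
Qed.

Lemma itg_ae_le T k1 k2 s t : 0 <= s -> t <= T -> intg T k1 -> intg T k2 ->
  ae_time T (fun x => k1 x <= k2 x) -> itg k1 s t <= itg k2 s t.
Proof.
by move=> s0 tT i1 i2 k12; apply: (itg_ae_le_on s0 tT i1 i2); apply: ae_timeS k12 => x _ + _.
Qed.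

Lemma itg_le T k1 k2 s t : 0 <= s -> t <= T -> intg T k1 -> intg T k2 ->
  (forall x, s < x < t -> k1 x <= k2 x) -> itg k1 s t <= itg k2 s t.
Proof.
move=> s0 tT i1 i2 k12; apply: le_Rintegral => //.
- exact: intg_sub i1.
- exact: intg_sub i2.
Qed.

Lemma itg_ge0 k s t : (forall x, 0 <= k x) -> 0 <= itg k s t.
Proof. by move=> k0; apply: Rintegral_ge0. Qed.

Lemma itg_abs_le T k k' s t : 0 <= s -> t <= T -> intg T k -> intg T k' ->
  ae_time T (fun x => `|k x| <= k' x) -> `|itg k s t| <= itg k' s t.
Proof.
move=> s0 tT i1 i2 kk'; rewrite ler_norml; apply/andP; split.
  rewrite -mulN1r -(itgZ _ s0 tT)//; apply: (@itg_ae_le T) => //; first exact: intgZ.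
  by apply: ae_timeS kk' => x _; rewrite ler_norml mulN1r => /andP[].
by apply: (@itg_ae_le T) => //; apply: ae_timeS kk' => x _; rewrite ler_norml => /andP[].
Qed.

Lemma itg_sub_le T k s t : 0 <= s -> s <= t -> t <= T -> intg T k -> (forall x, 0 <= k x) ->
  itg k s t <= itg k 0 T.
Proof.
move=> s0 st tT ik k0.
rewrite (itg_split _ (le_trans s0 st) tT _ ik)// (itg_split _ s0 st tT ik)//.
by rewrite -addrA addrCA -[leLHS]addr0 lerD// addr_ge0// itg_ge0.
Qed.

Lemma itg_continuous T k : 0 <= T -> intg T k -> {within `[0, T], continuous (fun t => itg k 0 t)}.
Proof.
move=> T0 ik.
(* Integrability is known on the open interval only; extension by 0 makes the closed interval
   available without changing the primitive. *)
pose k' : R -> R := k \_ `]0, T[.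
have ik' : leb1.-integrable setT (EFin \o k').
  have mT : measurable (`]0, T[%classic : set (measurableTypeR R)) by exact: measurable_itv.
  by have := (@integrable_mkcond _ (measurableTypeR R) R leb1 `]0, T[%classic (EFin \o k) mT).1 ik; rewrite restrict_EFin.
have ik'T : leb1.-integrable `[0, T] (EFin \o k') by apply: integrableS ik'.
have := parameterized_integral_continuous T0 ik'T.
apply: subspace_eq_continuous => t /set_mem; rewrite /= in_itv/= => /andP[t0 tT].
rewrite /from_subspace /parameterized_integral.
rewrite -Rintegral_itv_bndo_bndc; last by apply: integrableS ik'.
rewrite -Rintegral_itv_obnd_cbnd; last by apply: integrableS ik'.
apply: eq_Rintegral => x /set_mem; rewrite /= in_itv/= => /andP[x0 xt].
by rewrite /k' patchE mem_set//= in_itv/= x0 (lt_le_trans xt tT).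
Qed.

(** Extends the identity to the endpoints 0 and T: [m] minus the primitive of [k] is constant inside
    and continuous on the closed interval. *)
Lemma weak_derivative_integral T (m k : R -> R) : 0 < T -> {within `[0, T], continuous m} ->
  intg T k ->
  (forall phi, test1 T phi -> \int[leb1]_(x in `]0, T[) (derive1 phi x * m x) =
    - \int[leb1]_(x in `]0, T[) (phi x * k x)) ->
  forall s t, 0 <= s -> s <= t -> t <= T -> m t - m s = itg k s t.
Proof.
move=> T0 cm ik H s t s0 st tT.
have [B [sB Bl Br dB B01]] := @smooth_step R.
have H0 := weak_derivative_integral_oo T0 sB Bl Br dB B01 cm ik H.
pose D t := m t - itg k 0 t.
have cD : {within `[0, T], continuous D}.
  have ci := itg_continuous (ltW T0) ik.
  by move=> x; exact: (continuousB (cm x) (ci x)).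
have Dc x : 0 < x < T -> D x = D (T / 2).
  move=> /andP[x0 xT]; have h0 : 0 < T / 2 by lra.
  have hT : T / 2 < T by lra.
  have [xh|hx|->//] := ltgtP x (T / 2).
    have := H0 _ _ x0 xh hT; rewrite -/(itg k x (T / 2)) /D => E.
    have := itg_split (lexx 0) (ltW x0) (ltW xh) (ltW hT) ik; lra.
  have := H0 _ _ h0 hx xT; rewrite -/(itg k (T / 2) x) /D => E.
  have := itg_split (lexx 0) (ltW h0) (ltW hx) (ltW xT) ik; lra.
have Ds : D s = D (T / 2) by apply: (within_cst T0 cD Dc); rewrite s0 (le_trans st tT).
have Dt : D t = D (T / 2) by apply: (within_cst T0 cD Dc); rewrite tT (le_trans s0 st).
have := itg_split (lexx 0) s0 st tT ik; move: Ds Dt; rewrite /D; lra.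
Qed.

End interval_integrals.

(** * Norms in Bochner spaces and weak time derivatives *)

Section bochner_spaces.
Context {R : realType} {V : lmodType R} (X : nspace V) (sX : snormed X) (T : R) (T0 : 0 < T).

Let mT : measurable (`]0, T[%classic : set (measurableTypeR R)).
Proof. exact: measurable_itv. Qed.

(** The integrand formed with [f] need not be measurable in t, but the one formed with [f'] is; the
    comparison rests on [ae_ge0_eq_integral_nonmeas]. *)
Lemma LpT_nrm (r : R) (f f' : R -> V) : 0 < r -> smeas X f' ->
  ae_time T (fun t => f' t = f t) ->
  nrm (LpT T X r%:E) f =
  ((\int[leb1]_(t in `]0%R, T[%classic) (fnrm X (f' t) `^ r)%:E) `^ r^-1)%E.
Proof.
move=> r0 sf ff'; rewrite /= unlock; congr (_ `^ _)%E.
transitivity (\int[leb1]_x ((fun t : R => nrm X (f t) `^ r) \_ `]0%R, T[) (x : R))%E.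
  apply: eq_integral => t _; rewrite !patchE; case: ifPn => _.
    by rewrite gee0_abs// (sn_ge0 sX).
  by rewrite [point]/(0%E) abse0 poweR0r// gt_eqF.
rewrite -integral_mkcond; apply: ae_ge0_eq_integral_nonmeas => //.
- apply: measurable_EFin_comp; apply: measurable_funTS.
  have := smeas_measurable_fnrm sX sf.
  by move=> m; apply: (measurableT_comp (measurable_powR r) m).
- by move=> t _; exact: poweR_ge0.
- by move=> t _; rewrite lee_fin powR_ge0.
- apply: (ae_timeS _ ff') => t _ <-.
  by rewrite (nrmE sX) ?poweR_EFin//; case: sf.
Qed.

Lemma LpT_intg (r : R) (f f' : R -> V) : 0 < r -> smeas X f' ->
  ae_time T (fun t => f' t = f t) -> (nrm (LpT T X r%:E) f < +oo)%E ->
  intg T (fun t => fnrm X (f' t) `^ r).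
Proof.
move=> r0 sf ff'; rewrite (LpT_nrm r0 sf ff') => h.
apply/integrableP; split.
  apply: measurable_EFin_comp; apply: measurable_funTS.
  by apply: (measurableT_comp (measurable_powR r) (smeas_measurable_fnrm sX sf)).
under eq_integral do rewrite /= ger0_norm ?powR_ge0//.
move: h; set I := (\int[_]_(_ in _) _)%E.
have I0 : (0 <= I)%E by apply: integral_ge0 => t _; rewrite lee_fin powR_ge0.
by move: I0; case: I => [x _ _|_|//]; rewrite ?ltry// poweRyr// gt_eqF// invr_gt0.
Qed.

Lemma C0T_funct_continuous (fc : R -> V) l : C0T T X fc -> dom (dualS X) l ->
  {within `[0, T], continuous (fun t => l (fc t) : R)}.
Proof.
move=> cf dl; apply/subspace_continuousP => t; rewrite /= in_itv/= => tT.
have [dt ct] := cf t tT.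
have [M M0 HM] := funct_bounded sX dl.
have {}ct : fnrm X (fc s - fc t) @[s --> within `[0, T] (nbhs t)] --> 0.
  by rewrite /fnrm; exact: (fine_cvg ct).
apply: (@cvg_dist_le _ _ _ _ _ (fun s => M * fnrm X (fc s - fc t))).
  rewrite near_withinE; near=> s => sT.
  have [ds _] := cf s sT; rewrite -(functB sX dl)//; apply: HM; exact: (dom_sub sX).
by rewrite -[X in _ --> X](mulr0 M); apply: cvgMr.
Unshelve. all: by end_near. Qed.

Lemma funct_eq_fnrm0 l x y : dom (dualS X) l -> dom X x -> dom X y -> nrm X (x - y) = 0%E ->
  l x = l y.
Proof.
move=> dl dx dy xy; have [M M0 HM] := funct_bounded sX dl.
apply/eqP; rewrite -subr_eq0 -(functB sX dl)// -normr_le0.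
by apply: (le_trans (HM _ (dom_sub sX dx dy))); rewrite /fnrm xy mulr0.
Qed.

Lemma smeas_intg_funct l (g' : R -> V) : smeas X g' -> intg T (fun t => fnrm X (g' t)) ->
  dom (dualS X) l -> intg T (fun t => l (g' t)).
Proof.
move=> sg ig dl; have [M M0 HM] := funct_bounded sX dl.
apply: (intg_le (k2 := fun t => M * fnrm X (g' t))); last exact: intgZ.
  by apply: measurable_funTS; exact: (smeas_measurable_funct sX dl sg).
by move=> t _; apply: HM; case: sg.
Qed.

(** Applying [l] to the defining Bochner integrals reduces the statement to the scalar case, where
    the continuous function l(fc) has weak derivative l(g'). *)
Lemma tderiv_integral (f g fc g' : R -> V) l :
  is_tderiv T X f g -> C0T T X fc -> ae_time T (fun t => dom X (f t)) ->
  ae_time T (fun t => nrm X (fc t - f t) = 0%E) ->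
  smeas X g' -> ae_time T (fun t => g' t = g t) -> intg T (fun t => fnrm X (g' t)) ->
  dom (dualS X) l ->
  forall s t : R, 0 <= s -> s <= t -> t <= T ->
    l (fc t) - l (fc s) = itg (fun x => l (g' x)) s t.
Proof.
move=> fg cf df fcf sg gg' ig dl.
have cm := C0T_funct_continuous cf dl.
have ilg := smeas_intg_funct sg ig dl.
apply: (weak_derivative_integral T0 cm ilg) => phi tphi.
have [x b1 b2] := fg phi tphi.
have sphi : smooth1 phi by constructor => n x0; case: tphi.
have mphi : measurable_fun (`]0, T[%classic : set (measurableTypeR R)) phi.
  by apply: measurable_funTS; apply: continuous_measurable_fun; exact: smooth1_continuous.
have mdphi : measurable_fun (`]0, T[%classic : set (measurableTypeR R)) (derive1 phi).
  by apply: measurable_funTS; apply: continuous_measurable_fun; apply: smooth1_continuous; exact: smooth1_derive.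
have dx : dom X x by case: b1.
transitivity (l x : R).
  apply: (bochner_funct (h := fun t => derive1 phi t * l (fc t)) sX T0 b1 _ dl _ _).2.
  - by apply: ae_timeS df => t _ dft; exact: (dom_scale sX).
  - apply: measurable_funM => //.
    by have /measurable_int/measurable_EFinP := within_integrable cm.
  - apply: ae_timeS2 fcf df => t /andP[t0 tT] e dft; rewrite (functZ sX dl)//; congr (_ * _).
    have tT' : 0 <= t <= T by rewrite (ltW t0) ltW.
    have [dfct _] := cf t tT'.
    by apply/esym; apply: funct_eq_fnrm0 dl _ _ e.
have E : \int[leb1]_(x0 in `]0, T[) (phi x0 * l (g' x0)) = l (- x); last by rewrite E (functN sX dl) ?opprK.
apply: (bochner_funct (h := fun t => phi t * l (g' t)) sX T0 b2 _ dl _ _).2.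
- by apply: ae_timeS gg' => t _ <-; apply: (dom_scale sX); case: sg.
- by apply: measurable_funM => //; exact: intg_measurable ilg.
- by apply: ae_timeS gg' => t _ <-; rewrite (functZ sX dl)//; case: sg.
Qed.

End bochner_spaces.

(** * Linearity of the Bochner integral and uniqueness of time derivatives *)

Section bochner_integral_algebra.
Context {R : realType} {V : lmodType R} (X : nspace V) (sX : snormed X) (T : R) (T0 : 0 < T).

Let mT : measurable (`]0, T[%classic : set (measurableTypeR R)).
Proof. exact: measurable_itv. Qed.

(* [is_bochner_int] on everywhere strongly measurable representatives, where
   every integrand is measurable. *)
Definition bochner_repr (F' : R -> V) (x : V) (s : nat -> step V) : Prop :=
  [/\ forall k, is_step X (s k),
      ae_time T (fun t => fnrm X (step_fun (s k) t - F' t) @[k --> \oo] --> 0),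
      (\int[leb1]_(t in `]0%R, T[%classic) (fnrm X (step_fun (s k) t - F' t))%:E)%E
        @[k --> \oo] --> 0%E &
      fnrm X (step_int T (s k) - x) @[k --> \oo] --> 0].

Lemma integral_fnrm_step (F F' : R -> V) (s : step V) : is_step X s -> smeas X F' ->
  ae_time T (fun t => F' t = F t) ->
  (\int[leb1]_(t in `]0%R, T[%classic) nrm X (step_fun s t - F t))%E =
  (\int[leb1]_(t in `]0%R, T[%classic) (fnrm X (step_fun s t - F' t))%:E)%E.
Proof.
move=> ss sF FF'; apply: ae_ge0_eq_integral_nonmeas => //.
- apply: measurable_EFin_comp; apply: measurable_funTS; apply: (smeas_measurable_fnrm sX).
  by apply: (smeasB sX) => //; exact: (smeas_step sX).
- by move=> t _; exact: sn_ge0.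
- by move=> t _; rewrite lee_fin (fnrm_ge0 sX).
- apply: ae_timeS FF' => t _ <-; apply: (nrmE sX); apply: (dom_sub sX).
    exact: (dom_step_fun sX).
  by case: sF.
Qed.

Lemma cvg_nrmE (I : Type) (G : set_system I) (FG : Filter G) (x : I -> V) :
  (forall i, dom X (x i)) -> fnrm X (x i) @[i --> G] --> 0 -> nrm X (x i) @[i --> G] --> 0%E.
Proof.
move=> dx cx; rewrite (_ : (fun i => nrm X (x i)) = EFin \o (fun i => fnrm X (x i))).
  exact: cvg_comp cx _.
by apply/funext => i /=; exact: nrmE.
Qed.

Lemma bochner_reprP (F F' : R -> V) x : smeas X F' -> ae_time T (fun t => F' t = F t) ->
  is_bochner_int T X F x <-> dom X x /\ exists s, bochner_repr F' x s.
Proof.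
move=> sF FF'; have dF t : dom X (F' t) by case: sF.
split=> [[dx [s [ss aF iF ix]]]|[dx [s [ss aF iF ix]]]]; split => //; exists s; split => //.
- apply: ae_timeS2 aF FF' => t _ + e; rewrite -e; apply: (cvg_nrm_fnrm sX) => k.
  by apply: (dom_sub sX) => //; exact: (dom_step_fun sX).
- by under eq_fun do rewrite -(integral_fnrm_step (ss _) sF FF').
- apply: (cvg_nrm_fnrm sX) => // k; apply: (dom_sub sX) => //; exact: (dom_step_int sX).
- apply: ae_timeS2 aF FF' => t _ + e; rewrite -e; apply: cvg_nrmE => k.
  by apply: (dom_sub sX) => //; exact: (dom_step_fun sX).
- by under eq_fun do rewrite (integral_fnrm_step (ss _) sF FF').
- by apply: cvg_nrmE => // k; apply: (dom_sub sX) => //; exact: (dom_step_int sX).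
Qed.

Lemma bochner_int_lin (a b : R) (F G : R -> V) x y : 
  ae_time T (fun t => dom X (F t)) -> ae_time T (fun t => dom X (G t)) ->
  is_bochner_int T X F x -> is_bochner_int T X G y ->
  is_bochner_int T X (fun t => a *: F t + b *: G t) (a *: x + b *: y).
Proof.
move=> dF dG bF bG.
have smF : strongly_measurable T X F by case: bF => _ [s [ss aF _ _]]; exists s.
have smG : strongly_measurable T X G by case: bG => _ [s [ss aG _ _]]; exists s.
have [F' sF FF'] := smeas_of sX smF dF; have [G' sG GG'] := smeas_of sX smG dG.
have sFG := smeasD sX (smeasZ sX a sF) (smeasZ sX b sG).
have FGE : ae_time T (fun t => a *: F' t + b *: G' t = a *: F t + b *: G t).
  by apply: ae_timeS2 FF' GG' => t _ -> ->.
have [dx [s [ss aF iF ix]]] := (bochner_reprP _ sF FF').1 bF.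
have [dy [r [rs aG iG iy]]] := (bochner_reprP _ sG GG').1 bG.
have dxy : dom X (a *: x + b *: y) by apply: (dom_add sX); exact: (dom_scale sX).
apply/(bochner_reprP _ sFG FGE); split => //.
pose q k := step_add (step_scale a (s k)) (step_scale b (r k)).
have iq k : is_step X (q k).
  by apply: is_step_add; apply: (is_step_scale sX).
have ds k t : dom X (step_fun (s k) t - F' t).
  by apply: (dom_sub sX); [exact: (dom_step_fun sX)|case: sF].
have dr k t : dom X (step_fun (r k) t - G' t).
  by apply: (dom_sub sX); [exact: (dom_step_fun sX)|case: sG].
have bnd k t : fnrm X (step_fun (q k) t - (a *: F' t + b *: G' t)) <=
    `|a| * fnrm X (step_fun (s k) t - F' t) + `|b| * fnrm X (step_fun (r k) t - G' t).
  rewrite /q step_fun_add !step_fun_scale opprD addrACA -!scalerBr.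
  rewrite -!(fnrmZ sX)//; apply: (fnrmD sX); exact: (dom_scale sX).
have mm (H : R -> V) (z : step V) : is_step X z -> smeas X H ->
    measurable_fun (`]0, T[%classic : set (measurableTypeR R)) (fun t => fnrm X (step_fun z t - H t)).
  move=> hz hH; apply: measurable_funTS; apply: (smeas_measurable_fnrm sX).
  by apply: (smeasB sX) => //; exact: (smeas_step sX).
exists q; split => //.
- apply: ae_timeS2 aF aG => t _ cF cG.
  apply: (@cvg_dist_le _ _ _ _ _ (fun k =>
    `|a| * fnrm X (step_fun (s k) t - F' t) + `|b| * fnrm X (step_fun (r k) t - G' t))).
    by apply: nearW => k; rewrite subr0 ger0_norm ?(fnrm_ge0 sX)//; exact: bnd.
  rewrite -[X in _ --> X](addr0 0) -[X in _ --> X + _](mulr0 `|a|) -[X in _ --> _ + X](mulr0 `|b|).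
  by apply: cvgD; apply: cvgMr.
- apply: (@squeeze_cvge _ _ _ _ (cst 0%E) _ (fun k =>
    (`|a|%:E * (\int[leb1]_(t in `]0%R, T[%classic) (fnrm X (step_fun (s k) t - F' t))%:E) +
     `|b|%:E * (\int[leb1]_(t in `]0%R, T[%classic) (fnrm X (step_fun (r k) t - G' t))%:E))%E)).
  + apply: nearW => k; apply/andP; split.
      by apply: integral_ge0 => t _; rewrite lee_fin (fnrm_ge0 sX).
    rewrite -!ge0_integralZl//; try (by apply: measurable_EFin_comp; exact: mm);
      try (by move=> t _; rewrite lee_fin (fnrm_ge0 sX)).
    rewrite -ge0_integralD//; try (by apply: measurable_funeM; apply: measurable_EFin_comp; exact: mm);
      try (by move=> t _; rewrite mule_ge0// lee_fin ?(fnrm_ge0 sX)).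
    apply: ge0_le_integral => //.
    * by move=> t _; rewrite lee_fin (fnrm_ge0 sX).
    * by apply: measurable_EFin_comp; exact: mm.
    * apply: emeasurable_funD; apply: measurable_funeM; apply: measurable_EFin_comp; exact: mm.
    * by move=> t _; rewrite -!EFinM -EFinD lee_fin; exact: bnd.
  + exact: cvg_cst.
  + rewrite -[X in _ --> X](adde0 0%E) -[X in _ --> (X + _)%E](mule0 `|a|%:E) -[X in _ --> (_ + X)%E](mule0 `|b|%:E).
    by apply: cvgeD => //; apply: cvgeZl.
- apply: (@cvg_dist_le _ _ _ _ _ (fun k =>
    `|a| * fnrm X (step_int T (s k) - x) + `|b| * fnrm X (step_int T (r k) - y))).
    apply: nearW => k; rewrite subr0 ger0_norm ?(fnrm_ge0 sX)//.
    rewrite /q step_int_add !step_int_scale opprD addrACA -!scalerBr.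
    have h1 : dom X (step_int T (s k) - x) by apply: (dom_sub sX) => //; exact: (dom_step_int sX).
    have h2 : dom X (step_int T (r k) - y) by apply: (dom_sub sX) => //; exact: (dom_step_int sX).
    rewrite -!(fnrmZ sX)//; apply: (fnrmD sX); exact: (dom_scale sX).
  rewrite -[X in _ --> X](addr0 0) -[X in _ --> X + _](mulr0 `|a|) -[X in _ --> _ + X](mulr0 `|b|).
  by apply: cvgD; apply: cvgMr.
Qed.

Lemma is_tderivB (f1 g1 f2 g2 : R -> V) :
  ae_time T (fun t => dom X (f1 t)) -> ae_time T (fun t => dom X (g1 t)) ->
  ae_time T (fun t => dom X (f2 t)) -> ae_time T (fun t => dom X (g2 t)) ->
  is_tderiv T X f1 g1 -> is_tderiv T X f2 g2 ->
  is_tderiv T X (fun t => f1 t - f2 t) (fun t => g1 t - g2 t).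
Proof.
move=> df1 dg1 df2 dg2 d1 d2 phi tphi.
have [x1 b1 c1] := d1 phi tphi; have [x2 b2 c2] := d2 phi tphi.
have hs (h : R -> R) (f : R -> V) : ae_time T (fun t => dom X (f t)) ->
    ae_time T (fun t => dom X (h t *: f t)).
  by apply: ae_timeS => t _ d; exact: (dom_scale sX).
exists (x1 - x2).
  have := bochner_int_lin 1 (-1) (hs _ _ df1) (hs _ _ df2) b1 b2.
  rewrite scale1r scaleN1r; congr (is_bochner_int _ _ _ _); apply/funext => t.
  by rewrite scale1r scaleN1r -scalerBr.
have := bochner_int_lin 1 (-1) (hs _ _ dg1) (hs _ _ dg2) c1 c2.
rewrite scale1r scaleN1r opprK opprB addrC; congr (is_bochner_int _ _ _ _); apply/funext => t.
by rewrite scale1r scaleN1r -scalerBr.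
Qed.

Lemma LpT_dom (r : R) (f f' : R -> V) : 0 < r -> smeas X f' -> ae_time T (fun t => f' t = f t) ->
  intg T (fun t => fnrm X (f' t) `^ r) -> dom (LpT T X r%:E) f.
Proof.
move=> r0 sf ff' i; split.
- by apply: ae_timeS ff' => t _ <-; case: sf.
- have [s [ss c]] : strongly_measurable T X f' by exact: smeas_strong.
  exists s; split => //.
  by apply: ae_timeS2 ff' c => t _ <-.
- rewrite [X in (X < _)%E](_ : _ = nrm (LpT T X r%:E) f)// (LpT_nrm sX r0 sf ff').
  have /integrableP[_] := i.
  under eq_integral do rewrite /= ger0_norm ?powR_ge0//.
  set I := (\int[_]_(_ in _) _)%E => Ioo.
  have I0 : (0 <= I)%E by apply: integral_ge0 => t _; rewrite lee_fin powR_ge0.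
  by rewrite poweR_lty.
Qed.

Lemma LpT2_LpT1 (f : R -> V) : dom (LpT T X 2%:E) f -> dom (LpT T X 1%:E) f.
Proof.
move=> [df smf nf]; have [f' sf ff'] := smeas_of sX smf df.
have i2 : intg T (fun t => fnrm X (f' t) `^ 2) by apply: LpT_intg ff' nf.
apply: (LpT_dom ltr01 sf ff').
apply: (intg_le (k2 := fun t => 1 + fnrm X (f' t) `^ 2)).
- by apply: measurable_funTS; apply: (measurableT_comp (measurable_powR 1) (smeas_measurable_fnrm sX sf)).
- move=> t _; rewrite powRr1 ?(fnrm_ge0 sX)// ger0_norm ?(fnrm_ge0 sX)//.
  rewrite powR_mulrn ?(fnrm_ge0 sX)//; have := fnrm_ge0 sX (f' t).
  move: (fnrm X (f' t)) => y y0; nra.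
- by apply: intgD => //; apply: intg_cst; exact: ltW.
Qed.

Lemma tderivP (f : R -> V) : (exists g, dom (LpT T X 1%E) g /\ is_tderiv T X f g) ->
  dom (LpT T X 1%E) (tderiv T X f) /\ is_tderiv T X f (tderiv T X f).
Proof. by move=> ex; apply: (@xgetPex _ 0 [set g | dom (LpT T X 1%E) g /\ is_tderiv T X f g]). Qed.

(** The primitive of [k] extended by 0 vanishes identically, and Lebesgue's differentiation theorem
    recovers [k] from it almost everywhere. *)
Lemma itg0_ae0 (k : R -> R) : intg T k ->
  (forall s t, 0 <= s -> s <= t -> t <= T -> itg k s t = 0) -> ae_time T (fun t => k t = 0).
Proof.
move=> ik k0; pose k' : R -> R := k \_ `]0, T[.
have ik' : leb1.-integrable setT (EFin \o k').
  by have := (@integrable_mkcond _ (measurableTypeR R) R leb1 `]0, T[%classic (EFin \o k) mT).1 ik; rewrite restrict_EFin.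
have lk' : locally_integrable [set: R] k'.
  split => //.
  - by apply/measurable_EFinP; exact: measurable_int ik'.
  - exact: openT.
  - move=> K _ cK; have /integrableP[_] : leb1.-integrable K (EFin \o k').
      by apply: integrableS ik' => //; exact: compact_measurable.
    by [].
have F0 (x : R) : \int[leb1]_(t in `]-oo, x]) k' t = 0.
  rewrite -Rintegral_mkcondr.
  have [x0|x0] := leP x 0.
    rewrite (_ : _ `&` _ = set0) ?Rintegral_set0//; apply/seteqP; split => // t [] /=.
    by rewrite !in_itv/= => tx /andP[t0 _]; move: (lt_le_trans t0 tx); rewrite ltNge x0.
  have [Tx|xT] := leP T x.
    rewrite (_ : _ `&` _ = `]0, T[%classic); first exact: k0 (lexx 0) (ltW T0) (lexx T).
    apply/seteqP; split => [t []//|t tT]; split => //; move: tT; rewrite /= !in_itv/= => /andP[_ tT].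
    exact: ltW (lt_le_trans tT Tx).
  rewrite (_ : _ `&` _ = `]0, x]%classic); last first.
    apply/seteqP; split => t /=; rewrite !in_itv/=; first by move=> [-> /andP[-> _]].
    by move=> /andP[t0 tx]; rewrite t0 tx (le_lt_trans tx xT).
  rewrite -Rintegral_itv_bndo_bndc; first exact: k0 (lexx 0) (ltW x0) (ltW xT).
  exact: intg_sub (lexx 0) (ltW xT) ik.
have iy (y : R) : lebesgue_measure.-integrable `]-oo, y] (EFin \o k').
  by apply: integrableS ik'.
have := FTC1Ny iy lk'; apply: (@filterS _ (almost_everywhere leb1)) => t [_ e] tT.
move: e; rewrite (_ : (fun x : R => _) = cst 0); last by apply/funext.
by rewrite derive1_cst /k' patchE mem_set//= in_itv.
Qed.

Section tderiv_uniqueness.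
Variables (ip : V -> V -> R) (ip_dual : forall y, dom X y -> dom (dualS X) (ip y : V -> R^o))
  (ipE : forall y, dom X y -> ip y y = fnrm X y ^+ 2).

(* The values of the approximating step functions are countably many test vectors. *)
Lemma weakly_null_ae_null (d : R -> V) : smeas X d ->
  (forall y, dom X y -> ae_time T (fun t => ip y (d t) = 0)) ->
  (forall x y, dom X x -> dom X y -> ip x y = ip y x) ->
  ae_time T (fun t => fnrm X (d t) = 0).
Proof.
move=> [dd [s [ss sd]]] d0 ipC.
have : ae_time T (fun t => forall k, forall i, ip (@step_val _ _ (s k) i) (d t) = 0).
  apply: ae_time_forall_nat => k.
  have : ae_time T (fun t => forall j (jn : (j < step_n (s k))%N),
      ip (@step_val _ _ (s k) (Ordinal jn)) (d t) = 0).
    apply: ae_time_forall_nat => j; have [jn|jn] := pselect (j < step_n (s k))%N.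
      apply: ae_timeS (d0 (@step_val _ _ (s k) (Ordinal jn)) _); last by case: (ss k (Ordinal jn)).
      by move=> t _ e jn'; rewrite (bool_irrelevance jn' jn).
    by apply: ae_timeW => t _ jn'; case: jn.
  by apply: ae_timeS => t _ H [j jn].
apply: ae_timeS => t _ H; have dt := dd t.
have c : (ip (d t) (step_fun (s k) t) : R) @[k --> \oo] --> (ip (d t) (d t) : R).
  apply: (funct_cvg sX (ip_dual dt)) => // k; exact: (dom_step_fun sX).
have z k : ip (d t) (step_fun (s k) t) = 0.
  rewrite (funct_step sX _ (ip_dual dt) (ss k)) big1// => i _.
  by rewrite ipC ?H ?mulr0//; case: (ss k i).
have cz : ip (d t) (step_fun (s k) t) @[k --> \oo] --> (0 : R).
  by rewrite (_ : (fun k => _) = cst 0); [exact: cvg_cst|apply/funext].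
have dz : ip (d t) (d t) = 0 by exact: (cvg_unique (@Rhausdorff R) c cz).
by move: dz; rewrite ipE// => /eqP; rewrite sqrf_eq0 => /eqP.
Qed.

(** [tderiv] is an arbitrary choice in L1. Uniqueness transfers to it the regularity of any other
    derivative and identifies derivatives taken in different spaces. *)
Lemma tderiv_unique (f g1 g2 : R -> V) :
  (forall x y, dom X x -> dom X y -> ip x y = ip y x) ->
  ae_time T (fun t => dom X (f t)) ->
  dom (LpT T X 1%:E) g1 -> dom (LpT T X 1%:E) g2 ->
  is_tderiv T X f g1 -> is_tderiv T X f g2 ->
  ae_time T (fun t => nrm X (g1 t - g2 t) = 0%E).
Proof.
move=> ipC df [dg1 sm1 n1] [dg2 sm2 n2] d1 d2.
have [g1' s1 e1] := smeas_of sX sm1 dg1; have [g2' s2 e2] := smeas_of sX sm2 dg2.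
have iP g g' : smeas X g' -> ae_time T (fun t => g' t = g t) ->
    (nrm (LpT T X 1%:E) g < +oo)%E -> intg T (fun t => fnrm X (g' t)).
  move=> sg eg ng; have := LpT_intg sX ltr01 sg eg ng.
  by congr (is_true (intg _ _)); apply/funext => t; rewrite powRr1// (fnrm_ge0 sX).
have i1 := iP _ _ s1 e1 n1; have i2 := iP _ _ s2 e2 n2.
have sd := smeasB sX s1 s2.
have id : intg T (fun t => fnrm X (g1' t - g2' t)).
  apply: (intg_le _ _ (intgD i1 i2)).
    by apply: measurable_funTS; exact: (smeas_measurable_fnrm sX sd).
  by move=> t _; rewrite ger0_norm ?(fnrm_ge0 sX)//; apply: (fnrmB sX); [case: s1|case: s2].
have dd := is_tderivB df dg1 df dg2 d1 d2.
suff : ae_time T (fun t => fnrm X (g1' t - g2' t) = 0).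
  move=> h; apply: ae_timeS2 h (ae_timeS2 (fun t _ a b => conj a b) e1 e2) => t _ h [<- <-].
  by rewrite (nrmE sX) ?h//; apply: (dom_sub sX); [case: s1|case: s2].
apply: weakly_null_ae_null => // y dy.
have il := smeas_intg_funct sX sd id (ip_dual dy).
apply: itg0_ae0 => // s t s0 st tT.
(* The difference of the two derivatives is a derivative of f - f, whose continuous representative
   is 0; all its integrals against test vectors therefore vanish. *)
have c0 : C0T T X (fun=> 0).
  by move=> x _; split; [exact: sn_dom0|under eq_fun do rewrite subrr (nrmE sX (sn_dom0 sX)) (fnrm0 sX); exact: cvg_cst].
have := tderiv_integral sX T0 dd c0 _ _ sd _ id (ip_dual dy) s0 st tT.
rewrite subrr => <-//.
- by apply: ae_timeS df => x _ dx; exact: (dom_sub sX).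
- by apply: ae_timeW => x _; rewrite subrr subr0 (nrmE sX (sn_dom0 sX)) (fnrm0 sX).
- by apply: ae_timeS2 e1 e2 => x _ -> ->.
Qed.

End tderiv_uniqueness.

End bochner_integral_algebra.

(** * Transfer along a continuous embedding *)

Section bochner_embedding.
Context {R : realType} {V : lmodType R} (X Y : nspace V) (sX : snormed X) (sY : snormed Y)
  (XY : forall x, dom X x -> dom Y x) (le_fnrm : forall x, dom X x -> fnrm Y x <= fnrm X x)
  (T : R) (T0 : 0 < T).

Let mT : measurable (`]0, T[%classic : set (measurableTypeR R)).
Proof. exact: measurable_itv. Qed.

Lemma is_step_embed s : is_step X s -> is_step Y s.
Proof. by move=> ss i; have [ms ds] := ss i; split => //; exact: XY. Qed.

Lemma smeas_embed f : smeas X f -> smeas Y f.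
Proof.
move=> [df [s [ss sf]]]; split=> [t|]; first exact: XY.
exists s; split=> [k|t]; first exact: is_step_embed.
apply: (@cvg_dist_le _ _ _ _ _ _ _ _ (sf t)); apply: nearW => k.
rewrite subr0 ger0_norm ?(fnrm_ge0 sY)//; apply: le_fnrm; apply: (dom_sub sX) => //.
exact: (dom_step_fun sX).
Qed.

Lemma bochner_int_embed (F : R -> V) x : ae_time T (fun t => dom X (F t)) ->
  is_bochner_int T X F x -> is_bochner_int T Y F x.
Proof.
move=> dF bF.
have smF : strongly_measurable T X F by case: bF => _ [s [ss aF _ _]]; exists s.
have [F' sF FF'] := smeas_of sX smF dF.
have [dx [s [ss aF iF ix]]] := (bochner_reprP sX _ sF FF').1 bF.
have ds k t : dom X (step_fun (s k) t - F' t).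
  by apply: (dom_sub sX); [exact: (dom_step_fun sX)|case: sF].
apply/(bochner_reprP sY _ (smeas_embed sF) FF'); split; first exact: XY.
exists s; split => //.
- by move=> k; exact: is_step_embed.
- apply: ae_timeS aF => t _ c; apply: (@cvg_dist_le _ _ _ _ _ _ _ _ c).
  by apply: nearW => k; rewrite subr0 ger0_norm ?(fnrm_ge0 sY)//; exact: le_fnrm.
- apply: (@squeeze_cvge _ _ _ _ (cst 0%E) _ _ _ _ _ iF); last exact: cvg_cst.
  apply: nearW => k; apply/andP; split.
    by apply: integral_ge0 => t _; rewrite lee_fin (fnrm_ge0 sY).
  apply: ge0_le_integral => //.
  + by move=> t _; rewrite lee_fin (fnrm_ge0 sY).
  + apply: measurable_EFin_comp; apply: measurable_funTS; apply: (smeas_measurable_fnrm sY).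
    by apply: (smeasB sY); [apply: (smeas_step sY); exact: is_step_embed|exact: smeas_embed].
  + apply: measurable_EFin_comp; apply: measurable_funTS; apply: (smeas_measurable_fnrm sX).
    by apply: (smeasB sX) => //; exact: (smeas_step sX).
  + by move=> t _; rewrite lee_fin; exact: le_fnrm.
- apply: (@cvg_dist_le _ _ _ _ _ _ _ _ ix); apply: nearW => k.
  rewrite subr0 ger0_norm ?(fnrm_ge0 sY)//; apply: le_fnrm; apply: (dom_sub sX) => //.
  exact: (dom_step_int sX).
Qed.

Lemma is_tderiv_embed (f g : R -> V) : ae_time T (fun t => dom X (f t)) ->
  ae_time T (fun t => dom X (g t)) -> is_tderiv T X f g -> is_tderiv T Y f g.
Proof.
move=> df dg fg phi tphi; have [x b1 b2] := fg phi tphi.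
exists x; apply: bochner_int_embed => //.
  by apply: ae_timeS df => t _ d; exact: (dom_scale sX).
by apply: ae_timeS dg => t _ d; exact: (dom_scale sX).
Qed.

End bochner_embedding.

(** * Semi-inner products and L2 *)

(** Definiteness is not asked for: elements of L2 are representatives, and the gradient form
    vanishes on constants. Linearity is restricted to [D] since integrals of products are meaningful
    only there. *)
Record semi_inner (R : realType) (V : lmodType R) (D : set V) (b : V -> V -> R) : Prop :=
  SemiInner {
  si_dom0 : D 0 ;
  si_domP : forall (a : R) x y, D x -> D y -> D (a *: x + y) ;
  si_lin : forall (a : R) x y z, D x -> D y -> D z -> b (a *: x + y) z = a * b x z + b y z ;
  si_sym : forall x y, D x -> D y -> b x y = b y x ;
  si_ge0 : forall x, D x -> 0 <= b x x }.

Section semi_inner_theory.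
Context {R : realType} {V : lmodType R} (D : set V) (b : V -> V -> R) (sb : semi_inner D b).

Lemma si_domD x y : D x -> D y -> D (x + y).
Proof. by move=> dx dy; rewrite -[x]scale1r; apply: (si_domP sb). Qed.

Lemma si_domZ a x : D x -> D (a *: x).
Proof. by move=> dx; rewrite -[_ *: _]addr0; apply: (si_domP sb) => //; exact: (si_dom0 sb). Qed.

Lemma si_domB x y : D x -> D y -> D (x - y).
Proof. by move=> dx dy; apply: si_domD => //; rewrite -scaleN1r; exact: si_domZ. Qed.

Lemma si_Dl x y z : D x -> D y -> D z -> b (x + y) z = b x z + b y z.
Proof. by move=> dx dy dz; rewrite -[x]scale1r (si_lin sb)// mul1r scale1r. Qed.

Lemma si_0l z : D z -> b 0 z = 0.
Proof.
move=> dz; have d0 := si_dom0 sb; have := si_Dl d0 d0 dz; rewrite addr0 => /eqP.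
by rewrite -subr_eq0 opprD addNKr oppr_eq0 => /eqP.
Qed.

Lemma si_Zl a x z : D x -> D z -> b (a *: x) z = a * b x z.
Proof.
by move=> dx dz; rewrite -[_ *: _]addr0 (si_lin sb)// ?si_0l ?addr0//; exact: (si_dom0 sb).
Qed.

Lemma si_Bl x y z : D x -> D y -> D z -> b (x - y) z = b x z - b y z.
Proof.
move=> dx dy dz; rewrite si_Dl//; last by rewrite -scaleN1r; exact: si_domZ.
by rewrite -scaleN1r si_Zl// mulN1r.
Qed.

Lemma si_Dr x y z : D x -> D y -> D z -> b z (x + y) = b z x + b z y.
Proof.
move=> dx dy dz; rewrite (si_sym sb)//; last exact: si_domD.
by rewrite si_Dl// (si_sym sb dx)// (si_sym sb dy).
Qed.

Lemma si_Zr a x z : D x -> D z -> b z (a *: x) = a * b z x.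
Proof.
by move=> dx dz; rewrite (si_sym sb)//; [rewrite si_Zl// (si_sym sb dx)|exact: si_domZ].
Qed.

Lemma si_Br x y z : D x -> D y -> D z -> b z (x - y) = b z x - b z y.
Proof.
move=> dx dy dz; rewrite (si_sym sb)//; last exact: si_domB.
by rewrite si_Bl// (si_sym sb dx)// (si_sym sb dy).
Qed.

Lemma si_sqD x y : D x -> D y -> b (x + y) (x + y) = b x x + 2 * b x y + b y y.
Proof.
move=> dx dy; have dxy := si_domD dx dy.
by rewrite si_Dl// !si_Dr// (si_sym sb dy dx); ring.
Qed.

Lemma si_sqB x y : D x -> D y -> b (x - y) (x - y) = b x x - 2 * b x y + b y y.
Proof.
move=> dx dy; have dxy := si_domB dx dy.
by rewrite si_Bl// !si_Br// (si_sym sb dy dx); ring.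
Qed.

Lemma si_CS x y : D x -> D y -> b x y ^+ 2 <= b x x * b y y.
Proof.
move=> dx dy.
have H (t : R) : 0 <= b x x - 2 * (t * b x y) + t ^+ 2 * b y y.
  have := si_ge0 sb (si_domB dx (si_domZ t dy)).
  by rewrite si_sqB ?si_Zl ?si_Zr//; try exact: si_domZ; congr (0 <= _); ring.
have xx := si_ge0 sb dx; have yy := si_ge0 sb dy.
move: H xx yy; move: (b x x) (b x y) (b y y) => p q r H p0 r0.
have [r00|rn0] := eqVneq r 0.
  have [q0|q0] := eqVneq q 0; first by rewrite q0 expr0n/= r00 mulr0.
  (* With r = 0 the nonnegative quadratic is affine in t; this choice of t gives it the value -1. *)
  exfalso; have := H ((p + 1) / (2 * q)); rewrite r00 mulr0 addr0.
  have -> : 2 * ((p + 1) / (2 * q) * q) = p + 1 by field.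
  lra.
have rp : 0 < r by rewrite lt_neqAle eq_sym rn0.
have := H (q / r); have -> : p - 2 * (q / r * q) + (q / r) ^+ 2 * r = (p * r - q ^+ 2) / r by field.
by rewrite pmulr_lge0 ?invr_gt0// subr_ge0.
Qed.

Lemma si_CS_sqrt x y : D x -> D y -> `|b x y| <= Num.sqrt (b x x) * Num.sqrt (b y y).
Proof.
move=> dx dy; rewrite -sqrtrM ?(si_ge0 sb)// -sqrtr_sqr.
by apply: ler_wsqrtr; exact: si_CS.
Qed.

Lemma si_sqrtD x y : D x -> D y ->
  Num.sqrt (b (x + y) (x + y)) <= Num.sqrt (b x x) + Num.sqrt (b y y).
Proof.
move=> dx dy; rewrite -[leRHS]ger0_norm ?addr_ge0 ?sqrtr_ge0// -sqrtr_sqr.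
apply: ler_wsqrtr; rewrite si_sqD// sqrrD !sqr_sqrtr ?(si_ge0 sb)//.
have := si_CS_sqrt dx dy; rewrite ler_norml => /andP[_].
rewrite -mulr_natr; lra.
Qed.

Lemma snormed_of_form (X : nspace V) : dom X = D -> (forall x, (0 <= nrm X x)%E) ->
  (forall x, D x -> nrm X x = (Num.sqrt (b x x))%:E) -> snormed X.
Proof.
move=> XD X0 XE; split; rewrite ?XD.
- exact: (si_dom0 sb).
- exact: si_domP sb.
- exact: X0.
- by move=> x dx; rewrite XE.
- move=> x y dx dy; rewrite !XE//; last exact: si_domD.
  by rewrite -EFinD lee_fin si_sqrtD.
- move=> a x dx; rewrite !XE//; last exact: si_domZ.
  by rewrite -EFinM si_Zl ?si_Zr//; [rewrite mulrA -expr2 sqrtrM ?sqr_ge0// sqrtr_sqr|exact: si_domZ].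
Qed.

Lemma si_dual (X : nspace V) : snormed X -> (forall x, dom X x -> D x) ->
  (forall x, dom X x -> b x x <= fnrm X x ^+ 2) -> forall y, D y -> dom (dualS X) (b y : V -> R^o).
Proof.
move=> sX XD bX y dy; split=> [a x z dx dz|].
  by rewrite si_Dr ?si_Zr//; try exact: XD; apply: si_domZ; exact: XD.
exists (Num.sqrt (b y y)) => x dx; rewrite (nrmE sX dx) -EFinM lee_fin.
apply: (le_trans (si_CS_sqrt dy (XD _ dx))); rewrite ler_wpM2l ?sqrtr_ge0//.
rewrite -[leRHS]ger0_norm ?(fnrm_ge0 sX)// -sqrtr_sqr.
by apply: ler_wsqrtr; exact: bX.
Qed.

End semi_inner_theory.

Lemma si_add (R : realType) (V : lmodType R) (D D' : set V) (b a : V -> V -> R) :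
  (forall x, D' x -> D x) -> semi_inner D b -> semi_inner D' a ->
  semi_inner D' (fun x y => b x y + a x y).
Proof.
move=> DD sb sa; split; [exact: si_dom0 sa|exact: si_domP sa| | |].
- move=> c x y z dx dy dz.
  rewrite (si_lin sb c (DD _ dx) (DD _ dy) (DD _ dz)) (si_lin sa c dx dy dz).
  have key (p q r s : R) : c * p + q + (c * r + s) = c * (p + r) + (q + s) by ring.
  exact: key.
- by move=> x y dx dy; rewrite (si_sym sb (DD _ dx) (DD _ dy)) (si_sym sa dx dy).
- by move=> x dx; exact: addr_ge0 (si_ge0 sb (DD _ dx)) (si_ge0 sa dx).
Qed.

(** * The semi-inner product of L2 *)

Section L2_space.
Context d (S : measurableType d) {R : realType} (mu : {measure set S -> \bar R}) (D : set S)
  (mD : measurable D).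

Local Notation L2 := (LpS mu D 2%:E).

Lemma L2_nrmE (f : S -> R^o) :
  nrm L2 f = ((\int[mu]_(x in D) ((f x : R) ^+ 2)%:E) `^ 2^-1)%E.
Proof.
rewrite /= unlock; congr (_ `^ _)%E.
transitivity (\int[mu]_x ((fun x => ((f x : R) ^+ 2)%:E) \_ D) x)%E.
  apply: eq_integral => t _; rewrite !patchE; case: ifPn => _.
    by rewrite -[`|_|%E]/(`|f t|%:E) poweR_EFin powR_mulrn ?normr_ge0// real_normK ?num_real.
  by rewrite [point]/(0%E) abse0 poweR0r.
by rewrite -integral_mkcond.
Qed.

Lemma L2_domP (f : S -> R^o) : dom L2 f <->
  measurable_fun D (f : S -> R) /\ mu.-integrable D (fun x => ((f x : R) ^+ 2)%:E).
Proof.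
have sq0 : (0 <= \int[mu]_(x in D) ((f x : R) ^+ 2)%:E)%E.
  by apply: integral_ge0 => x _; rewrite lee_fin sqr_ge0.
split=> -[mf H]; split => //.
  apply/integrableP; split.
    by apply/measurable_EFinP; exact: measurable_funX.
  under eq_integral do rewrite /= ger0_norm ?sqr_ge0//.
  move: H; rewrite [X in (X < _)%E -> _](_ : _ = nrm L2 f)// L2_nrmE.
  move: sq0; case: (integral _ _ _) => [x _ _|_|//]; rewrite ?ltry// poweRyr//.
rewrite [X in (X < _)%E](_ : _ = nrm L2 f)// L2_nrmE poweR_lty//.
by move/integrableP : H => [_]; under eq_integral do rewrite /= ger0_norm ?sqr_ge0//.
Qed.

Lemma L2_integrableM (f g : S -> R^o) : dom L2 f -> dom L2 g ->
  mu.-integrable D (fun x => ((f x : R) * (g x : R))%:E).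
Proof.
move=> /L2_domP[mf if2] /L2_domP[mg ig2].
apply: le_integrable (integrableD mD if2 ig2) => //.
  by apply/measurable_EFinP; exact: measurable_funM.
move=> x _; rewrite /= lee_fin [leRHS]ger0_norm ?addr_ge0 ?sqr_ge0//.
rewrite ler_norml; move: (f x : R) (g x : R) => a c; apply/andP; split; nra.
Qed.

Definition L2ip (f g : S -> R) : R := \int[mu]_(x in D) (f x * g x).

Lemma semi_inner_L2 : semi_inner (dom L2) L2ip.
Proof.
split.
- apply/L2_domP; split; first exact: measurable_cst.
  by under eq_fun do rewrite expr0n/=; exact: integrable0.
- move=> a x y dx dy; apply/L2_domP.
  have [mx ix] := (L2_domP x).1 dx; have [my iy] := (L2_domP y).1 dy.
  split; first by apply: measurable_funD => //; apply: measurable_funM => //; exact: measurable_cst.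
  have i1 := integrableD mD (integrableZl mD (a ^+ 2) ix)
     (integrableD mD (integrableZl mD (2 * a) (L2_integrableM dx dy)) iy).
  apply: eq_integrable i1 => // z _; rewrite /= -!EFinM -!EFinD; congr EFin.
  have key (p q : R) : a ^+ 2 * p ^+ 2 + (2 * a * (p * q) + q ^+ 2) = (a * p + q) ^+ 2 by ring.
  exact: key.
- move=> a x y z dx dy dz; rewrite /L2ip.
  rewrite -RintegralZl//; last exact: L2_integrableM.
  rewrite -RintegralD//; last exact: L2_integrableM.
    by apply: eq_Rintegral => t _; rewrite mulrDl mulrA.
  exact: (integrableZl mD a (L2_integrableM dx dz)).
- by move=> x y _ _; apply: eq_Rintegral => t _; rewrite mulrC.
- by move=> x _; apply: Rintegral_ge0 => t _; rewrite -expr2 sqr_ge0.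
Qed.

Lemma L2_nrm_sqrt (f : S -> R^o) : dom L2 f -> nrm L2 f = (Num.sqrt (L2ip f f))%:E.
Proof.
move=> df; rewrite L2_nrmE -[RHS]/(sqrte (L2ip f f)%:E) -poweR12_sqrt ?lee_fin ?(si_ge0 semi_inner_L2)//.
rewrite /L2ip /Rintegral fineK; last by apply: integrable_fin_num => //; exact: L2_integrableM.
by [].
Qed.

Lemma snormed_L2 : snormed L2.
Proof.
by apply: (snormed_of_form semi_inner_L2) => [//|x|x dx]; [exact: Lnorm_ge0|exact: L2_nrm_sqrt].
Qed.

Lemma L2_fnrm_sq f : dom L2 f -> fnrm L2 f ^+ 2 = L2ip f f.
Proof. by move=> df; rewrite /fnrm L2_nrm_sqrt//= sqr_sqrtr// (si_ge0 semi_inner_L2). Qed.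

End L2_space.

(** * Boxes and the fundamental lemma of the calculus of variations *)

Section zero_integrals.
Context d (S : measurableType d) d' (S' : measurableType d') {R : realType}
  (mu : {measure set S -> \bar R}).
Local Open Scope ereal_scope.

(** Dynkin's argument: the sets A with vanishing integral are stable under complement because the
    total integral is 0, and under disjoint countable unions by integrability. The map [p] allows
    one coordinate to be treated at a time. *)
Lemma integral_preimage_eq0 (p : S -> S') (E : set S) (g : S -> \bar R) (G : set (set S')) :
  measurable_fun setT p -> measurable E -> mu.-integrable E g ->
  @measurable _ S' = <<s G >> -> setI_closed G ->
  \int[mu]_(x in E) g x = 0 ->
  (forall A, G A -> \int[mu]_(x in E `&` p @^-1` A) g x = 0) ->
  forall A, measurable A -> \int[mu]_(x in E `&` p @^-1` A) g x = 0.
Proof.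
move=> mp mE ig GE GI E0 G0 A; rewrite GE.
have mpA B : measurable B -> measurable (E `&` p @^-1` B).
  by move=> mB; apply: measurableI => //; rewrite -[_ @^-1` _]setTI; exact: mp.
apply: (dynkin_induction (P := fun A => \int[mu]_(x in E `&` p @^-1` A) g x = 0) GE GI).
- by rewrite preimage_setT setIT.
- exact: G0.
- move=> B mB B0.
  have := E0; rewrite -[E in integral _ E](_ : (E `&` p @^-1` B) `|` (E `&` p @^-1` (~` B)) = E).
    rewrite integral_setU//; first by rewrite B0 add0e.
    + exact: mpA.
    + by apply: mpA; exact: measurableC.
    + by apply: measurable_funS (measurable_int _ ig) => // x [] [].
    + by apply/disj_set2P; apply/seteqP; split => // x [[_ Bx] [_]].
  by rewrite -setIUr preimage_setC setUv setIT.
- move=> F mF tF F0.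
  rewrite preimage_bigcup setI_bigcupr integral_bigcup//.
  + by rewrite eseries0// => i _ _; exact: F0.
  + by move=> i j _ _ [x [[_ Fi] [_ Fj]]]; apply: (tF i j) => //; exists (p x).
  + by move=> k; exact: mpA.
  + apply: integrableS ig => //; first by apply: bigcupT_measurable => k; exact: mpA.
    by move=> x [k _ []].
Qed.

End zero_integrals.

(** * Boxes exhausting an open set *)

Section boxes.
Context {R : realType}.
Local Notation space := (space3 R).

Definition box (p q : space) : set space :=
  [set x | [/\ p.1.1 < x.1.1 < q.1.1, p.1.2 < x.1.2 < q.1.2 & p.2 < x.2 < q.2]].

Definition cbox (p q : space) : set space :=
  [set x | [/\ p.1.1 <= x.1.1 <= q.1.1, p.1.2 <= x.1.2 <= q.1.2 & p.2 <= x.2 <= q.2]].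

Lemma boxE p q : box p q =
  (`]p.1.1, q.1.1[%classic `*` `]p.1.2, q.1.2[%classic) `*` `]p.2, q.2[%classic.
Proof.
apply/seteqP; split => [x [h1 h2 h3]|x [[]]] /=; rewrite !in_itv/=; first by split.
by move=> h1 h2 h3; split.
Qed.

Lemma cboxE p q : cbox p q =
  (`[p.1.1, q.1.1]%classic `*` `[p.1.2, q.1.2]%classic) `*` `[p.2, q.2]%classic.
Proof.
apply/seteqP; split => [x [h1 h2 h3]|x [[]]] /=; rewrite !in_itv/=; first by split.
by move=> h1 h2 h3; split.
Qed.

Lemma box_cbox p q : box p q `<=` cbox p q.
Proof. by move=> x [/andP[? ?] /andP[? ?] /andP[? ?]]; split; rewrite !ltW. Qed.

Lemma measurable_box p q : measurable (box p q).
Proof.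
rewrite boxE; apply: measurableX; first apply: measurableX; exact: measurable_itv.
Qed.

Lemma compact_cbox p q : compact (cbox p q).
Proof.
rewrite cboxE; apply: compact_setX; first apply: compact_setX; exact: segment_compact.
Qed.

Definition rat_box (r : (rat * rat * rat) * (rat * rat * rat)) : space * space :=
  ((ratr r.1.1.1, ratr r.1.1.2, ratr r.1.2), (ratr r.2.1.1, ratr r.2.1.2, ratr r.2.2)).

Lemma open_rat_box (Om : set space) x : open Om -> Om x ->
  exists r, box (rat_box r).1 (rat_box r).2 x /\ cbox (rat_box r).1 (rat_box r).2 `<=` Om.
Proof.
move=> oOm Omx; have /nbhs_ballP[e /= e0 He] : nbhs x Om by exact: open_nbhs_nbhs.
have ratP (y : R) : exists r : rat * rat, ratr r.1 < y < ratr r.2 /\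
    forall z, ratr r.1 <= z <= ratr r.2 -> ball y e z.
  have [a] : exists q : rat, ratr q \in `]y - e, y[ by apply: rat_in_itvoo; lra.
  have [b] : exists q : rat, ratr q \in `]y, y + e[ by apply: rat_in_itvoo; lra.
  rewrite !in_itv/= => /andP[yb be] /andP[ea ay]; exists (a, b); split; first by rewrite ay.
  move=> z /andP[az zb]; rewrite /ball/= ltr_distlC (lt_le_trans ea az).
  exact: le_lt_trans be.
have [r1 [x1 H1]] := ratP x.1.1; have [r2 [x2 H2]] := ratP x.1.2.
have [r3 [x3 H3]] := ratP x.2.
exists ((r1.1, r2.1, r3.1), (r1.2, r2.2, r3.2)); split; first by split.
move=> z [z1 z2 z3]; apply: He; split; last exact: H3.
by split; [exact: H1|exact: H2].
Qed.

(** Countability lets almost-everywhere statements on boxes be combined, and closed boxes inside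
    [Om] leave room for compactly supported test functions. Inadmissible indices contribute the
    empty set. *)
Lemma open_bigcup_box (Om : set space) : open Om -> exists P : nat -> set space,
  (forall n, P n = set0 \/ exists p q, P n = box p q /\ cbox p q `<=` Om) /\
  Om = \bigcup_n P n.
Proof.
move=> oOm.
have [e eP] : exists e : nat -> option ((rat * rat * rat) * (rat * rat * rat)),
    forall r, exists n, e n = Some r.
  by exists unpickle => r; exists (pickle r); exact: pickleK.
pose P n := if e n is Some r then
     (if pselect (cbox (rat_box r).1 (rat_box r).2 `<=` Om) then box (rat_box r).1 (rat_box r).2 else set0)
     else set0.
exists P; split=> [n|].
  rewrite /P; case: (e n) => [r|]; last by left.
  by case: pselect => sub; [right; exists (rat_box r).1, (rat_box r).2|left].
apply/seteqP; split=> [x Omx|x [n _]].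
  have [r [rx sub]] := open_rat_box oOm Omx; have [n en] := eP r; exists n; first exact: I.
  by rewrite /P en; case: pselect.
rewrite /P; case: (e n) => [r|//]; case: pselect => [sub h|//]; apply: (sub); exact: box_cbox.
Qed.

Lemma open_measurable_space3 (Om : set space) : open Om -> measurable Om.
Proof.
move=> oOm; have [P [HP ->]] := open_bigcup_box oOm; apply: bigcupT_measurable => n.
by case: (HP n) => [->|[p [q [-> _]]]]; [exact: measurable0|exact: measurable_box].
Qed.

Lemma leb3_box p q : p.1.1 <= q.1.1 -> p.1.2 <= q.1.2 -> p.2 <= q.2 ->
  leb3 (box p q) = ((q.1.1 - p.1.1) * (q.1.2 - p.1.2) * (q.2 - p.2))%:E.
Proof.
move=> h1 h2 h3; rewrite boxE.
rewrite [LHS](product_measure1E); [|apply: measurableX; exact: measurable_itv|exact: measurable_itv].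
rewrite [X in (X * _)%E](product_measure1E); [|exact: measurable_itv|exact: measurable_itv].
by rewrite !leb1_itv.
Qed.

Lemma bounded_sub_box (Om : set space) : bounded_set Om ->
  exists m : R, 0 <= m /\ Om `<=` box ((- m, - m), - m) ((m, m), m).
Proof.
move=> [M [_ HM]]; have [M1 M0] : M < `|M| + 1 /\ 0 < `|M| + 1.
  by split; [rewrite ltr_pwDr// ler_norm|rewrite ltr_wpDl].
(* [HM] applies to bounds above M, hence |M| + 1; one more unit makes the inequalities strict, as
   the open box requires. *)
exists (`|M| + 2); split; first by rewrite addr_ge0.
move=> x Omx; have := HM _ M1 x Omx; rewrite /= => nx.
have n1 : `|x.1.1| <= `|x|.
  by apply: le_trans (_ : `|x.1| <= _); rewrite [leRHS]prod_normE le_max lexx.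
have n2 : `|x.1.2| <= `|x|.
  by apply: le_trans (_ : `|x.1| <= _); rewrite [leRHS]prod_normE le_max lexx ?orbT.
have n3 : `|x.2| <= `|x| by rewrite [leRHS]prod_normE le_max lexx orbT.
have lt z : `|z| <= `|x| -> - (`|M| + 2) < z < `|M| + 2.
  by move=> zx; rewrite -ltr_norml (le_lt_trans zx)// (le_lt_trans nx)//; lra.
by split; exact: lt.
Qed.

Lemma leb3_bounded_lty (Om : set space) : open Om -> bounded_set Om -> (leb3 Om < +oo)%E.
Proof.
move=> oOm /bounded_sub_box[m [m0 sub]].
apply: (@le_lt_trans _ _ (leb3 (box ((- m, - m), - m) ((m, m), m)))).
  by apply: le_measure => //; rewrite inE; [exact: open_measurable_space3|exact: measurable_box].
by rewrite leb3_box ?ltry//= lerNl; lra.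
Qed.

End boxes.

(** * Test functions that are products of functions of one variable *)

Section tensor_test_functions.
Context {R : realType}.
Local Notation space := (space3 R).

Definition coord3 (i : 'I_3) (x : space) : R :=
  if i == 0%N :> nat then x.1.1 else if i == 1%N :> nat then x.1.2 else x.2.

Local Notation i0 := (@Ordinal 3 0 isT).
Local Notation i1 := (@Ordinal 3 1 isT).
Local Notation i2 := (@Ordinal 3 2 isT).

Definition tensor3 (f : 'I_3 -> R -> R) (x : space) : R :=
  f i0 (coord3 i0 x) * f i1 (coord3 i1 x) * f i2 (coord3 i2 x).

Lemma coord3_basis (i j : 'I_3) (h : R) (x : space) :
  coord3 j (h *: basis3 i + x) = h * (j == i)%:R + coord3 j x.
Proof.
by case: i => [[|[|[|//]]] ?]; case: j => [[|[|[|//]]] ?].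
Qed.

Lemma is_derive_coord3 (i j : 'I_3) (f : R -> R) (x : space) : smooth1 f ->
  is_derive x (basis3 i) (f \o coord3 j) (if j == i then derive1 f (coord3 j x) else 0).
Proof.
move=> sf; case: eqP => [ji|/eqP ji].
  have df := smooth1_is_derive (coord3 j x) sf.
  have E : (fun h : R => h^-1 *: (((f \o coord3 j) \o shift x) (h *: basis3 i) - (f \o coord3 j) x)) =
      (fun h : R => h^-1 *: ((f \o shift (coord3 j x)) (h *: (1 : R)) - f (coord3 j x))).
    by apply/funext => h; rewrite /= coord3_basis ji eqxx.
  split; first by rewrite /derivable E; exact: ex_derive.
  by rewrite /derive E; exact: derive_val.
have E : (fun h : R => h^-1 *: (((f \o coord3 j) \o shift x) (h *: basis3 i) - (f \o coord3 j) x)) =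
    cst 0.
  by apply/funext => h; rewrite /= coord3_basis (negbTE ji) mulr0 add0r subrr scaler0.
split; rewrite /derivable /derive E; first by apply/cvg_ex; exists 0; exact: cvg_cst.
exact: lim_cst.
Qed.

Lemma coord3_continuous (i : 'I_3) : continuous (coord3 i).
Proof.
move=> x; case: i => [[|[|[|//]]] ?]; rewrite /coord3/=.
- apply: (@continuous_comp _ _ _ fst fst); exact: cvg_fst.
- apply: (@continuous_comp _ _ _ fst snd); [exact: cvg_fst|exact: cvg_snd].
- exact: cvg_snd.
Qed.

Lemma tensor3_continuous f : (forall i, smooth1 (f i)) -> continuous (tensor3 f).
Proof.
move=> sf x.
have c i : {for x, continuous (fun y => f i (coord3 i y))}.
  by apply: continuous_comp; [exact: coord3_continuous|exact: smooth1_continuous].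
by apply: cvgM; [apply: cvgM|]; exact: c.
Qed.

Lemma is_derive_tensor3 f (i : 'I_3) (x : space) : (forall j, smooth1 (f j)) ->
  is_derive x (basis3 i) (tensor3 f) (tensor3 (fun j => if j == i then derive1 (f j) else f j) x).
Proof.
move=> sf.
have d j := is_derive_coord3 i j x (sf j).
have dM : is_derive x (basis3 i) (tensor3 f) _ := is_deriveM (is_deriveM (d i0) (d i1)) (d i2).
apply: (is_derive_eq dM).
rewrite /tensor3 /GRing.scale/= -[X in X * _ + _]/(f i0 (coord3 i0 x) * f i1 (coord3 i1 x)).
by case: i {d dM} => [[|[|[|//]]] ?]; rewrite -!val_eqE /=; ring.
Qed.

Lemma smooth3_tensor3 f : (forall i, smooth1 (f i)) -> smooth3 (tensor3 f).
Proof.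
move=> sf s.
(* A partial derivative differentiates one factor only, so iterated partial derivatives remain
   tensor products of smooth functions. *)
have [f' [sf' ->]] : exists f', (forall i, smooth1 (f' i)) /\ foldr pderiv (tensor3 f) s = tensor3 f'.
  elim: s => [|i s [f' [sf' E]]]; first by exists f.
  exists (fun j => if j == i then derive1 (f' j) else f' j); split.
    by move=> j; case: eqP => _ //; exact: smooth1_derive.
  rewrite /= E; apply/funext => x; rewrite /pderiv.
  by have := is_derive_tensor3 i x sf' => d; rewrite derive_val.
split; first exact: tensor3_continuous.
by move=> i x; apply: ex_derive; exact: is_derive_tensor3.
Qed.

(** Since [eta] tends to 1 at infinity, scaling its argument by n + 1 drives the bump to the
    indicator of (a, b) while it keeps vanishing outside. *)
Definition bumpn (n : nat) (a b x : R) := eta (n.+1%:R * (x - a)) * eta (n.+1%:R * (b - x)).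

Lemma smooth1_bumpn n a b : smooth1 (bumpn n a b).
Proof.
have h1 := smooth1_affine n.+1%:R (- (n.+1%:R * a)) (@smooth1_eta R).
have h2 := smooth1_affine (- n.+1%:R) (n.+1%:R * b) (@smooth1_eta R).
have := smooth1M h1 h2; congr smooth1; apply/funext => x; rewrite /bumpn.
by congr (eta _ * eta _); ring.
Qed.

Lemma bumpn_neq0 n a b x : bumpn n a b x != 0 -> a < x < b.
Proof.
apply: contraR; rewrite negb_and -!leNgt /bumpn => /orP[h|h].
  by rewrite eta_eq0 ?mul0r// mulr_ge0_le0// subr_le0.
by rewrite [X in _ * X]eta_eq0 ?mulr0// mulr_ge0_le0// subr_le0.
Qed.

Lemma bumpn_01 n a b x : 0 <= bumpn n a b x <= 1.
Proof.
by rewrite mulr_ge0 ?eta_ge0//= -[leRHS]mulr1 ler_pM ?eta_ge0 ?eta_le1.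
Qed.

Lemma eta_scale_cvg (y : R) : 0 < y -> eta (n.+1%:R * y) @[n --> \oo] --> (1 : R).
Proof.
move=> y0.
have -> : (fun n => eta (n.+1%:R * y)) = (fun n => expR (- (n.+1%:R^-1 * y^-1))).
  by apply/funext => n; rewrite etaE mulr_gt0 ?ltr0n// invfM.
rewrite -[X in _ --> X]expR0; apply: continuous_cvg; first exact: continuous_expR.
rewrite -[X in _ --> X]oppr0; apply: cvgN; rewrite -[X in _ --> X](mul0r y^-1).
by apply: cvgMl; exact: cvg_harmonic.
Qed.

Lemma bumpn_cvg a b x : bumpn n a b x @[n --> \oo] --> ((a < x < b)%R%:R : R).
Proof.
case: (boolP (a < x < b)) => [/andP[ax xb]|nx].
  rewrite -[X in _ --> X](mulr1 1); apply: cvgM; apply: eta_scale_cvg; by rewrite subr_gt0.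
apply: cvg_near_cst; apply: nearW => n; apply/eqP; apply: contraTT nx => /bumpn_neq0 ->.
by [].
Qed.

Definition box_bump (p q : space) (n : nat) : space -> R :=
  tensor3 (fun i => bumpn n (coord3 i p) (coord3 i q)).

Lemma box_bump_neq0 p q n x : box_bump p q n x != 0 -> box p q x.
Proof.
move=> H; have h i : bumpn n (coord3 i p) (coord3 i q) (coord3 i x) != 0.
  apply: contraNneq H; rewrite /box_bump /tensor3.
  by case: i => [[|[|[|//]]] ?]; rewrite /coord3/= => ->; rewrite ?(mul0r, mulr0).
by split; [exact: bumpn_neq0 (h i0)|exact: bumpn_neq0 (h i1)|exact: bumpn_neq0 (h i2)].
Qed.

Lemma test3_box_bump (Om : set space) p q n : cbox p q `<=` Om -> test3 Om (box_bump p q n).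
Proof.
move=> sub.
have cl : closure [set x | box_bump p q n x != 0] `<=` cbox p q.
  have cb : closed (cbox p q).
    by apply: compact_closed; [exact: norm_hausdorff|exact: compact_cbox].
  rewrite (closure_id (cbox p q)).1//.
  by apply: closure_subset => x /box_bump_neq0; exact: box_cbox.
split.
- by apply: smooth3_tensor3 => i; exact: smooth1_bumpn.
- by apply: subclosed_compact cl; [exact: closed_closure|exact: compact_cbox].
- exact: subset_trans cl sub.
Qed.

Lemma box_bump_cvg p q x : box_bump p q n x @[n --> \oo] --> (\1_(box p q) x : R).
Proof.
have -> : \1_(box p q) x = (p.1.1 < x.1.1 < q.1.1)%R%:R * (p.1.2 < x.1.2 < q.1.2)%R%:R * (p.2 < x.2 < q.2)%R%:R :> R.
  rewrite indicE; have [/set_mem[-> -> ->]|/negP nb] := boolP (x \in box p q); first by rewrite !mulr1.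
  case: (boolP (p.1.1 < _ < _)) => [h1|]; last by rewrite !mul0r.
  case: (boolP (p.1.2 < _ < _)) => [h2|]; last by rewrite mulr0 mul0r.
  case: (boolP (p.2 < _ < _)) => [h3|]; last by rewrite mulr0.
  by exfalso; apply: nb; rewrite inE.
by apply: cvgM; [apply: cvgM|]; exact: bumpn_cvg.
Qed.

Lemma box_bump_01 p q n x : 0 <= box_bump p q n x <= 1.
Proof.
have b i := bumpn_01 n (coord3 i p) (coord3 i q) (coord3 i x).
have [/andP[a0 a1] /andP[b0 b1] /andP[c0 c1]] := And3 (b i0) (b i1) (b i2).
rewrite /box_bump /tensor3; apply/andP; split; first by apply: mulr_ge0 => //; exact: mulr_ge0.
rewrite -[leRHS](mulr1 1); apply: ler_pM => //; first exact: mulr_ge0.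
by rewrite -[leRHS](mulr1 1); apply: ler_pM.
Qed.

Lemma measurable_box_bump p q n : measurable_fun setT (box_bump p q n).
Proof.
have mb i : measurable_fun setT (bumpn n (coord3 i p) (coord3 i q)).
  by apply: continuous_measurable_fun; apply: smooth1_continuous; exact: smooth1_bumpn.
have m1 : measurable_fun setT (fun x : space => x.1.1).
  exact: measurableT_comp measurable_fst measurable_fst.
have m2 : measurable_fun setT (fun x : space => x.1.2).
  exact: measurableT_comp measurable_snd measurable_fst.
have m3 : measurable_fun setT (fun x : space => x.2) := measurable_snd.
apply: measurable_funM; first apply: measurable_funM.
- exact: measurableT_comp (mb i0) m1.
- exact: measurableT_comp (mb i1) m2.
- exact: measurableT_comp (mb i2) m3.
Qed.

End tensor_test_functions.

Section fundamental_lemma.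
Context {R : realType} (Om : set (space3 R)) (oOm : open Om).
Local Notation space := (space3 R).
Local Notation mu := (@leb3 R).

(** The box bumps are admissible test functions, bounded by 1 and tending to the indicator of the
    box; dominated convergence passes to the limit. *)
Lemma box_integral_eq0 (h : space -> R) (p q : space) : mu.-integrable Om (EFin \o h) ->
  (forall phi, test3 Om phi -> \int[mu]_(x in Om) (h x * phi x) = 0) ->
  cbox p q `<=` Om -> (\int[mu]_(x in box p q) (h x)%:E)%E = 0%E.
Proof.
move=> ih h0 sub; have mOm := open_measurable_space3 oOm.
have mh : measurable_fun Om h by apply/measurable_EFinP; exact: measurable_int ih.
have bOm : box p q `<=` Om := subset_trans (@box_cbox R p q) sub.
pose k x := h x * (\1_(box p q) x : R).
have [ik c] : mu.-integrable Om (EFin \o k) /\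
    \int[mu]_(x in Om) (h x * box_bump p q n x) @[n --> \oo] --> \int[mu]_(x in Om) k x.
  apply: (@Rintegral_dominated_cvg _ _ R mu Om (fun n x => h x * box_bump p q n x) k (fun x => `|h x|)) => //.
  - by move=> n; apply: measurable_funM => //; apply: measurable_funTS; exact: measurable_box_bump.
  - by apply: measurable_funM => //; apply: measurable_funTS; apply: measurable_indic; exact: measurable_box.
  - by apply: aeW => x _; apply: cvgMr; exact: box_bump_cvg.
  - exact: integrable_norm.
  - apply: aeW => x _ n; have /andP[b0 b1] := box_bump_01 p q n x.
    by rewrite normrM (ger0_norm b0) ler_piMr.
have k0 : \int[mu]_(x in Om) k x = 0.
  have cz : (fun n => \int[mu]_(x in Om) (h x * box_bump p q n x)) @ \oo --> (0 : R).
    have -> : (fun n => \int[mu]_(x in Om) (h x * box_bump p q n x)) = cst 0.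
      by apply/funext => n; apply: h0; exact: test3_box_bump.
    exact: cvg_cst.
  exact: (cvg_unique (@Rhausdorff R) c cz).
have ib : mu.-integrable (box p q) (EFin \o h).
  by apply: integrableS ih => //; exact: measurable_box.
rewrite -(fineK (integrable_fin_num _ ib)); last exact: measurable_box.
congr EFin; rewrite -[RHS]k0 -[LHS]/(Rintegral _ _ _).
rewrite -[in LHS](_ : Om `&` box p q = box p q); last exact/setIidPr.
rewrite Rintegral_mkcondr; apply: eq_Rintegral => x _.
by rewrite /k patchE indicE; case: ifP => _; rewrite ?mulr1 ?mulr0.
Qed.

Lemma setI_closed_rays : setI_closed (@RGenOInfty.G R).
Proof.
move=> _ _ [x ->] [y ->]; exists (Num.max x y); apply/seteqP; split => z /=.
  by rewrite !in_itv/= !andbT gt_max => -[-> ->].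
by rewrite !in_itv/= !andbT gt_max => /andP[].
Qed.

Lemma setI_closed_rectangles d1 d2 (T1 : measurableType d1) (T2 : measurableType d2) :
  setI_closed [set A `*` B | A in @measurable d1 T1 & B in @measurable d2 T2].
Proof.
move=> _ _ [A1 mA1 [B1 mB1 <-]] [A2 mA2 [B2 mB2 <-]].
exists (A1 `&` A2); first exact: measurableI.
exists (B1 `&` B2); first exact: measurableI.
by rewrite setXI.
Qed.

(** The sigma-algebra of [space3] is an iterated product. Vanishing on sub-boxes is extended first
    to measurable sets in each coordinate, then to rectangles, then to all measurable sets. *)
Lemma box_ae_eq0 (h : space -> R) (p q : space) : mu.-integrable Om (EFin \o h) ->
  (forall phi, test3 Om phi -> \int[mu]_(x in Om) (h x * phi x) = 0) ->
  cbox p q `<=` Om -> {ae mu, forall x, box p q x -> h x = 0}.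
Proof.
move=> ih h0 sub; have mOm := open_measurable_space3 oOm.
have mb := @measurable_box R p q.
have bOm : box p q `<=` Om := subset_trans (@box_cbox R p q) sub.
have ib : mu.-integrable (box p q) (EFin \o h) by exact: integrableS ih.
pose Z (E : set space) := (\int[mu]_(x in E) (h x)%:E)%E = 0%E.
have iI E : measurable E -> mu.-integrable (box p q `&` E) (EFin \o h).
  by move=> mE; apply: integrableS ib => //; exact: measurableI.
pose p1 (x : space) := x.1.1; pose p2 (x : space) := x.1.2; pose p3 (x : space) := x.2.
have m1 : measurable_fun setT p1 by exact: measurableT_comp measurable_fst measurable_fst.
have m2 : measurable_fun setT p2 by exact: measurableT_comp measurable_snd measurable_fst.
have m3 : measurable_fun setT p3 := measurable_snd.
have mp1 A : measurable A -> measurable (p1 @^-1` A) by move=> mA; rewrite -[_ @^-1` _]setTI; exact: m1.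
have mp2 A : measurable A -> measurable (p2 @^-1` A) by move=> mA; rewrite -[_ @^-1` _]setTI; exact: m2.
have mp3 A : measurable A -> measurable (p3 @^-1` A) by move=> mA; rewrite -[_ @^-1` _]setTI; exact: m3.
have Zeq E E' : (forall x, E x <-> E' x) -> Z E -> Z E'.
  by move=> EE'; rewrite (_ : E' = E)//; apply/seteqP; split => x /EE'.
have hb x : box p q x -> p.1.1 < x.1.1 /\ p.1.2 < x.1.2 /\ p.2 < x.2.
  by move=> [/andP[? _] /andP[? _] /andP[? _]].
(* Intersecting the box with three half-spaces gives a smaller box, still admissible. *)
have z0 a b c : Z [set x | box p q x /\ a < x.1.1 /\ b < x.1.2 /\ c < x.2].
  rewrite /Z; set E := [set x | _].
  have -> : E = box ((Num.max p.1.1 a, Num.max p.1.2 b), Num.max p.2 c) q.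
    apply/seteqP; rewrite /E; split => x /=; rewrite /box/= !gt_max.
      by move=> [[/andP[-> ->] /andP[-> ->] /andP[-> ->]] [-> [-> ->]]].
    by move=> [/andP[/andP[-> ->] ->] /andP[/andP[-> ->] ->] /andP[/andP[-> ->] ->]].
  apply: box_integral_eq0 => // x [/= /andP[h1 h2] /andP[h3 h4] /andP[h5 h6]]; apply: sub.
  by split; apply/andP; split => //; [move: h1|move: h3|move: h5]; rewrite ge_max => /andP[].
have GE := RGenOInfty.measurableE R.
have GI := setI_closed_rays.
(* Replaces the rays in one coordinate [k] by measurable sets, the other constraints being frozen in
   [F]. Since [a0] lies below [k] on the box, the ray from [a0] supplies the total integral. *)
have step (k : space -> R) (F : set space) (a0 : R) : measurable_fun setT k -> measurable F ->
    (forall x, box p q x -> a0 < k x) ->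
    (forall a, Z [set x | box p q x /\ F x /\ a < k x]) ->
    forall A, measurable A -> Z [set x | box p q x /\ F x /\ A (k x)].
  move=> mk mF ka H A mA.
  have E0 : Z (box p q `&` F) by apply: (Zeq _ _ _ (H a0)) => x; split=> [[? []]|[b f]] //; split => //; split => //; exact: ka.
  have Hr B : RGenOInfty.G B -> Z (box p q `&` F `&` k @^-1` B).
    move=> [x ->]; apply: (Zeq _ _ _ (H x)) => y /=; rewrite in_itv/= andbT; tauto.
  have := @integral_preimage_eq0 _ _ _ _ R mu k (box p q `&` F) _ _ mk (measurableI _ _ mb mF) (iI _ mF) GE GI E0 Hr A mA.
  by apply: Zeq => y /=; tauto.
have mr k a : measurable_fun setT k -> measurable [set x : space | (a : R) < (k x : R)].
  move=> mk; rewrite (_ : [set x | _] = k @^-1` `]a, +oo[).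
    by rewrite -[_ @^-1` _]setTI; apply: mk => //; exact: measurable_itv.
  by apply/seteqP; split => x /=; rewrite in_itv/= andbT.
have z1 A b c : measurable A -> Z [set x | box p q x /\ A x.1.1 /\ b < x.1.2 /\ c < x.2].
  move=> mA; have := step p1 ([set x | b < p2 x] `&` [set x | c < p3 x]) p.1.1 m1 (measurableI _ _ (mr _ _ m2) (mr _ _ m3)) _ _ A mA.
  move=> H; apply: (Zeq _ _ _ (H _ _)) => [x /=|x /hb[]//|a]; first by rewrite /p1 /p2 /p3; tauto.
  by apply: (Zeq _ _ _ (z0 a b c)) => x; rewrite /= /p1 /p2 /p3; tauto.
have z2 A B c : measurable A -> measurable B -> Z [set x | box p q x /\ A x.1.1 /\ B x.1.2 /\ c < x.2].
  move=> mA mB; have := step p2 (p1 @^-1` A `&` [set x | c < p3 x]) p.1.2 m2 (measurableI _ _ (mp1 _ mA) (mr _ _ m3)) _ _ B mB.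
  move=> H; apply: (Zeq _ _ _ (H _ _)) => [x /=|x /hb[_ []]//|a]; first by rewrite /p1 /p2 /p3; tauto.
  by apply: (Zeq _ _ _ (z1 A a c mA)) => x; rewrite /= /p1 /p2 /p3; tauto.
have z3 A B C : measurable A -> measurable B -> measurable C -> Z [set x | box p q x /\ A x.1.1 /\ B x.1.2 /\ C x.2].
  move=> mA mB mC; have := step p3 (p1 @^-1` A `&` p2 @^-1` B) p.2 m3 (measurableI _ _ (mp1 _ mA) (mp2 _ mB)) _ _ C mC.
  move=> H; apply: (Zeq _ _ _ (H _ _)) => [x /=|x /hb[_ []]//|a]; first by rewrite /p1 /p2 /p3; tauto.
  by apply: (Zeq _ _ _ (z2 A B a mA mB)) => x; rewrite /= /p1 /p2 /p3; tauto.
have mfst := @measurable_fst _ _ (measurableTypeR R * measurableTypeR R)%type (measurableTypeR R).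
(* The first factor of [space3] is itself a product, generated by rectangles, so the same argument
   is run along [fst]. *)
have z4 D C : measurable D -> measurable C -> Z [set x | box p q x /\ D x.1 /\ C x.2].
  move=> mD mC.
  have iE := iI _ (mp3 _ mC).
  have E0 : Z (box p q `&` p3 @^-1` C).
    by apply: (Zeq _ _ _ (z3 setT setT C measurableT measurableT mC)) => x; rewrite /= /p3; tauto.
  have := integral_preimage_eq0 mfst (measurableI _ _ mb (mp3 _ mC)) iE (measurable_prod_measurableType _ _) (@setI_closed_rectangles _ _ _ _) E0.
  move=> H; apply: (Zeq _ _ _ (H _ D mD)) => [x /=|_ [A mA [B mB <-]]]; first by rewrite /p3; tauto.
  by apply: (Zeq _ _ _ (z3 A B C mA mB mC)) => x; rewrite /= /p3; tauto.
have z5 E : measurable E -> Z (box p q `&` E).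
  move=> mE; have E0 : Z (box p q).
    by apply: (Zeq _ _ _ (z4 setT setT measurableT measurableT)) => x /=; tauto.
  have := integral_preimage_eq0 (@measurable_id _ _ setT) mb ib (measurable_prod_measurableType _ _) (@setI_closed_rectangles _ _ _ _) E0.
  move=> H; apply: (Zeq _ _ _ (H _ E mE)) => [x //|_ [A mA [B mB <-]]].
  by apply: (Zeq _ _ _ (z4 A B mA mB)) => x /=; tauto.
have := @integral_ae_eq _ _ R mu (box p q) mb (cst 0%E) (EFin \o h) ib (@measurable_cst _ _ _ _ _ _).
have H E : E `<=` box p q -> measurable E -> (\int[mu]_(x in E) (EFin \o h) x = \int[mu]_(x in E) cst 0 x)%E.
  move=> Eb mE; rewrite integral0; have := z5 E mE; rewrite /Z => <-.
  by congr integral; rewrite setIC; apply/esym/setIidPl.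
move=> /(_ H); apply: filterS => x hx bx; have := hx bx; by case.
Qed.

Lemma fundamental_lemma (h : space -> R) : mu.-integrable Om (EFin \o h) ->
  (forall phi, test3 Om phi -> \int[mu]_(x in Om) (h x * phi x) = 0) ->
  {ae mu, forall x, Om x -> h x = 0}.
Proof.
move=> ih h0; have [P [HP PE]] := open_bigcup_box oOm.
have : \forall x \ae mu, forall n, P n x -> h x = 0.
  apply: ae_foralln => n; case: (HP n) => [->|[p [q [-> sub]]]]; first by apply: aeW.
  exact: box_ae_eq0.
by apply: filterS => x H; rewrite PE => -[n _ /H].
Qed.

End fundamental_lemma.

(** * The spaces L2 and H1 *)

Section H1_space.
Context {R : realType} (Om : set (space3 R)) (oOm : open Om) (bOm : bounded_set Om).
Local Notation space := (space3 R).
Local Notation mu := (@leb3 R).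
Local Notation dL2 := (dom (L2 Om)).
Let mOm : measurable Om := open_measurable_space3 oOm.

Lemma ipE (f h : space -> R) : ip Om f h = L2ip mu Om f h.
Proof. by []. Qed.

Definition si_ip : semi_inner dL2 (ip Om) := semi_inner_L2 mu mOm.

Lemma sL2 : snormed (L2 Om).
Proof. exact: snormed_L2. Qed.

(** Measurability refers to the product sigma-algebra; it contains the open sets because they are
    countable unions of boxes. *)
Lemma open_measurable_preimage (f : space -> R) : continuous f -> measurable_fun setT f.
Proof.
move=> cf; apply: (measurability _ (RGenOInfty.measurableE R)) => _ [_ [x ->] <-].
rewrite setTI; apply: open_measurable_space3.
by apply: open_comp; [move=> y _; exact: cf|exact: interval_open].
Qed.

Lemma bounded_L2 (f : space -> R^o) (M : R) : measurable_fun Om (f : space -> R) ->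
  (forall x, Om x -> `|f x| <= M) -> dL2 f.
Proof.
move=> mf fM; apply/L2_domP; split => //.
apply: (@le_integrable _ _ _ mu Om mOm _ (EFin \o cst (M ^+ 2))).
- by apply/measurable_EFinP; exact: measurable_funX.
- move=> x Omx /=; rewrite lee_fin !normrX !ler_sqr ?nnegrE//; apply: le_trans (ler_norm _).
  exact: fM.
- apply/integrableP; split; first by apply/measurable_EFinP.
  rewrite [X in (X < _)%E](_ : _ = (M ^+ 2)%:E * mu Om)%E.
    by apply: lte_mul_pinfty => //; [rewrite lee_fin sqr_ge0|exact: leb3_bounded_lty].
  rewrite -[RHS](@integral_cst _ _ _ mu Om mOm).
  by apply: eq_integral => x _; rewrite /= ger0_norm ?sqr_ge0.
Qed.

Lemma continuous_L2 (f : space -> R^o) : continuous (f : space -> R) -> dL2 f.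
Proof.
move=> cf; have [m [_ sub]] := bounded_sub_box bOm.
have := continuous_compact (@continuous_subspaceT _ _ (cbox ((- m, - m), - m) ((m, m), m)) f cf) (@compact_cbox R _ _).
move=> /compact_bounded[M [_ HM]].
apply: (@bounded_L2 f (M + 1)).
  by apply: measurable_funTS; exact: open_measurable_preimage.
move=> x Omx; apply: HM; first by rewrite ltrDl.
by exists x => //; apply: box_cbox; exact: sub.
Qed.

Lemma L2_integrable (f : space -> R^o) : dL2 f -> mu.-integrable Om (EFin \o (f : space -> R)).
Proof.
move=> df; have d1 : dL2 (cst 1) by apply: continuous_L2; exact: cst_continuous.
have := L2_integrableM mOm df d1; congr integrable.
by apply/funext => x /=; rewrite mulr1.
Qed.

Lemma test3_L2 phi : test3 Om phi -> dL2 phi /\ forall i, dL2 (pderiv i phi).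
Proof.
move=> [s _ _]; split=> [|i]; apply: continuous_L2; first exact: (s [::]).1.
exact: (s [:: i]).1.
Qed.

Definition ae_Om (f h : space -> R) := {ae mu, forall x, Om x -> f x = h x}.

Lemma ae_ip (f h k : space -> R^o) : dL2 f -> dL2 h -> dL2 k -> ae_Om f h -> ip Om f k = ip Om h k.
Proof.
move=> /L2_domP[mf _] /L2_domP[mh _] /L2_domP[mk _] fh.
rewrite /ip /Rintegral; congr fine; apply: ae_eq_integral => //.
- by apply/measurable_EFinP; exact: measurable_funM.
- by apply/measurable_EFinP; exact: measurable_funM.
- by apply: (@filterS _ (almost_everywhere mu) _ _ _ _ fh) => x H /H ->.
Qed.

Lemma weak_pderiv_unique i v h1 h2 : dL2 h1 -> dL2 h2 ->
  is_weak_pderiv Om i v h1 -> is_weak_pderiv Om i v h2 -> ae_Om h1 h2.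
Proof.
move=> d1 d2 w1 w2; have d12 := si_domB si_ip d1 d2.
have := @fundamental_lemma R Om oOm (h1 - h2) (L2_integrable d12).
have H phi : test3 Om phi -> \int[mu]_(x in Om) ((h1 - h2) x * phi x) = 0.
  move=> tp; have [dp _] := test3_L2 tp.
  rewrite -[LHS]/(ip Om (h1 - h2) phi) (si_Bl si_ip)//.
  by have := w1 _ tp; rewrite w2// => /eqP; rewrite eqr_opp => /eqP ->; rewrite subrr.
move=> /(_ H) K; apply: (@filterS _ (almost_everywhere mu) _ _ _ _ K) => x hx /hx.
by move/eqP; rewrite subr_eq0 => /eqP.
Qed.

Lemma is_weak_pderivP i a v1 v2 h1 h2 : dL2 v1 -> dL2 v2 -> dL2 h1 -> dL2 h2 ->
  is_weak_pderiv Om i v1 h1 -> is_weak_pderiv Om i v2 h2 ->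
  is_weak_pderiv Om i (a *: (v1 : space -> R^o) + v2) (a *: (h1 : space -> R^o) + h2).
Proof.
move=> dv1 dv2 dh1 dh2 w1 w2 phi tp; have [dp /(_ i) ddp] := test3_L2 tp.
by rewrite (si_lin si_ip a dv1 dv2 ddp) (si_lin si_ip a dh1 dh2 dp) w1// w2//; ring.
Qed.

Local Notation dH1 := (dom (H1 Om)).

Lemma weak_pderivP i v : dH1 v -> dL2 (weak_pderiv Om i v) /\ is_weak_pderiv Om i v (weak_pderiv Om i v).
Proof. by move=> [_ /(_ i)] => /(xgetPex 0). Qed.

Lemma dL2_weak_pderiv i v : dH1 v -> dL2 (weak_pderiv Om i v).
Proof. by move=> /(weak_pderivP i)[]. Qed.

Lemma dH1_dL2 v : dH1 v -> dL2 v. Proof. by case. Qed.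

Lemma dH1_0 : dH1 0.
Proof.
have d0 := si_dom0 si_ip; split => // i; exists 0; split => // phi tp; have [dp /(_ i) ddp] := test3_L2 tp.
by rewrite !(si_0l si_ip)// oppr0.
Qed.

Lemma dH1_lin a x y : dH1 x -> dH1 y -> dH1 (a *: x + y).
Proof.
move=> dx dy; have [dx2 dy2] := (dH1_dL2 dx, dH1_dL2 dy).
split=> [|i]; first exact: si_domP si_ip _ _ _ dx2 dy2.
have [[d1 w1] [d2 w2]] := (weak_pderivP i dx, weak_pderivP i dy).
by exists (a *: weak_pderiv Om i x + weak_pderiv Om i y); split;
  [exact: si_domP si_ip _ _ _ d1 d2|exact: is_weak_pderivP].
Qed.

(** [weak_pderiv] is chosen separately for each function, so linearity can only hold up to a null
    set. *)
Lemma weak_pderiv_lin i a x y : dH1 x -> dH1 y ->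
  ae_Om (weak_pderiv Om i (a *: x + y)) (a *: weak_pderiv Om i x + weak_pderiv Om i y).
Proof.
move=> dx dy; have [[d1 w1] [d2 w2]] := (weak_pderivP i dx, weak_pderivP i dy).
have [d3 w3] := weak_pderivP i (dH1_lin a dx dy).
apply: (weak_pderiv_unique d3 _ w3); first exact: si_domP si_ip _ _ _ d1 d2.
by apply: is_weak_pderivP => //; exact: dH1_dL2.
Qed.

Lemma si_ip_grad : semi_inner dH1 (ip_grad Om).
Proof.
split; [exact: dH1_0|exact: dH1_lin| | |].
- move=> a x y z dx dy dz; rewrite /ip_grad mulr_sumr -big_split/=; apply: eq_bigr => i _.
  have [[d1 _] [d2 _]] := (weak_pderivP i dx, weak_pderivP i dy).
  have d3 := dL2_weak_pderiv i dz.
  rewrite (ae_ip _ _ d3 (weak_pderiv_lin i a dx dy)) ?(si_lin si_ip)//.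
    exact/dL2_weak_pderiv/dH1_lin.
  exact: si_domP si_ip _ _ _ d1 d2.
- by move=> x y dx dy; apply: eq_bigr => i _; apply: (si_sym si_ip); exact: dL2_weak_pderiv.
- by move=> x dx; apply: sumr_ge0 => i _; apply: (si_ge0 si_ip); exact: dL2_weak_pderiv.
Qed.

Definition ipH (x y : space -> R^o) : R := ip Om x y + ip_grad Om x y.

Lemma si_ipH : semi_inner dH1 ipH.
Proof. exact: (si_add dH1_dL2 si_ip si_ip_grad). Qed.

Lemma H1_nrm_sqrt x : dH1 x -> nrm (H1 Om) x = (Num.sqrt (ipH x x))%:E.
Proof.
move=> dx; have E v : dL2 v -> (nrm (L2 Om) v ^+ 2)%E = (ip Om v v)%:E.
  by move=> dv; rewrite (L2_nrm_sqrt mOm dv) -EFin_expe sqr_sqrtr// (si_ge0 si_ip).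
rewrite -[LHS]/(sqrte (nrm (L2 Om) x ^+ 2 + \sum_(i < 3) nrm (L2 Om) (weak_pderiv Om i x) ^+ 2)%E).
rewrite E; last exact: dH1_dL2.
rewrite (eq_bigr (fun i => (ip Om (weak_pderiv Om i x) (weak_pderiv Om i x))%:E)).
  by rewrite sumEFin.
by move=> i _; apply: E; exact: dL2_weak_pderiv.
Qed.

Lemma sH1 : snormed (H1 Om).
Proof. by apply: (snormed_of_form si_ipH) => // x; [rewrite sqrte_ge0|exact: H1_nrm_sqrt]. Qed.

Lemma H1_fnrm_sq x : dH1 x -> fnrm (H1 Om) x ^+ 2 = ip Om x x + ip_grad Om x x.
Proof. by move=> dx; rewrite /fnrm H1_nrm_sqrt// sqr_sqrtr// (si_ge0 si_ipH). Qed.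

Lemma L2_fnrmE x : dL2 x -> fnrm (L2 Om) x ^+ 2 = ip Om x x.
Proof. exact: (L2_fnrm_sq mOm). Qed.

Lemma ip_le_H1 x : dH1 x -> ip Om x x <= fnrm (H1 Om) x ^+ 2.
Proof. by move=> dx; rewrite H1_fnrm_sq// lerDl (si_ge0 si_ip_grad). Qed.

Lemma ip_grad_le_H1 x : dH1 x -> ip_grad Om x x <= fnrm (H1 Om) x ^+ 2.
Proof. by move=> dx; rewrite H1_fnrm_sq// lerDr (si_ge0 si_ip)//; exact: dH1_dL2. Qed.

Lemma fnrm_L2_H1 x : dH1 x -> fnrm (L2 Om) x <= fnrm (H1 Om) x.
Proof.
move=> dx; have dx2 := dH1_dL2 dx.
rewrite -ler_sqr ?nnegrE ?(fnrm_ge0 sL2)// ?(fnrm_ge0 sH1)// L2_fnrmE//; exact: ip_le_H1.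
Qed.

Lemma ip_CS x y : dL2 x -> dL2 y -> `|ip Om x y| <= fnrm (L2 Om) x * fnrm (L2 Om) y.
Proof. by move=> dx dy; rewrite /fnrm !(L2_nrm_sqrt mOm)//=; exact: (si_CS_sqrt si_ip). Qed.

Lemma ip_grad_CS x y : dH1 x -> dH1 y -> `|ip_grad Om x y| <= fnrm (H1 Om) x * fnrm (H1 Om) y.
Proof.
move=> dx dy; apply: (le_trans (si_CS_sqrt si_ip_grad dx dy)).
have K z : dH1 z -> Num.sqrt (ip_grad Om z z) <= fnrm (H1 Om) z.
  move=> dz; rewrite -[leRHS]ger0_norm ?(fnrm_ge0 sH1)// -sqrtr_sqr; apply: ler_wsqrtr; exact: ip_grad_le_H1.
by apply: ler_pM; rewrite ?sqrtr_ge0//; exact: K.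
Qed.

Lemma ip_dualL2 y : dL2 y -> dom (dualS (L2 Om)) (ip Om y).
Proof. by apply: (si_dual si_ip sL2) => // x dx; rewrite L2_fnrmE. Qed.

Lemma ip_dualH1 y : dL2 y -> dom (H1' Om) (ip Om y).
Proof. by apply: (si_dual si_ip sH1) => // x dx; [exact: dH1_dL2|exact: ip_le_H1]. Qed.

Lemma ip_grad_dual y : dH1 y -> dom (H1' Om) (ip_grad Om y).
Proof. by apply: (si_dual si_ip_grad sH1) => // x dx; exact: ip_grad_le_H1. Qed.

Lemma lipschitz_le (g : R -> R) : lipschitz g ->
  exists2 L : R, 0 <= L & forall x y : R, `|g x - g y| <= L * `|x - y|.
Proof.
move=> [M [_ HM]]; exists (`|M| + 1); first by rewrite addr_ge0.
move=> x y; have /HM/(_ (x, y)) : M < `|M| + 1 by rewrite ltr_pwDr// ler_norm.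
exact.
Qed.

Lemma lipschitz_L2 (g : R -> R) (u : space -> R^o) : lipschitz g -> dL2 u -> dL2 (fun x => g (u x)).
Proof.
move=> lg du; have [L L0 HL] := lipschitz_le lg.
have cg : continuous g.
  move=> x; apply: (@cvg_dist_le R R (nbhs x) _ g (fun y : R => L * `|x - y|) (g x)).
    by near=> y; rewrite distrC.
  have -> : (0 : R) = L * `|x - x| by rewrite subrr normr0 mulr0.
  apply: cvgMr; apply: cvg_norm; apply: cvgB; [exact: cvg_cst|exact: cvg_id].
have mgu : measurable_fun Om (fun x => g (u x)).
  apply: (measurableT_comp (continuous_measurable_fun cg)).
  by have /L2_domP[] := du.
have dh : dL2 (fun x => L * `|u x| + `|g 0|).
  have du1 : dL2 (fun x => `|u x|).
    have /L2_domP[mu1 iu1] := du; apply/L2_domP; split; first exact: measurableT_comp mu1.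
    by move: iu1; congr integrable; apply/funext => x; rewrite real_normK ?num_real.
  apply: (si_domP si_ip L du1); apply: continuous_L2; exact: cst_continuous.
have /L2_domP[_ ih] := dh; apply/L2_domP; split => //.
apply: le_integrable ih => //; first by apply/measurable_EFinP; exact: measurable_funX.
move=> x Omx /=; rewrite lee_fin !normrX ler_sqr ?nnegrE//.
rewrite [leRHS]ger0_norm ?addr_ge0 ?mulr_ge0//.
have := HL (u x) 0; rewrite subr0 => H; have := ler_normD (g (u x) - g 0) (g 0); rewrite subrK => H'.
by apply: (le_trans H'); rewrite lerD2r.
Unshelve. all: by end_near.
Qed.

Lemma fnrm_lipschitz (g : R -> R) (u1 u2 : space -> R^o) (L : R) : 0 <= L ->
  (forall x y : R, `|g x - g y| <= L * `|x - y|) -> lipschitz g -> dL2 u1 -> dL2 u2 ->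
  fnrm (L2 Om) ((fun x => g (u1 x)) - (fun x => g (u2 x)) : space -> R^o) <= L * fnrm (L2 Om) (u1 - u2).
Proof.
move=> L0 HL lg d1 d2; have [dg1 dg2] := (lipschitz_L2 lg d1, lipschitz_L2 lg d2).
have d12 := si_domB si_ip d1 d2; have dg12 := si_domB si_ip dg1 dg2.
have dl := si_domZ si_ip L d12.
rewrite -(ger0_norm L0) -(fnrmZ sL2 _ d12) -ler_sqr ?nnegrE ?(fnrm_ge0 sL2)//.
rewrite !L2_fnrmE// /ip; apply: le_Rintegral => //; [exact: L2_integrableM|exact: L2_integrableM|].
move=> x _; rewrite -!expr2 -[leLHS]real_normK ?num_real// -[leRHS]real_normK ?num_real// ler_sqr ?nnegrE//.
rewrite -[leRHS]/(`|L * (u1 x - u2 x)|) normrM (ger0_norm L0); exact: HL.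
Qed.

End H1_space.

(** * Product measures and sections at fixed times *)

Section sigma_finite_product.
Context d1 d2 (T1 : measurableType d1) (T2 : measurableType d2) (R : realType).
Variable m1 : {sigma_finite_measure set T1 -> \bar R}.
Variable m2 : {sigma_finite_measure set T2 -> \bar R}.

(** A name to which the sigma-finite structure is attached, so that an iterated product can itself
    be a factor in Tonelli's theorem. *)
Definition sf_product : set (T1 * T2) -> \bar R := (m1 \x m2)%E.

Lemma sigma_finite_sf_product : sigma_finite setT sf_product.
Proof.
have /sigma_finiteP[F [TF ndF Foo]] := sigma_finiteT m1.
have /sigma_finiteP[G [TG ndG Goo]] := sigma_finiteT m2.
exists (fun n => F n `*` G n) => [|k]; last first.
  have [[? ?] [? ?]] := (Foo k, Goo k); split; first exact: measurableX.
  by rewrite /sf_product product_measure1E// lte_mul_pinfty// ge0_fin_numE.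
apply/seteqP; split => // -[x y] _.
have [[n _ Fn] [k _ Gk]] : (\bigcup_i F i) x /\ (\bigcup_i G i) y by rewrite -TF -TG.
exists (maxn n k) => //; split; first by move: x Fn; exact/subsetPset/ndF/leq_maxl.
by move: y Gk; exact/subsetPset/ndG/leq_maxr.
Qed.

HB.instance Definition _ := Measure.on sf_product.
HB.instance Definition _ := Measure_isSigmaFinite.Build _ _ _ sf_product sigma_finite_sf_product.

End sigma_finite_product.

Section time_sections.
Context {R : realType}.
Local Notation space := (space3 R).

Let leb1_sf : {sigma_finite_measure set (measurableTypeR R) -> \bar R} := @lebesgue_measure R.
Let leb3_sf : {sigma_finite_measure set space -> \bar R} :=
  sf_product (sf_product leb1_sf leb1_sf) leb1_sf.

(** By Tonelli the measure of a null set is the integral of the measures of its sections, so almost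
    every section is null. *)
Lemma ae_leb4_section (P : space * measurableTypeR R -> Prop) : {ae @leb4 R, forall z, P z} ->
  {ae @leb1 R, forall t, {ae @leb3 R, forall x, P (x, t)}}.
Proof.
move=> [A [mA A0 sA]].
have G0 : \forall t \ae leb1_sf, (leb3_sf (ysection A t) = 0)%E.
  have mG := measurable_fun_ysection leb3_sf mA.
  have : (\int[leb1_sf]_t `|leb3_sf (ysection A t)| = 0)%E.
    rewrite -[RHS]A0 -[RHS]/((leb3_sf \x leb1_sf)%E A).
    have E1 : (leb3_sf \x leb1_sf)%E A = (\int[leb3_sf \x leb1_sf]_z (\1_A z)%:E)%E.
      by rewrite integral_indic// setIT.
    rewrite E1 (indic_fubini_tonelli1 leb3_sf leb1_sf mA) (indic_fubini_tonelli leb3_sf leb1_sf mA).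
    by rewrite indic_fubini_tonelli_GE//; apply: eq_integral => t _; rewrite gee0_abs.
  move/(ae_eq_integral_abs _ measurableT mG); apply: filterS => t /(_ I); exact.
apply: (@filterS _ (almost_everywhere leb1_sf) _ _ _ _ G0) => t At0.
exists (ysection A t); split => //; first exact: measurable_ysection.
by move=> x /= nP; rewrite /ysection/= inE; apply: sA.
Qed.

Lemma L2Q_section (Om : set space) (T : R) (xi : space * measurableTypeR R -> R^o) :
  measurable Om -> 0 <= T -> dom (L2Q Om T) xi ->
  exists m : R -> R, intg T m /\ ae_time T (fun t => dom (L2 Om) (fun x => xi (x, t)) /\
    fnrm (L2 Om) (fun x => xi (x, t)) <= m t).
Proof.
move=> mOm T0; have mc : measurable (cylinder Om T) by apply: measurableX => //; exact: measurable_itv.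
move=> /L2_domP[mxi ixi].
pose f := (fun z => ((xi z : R) ^+ 2)%:E) \_ (cylinder Om T).
have if1 : (leb3_sf \x leb1_sf)%E.-integrable setT f by apply/(integrable_mkcond _ mc).
have f0 z : (0 <= f z)%E by rewrite /f patchE; case: ifP => // _; rewrite lee_fin sqr_ge0.
pose G := fubini_G leb3_sf f.
have mf := measurable_int _ if1.
have G0 t : (0 <= G t)%E by apply: integral_ge0 => x _; exact: f0.
have iG : leb1_sf.-integrable setT G.
  apply/integrableP; split; first exact: measurable_fun_fubini_tonelli_G.
  have := (integrable21ltyP leb3_sf leb1_sf mf).1 if1.
  rewrite (eq_integral (fun t => `|G t|)%E)// => t _; rewrite gee0_abs//.
  by apply: eq_integral => x _; rewrite gee0_abs.
(* [G t] is the squared L2 norm of the section, integrable by Tonelli, and n <= 1 + n^2. *)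
exists (fun t : R => 1 + fine (G t)); split.
  apply: (@intgD _ _ (fun=> 1) (fun t : R => fine (G t))); [exact: intg_cst|].
  have mT : measurable (`]0, T[%classic : set (measurableTypeR R)) by exact: measurable_itv.
  have iGT := integrableS measurableT mT (@subsetT _ _) iG.
  apply: (le_integrable mT _ _ iGT).
    by apply/measurable_EFinP; exact: (measurableT_comp _ (measurable_int _ iGT)).
  by move=> t _ /=; case: (G t) => [r| |] /=; rewrite ?normr0 ?leey// lexx.
have cP x (t : R) : 0 < t < T -> cylinder Om T (x, t) = Om x.
  move=> tT; apply/propext; rewrite /cylinder; split=> [[]//|Omx]; split => //=; by rewrite in_itv.
have secE (t : R) : 0 < t < T -> (fun x => f (x, t)) = (fun x => ((xi (x, t) : R) ^+ 2)%:E) \_ Om.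
  move=> tT; apply/funext => x; rewrite /f !patchE; congr (if _ then _ else _).
  by apply: asbool_equiv_eq; rewrite cP.
have aei := ae_integrable2 if1.
apply: (@filterS _ (almost_everywhere leb1_sf) _ _ _ _ aei) => t it tT.
have d : dom (L2 Om) (fun x => xi (x, t)).
  apply/L2_domP; split; last by move: it; rewrite secE// => /(integrable_mkcond _ mOm).
  move=> _ B mB; have /(measurable_ysection t) := mxi mc B mB.
  rewrite (_ : ysection _ _ = Om `&` (fun x => xi (x, t)) @^-1` B)//.
  by apply/seteqP; split => x; rewrite /ysection/= inE/= cP.
split => //; have E := L2_fnrm_sq mOm d.
have GE : fine (G t) = fnrm (L2 Om) (fun x => xi (x, t)) ^+ 2.
  by rewrite E [in LHS]/G /fubini_G (secE t tT) -integral_mkcond.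
rewrite GE; have := sqr_ge0 (fnrm (L2 Om) (fun x => xi (x, t)) - 1); rewrite sqrrB1.
set n := fnrm _ _ => H; nra.
Qed.

End time_sections.

(** * Gronwall inequalities *)

Section heine.
Context {R : realType}.

(** Stated for a [phi] that obeys a triangle inequality, so that it covers real functions and
    functions with values in a seminormed space alike. *)
Lemma heine (T : R) (phi : R -> R -> R) :
  (forall x y z : R, 0 <= x <= T -> 0 <= y <= T -> 0 <= z <= T -> phi x z <= phi x y + phi y z) ->
  (forall t : R, 0 <= t <= T -> forall e : R, 0 < e -> exists2 d : R, 0 < d &
     forall s : R, 0 <= s <= T -> `|s - t| < d -> phi s t < e /\ phi t s < e) ->
  forall e : R, 0 < e -> exists2 d : R, 0 < d &
     forall s t : R, 0 <= s <= T -> 0 <= t <= T -> `|s - t| < d -> phi s t < e.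
Proof.
move=> tri cont e e0; have e20 : 0 < e / 2 by lra.
have /compact_near_coveringP := @segment_compact R 0 T.
move=> /(_ R (0^'+) (fun d x => 0 <= x <= T -> forall s : R, 0 <= s <= T -> `|s - x| < d -> phi s x < e) _).
case=> [x|].
  rewrite /= in_itv/= => xT; have [d d0 Hd] := cont x xT _ e20.
  exists ([set y : R | `|x - y| < d / 2], [set d' : R | d' < d / 2]).
    split => /=; first by apply/nbhs_ballP; exists (d / 2) => //=; lra.
    by apply: nbhs_right_lt; lra.
  move=> [y d'] /= [xy dd] yT s sT syd.
  have h1 : `|s - x| < d.
    have -> : s - x = (s - y) + (y - x) by ring.
    by rewrite (le_lt_trans (ler_normD _ _))// (distrC y); lra.
  have h2 : `|y - x| < d by rewrite distrC; lra.
  have [p1 _] := Hd _ sT h1; have [_ p2] := Hd _ yT h2.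
  by have := tri _ _ _ sT xT yT; lra.
move=> /= d /= d0 Hd; exists (d / 2); first by lra.
have b : ball_ [eta Num.Def.normr] 0 d (d / 2).
  by rewrite /= sub0r normrN gtr0_norm; lra.
have d20 : 0 < d / 2 by lra.
by move=> s t sT tT std; apply: (Hd _ b d20 t) => //; rewrite /= in_itv.
Qed.

Lemma heine_fun (T : R) (K : R -> R) : {within `[0, T], continuous K} ->
  forall e : R, 0 < e -> exists2 d : R, 0 < d &
     forall s t : R, 0 <= s <= T -> 0 <= t <= T -> `|s - t| < d -> `|K s - K t| < e.
Proof.
move=> cK; apply: (heine (phi := fun s t => `|K s - K t|)).
  by move=> x y z _ _ _; rewrite (_ : K x - K z = (K x - K y) + (K y - K z)) ?ler_normD//; ring.
move=> t tT e e0; have /subspace_continuousP/(_ t) := cK.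
rewrite /= in_itv/= => /(_ tT)/cvgrPdist_lt/(_ e e0).
move=> [d /= d0 Hd]; exists d => // s sT sd.
have := Hd s; rewrite /= distrC in_itv/= => /(_ sd sT) H.
by split => //; rewrite distrC.
Qed.

(** Cut [s, t] into equal pieces shorter than d: the errors telescope to e (N t - N s), and e is
    arbitrary. *)
Lemma nonincreasing_of_modulus (T : R) (D N : R -> R) :
  (forall e : R, 0 < e -> exists2 d : R, 0 < d & forall s t : R, 0 <= s -> s <= t -> t <= T ->
     t - s < d -> D t - D s <= e * (N t - N s)) ->
  forall s t : R, 0 <= s -> s <= t -> t <= T -> D t <= D s.
Proof.
move=> H s t s0 st tT.
have key (e : R) : 0 < e -> D t - D s <= e * (N t - N s).
  move=> e0; have [d d0 Hd] := H e e0.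
  have [n /= nP] : exists n : nat, (t - s) / d < n.+1%:R.
    exists (Num.bound ((t - s) / d)); apply: (lt_le_trans (archi_boundP _)); last by rewrite ler_nat.
    by rewrite divr_ge0 ?subr_ge0// ltW.
  have n0 : (0 : R) < n.+1%:R by rewrite ltr0n.
  have [h hE] : exists h : R, h = (t - s) / n.+1%:R by eexists.
  have h0 : 0 <= h by rewrite hE divr_ge0 ?subr_ge0// ltW.
  have nh : n.+1%:R * h = t - s by rewrite hE mulrCA divff ?mulr1// gt_eqF.
  have hd : h < d by rewrite hE ltr_pdivrMr// mulrC -ltr_pdivrMr.
  have I (i : nat) : (i <= n.+1)%N -> D (s + i%:R * h) - D s <= e * (N (s + i%:R * h) - N s).
    elim: i => [_|i IH i_n]; first by rewrite mul0r addr0 !subrr mulr0.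
    have := IH (ltnW i_n).
    have ih : i.+1%:R * h <= t - s by rewrite -nh ler_wpM2r// ler_nat.
    have i1 : i.+1%:R * h = i%:R * h + h by rewrite -natr1; ring.
    have i0 : 0 <= i%:R * h by rewrite mulr_ge0.
    have := Hd (s + i%:R * h) (s + i.+1%:R * h).
    have -> : s + i.+1%:R * h - (s + i%:R * h) = h by rewrite i1; ring.
    move=> K; have := K _ _ _ hd.
    have a1 : 0 <= s + i%:R * h by lra.
    have a2 : s + i%:R * h <= s + i.+1%:R * h by lra.
    have a3 : s + i.+1%:R * h <= T by lra.
    move=> /(_ a1 a2 a3); lra.
  have := I n.+1 (leqnn _); rewrite nh (_ : s + (t - s) = t)//; ring.
have key2 (e : R) : 0 < e -> D t - D s <= e.
  move=> e0; have [Nle|Ngt] := leP (N t - N s) 0.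
    have h1 := key e e0; have h2 : e * (N t - N s) <= 0 by rewrite pmulr_rle0.
    exact: le_trans h1 (le_trans h2 (ltW e0)).
  have := key (e / (N t - N s)) (divr_gt0 e0 Ngt).
  by rewrite divfK// gt_eqF.
by rewrite -subr_le0; apply/ler_addgt0Pl => e e0; rewrite addr0; exact: key2.
Qed.

(** As [k] is only integrable, Z exp(-K) is not differentiated; its increments are shown to be of
    second order in those of K, and [nonincreasing_of_modulus] concludes. *)
Lemma gronwall (T a : R) (k Y : R -> R) : 0 <= T -> 0 <= a -> intg T k ->
  (forall t, 0 <= k t) -> (forall t, 0 <= Y t) -> intg T (fun t => k t * Y t) ->
  (forall t : R, 0 <= t <= T -> Y t <= a + itg (fun s => k s * Y s) 0 t) ->
  forall t : R, 0 <= t <= T -> Y t <= a * expR (itg k 0 t).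
Proof.
move=> T0 a0 ik k0 Y0 ikY HY t tT.
pose Z s := a + itg (fun s => k s * Y s) 0 s.
pose K s := itg k 0 s.
have Kle (s r : R) : 0 <= s -> s <= r -> r <= T -> K r - K s = itg k s r.
  by move=> s0 sr rT; rewrite /K (itg_split _ s0 sr rT ik)//; lra.
have Zle (s r : R) : 0 <= s -> s <= r -> r <= T -> Z r - Z s = itg (fun s => k s * Y s) s r.
  by move=> s0 sr rT; rewrite /Z (itg_split _ s0 sr rT ikY)//; lra.
have Z0 s : 0 <= Z s by rewrite addr_ge0// itg_ge0// => x; rewrite mulr_ge0.
have Zmono (s r : R) : 0 <= s -> s <= r -> r <= T -> Z s <= Z r.
  by move=> s0 sr rT; rewrite -subr_ge0 Zle// itg_ge0// => x; rewrite mulr_ge0.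
have ZK (s r : R) : 0 <= s -> s <= r -> r <= T -> Z r - Z s <= (K r - K s) * Z r.
  move=> s0 sr rT; rewrite Zle// Kle// mulrC -(itgZ _ s0 rT ik).
  apply: (itg_le s0 rT ikY (intgZ _ ik)) => x /andP[sx xr]; rewrite mulrC ler_wpM2r//.
  apply: le_trans (HY x _) (Zmono _ _ _ _ _) => //; [apply/andP; split|..]; lra.
have := @nonincreasing_of_modulus T (fun s => Z s * expR (- K s)) (fun s => Z T * K s).
have [d1 d10 Hd1] := heine_fun (itg_continuous T0 ik) ltr01.
move=> H; have {}H : Z t * expR (- K t) <= Z 0 * expR (- K 0).
  have /andP[t0 tT'] := tT; apply: H => // e e0.
  have [d2 d20 Hd2] := heine_fun (itg_continuous T0 ik) e0.
  exists (Num.min d1 d2); first by rewrite lt_min d10.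
  move=> s r s0 sr rT; rewrite lt_min => /andP[h1 h2].
  have absrs : `|r - s| = r - s by rewrite ger0_norm ?subr_ge0.
  have [rT' sT'] : 0 <= r <= T /\ 0 <= s <= T by split; apply/andP; split; lra.
  have := Hd1 r s rT' sT'; rewrite absrs => /(_ h1); have := Hd2 r s rT' sT'; rewrite absrs => /(_ h2).
  rewrite -/(K r) -/(K s); have Dl0 : 0 <= K r - K s by rewrite Kle// itg_ge0.
  rewrite ger0_norm//; have [dl dlE] : exists dl : R, dl = K r - K s by eexists.
  rewrite -mulrBr -dlE => dle dl1.
  have -> : - K s = - K r + dl by rewrite dlE; ring.
  rewrite expRD; have := ZK _ _ s0 sr rT; rewrite -dlE => ZZ.
  have e1 := expR_ge1Dx dl.
  have eK0 : 0 < expR (- K r) by exact: expR_gt0.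
  have eK1 : expR (- K r) <= 1 by rewrite -expR0 ler_expR oppr_le0 /K itg_ge0.
  have ZrT : Z r <= Z T by apply: Zmono => //; lra.
  have Zr := Z0 r.
  have dl0 : 0 <= dl by rewrite dlE.
  (* Combines Z r (1 - dl) <= Z s with 1 + dl <= e^dl, leaving an error Z r dl^2; smallness of dl
     bounds it by e times an increment of Z T K. *)
  have h3 : (Z r * (1 - dl)) * (1 + dl) <= Z s * expR dl.
    apply: ler_pM => //; [|lra|lra]; rewrite mulr_ge0//; lra.
  have h4 : Z r * expR (- K r) - Z s * (expR (- K r) * expR dl) <= expR (- K r) * (Z r * dl ^+ 2).
    rewrite (_ : _ - _ = expR (- K r) * (Z r - Z s * expR dl)); last by ring.
    by rewrite ler_pM2l//; lra.
  apply: (le_trans h4); apply: (@le_trans _ _ (Z r * dl ^+ 2)).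
    by rewrite ler_piMl// mulr_ge0// sqr_ge0.
  rewrite expr2 mulrA mulrC; apply: ler_pM => //; [by rewrite mulr_ge0|exact: ltW|].
  by rewrite ler_wpM2r.
apply: (le_trans (HY t tT)); rewrite -/(Z t).
move: H; rewrite /Z /K !itgxx oppr0 expR0 addr0 mulr1 -/(Z t) => H.
have := ler_wpM2r (expR_ge0 (itg k 0 t)) H.
by rewrite -mulrA -expRD addNr expR0 mulr1.
Qed.

End heine.

(** * Translations in time *)

Section averaging.
Context {R : realType}.

Lemma itg_cc (F : R -> R) (s t : R) : continuous F ->
  itg F s t = \int[leb1]_(x in `[s, t]) F x.
Proof.
move=> cF; have i b0 b1 : leb1.-integrable [set` Interval (BSide b0 s) (BSide b1 t)] (EFin \o F).
  have ic : leb1.-integrable `[s, t] (EFin \o F).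
    by apply: continuous_compact_integrable; [exact: segment_compact|exact: continuous_subspaceT].
  apply: integrableS ic => //; apply: subset_itv; by rewrite bnd_simp ?leBSide; case: b0 b1 => -[].
by rewrite /itg (Rintegral_itv_bndo_bndc (i false true)) (Rintegral_itv_obnd_cbnd (i false false)).
Qed.

Lemma intg_continuous (T : R) (F : R -> R) : continuous F -> intg T F.
Proof.
move=> cF; have ic : leb1.-integrable `[0, T] (EFin \o F).
  by apply: continuous_compact_integrable; [exact: segment_compact|exact: continuous_subspaceT].
by apply: integrableS ic => //; exact: subset_itv_oo_cc.
Qed.

Lemma itg_shift (F : R -> R) (h t : R) : continuous F -> h <= t ->
  itg (fun x => F (x - h)) h t = itg F 0 (t - h).
Proof.
move=> cF ht; have cFh : continuous (fun x : R => F (x - h)).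
  move=> x; apply: continuous_comp; last exact: cF.
  by apply: cvgB; [exact: cvg_id|exact: cvg_cst].
rewrite !itg_cc// /Rintegral; congr fine.
pose S (x : R) := x - h.
have dSx (x : R) : is_derive x (1 : R) S (1 - 0).
  by apply: (@is_deriveB _ _ _ id (cst h) x 1 1 0).
have dS : derive1 S = cst 1.
  by apply/funext => x; rewrite derive1E (@derive_val _ _ _ _ _ _ _ (dSx x)) subr0.
have S0 : S h = 0 by rewrite /S subrr.
have cS : continuous S by move=> x; apply: cvgB; [exact: cvg_id|exact: cvg_cst].
have H := @integration_by_substitution_increasing R S F h t ht.
rewrite S0 dS in H; rewrite [RHS]H.
- by apply: eq_integral => x _; rewrite /= mulr1.
- by move=> x y _ _ xy; rewrite ltrD2r.
- by move=> x _; exact: cvg_cst.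
- exact: is_cvg_cst.
- exact: is_cvg_cst.
- split; first by move=> x _; exact: (@ex_derive _ _ _ _ _ _ _ (dSx x)).
  + by apply: cvg_at_right_filter; exact: cS.
  + by apply: cvg_at_left_filter; exact: cS.
- exact: continuous_subspaceT.
Qed.

(** The retraction onto [0, T]: composition with it extends a continuous function from the interval
    to the line, where it can be translated. *)
Definition clamp (T x : R) : R := Num.min (Num.max x 0) T.

Lemma clamp_itv (T x : R) : 0 <= T -> 0 <= clamp T x <= T.
Proof. by move=> T0; rewrite /clamp le_min le_max lexx orbT T0 ge_min lexx orbT. Qed.

Lemma clampE (T x : R) : 0 <= x <= T -> clamp T x = x.
Proof. by move=> /andP[x0 xT]; rewrite /clamp max_l// min_l. Qed.

Lemma clamp_dist (T x y : R) : `|clamp T y - clamp T x| <= `|y - x|.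
Proof.
have h1 := ler_norm (y - x); have h2 := ler_norm (x - y); rewrite distrC in h2.
rewrite ler_norml /clamp; apply/andP.
by case: (leP (Num.max y 0) T); case: (leP (Num.max x 0) T);
  case: (leP y 0) => ?; case: (leP x 0) => ? ? ?; split; lra.
Qed.

Lemma continuous_clamp (T : R) (F : R -> R) : 0 <= T -> {within `[0, T], continuous F} ->
  continuous (F \o clamp T).
Proof.
move=> T0 cF x.
have cc : clamp T y @[y --> x] --> clamp T x.
  apply: (@cvg_dist_le R R (nbhs x) _ (clamp T) (fun y : R => `|y - x|) (clamp T x)).
    by near=> y; exact: clamp_dist.
  have -> : (0 : R) = `|x - x| by rewrite subrr normr0.
  by apply: cvg_norm; apply: cvgB; [exact: cvg_id|exact: cvg_cst].
have /subspace_continuousP/(_ (clamp T x)) := cF.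
rewrite /= in_itv/= clamp_itv// => /(_ isT) H.
apply: cvg_trans H => A /= nA.
have H2 : \forall y \near x, `[0, T]%classic (clamp T y) -> A (F (clamp T y)) by exact: cc nA.
by apply: filterS H2 => y; apply; rewrite /= in_itv/= clamp_itv.
Unshelve. all: by end_near.
Qed.


Lemma itg_cvg0 (T : R) (q : nat -> R -> R) (C : R) : 0 <= T ->
  (forall n, measurable_fun (`]0, T[ : set (measurableTypeR R)) (q n)) ->
  (forall n (t : R), 0 <= q n t <= C) ->
  ae_time T (fun t => q n t @[n --> \oo] --> 0) ->
  itg (q n) 0 T @[n --> \oo] --> 0.
Proof.
move=> T0 mq q0 cq.
have [_] : leb1.-integrable (`]0, T[ : set (measurableTypeR R)) (EFin \o cst 0) /\
    \int[leb1]_(x in `]0, T[) q n x @[n --> \oo] --> \int[leb1]_(x in `]0, T[) (cst 0 x : R).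
  apply: (@Rintegral_dominated_cvg _ (measurableTypeR R) R leb1 `]0, T[%classic q (cst 0) (cst C)).
  - exact: measurable_itv.
  - exact: mq.
  - exact: measurable_cst.
  - by apply: (@filterS _ (almost_everywhere leb1) _ _ _ _ cq) => t + tT; apply; move: tT; rewrite /= in_itv.
  - exact: intg_cst.
  - apply: aeW => t /=; rewrite in_itv/= => tT n; have /andP[a b] := q0 n t.
    by rewrite ger0_norm.
by rewrite Rintegral_cst//; rewrite mul0r.
Qed.

(* Integrating the difference quotients of [D] over time, the error terms vanish
   in mean as the step tends to 0. *)
Lemma averaging (T : R) (D N : R -> R) : 0 < T -> {within `[0, T], continuous D} ->
  {within `[0, T], continuous N} ->
  (forall s t : R, 0 <= s -> s <= t -> t <= T -> N s <= N t) ->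
  (forall e : R, 0 < e -> exists (k : R -> R) (p : nat -> R -> R) (C : R),
    [/\ intg T k, (forall t, 0 <= k t), itg k 0 T <= e,
        (forall n, measurable_fun (`]0, T[ : set (measurableTypeR R)) (p n)) /\
        (forall n (t : R), 0 <= p n t <= C) /\
        ae_time T (fun t => p n t @[n --> \oo] --> 0) &
        \forall n \near \oo, ae_time T (fun t => let h := n.+1%:R^-1 in h < t ->
          D t - D (t - h) <= e * (N t - N (t - h)) + itg k (t - h) t + h * (k t + p n t))]) ->
  forall t : R, 0 <= t <= T -> D t <= D 0.
Proof.
move=> T0 cD cN N_mono H t tT; have T0' := ltW T0.
have [-> //|tn0] := eqVneq t 0.
have /andP[t0' tT'] := tT; have t0 : 0 < t by rewrite lt_neqAle eq_sym tn0.
pose Dc := D \o clamp T; pose Nc := N \o clamp T.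
have cDc : continuous Dc := continuous_clamp T0' cD.
have cNc : continuous Nc := continuous_clamp T0' cN.
have N_ge : N 0 <= N T by exact: N_mono.
(* The 5 counts two uses of the modulus of continuity of D, one bound of the primitive of [k], and
   the integrals of [k] and of [p n], each at most e. *)
suff key (e : R) : 0 < e -> D t - D 0 <= e * (N T - N 0 + 5).
  have c0 : 0 < N T - N 0 + 5 by lra.
  rewrite -subr_le0; apply/ler_addgt0Pl => e e0; rewrite addr0.
  by have := key (e / (N T - N 0 + 5)) (divr_gt0 e0 c0); rewrite divfK// gt_eqF.
move=> e0; have [k [p [C [ik k0 ke [mp [p0 cp]] near_n]]]] := H e e0.
pose Kc := (fun x => itg k 0 x) \o clamp T.
have cKc : continuous Kc := continuous_clamp T0' (itg_continuous T0' ik).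
have [d d0 Hd] := heine_fun cD e0.
have ip n : intg T (p n).
  by apply: (intg_le (mp n) (k2 := fun=> C)); [move=> x _; have /andP[a b] := p0 n x; rewrite ger0_norm|exact: intg_cst].
have [n [nin nd nt np]] : exists n : nat, [/\ ae_time T (fun t => let h := n.+1%:R^-1 in h < t ->
          D t - D (t - h) <= e * (N t - N (t - h)) + itg k (t - h) t + h * (k t + p n t)),
    (n.+1%:R^-1 : R) < d, (n.+1%:R^-1 : R) < t & itg (p n) 0 T <= e].
  have h1 : \forall n \near \oo, (n.+1%:R^-1 : R) < d by exact: near_infty_natSinv_lt (PosNum d0).
  have h2 : \forall n \near \oo, (n.+1%:R^-1 : R) < t by exact: near_infty_natSinv_lt (PosNum t0).
  have h3 : \forall n \near \oo, itg (p n) 0 T < e.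
    have /cvgrPdist_lt/(_ e e0) := itg_cvg0 T0' mp p0 cp.
    by apply: filterS => n; rewrite sub0r normrN; apply: le_lt_trans; exact: ler_norm.
  have [m [[? ?] [? ?]]] := filter_ex (filterI (filterI near_n h1) (filterI h2 h3)).
  by exists m; split => //; exact: ltW.
have [h hE] : exists h : R, h = n.+1%:R^-1 by eexists.
rewrite -hE in nd nt; have h0 : 0 < h by rewrite hE invr_gt0 ltr0n.
(* Subtracting the telescoping terms leaves only h (k + p) on the right of the difference
   inequality. *)
pose F (x : R) := Dc x - e * Nc x - Kc x.
have cF : continuous F.
  move=> x; apply: cvgB; [apply: cvgB; [exact: cDc|apply: cvgMr; exact: cNc]|exact: cKc].
have cFh : continuous (fun x : R => F (x - h)).
  move=> x; apply: (@continuous_comp _ _ _ (fun x : R => x - h) F); last exact: cF.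
  by apply: cvgB; [exact: cvg_id|exact: cvg_cst].
have iF := intg_continuous T cF; have iFh := intg_continuous T cFh.
have I1 : itg (fun x => F x - F (x - h)) h t <= itg (fun x => h * (k x + p n x)) h t.
  apply: (itg_ae_le_on (ltW h0) tT' (intgB iF iFh) (intgZ h (intgD ik (ip n)))).
  apply: ae_timeS nin => x /andP[x0 xT] + /andP[hx xt]; rewrite -hE => /(_ hx).
  have xT1 : 0 <= x <= T by rewrite !ltW.
  have xT2 : 0 <= x - h <= T by apply/andP; split; lra.
  rewrite /F /Dc /Nc /Kc/= !clampE// => G.
  have a1 : x - h <= x by lra.
  have a2 : 0 <= x - h by lra.
  have := itg_split (lexx 0) a2 a1 (ltW xT) ik; lra.
(* The integral of a difference of translates reduces to means over the two end intervals, which by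
   continuity approximate D t and D 0. *)
have E1 : itg (fun x => F x - F (x - h)) h t = itg F (t - h) t - itg F 0 h.
  rewrite (itgB (ltW h0) tT' iF iFh) itg_shift//; last exact: ltW.
  have a1 : 0 <= t - h by lra.
  have a2 : t - h <= t by lra.
  have s1 := itg_split (lexx 0) (ltW h0) (ltW nt) tT' iF.
  have s2 := itg_split (lexx 0) a1 a2 tT' iF; lra.
have I2 : itg (fun x => h * (k x + p n x)) h t <= h * (2 * e).
  rewrite (itgZ h (ltW h0) tT' (intgD ik (ip n))) ler_pM2l// (itgD (ltW h0) tT' ik (ip n)).
  have a1 : itg k h t <= itg k 0 T by apply: itg_sub_le => //; exact: ltW.
  have a2 : itg (p n) h t <= itg (p n) 0 T.
    by apply: itg_sub_le => //; [exact: ltW|exact: ltW|move=> x; case/andP: (p0 n x)].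
  lra.
have cst_itg c s r : s <= r -> itg (fun=> c) s r = c * (r - s) by exact: itg_cst.
have mono (G : R -> R) (s r : R) c : continuous G -> 0 <= s -> s <= r -> r <= T ->
    (forall x : R, s < x < r -> c <= G x) -> c * (r - s) <= itg G s r.
  move=> cG s0 sr rT Gc; rewrite -cst_itg//.
  by apply: (@itg_le _ T) => //; [exact: intg_cst|exact: intg_continuous].
have mono' (G : R -> R) (s r : R) c : continuous G -> 0 <= s -> s <= r -> r <= T ->
    (forall x : R, s < x < r -> G x <= c) -> itg G s r <= c * (r - s).
  move=> cG s0 sr rT Gc; rewrite -cst_itg//.
  by apply: (@itg_le _ T) => //; [exact: intg_continuous|exact: intg_cst].
have KT : itg k 0 T <= e := ke.
have Kb x : 0 <= x <= T -> 0 <= itg k 0 x <= e.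
  move=> /andP[x0 xT]; rewrite itg_ge0//=; apply: le_trans KT; exact: itg_sub_le.
have lowF : (D t - e - e * N T - e) * h <= itg F (t - h) t.
  rewrite [in X in X <= _](_ : h = t - (t - h)); last by ring.
  apply: mono => //; [lra|lra|move=> x /andP[x1 x2]].
  have xT : 0 <= x <= T by apply/andP; split; lra.
  rewrite /F /Dc /Nc /Kc/= !clampE//.
  have /andP[_ k1] := Kb _ xT.
  have xt : `|x - t| < d by rewrite ltr_distlC; apply/andP; split; lra.
  have := Hd x t xT tT xt; rewrite ltr_distlC => /andP[g1 g2].
  have : e * N x <= e * N T by rewrite ler_pM2l//; apply: N_mono; lra.
  lra.
have upF : itg F 0 h <= (D 0 + e - e * N 0) * h.
  rewrite [in X in _ <= X](_ : h = h - 0); last by ring.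
  apply: mono' => //; [lra|lra|move=> x /andP[x1 x2]].
  have xT : 0 <= x <= T by apply/andP; split; lra.
  rewrite /F /Dc /Nc /Kc/= !clampE//.
  have /andP[k1 _] := Kb _ xT.
  have xt : `|x - 0| < d by rewrite subr0 ger0_norm; lra.
  have T00 : 0 <= (0 : R) <= T by rewrite lexx.
  have := Hd x 0 xT T00 xt; rewrite ltr_distlC => /andP[g1 g2].
  have : e * N 0 <= e * N x by rewrite ler_pM2l//; apply: N_mono; lra.
  lra.
have fin : (D t - e - e * N T - e - (D 0 + e - e * N 0)) * h <= 2 * e * h.
  rewrite mulrBl (mulrC (2 * e)); lra.
rewrite ler_pM2r// in fin; lra.
Qed.

End averaging.

(** * Translations of indicator functions *)

Section indicator_translation.
Context {R : realType}.
Implicit Types (A : set R).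

Lemma indic_01 A (t : R) : 0 <= (\1_A t : R) <= 1.
Proof. by rewrite indicE; case: (t \in A); rewrite /= ?lexx ?ler01. Qed.

Lemma indic_integrable A (i : interval R) : measurable (A : set (measurableTypeR R)) ->
  (leb1 [set` i] < +oo)%E -> leb1.-integrable [set` i] (EFin \o (\1_A : R -> R)).
Proof.
move=> mA fi; apply: measurable_bounded_integrable => //.
exists 1; split => // M M1 x _; have /andP[a b] := indic_01 A x.
by rewrite /= ger0_norm// (le_trans b)// ltW.
Qed.

Lemma leb1_itv_lty b0 b1 (x y : R) : (leb1 [set` Interval (BSide b0 x) (BSide b1 y)] < +oo)%E.
Proof.
rewrite [X in (X < _)%E](lebesgue_measure_itv (Interval (BSide b0 x) (BSide b1 y))).
by case: ifP => _; rewrite /= ltry.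
Qed.

Lemma indic_intg A (T : R) : measurable (A : set (measurableTypeR R)) -> intg T (\1_A).
Proof. by move=> mA; apply: indic_integrable => //; exact: leb1_itv_lty. Qed.

(** The mean of the indicator over the backward interval of length 1/(n+1), with clamped ends so
    that it is defined and continuous for all t. *)
Definition indic_mean A (T : R) (n : nat) (t : R) : R :=
  n.+1%:R * (itg \1_A 0 (clamp T t) - itg \1_A 0 (clamp T (t - n.+1%:R^-1))).

Lemma clamp_le (T x y : R) : x <= y -> clamp T x <= clamp T y.
Proof.
by move=> xy; rewrite /clamp; case: (leP (Num.max x 0) T); case: (leP (Num.max y 0) T);
  case: (leP y 0) => ?; case: (leP x 0) => ? ? ?; lra.
Qed.

Lemma indic_mean_01 A (T : R) n t : 0 <= T -> measurable (A : set (measurableTypeR R)) ->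
  0 <= indic_mean A T n t <= 1.
Proof.
move=> T0 mA; have iA := indic_intg T mA.
have h0 : 0 < (n.+1%:R^-1 : R) by rewrite invr_gt0 ltr0n.
have n0 : 0 < (n.+1%:R : R) by rewrite ltr0n.
have [h hE] : exists h : R, h = n.+1%:R^-1 by eexists.
rewrite /indic_mean -hE; rewrite -hE in h0.
have cle : clamp T (t - h) <= clamp T t by apply: clamp_le; lra.
have /andP[c0 cT] := clamp_itv t T0; have /andP[d0 dT] := clamp_itv (t - h) T0.
have -> : itg \1_A 0 (clamp T t) - itg \1_A 0 (clamp T (t - h)) = itg \1_A (clamp T (t - h)) (clamp T t).
  by rewrite (itg_split (lexx 0) d0 cle cT iA); ring.
have i0 : 0 <= itg \1_A (clamp T (t - h)) (clamp T t) by apply: itg_ge0 => x; case/andP: (indic_01 A x).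
have i1 : itg \1_A (clamp T (t - h)) (clamp T t) <= h.
  apply: (@le_trans _ _ (itg (fun=> 1) (clamp T (t - h)) (clamp T t))).
    apply: (itg_le d0 cT iA); first exact: intg_cst.
    by move=> x _; case/andP: (indic_01 A x).
  rewrite itg_cst// mul1r; have := clamp_dist T (t - h) t.
  by rewrite !ger0_norm ?subr_ge0//; lra.
have nh : n.+1%:R * h = 1 by rewrite hE divff// gt_eqF.
apply/andP; split; first by rewrite mulr_ge0// ltW.
by rewrite -[leRHS]nh ler_pM2l.
Qed.

Lemma measurable_indic_mean A (T : R) n : 0 <= T -> measurable (A : set (measurableTypeR R)) ->
  measurable_fun setT (indic_mean A T n).
Proof.
move=> T0 mA; apply: continuous_measurable_fun => x; apply: cvgMr.
have cF := continuous_clamp T0 (itg_continuous T0 (indic_intg T mA)).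
apply: cvgB; first exact: cF.
apply: (@continuous_comp _ _ _ (fun x : R => x - n.+1%:R^-1) ((fun t => itg \1_A 0 t) \o clamp T)); last exact: cF.
by apply: cvgB; [exact: cvg_id|exact: cvg_cst].
Qed.

(** Lebesgue's differentiation theorem, read along the negative increments -1/(n+1). *)
Lemma indic_mean_cvg A (T : R) : 0 <= T -> measurable (A : set (measurableTypeR R)) ->
  ae_time T (fun t => indic_mean A T n t @[n --> \oo] --> (\1_A t : R)).
Proof.
move=> T0 mA; have iA := indic_intg T mA.
have H := @FTC1 R \1_A (BLeft 0) _ (locally_integrable_indic openT mA).
have {}H := H (fun y => indic_integrable mA (leb1_itv_lty _ _ _ _)).
apply: (@filterS _ (almost_everywhere leb1) _ _ _ _ H) => t + /andP[t0 tT].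
move=> /(_ _)[|dF dFE]; first by rewrite lte_fin.
set F := (fun x : R => _) in dF dFE.
have FE (x : R) : 0 <= x <= T -> F x = itg \1_A 0 (clamp T x).
  move=> xT; rewrite clampE// /F -Rintegral_itv_bndo_bndc; last first.
    by apply: indic_integrable => //; exact: leb1_itv_lty.
  by rewrite -Rintegral_itv_obnd_cbnd//; apply: indic_integrable => //; exact: leb1_itv_lty.
have c0 : (k^-1 *: (F (k + t) - F t) @[k --> (0 : R)^'] --> (\1_A t : R)).
  have := dF; rewrite /derivable => /cvgP; rewrite -dFE derive1E /derive => H'.
  have -> : (fun k : R => k^-1 *: (F (k + t) - F t)) = (fun h : R => h^-1 *: (F (h *: 1 + t) - F t)).
    by apply/funext => k; rewrite /= [k *: 1]mulr1.
  exact: H'.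
have hs : (- (n.+1%:R^-1 : R)) @[n --> \oo] --> (0 : R)^'.
  have c : (- (n.+1%:R^-1 : R)) @[n --> \oo] --> (0 : R).
    apply/cvgrPdist_lt => e e0; have := near_infty_natSinv_lt (PosNum e0).
    by apply: filterS => n /=; rewrite sub0r opprK ger0_norm.
  move=> U U0; have h : \forall n \near \oo, - (n.+1%:R^-1 : R) != 0 -> U (- (n.+1%:R^-1 : R)) by exact: c U0.
  by apply: filterS h => n; apply; rewrite oppr_eq0 invr_eq0 pnatr_eq0.
have := cvg_comp _ _ hs c0; apply: cvg_trans; apply: near_eq_cvg.
have : \forall n \near \oo, (n.+1%:R^-1 : R) < t by exact: near_infty_natSinv_lt (PosNum t0).
apply: filterS => n nt /=.
have h0 : 0 < (n.+1%:R^-1 : R) by rewrite invr_gt0 ltr0n.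
have tT1 : 0 <= t <= T by rewrite !ltW.
have tT2 : 0 <= t - n.+1%:R^-1 <= T.
  have nt' : n.+1%:R^-1 < t := nt; rewrite subr_ge0 ltW//= lerBlDr (le_trans (ltW tT))// lerDl ltW//.
rewrite (addrC (- _) t) (FE _ tT1) (FE _ tT2) /indic_mean invrN invrK.
by rewrite -[LHS]/(_ * _) mulNr -mulrN opprB.
Qed.


(** As an indicator takes only the values 0 and 1, r |-> |1_A(r) - 1_A(t)| is 1_A or 1 - 1_A
    according to t, so its mean is the distance from 1_A(t) to the mean of 1_A. *)
Lemma itg_indic_dist A (T : R) n t : 0 <= T -> measurable (A : set (measurableTypeR R)) ->
  n.+1%:R^-1 <= t <= T ->
  itg (fun r => `|(\1_A r : R) - \1_A t|) (t - n.+1%:R^-1) t =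
    n.+1%:R^-1 * `|(\1_A t : R) - indic_mean A T n t|.
Proof.
move=> T0 mA /andP[nt tT]; have iA := indic_intg T mA.
have n0 : 0 < (n.+1%:R : R) by rewrite ltr0n.
have h0 : 0 < (n.+1%:R^-1 : R) by rewrite invr_gt0.
have m01 := indic_mean_01 n t T0 mA; rewrite /indic_mean in m01 *.
have [h hE] : exists h : R, h = n.+1%:R^-1 by eexists.
rewrite -hE in h0 nt m01 *.
have nE : n.+1%:R = h^-1 by rewrite hE invrK.
have tT1 : 0 <= t <= T by apply/andP; split; lra.
have tT2 : 0 <= t - h <= T by apply/andP; split; lra.
have a1 : 0 <= t - h by lra.
have a2 : t - h <= t by lra.
rewrite !clampE// in m01 *; rewrite (itg_split (lexx 0) a1 a2 tT iA) in m01 *.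
set I0 := itg _ 0 _ in m01 *; rewrite (_ : I0 + _ - I0 = itg \1_A (t - h) t) in m01 *; last by ring.
set I1 := itg _ _ _ in m01 *.
have Ih : h * (n.+1%:R * I1) = I1 by rewrite nE mulrA divff ?mul1r// gt_eqF.
have /andP[m0 m1] := m01.
have [At|At] := boolP (t \in A).
  rewrite [X in `|X - _|]indicE At ger0_norm ?subr_ge0// mulrBr Ih mulr1.
  have -> : (fun r : R => `|(\1_A r : R) - \1_A t|) = (fun r : R => 1 - (\1_A r : R)).
    apply/funext => r; have /andP[b0 b1] := indic_01 A r.
    by rewrite [X in _ - X]indicE At distrC ger0_norm ?subr_ge0.
  rewrite (itgB a1 tT (intg_cst 1 T0) iA) itg_cst//; rewrite -/I1; ring.
rewrite [X in `|X - _|]indicE (negbTE At) sub0r normrN ger0_norm// Ih.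
congr (itg _ _ _); apply/funext => r; have /andP[b0 b1] := indic_01 A r.
by rewrite [X in _ - X]indicE (negbTE At) subr0 ger0_norm.
Qed.

End indicator_translation.

(** * Translation and approximation of vector-valued functions by step functions *)

Section step_translation.
Context {R : realType} {V : lmodType R} (X : nspace V) (sX : snormed X).

Lemma fnrm_sum n (F : 'I_n -> V) : (forall i, dom X (F i)) -> fnrm X (\sum_i F i) <= \sum_i fnrm X (F i).
Proof.
elim: n F => [|n IH] F dF; first by rewrite !big_ord0 (fnrm0 sX).
rewrite !big_ord_recl; apply: le_trans (fnrmD sX _ _) _ => //; first by apply: (dom_sum sX).
by rewrite lerD2l; exact: IH.
Qed.

Lemma smeas_cst (x : V) : dom X x -> smeas X (fun=> x).
Proof.
move=> dx; have st : is_step X (@Step R V 1 (fun=> setT) (fun=> x)).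
  by move=> i; split; [exact: measurableT|].
have := smeas_step sX st; congr smeas; apply/funext => r.
by rewrite /step_fun/= big_ord1 indicT scale1r.
Qed.

(** The norm of the increment is at most the sum of c_i |1_i(r) - 1_i(t)|, itself at most [Cs]; its
    square is thus at most [Cs] times that sum, whose mean [itg_indic_dist] evaluates. *)
Lemma step_translation (T : R) (s : step V) : 0 <= T -> is_step X s ->
  exists (p : nat -> R -> R) (C : R),
    [/\ forall n, measurable_fun (`]0, T[ : set (measurableTypeR R)) (p n),
        forall n (t : R), 0 <= p n t <= C,
        ae_time T (fun t => p n t @[n --> \oo] --> 0) &
        forall n (t : R), n.+1%:R^-1 <= t <= T ->
          intg T (fun r => fnrm X (step_fun s r - step_fun s t) ^+ 2) /\
          itg (fun r => fnrm X (step_fun s r - step_fun s t) ^+ 2) (t - n.+1%:R^-1) t <=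
            n.+1%:R^-1 * p n t].
Proof.
move=> T0 ss; pose c i := fnrm X (@step_val _ _ s i); pose Cs := \sum_i c i.
have c0 i : 0 <= c i := fnrm_ge0 sX _.
have Cs0 : 0 <= Cs by apply: sumr_ge0.
have mA i : measurable (@step_set _ _ s i : set (measurableTypeR R)) by case: (ss i).
pose m n i t := `|(\1_(@step_set _ _ s i) t : R) - indic_mean (@step_set _ _ s i) T n t|.
have m01 n i t : 0 <= m n i t <= 1.
  have /andP[a1 a2] := indic_01 (@step_set _ _ s i) t.
  have /andP[b1 b2] := indic_mean_01 n t T0 (mA i).
  by rewrite normr_ge0 ler_norml; apply/andP; split; lra.
exists (fun n t => Cs * \sum_i c i * m n i t), (Cs * Cs); split.
- move=> n; apply: measurable_funM => //; apply: measurable_sum => i; apply: measurable_funM => //.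
  apply: measurableT_comp => //; apply: measurable_funB; first exact: measurable_indic.
  by apply: measurable_funTS; exact: measurable_indic_mean.
- move=> n t; apply/andP; split.
    by apply: mulr_ge0 => //; apply: sumr_ge0 => i _; apply: mulr_ge0 => //; case/andP: (m01 n i t).
  by rewrite ler_wpM2l//; apply: ler_sum => i _; rewrite ler_piMr//; case/andP: (m01 n i t).
- have H : ae_time T (fun t => forall i, m n i t @[n --> \oo] --> 0).
    have H (j : nat) : ae_time T (fun t => forall i : 'I_(step_n s), i = j :> nat -> m n i t @[n --> \oo] --> 0).
      have [jn|nj] := ltnP j (step_n s).
        apply: ae_timeS (indic_mean_cvg T0 (mA (Ordinal jn))) => t _ ct i ij.
        have -> : i = Ordinal jn by apply/val_inj.
        have -> : (0 : R) = `|(\1_(@step_set _ _ s (Ordinal jn)) t : R) - \1_(@step_set _ _ s (Ordinal jn)) t|.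
          by rewrite subrr normr0.
        by apply: cvg_norm; apply: cvgB => //; exact: cvg_cst.
      by apply: ae_timeW => t _ i ij; have := ltn_ord i; rewrite ij ltnNge nj.
    by apply: ae_timeS (ae_time_forall_nat H) => t _ Ht i; exact: (Ht i).
  apply: ae_timeS H => t _ Ht.
  have H0 (I : seq 'I_(step_n s)) : \sum_(i <- I) c i * m n i t @[n --> \oo] --> (0 : R).
    elim: I => [|i I IH].
      have -> : (fun n => \sum_(i <- [::]) c i * m n i t) = (fun=> 0) by apply/funext => n; rewrite big_nil.
      exact: cvg_cst.
    have -> : (fun n => \sum_(j <- i :: I) c j * m n j t) = (fun n => c i * m n i t + \sum_(j <- I) c j * m n j t).
      by apply/funext => n; rewrite big_cons.
    rewrite -[X in _ --> X](addr0 (0 : R)) -[X in _ --> X + _](mulr0 (c i)).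
    by apply: cvgD => //; apply: cvgMr; exact: Ht.
  by rewrite -[X in _ --> X](mulr0 Cs); apply: cvgMr; exact: H0.
- move=> n t ntT; have /andP[nt tT] := ntT.
  have h0 : 0 < (n.+1%:R^-1 : R) by rewrite invr_gt0 ltr0n.
  have a1 : 0 <= t - n.+1%:R^-1 by rewrite subr_ge0.
  have ds r : dom X (step_fun s r) := dom_step_fun sX r ss.
  pose d i (r : R) := `|(\1_(@step_set _ _ s i) r : R) - \1_(@step_set _ _ s i) t|.
  have d01 i r : 0 <= d i r <= 1.
    have /andP[u1 u2] := indic_01 (@step_set _ _ s i) t.
    have /andP[v1 v2] := indic_01 (@step_set _ _ s i) r.
    by rewrite normr_ge0 ler_norml; apply/andP; split; lra.
  have B1 r : fnrm X (step_fun s r - step_fun s t) <= \sum_i c i * d i r.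
    rewrite /step_fun -sumrB.
    have dF i : dom X ((\1_(@step_set _ _ s i) r : R) *: step_val i - (\1_(@step_set _ _ s i) t : R) *: step_val i).
      by apply: (dom_sub sX); apply: (dom_scale sX); case: (ss i).
    apply: (le_trans (fnrm_sum dF)); apply: ler_sum => i _.
    have dv : dom X (step_val i) by case: (ss i).
    by rewrite -scalerBl (fnrmZ sX _ dv) mulrC lexx.
  have B2 r : \sum_i c i * d i r <= Cs.
    by apply: ler_sum => i _; rewrite ler_piMr//; case/andP: (d01 i r).
  have B0 r : 0 <= \sum_i c i * d i r.
    by apply: sumr_ge0 => i _; apply: mulr_ge0 => //; case/andP: (d01 i r).
  have id i : intg T (d i).
    apply: (intg_le (k2 := fun=> 1)); [|move=> r _|exact: intg_cst].
      apply: measurableT_comp => //; apply: measurable_funB => //; exact: measurable_indic.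
    by rewrite ger0_norm; case/andP: (d01 i r).
  have isum (I : seq 'I_(step_n s)) : intg T (fun r => \sum_(i <- I) c i * d i r) /\
      itg (fun r => \sum_(i <- I) c i * d i r) (t - n.+1%:R^-1) t =
        \sum_(i <- I) c i * itg (d i) (t - n.+1%:R^-1) t.
    elim: I => [|i I [IH1 IH2]].
      have -> : (fun r : R => \sum_(i <- [::]) c i * d i r) = (fun=> 0) by apply/funext => r; rewrite big_nil.
      rewrite big_nil itg_cst ?mul0r//; first by split => //; exact: intg_cst.
      by rewrite gerBl ltW.
    have -> : (fun r : R => \sum_(j <- i :: I) c j * d j r) = (fun r => c i * d i r + \sum_(j <- I) c j * d j r).
      by apply/funext => r; rewrite big_cons.
    rewrite big_cons -IH2 (itgD a1 tT (intgZ _ (id i)) IH1) (itgZ _ a1 tT (id i)); split => //.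
    exact: intgD (intgZ _ (id i)) IH1.
  have [is1 is2] := isum (index_enum _).
  have B3 r : fnrm X (step_fun s r - step_fun s t) ^+ 2 <= Cs * \sum_i c i * d i r.
    rewrite expr2; apply: ler_pM; rewrite ?(fnrm_ge0 sX)//; exact: le_trans (B1 r) (B2 r).
  have mq : measurable_fun (`]0, T[ : set (measurableTypeR R)) (fun r => fnrm X (step_fun s r - step_fun s t) ^+ 2).
    apply: measurable_funX; apply: measurable_funTS.
    have sm : smeas X (fun r => step_fun s r - step_fun s t).
      apply: (smeasB sX); first exact: smeas_step.
      exact: smeas_cst (ds t).
    exact: smeas_measurable_fnrm sm.
  have iq : intg T (fun r => fnrm X (step_fun s r - step_fun s t) ^+ 2).
    apply: (intg_le mq _ (intgZ Cs is1)) => r _; rewrite ger0_norm ?sqr_ge0//; exact: B3.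
  split => //; apply: (le_trans (itg_le a1 tT iq (intgZ Cs is1) (fun r _ => B3 r))).
  rewrite (itgZ _ a1 tT is1) is2 mulrCA ler_wpM2l// mulr_sumr; apply: ler_sum => i _.
  by rewrite /d (itg_indic_dist T0 (mA i) ntT) mulrCA.
Qed.


Lemma step_approx (T : R) (f : R -> V) : 0 < T -> smeas X f -> intg T (fun t => fnrm X (f t) ^+ 2) ->
  forall e : R, 0 < e -> exists s : step V, [/\ is_step X s,
    intg T (fun t => fnrm X (f t - step_fun s t) ^+ 2) &
    itg (fun t => fnrm X (f t - step_fun s t) ^+ 2) 0 T <= e].
Proof.
move=> T0 sf if2 e e0; have T0' := ltW T0; have [df [s [ss sfs]]] := sf.
have mf := smeas_measurable_fnrm sX sf.
have ds k t : dom X (step_fun (s k) t) := dom_step_fun sX t (ss k).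
(* Truncation where the step value exceeds twice |f| provides a dominating function: the distance to
   f is at most 3 |f|, hence the 9 below. *)
pose A k : set (measurableTypeR R) := [set t | fnrm X (step_fun (s k) t) <= 2 * fnrm X (f t)].
have mA k : measurable (A k).
  rewrite -[A k]setTI; apply: measurable_fun_le => //.
    exact: smeas_measurable_fnrm (smeas_step sX (ss k)).
  exact: measurable_funM.
pose S k := step_restrict (A k) (s k).
have sS k : is_step X (S k) := is_step_restrict (mA k) (ss k).
pose q k (t : R) := fnrm X (f t - step_fun (S k) t) ^+ 2.
have n0 t : 0 <= fnrm X (f t) := fnrm_ge0 sX _.
have mq k : measurable_fun (`]0, T[ : set (measurableTypeR R)) (q k).
  apply: measurable_funX; apply: measurable_funTS.
  apply: (smeas_measurable_fnrm sX (f := fun t => f t - step_fun (S k) t)).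
  by apply: (smeasB sX) => //; exact: smeas_step.
have SE k t : step_fun (S k) t = if t \in A k then step_fun (s k) t else 0.
  by rewrite step_fun_restrict indicE; case: ifP => _; rewrite ?scale1r ?scale0r.
have dSk k t : dom X (step_fun (S k) t) := dom_step_fun sX t (sS k).
have qb k t : `|q k t| <= 9 * fnrm X (f t) ^+ 2.
  rewrite ger0_norm ?sqr_ge0// (_ : 9 * _ = (3 * fnrm X (f t)) ^+ 2); last by ring.
  rewrite ler_sqr ?nnegrE ?(fnrm_ge0 sX) ?mulr_ge0//.
  apply: (le_trans (fnrmB sX (df t) (dSk k t))).
  have : fnrm X (step_fun (S k) t) <= 2 * fnrm X (f t).
    rewrite SE; case: ifPn => [|_]; first by rewrite inE.
    by rewrite (fnrm0 sX) mulr_ge0.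
  lra.
have iq k : intg T (q k).
  by apply: (intg_le (mq k) (k2 := fun t => 9 * fnrm X (f t) ^+ 2)) => //; exact: intgZ.
have cq (t : R) : q k t @[k --> \oo] --> (0 : R).
  have cn : fnrm X (f t - step_fun (S k) t) @[k --> \oo] --> (0 : R).
    (* Where |f| = 0 the truncation forces the value to have norm 0; elsewhere it is inactive for
       large k. *)
    have [f0|fn0] := eqVneq (fnrm X (f t)) 0.
      have -> : (fun k => fnrm X (f t - step_fun (S k) t)) = (fun=> 0).
        apply/funext => k; apply/eqP; rewrite eq_le (fnrm_ge0 sX) andbT.
        apply: (le_trans (fnrmB sX (df t) (dSk k t))); rewrite f0 add0r SE.
        by case: ifPn => [|_]; rewrite ?(fnrm0 sX)// inE /A/= f0 mulr0.
      exact: cvg_cst.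
    have fp : 0 < fnrm X (f t) by rewrite lt_neqAle eq_sym fn0 n0.
    apply: cvg_trans (sfs t); apply: near_eq_cvg.
    have /cvgrPdist_lt/(_ _ fp) := sfs t; apply: filterS => k.
    rewrite sub0r normrN ger0_norm ?(fnrm_ge0 sX)// => H.
    have tA : t \in A k.
      apply/mem_set; rewrite /A/=.
      have := fnrmD sX (dom_sub sX (ds k t) (df t)) (df t); rewrite subrK => H'.
      apply: (le_trans H'); rewrite mulrDl mul1r lerD2r; exact: ltW.
    by rewrite SE tA; apply: (fnrmBC sX); [exact: ds|exact: df].
  have -> : (0 : R) = 0 * 0 by rewrite mul0r.
  by rewrite /q; under eq_fun do rewrite expr2; exact: cvgM.
have [_] : leb1.-integrable (`]0, T[ : set (measurableTypeR R)) (EFin \o cst 0) /\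
    \int[leb1]_(x in `]0, T[) q n x @[n --> \oo] --> \int[leb1]_(x in `]0, T[) (cst 0 x : R).
  apply: (@Rintegral_dominated_cvg _ (measurableTypeR R) R leb1 `]0, T[%classic q (cst 0) (fun t => 9 * fnrm X (f t) ^+ 2)).
  - exact: measurable_itv.
  - exact: mq.
  - exact: measurable_cst.
  - by apply: aeW => t _; exact: cq.
  - exact: intgZ.
  - by apply: aeW => t _ k; exact: qb.
rewrite Rintegral_cst// mul0r => /cvgrPdist_lt/(_ e e0) /filter_ex[k].
rewrite sub0r normrN => H; exists (S k); split => //; first exact: iq.
by apply: ltW; apply: le_lt_trans H; exact: ler_norm.
Qed.

End step_translation.

(** * The energy inequality *)

Lemma within_continuousD (R : realType) (A : set R) (f g : R -> R) :
  {within A, continuous f} -> {within A, continuous g} ->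
  {within A, continuous (fun x => f x + g x)}.
Proof. by move=> cf cg x; exact: (continuousD (cf x) (cg x)). Qed.

Lemma within_continuousB (R : realType) (A : set R) (f g : R -> R) :
  {within A, continuous f} -> {within A, continuous g} ->
  {within A, continuous (fun x => f x - g x)}.
Proof. by move=> cf cg x; exact: (continuousB (cf x) (cg x)). Qed.

Lemma within_continuousZ (R : realType) (A : set R) (c : R) (f : R -> R) :
  {within A, continuous f} -> {within A, continuous (fun x => c * f x)}.
Proof. by move=> cf; apply: within_continuousM => // x; exact: cvg_cst. Qed.

Lemma unif_within_continuous (R : realType) (T : R) (K : R -> R) :
  (forall e : R, 0 < e -> exists2 d : R, 0 < d & forall s t : R, 0 <= s -> s <= t -> t <= T ->
     t - s < d -> `|K t - K s| < e) -> {within `[0, T], continuous K}.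
Proof.
move=> H; apply/subspace_continuousP => t; rewrite /= in_itv/= => /andP[t0 tT].
apply/cvgrPdist_lt => e e0; have [d d0 Hd] := H e e0.
have : \forall s \near t, `|t - s| < d by apply/nbhs_ballP; exists d.
apply: filterS => s; rewrite /= => ts; rewrite /= in_itv/= => /andP[s0 sT].
case: (leP s t) => st.
  by apply: Hd => //; rewrite -(ger0_norm (_ : 0 <= t - s)) ?subr_ge0.
rewrite distrC; apply: Hd => //; first exact: ltW.
by rewrite -(ger0_norm (_ : 0 <= s - t)) ?subr_ge0 1?distrC// ltW.
Qed.

Lemma intg_cM (R : realType) (T : R) (f k : R -> R) : 0 < T -> {within `[0, T], continuous f} ->
  intg T k -> intg T (fun t => k t * f t).
Proof.
move=> T0 cf ik; have /compact_bounded[M [_ HM]] := continuous_compact cf (@segment_compact R 0 T).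
have fM (t : R) : 0 < t < T -> `|f t| <= `|M| + 1.
  move=> /andP[t0 tT]; apply: HM; first by rewrite ltr_pwDr// ler_norm.
  by exists t => //; rewrite /= in_itv/= !ltW.
have ik' : intg T (fun t => (`|M| + 1) * `|k t|) by apply: intgZ; exact: integrable_norm ik.
apply: (intg_le _ _ ik').
  apply: measurable_funM; first exact: intg_measurable ik.
  have icf : intg T f by exact: (within_integrable cf).
  exact: intg_measurable icf.
by move=> t tT; rewrite normrM mulrC ler_wpM2r//; exact: fM.
Qed.

(** * Gronwall's lemma applied to the energy inequality *)

Section energy_gronwall.
Context {R : realType}.

(** Obtained by integrating the square of x minus its mean X / t. *)
Lemma itg_CS (T : R) (x : R -> R) (t : R) : 0 <= t -> t <= T -> intg T x -> intg T (fun r => x r ^+ 2) ->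
  itg x 0 t ^+ 2 <= t * itg (fun r => x r ^+ 2) 0 t.
Proof.
move=> t0 tT ix ix2; have T0 : 0 <= T := le_trans t0 tT.
have [->|tn0] := eqVneq t 0; first by rewrite !itgxx expr0n mul0r.
have tp : 0 < t by rewrite lt_neqAle eq_sym tn0.
have [X XE] : exists X : R, itg x 0 t = X by eexists.
have [X2 X2E] : exists X : R, itg (fun r => x r ^+ 2) 0 t = X by eexists.
have i1 := intgZ (2 * (X / t)) ix; have i2 := intgB ix2 i1.
have i3 := intg_cst ((X / t) ^+ 2) T0.
have : 0 <= itg (fun r => x r ^+ 2 - 2 * (X / t) * x r + (X / t) ^+ 2) 0 t.
  apply: itg_ge0 => r; have -> : x r ^+ 2 - 2 * (X / t) * x r + (X / t) ^+ 2 = (x r - X / t) ^+ 2 by ring.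
  exact: sqr_ge0.
rewrite (itgD (lexx 0) tT i2 i3) (itgB (lexx 0) tT ix2 i1) (itgZ _ (lexx 0) tT ix) itg_cst// XE X2E subr0.
have -> : X2 - 2 * (X / t) * X + (X / t) ^+ 2 * t = X2 - X ^+ 2 / t by field.
by rewrite subr_ge0 ler_pdivrMr// mulrC.
Qed.

(** In the application x and x2 are the H1 and L2 norms of W, y is the L2 norm of U, p and q are
    |W'|^2 and |grad U|^2, m1 bounds the source error and beta grad w, and Lx is Lambda(W). The
    constant is chosen before beta and all these functions. *)
Lemma energy_gronwall (T alpha L k B0 : R) : 0 < T -> 0 < alpha -> 0 <= L -> 0 <= k -> 0 <= B0 ->
  exists2 C : R, 0 <= C & forall (beta E0 lam0 : R) (x x2 y p q m1 Lx : R -> R),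
    0 < beta <= B0 -> 0 <= lam0 ->
    (forall t, 0 <= x2 t <= x t) -> (forall t, 0 <= p t) -> (forall t, 0 <= q t) -> (forall t, 0 <= m1 t) ->
    intg T p -> intg T q -> intg T m1 -> {within `[0, T], continuous x} -> {within `[0, T], continuous y} ->
    (forall t : R, 0 <= t <= T ->
       alpha / 2 * (x t ^+ 2 - x2 t ^+ 2) + 2^-1 * y t ^+ 2 - Lx t + itg p 0 t + 2^-1 * itg q 0 t <=
       E0 + itg (fun r => (m1 r + beta * x r) * x r) 0 t + L * itg (fun r => y r ^+ 2) 0 t) ->
    (forall t : R, 0 <= t <= T -> Lx t <= (lam0 + itg (fun r => m1 r + beta * x r) 0 t) * x t) ->
    (forall t : R, 0 <= t <= T -> x2 t ^+ 2 <= 2 * x2 0 ^+ 2 + 2 * T * itg p 0 t) ->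
    itg m1 0 T <= k * beta -> lam0 <= k * beta -> E0 <= k * beta ^+ 2 -> x2 0 <= k * beta ->
    forall t : R, 0 <= t <= T -> x t ^+ 2 + y t ^+ 2 + itg p 0 t + itg q 0 t <= C * beta ^+ 2.
Proof.
move=> T0 a0 L0 k0 B00; have T0' := ltW T0.
(* [g] is the weight of the full norm x^2 on the left: at most alpha/2, to be taken from the
   gradient term; at most 1/(8 T), so that recovering x2^2 costs a quarter of the integral of p; at
   most 1/4, to bound the other weights. *)
have [g [g0 ga gT g4]] : exists g : R, [/\ 0 < g, g <= alpha / 2, g * (8 * T) <= 1 & g <= 4^-1].
  exists (Num.min (alpha / 2) (Num.min (8 * T)^-1 4^-1)); split.
  - by rewrite !lt_min; apply/and3P; split; rewrite ?divr_gt0 ?invr_gt0 ?mulr_gt0.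
  - by rewrite ge_min lexx.
  - by rewrite -ler_pdivlMr ?mulr_gt0// div1r !ge_min lexx orbT.
  - by rewrite !ge_min lexx !orbT.
(* The coefficients of beta^2, in order: initial energy, initial value of x2, Young's inequality for
   Lx, and integral of m1. *)
pose A := k + 2 * g * k ^+ 2 + 4 * k ^+ 2 / g + k / 2.
have A0 : 0 <= A.
  have gk : 0 <= 2 * g * k ^+ 2 by rewrite mulr_ge0 ?sqr_ge0// mulr_ge0// ltW.
  have kg : 0 <= 4 * k ^+ 2 / g by rewrite divr_ge0 ?(ltW g0)// mulr_ge0// sqr_ge0.
  rewrite /A; lra.
(* The coefficients of the integral of Y, coming from the beta x part of Lx, from beta x^2 and from
   L y^2. *)
pose c1 := B0 ^+ 2 * T / g + B0 + L.
have c10 : 0 <= c1 by rewrite /c1 addr_ge0// addr_ge0// divr_ge0 ?(ltW g0)// mulr_ge0// sqr_ge0.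
exists (2 / g * A * expR (2 / g * (c1 * T + k / 2))).
  by rewrite mulr_ge0 ?expR_ge0// mulr_ge0// divr_ge0// ltW.
move=> beta E0 lam0 x x2 y p q m1 Lx /andP[b0 bB] lam00 x20 p0 q0 m10 ip iq im1 cx cy En HLx Hx2 km klam kE kx2.
have x0 r : 0 <= x r by case/andP: (x20 r) => u v; exact: le_trans v.
have xx2 r : x2 r ^+ 2 <= x r ^+ 2 by case/andP: (x20 r) => u v; rewrite ler_sqr ?nnegrE.
pose Y t := x t ^+ 2 + y t ^+ 2 + itg p 0 t + itg q 0 t.
have Y0 t : 0 <= Y t by rewrite /Y !addr_ge0 ?sqr_ge0 ?itg_ge0.
have cY : {within `[0, T], continuous Y}.
  have H := within_continuousD (within_continuousD (within_continuousD (within_continuousM cx cx)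
    (within_continuousM cy cy)) (itg_continuous T0' ip)) (itg_continuous T0' iq).
  exact: H.
have iY : intg T Y := within_integrable cY.
have ix : intg T x := within_integrable cx.
have ix2 : intg T (fun r => x r ^+ 2) := within_integrable (within_continuousM cx cx).
have iy2 : intg T (fun r => y r ^+ 2) := within_integrable (within_continuousM cy cy).
have im1Y : intg T (fun r => m1 r * Y r) := intg_cM T0 cY im1.
have im1x : intg T (fun r => m1 r * x r) := intg_cM T0 cx im1.
(* The kernel contains m1 / (2 beta), singular as beta tends to 0, but since the integral of m1 is
   at most k beta this term integrates to at most k / 2. *)
pose K r := 2 / g * (c1 + (2 * beta)^-1 * m1 r).
have iK' : intg T (fun r => c1 + (2 * beta)^-1 * m1 r) by apply: intgD (intg_cst _ T0') (intgZ _ im1).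
have iK : intg T K := intgZ _ iK'.
have K0 r : 0 <= K r.
  by rewrite /K mulr_ge0 ?divr_ge0 ?(ltW g0)// addr_ge0// mulr_ge0// invr_ge0 mulr_ge0// ltW.
have iKY' : intg T (fun r => c1 * Y r + (2 * beta)^-1 * (m1 r * Y r)).
  exact: intgD (intgZ _ iY) (intgZ _ im1Y).
have KYE : (fun r => K r * Y r) = (fun r => 2 / g * (c1 * Y r + (2 * beta)^-1 * (m1 r * Y r))).
  by apply/funext => r; rewrite /K; ring.
have iKY : intg T (fun r => K r * Y r) by rewrite KYE; exact: intgZ.
have HY (t : R) : 0 <= t <= T -> Y t <= 2 / g * A * beta ^+ 2 + itg (fun r => K r * Y r) 0 t.
  move=> tT; have /andP[t0 tT'] := tT; have z0 := lexx (0 : R).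
  have xY r : x r ^+ 2 <= Y r by rewrite /Y -!addrA lerDl !addr_ge0 ?sqr_ge0 ?itg_ge0.
  have yY r : y r ^+ 2 <= Y r.
    by rewrite /Y -!addrA addrCA lerDl !addr_ge0 ?sqr_ge0 ?itg_ge0.
  have [IY IYE] : exists v : R, itg Y 0 t = v by eexists.
  have [IM IME] : exists v : R, itg (fun r => m1 r * Y r) 0 t = v by eexists.
  rewrite KYE (itgZ _ z0 tT' iKY') (itgD z0 tT' (intgZ _ iY) (intgZ _ im1Y)) (itgZ _ z0 tT' iY) (itgZ _ z0 tT' im1Y) IYE IME.
  have Ix2 : itg (fun r => x r ^+ 2) 0 t <= IY.
    by rewrite -IYE; apply: (itg_le z0 tT' ix2 iY) => r _; exact: xY.
  have Iy2 : itg (fun r => y r ^+ 2) 0 t <= IY.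
    by rewrite -IYE; apply: (itg_le z0 tT' iy2 iY) => r _; exact: yY.
  have IY0 : 0 <= IY by rewrite -IYE itg_ge0.
  have [X XE] : exists v : R, itg x 0 t = v by eexists.
  have X0 : 0 <= X by rewrite -XE itg_ge0.
  have X2 : X ^+ 2 <= T * IY.
    rewrite -XE; apply: (le_trans (itg_CS t0 tT' ix ix2)); apply: ler_pM => //.
    by apply: itg_ge0 => r; exact: sqr_ge0.
  have [M ME] : exists v : R, itg m1 0 t = v by eexists.
  have M0 : 0 <= M by rewrite -ME itg_ge0.
  have Mk : M <= k * beta by rewrite -ME; apply: le_trans km; exact: itg_sub_le.
  (* Young's inequality in the form x <= beta / 2 + x^2 / (2 beta): the first part integrates to
     O(beta^2), the second enters the kernel. *)
  have I1 : itg (fun r => (m1 r + beta * x r) * x r) 0 t <= beta / 2 * M + (2 * beta)^-1 * IM + beta * IY.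
    have -> : (fun r => (m1 r + beta * x r) * x r) = (fun r => m1 r * x r + beta * x r ^+ 2).
      by apply/funext => r; ring.
    rewrite (itgD z0 tT' im1x (intgZ _ ix2)) (itgZ _ z0 tT' ix2).
    apply: lerD; last by rewrite ler_pM2l.
    rewrite -ME -IME -(itgZ _ z0 tT' im1) -(itgZ _ z0 tT' im1Y) -(itgD z0 tT' (intgZ _ im1) (intgZ _ im1Y)).
    apply: (itg_le z0 tT' im1x (intgD (intgZ _ im1) (intgZ _ im1Y))) => r _.
    have -> : beta / 2 * m1 r + (2 * beta)^-1 * (m1 r * Y r) = m1 r * (beta / 2 + (2 * beta)^-1 * Y r) by ring.
    rewrite ler_wpM2l//; apply: (@le_trans _ _ (beta / 2 + (2 * beta)^-1 * x r ^+ 2)); last first.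
      by rewrite lerD2l ler_wpM2l// invr_ge0 mulr_ge0// ltW.
    rewrite -subr_ge0 (_ : _ - _ = (2 * beta)^-1 * (x r - beta) ^+ 2).
      by rewrite mulr_ge0 ?sqr_ge0// invr_ge0 mulr_ge0// ltW.
    by field; rewrite gt_eqF.
  have I2 : Lx t <= g / 2 * x t ^+ 2 + 4 * k ^+ 2 / g * beta ^+ 2 + B0 ^+ 2 * T / g * IY.
    apply: (le_trans (HLx t tT)); rewrite (itgD z0 tT' im1 (intgZ _ ix)) (itgZ _ z0 tT' ix) ME XE.
    have s1 : lam0 + (M + beta * X) <= 2 * k * beta + beta * X by lra.
    apply: (le_trans (ler_wpM2r (x0 t) s1)).
    set z := 2 * k * beta + beta * X.
    apply: (@le_trans _ _ (g / 2 * x t ^+ 2 + (2 * g)^-1 * z ^+ 2)).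
      rewrite -subr_ge0 (_ : _ - _ = (2 * g)^-1 * (g * x t - z) ^+ 2).
        by rewrite mulr_ge0 ?sqr_ge0// invr_ge0 mulr_ge0// ltW.
      by field; rewrite gt_eqF.
    rewrite -addrA lerD2l.
    have z2 : z ^+ 2 <= 8 * k ^+ 2 * beta ^+ 2 + 2 * (B0 ^+ 2 * (T * IY)).
      have h1 : z ^+ 2 <= 2 * (2 * k * beta) ^+ 2 + 2 * (beta * X) ^+ 2.
        by rewrite /z -subr_ge0 (_ : _ - _ = (2 * k * beta - beta * X) ^+ 2) ?sqr_ge0//; ring.
      have h2 : (beta * X) ^+ 2 <= B0 ^+ 2 * (T * IY).
        rewrite exprMn; apply: ler_pM; rewrite ?sqr_ge0// ler_sqr ?nnegrE//; exact: ltW.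
      have h3 : 2 * (2 * k * beta) ^+ 2 = 8 * k ^+ 2 * beta ^+ 2 by ring.
      rewrite h3 in h1; lra.
    have -> : 4 * k ^+ 2 / g * beta ^+ 2 + B0 ^+ 2 * T / g * IY =
        (2 * g)^-1 * (8 * k ^+ 2 * beta ^+ 2 + 2 * (B0 ^+ 2 * (T * IY))).
      by field; rewrite gt_eqF.
    by rewrite ler_wpM2l// invr_ge0 mulr_ge0// ltW.
  (* The gradient term only controls x^2 - x2^2; the missing g x2^2 is paid for with a quarter of
     the integral of p. *)
  have I3 : g * x t ^+ 2 <= alpha / 2 * (x t ^+ 2 - x2 t ^+ 2) + 4^-1 * itg p 0 t + 2 * g * k ^+ 2 * beta ^+ 2.
    have P0 : 0 <= itg p 0 t by exact: itg_ge0.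
    have h1 : g * (x t ^+ 2 - x2 t ^+ 2) <= alpha / 2 * (x t ^+ 2 - x2 t ^+ 2).
      by rewrite ler_wpM2r// subr_ge0.
    have h2 : g * x2 t ^+ 2 <= g * (2 * x2 0 ^+ 2 + 2 * T * itg p 0 t).
      by rewrite ler_pM2l//; exact: Hx2.
    have h3 : g * (2 * T * itg p 0 t) <= 4^-1 * itg p 0 t.
      have := ler_wpM2r P0 gT; rewrite mul1r; set P := itg p 0 t.
      have -> : g * (8 * T) * P = 4 * (g * (2 * T * P)) by ring.
      lra.
    have h4 : g * (2 * x2 0 ^+ 2) <= 2 * g * k ^+ 2 * beta ^+ 2.
      have -> : 2 * g * k ^+ 2 * beta ^+ 2 = g * (2 * (k * beta) ^+ 2) by ring.
      rewrite ler_pM2l// ler_pM2l//.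
      case/andP: (x20 0) => u _; by rewrite ler_sqr ?nnegrE// mulr_ge0// ltW.
    rewrite mulrBr in h1; rewrite mulrDr in h2; lra.
  have I4 : beta * IY <= B0 * IY by rewrite ler_wpM2r.
  have I5 : L * itg (fun r => y r ^+ 2) 0 t <= L * IY by rewrite ler_wpM2l.
  have I6 : beta / 2 * M <= k / 2 * beta ^+ 2.
    have -> : k / 2 * beta ^+ 2 = beta / 2 * (k * beta) by ring.
    by rewrite ler_wpM2l// divr_ge0// ltW.
  have P0 : 0 <= itg p 0 t by exact: itg_ge0.
  have Q0 : 0 <= itg q 0 t by exact: itg_ge0.
  have y20 := sqr_ge0 (y t); have x20' := sqr_ge0 (x t).
  have S1 : g / 2 * Y t <= A * beta ^+ 2 + (c1 * IY + (2 * beta)^-1 * IM).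
    have e1 : A * beta ^+ 2 = k * beta ^+ 2 + 2 * g * k ^+ 2 * beta ^+ 2 + 4 * k ^+ 2 / g * beta ^+ 2 + k / 2 * beta ^+ 2.
      by rewrite /A; ring.
    have e2 : c1 * IY = B0 ^+ 2 * T / g * IY + B0 * IY + L * IY by rewrite /c1; ring.
    have e3 : g / 2 * Y t = g * x t ^+ 2 - g / 2 * x t ^+ 2 + g / 2 * y t ^+ 2 + g / 2 * itg p 0 t + g / 2 * itg q 0 t.
      by rewrite /Y; field.
    have g2 : g / 2 <= 2^-1 by lra.
    have j1 := ler_wpM2r y20 g2; have j2 := ler_wpM2r P0 g2; have j3 := ler_wpM2r Q0 g2.
    rewrite e1 e2 e3.
    have key (ca y2 Lt P Q E w1 w2 v1 v2 v3 v4 v5 v6 v7 v8 v9 v10 gx hgx hy hP hQ : R) :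
      ca + 2^-1 * y2 - Lt + P + 2^-1 * Q <= E + w1 + w2 -> w1 <= v1 + v2 + v3 -> Lt <= hgx + v4 + v5 ->
      gx <= ca + 4^-1 * P + v6 -> v3 <= v7 -> w2 <= v8 -> v1 <= v9 -> E <= v10 ->
      hy <= 2^-1 * y2 -> hP <= 2^-1 * P -> hQ <= 2^-1 * Q -> 0 <= P ->
      gx - hgx + hy + hP + hQ <= v10 + v6 + v4 + v9 + (v5 + v7 + v8 + v2) by lra.
    exact: key (En t tT) I1 I2 I3 I4 I5 I6 kE j1 j2 j3 P0.
  have -> : Y t = 2 / g * (g / 2 * Y t) by field; rewrite gt_eqF.
  have -> : 2 / g * A * beta ^+ 2 + 2 / g * (c1 * IY + (2 * beta)^-1 * IM) =
      2 / g * (A * beta ^+ 2 + (c1 * IY + (2 * beta)^-1 * IM)) by ring.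
  by rewrite ler_pM2l// divr_gt0.
move=> t tT; have /andP[t0 tT'] := tT.
have a00 : 0 <= 2 / g * A * beta ^+ 2 by rewrite mulr_ge0 ?sqr_ge0// mulr_ge0// divr_ge0// ltW.
apply: (le_trans (gronwall T0' a00 iK K0 Y0 iKY HY tT)).
rewrite mulrAC ler_wpM2r ?sqr_ge0// ler_wpM2l//; first by rewrite mulr_ge0// divr_ge0// ltW.
rewrite ler_expR (itgZ _ (lexx 0) tT' iK') ler_pM2l ?divr_gt0//.
rewrite (itgD (lexx 0) tT' (intg_cst _ T0') (intgZ _ im1)) itg_cst// subr0 (itgZ _ (lexx 0) tT' im1).
apply: lerD; first by rewrite ler_wpM2l.
have h : itg m1 0 t <= k * beta by apply: le_trans km; exact: itg_sub_le.
have -> : k / 2 = (2 * beta)^-1 * (k * beta) by field; rewrite gt_eqF.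
by rewrite ler_wpM2l// invr_ge0 mulr_ge0// ltW.
Qed.

End energy_gronwall.

(** * The energy inequality for an abstract pair of spaces *)

Section energy.
Context {R : realType} {V : lmodType R} (X1 X2 : nspace V) (s1 : snormed X1) (s2 : snormed X2)
  (b a : V -> V -> R) (sb : semi_inner (dom X2) b) (sa : semi_inner (dom X1) a)
  (X12 : forall x, dom X1 x -> dom X2 x)
  (n2E : forall x, dom X2 x -> fnrm X2 x ^+ 2 = b x x)
  (n1E : forall x, dom X1 x -> fnrm X1 x ^+ 2 = b x x + a x x).
Local Notation n1 := (fnrm X1).
Local Notation n2 := (fnrm X2).
Local Notation D1 := (dom X1).
Local Notation D2 := (dom X2).

Let n10 x : 0 <= n1 x := fnrm_ge0 s1 x.
Let n20 x : 0 <= n2 x := fnrm_ge0 s2 x.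

Lemma n2_sqrt x : D2 x -> n2 x = Num.sqrt (b x x).
Proof. by move=> dx; rewrite -n2E// sqrtr_sqr ger0_norm. Qed.

Lemma b_CS x y : D2 x -> D2 y -> `|b x y| <= n2 x * n2 y.
Proof. by move=> dx dy; rewrite !n2_sqrt//; exact: (si_CS_sqrt sb). Qed.

Lemma a_le x : D1 x -> a x x <= n1 x ^+ 2.
Proof. by move=> dx; rewrite n1E// lerDr (si_ge0 sb)//; exact: X12. Qed.

Lemma b_le x : D1 x -> b x x <= n1 x ^+ 2.
Proof. by move=> dx; rewrite n1E// lerDl (si_ge0 sa). Qed.

Lemma n2_le_n1 x : D1 x -> n2 x <= n1 x.
Proof. by move=> dx; rewrite -ler_sqr ?nnegrE// (n2E (X12 dx)); exact: b_le. Qed.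

Lemma a_CS x y : D1 x -> D1 y -> `|a x y| <= n1 x * n1 y.
Proof.
move=> dx dy; apply: (le_trans (si_CS_sqrt sa dx dy)).
have K z : D1 z -> Num.sqrt (a z z) <= n1 z.
  by move=> dz; rewrite -[leRHS]ger0_norm// -sqrtr_sqr; apply: ler_wsqrtr; exact: a_le.
by apply: ler_pM; rewrite ?sqrtr_ge0 ?K.
Qed.

Lemma b_dual1 y : D2 y -> dom (dualS X1) (b y).
Proof. by apply: (si_dual sb s1) => // x; exact: b_le. Qed.

Lemma a_dual y : D1 y -> dom (dualS X1) (a y).
Proof. by apply: (si_dual sa s1) => // x; exact: a_le. Qed.

Lemma ba_CS x y : D1 x -> D1 y -> `|b x y + a x y| <= n1 x * n1 y.
Proof.
move=> dx dy; have K z : D1 z -> n1 z = Num.sqrt (b z z + a z z).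
  by move=> dz; rewrite -n1E// sqrtr_sqr ger0_norm.
by rewrite !K//; apply: (si_CS_sqrt (si_add X12 sb sa)).
Qed.

(** [eq1] holds for all v off one null set, so it may be tested with W'. [eq2] is integrated in time
    with v fixed; its [rho] stands for the pairing of v with the differences of xi and g(u). The
    lower bound on [rho] encodes monotonicity at U r and the Lipschitz bound, the term with [m]
    being the price of testing with v instead of U r. *)
Context (T : R) (T0 : 0 < T) (alpha L : R) (alpha0 : 0 <= alpha) (L0 : 0 <= L)
  (W W' U Ur : R -> V) (Lam : R -> V -> R^o) (mu m : R -> R) (lam0 : R)
  (dW : forall t : R, 0 <= t <= T -> D1 (W t))
  (sW' : smeas X1 W') (iW' : intg T (fun t => n1 (W' t) ^+ 2))
  (ftcW : forall l, dom (dualS X1) l -> forall s t : R, 0 <= s -> s <= t -> t <= T ->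
     l (W t) - l (W s) = itg (fun r => l (W' r)) s t)
  (dU : forall t : R, 0 <= t <= T -> D2 (U t))
  (unifU : forall e : R, 0 < e -> exists2 d : R, 0 < d & forall s t : R, 0 <= s <= T -> 0 <= t <= T ->
     `|s - t| < d -> n2 (U s - U t) < e)
  (sUr : smeas X1 Ur) (iUr : intg T (fun t => n1 (Ur t) ^+ 2)) (UrU : ae_time T (fun t => Ur t = U t))
  (mu0 : forall t, 0 <= mu t) (imu : intg T mu) (m0 : forall t, 0 <= m t) (im : intg T m)
  (dLam : forall t : R, 0 <= t <= T -> dom (dualS X1) (Lam t)) (lam00 : 0 <= lam0)
  (Lam0 : forall v, D1 v -> `|Lam 0 v| <= lam0 * n1 v)
  (LamB : forall s t : R, 0 <= s -> s <= t -> t <= T -> forall v, D1 v ->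
     `|Lam t v - Lam s v| <= itg mu s t * n1 v)
  (eq1 : ae_time T (fun t => forall v, D1 v ->
     b (W' t) v + alpha * a (W t) v + b (U t) v = Lam t v))
  (eq2 : forall v, D1 v -> exists rho : R -> R, [/\ intg T rho,
     forall s t : R, 0 <= s -> s <= t -> t <= T ->
       b (U t - U s) v + itg (fun r => a (Ur r) v) s t + itg rho s t = b (W t - W s) v &
     ae_time T (fun r => - (L * n2 (U r) * n2 v) - m r * n2 (v - U r) <= rho r)]).

Let T0' : 0 <= T := ltW T0.
Let dW' t : D1 (W' t). Proof. by case: sW'. Qed.
Let dUr t : D1 (Ur t). Proof. by case: sUr. Qed.

Let intg_sqrt (f : R -> V) : smeas X1 f -> intg T (fun t => n1 (f t) ^+ 2) -> intg T (fun t => n1 (f t)).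
Proof.
move=> sf i2; apply: (intg_le (k2 := fun t => 1 + n1 (f t) ^+ 2)).
- by apply: measurable_funTS; exact: smeas_measurable_fnrm.
- move=> t _; rewrite ger0_norm//.
  have := sqr_ge0 (n1 (f t) - 1); rewrite sqrrB1; have := n10 (f t); set x := n1 (f t); nra.
- by apply: intgD => //; exact: intg_cst.
Qed.

Let iW'1 : intg T (fun t => n1 (W' t)) := intg_sqrt sW' iW'.

(** [ftcW] is scalar: applying it to the functional represented by the increment W t - W s itself
    gives the squared norm, and one factor is divided out. *)
Lemma W_dist (s t : R) : 0 <= s -> s <= t -> t <= T -> n1 (W t - W s) <= itg (fun r => n1 (W' r)) s t.
Proof.
move=> s0 st tT; have ds : D1 (W s) by apply: dW; rewrite s0 (le_trans st).
have dt : D1 (W t) by apply: dW; rewrite tT (le_trans s0).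
have dz := dom_sub s1 dt ds.
pose h x := b (W t - W s) x + a (W t - W s) x.
have dh : dom (dualS X1) (h : V -> R^o).
  exact: (dom_add (snormed_dual s1) (b_dual1 (X12 dz)) (a_dual dz)).
have E : n1 (W t - W s) ^+ 2 = itg (fun r => h (W' r)) s t.
  rewrite n1E// -(ftcW dh s0 st tT) -(functB s1 dh dt ds)//.
have I : itg (fun r => h (W' r)) s t <= n1 (W t - W s) * itg (fun r => n1 (W' r)) s t.
  rewrite -(itgZ _ s0 tT iW'1); apply: (itg_le s0 tT).
  - exact: smeas_intg_funct s1 _ _ _ sW' iW'1 dh.
  - exact: intgZ.
  - by move=> r _; apply: (le_trans (ler_norm _)); exact: ba_CS.
rewrite -E expr2 in I; have [->|z0] := eqVneq (n1 (W t - W s)) 0; first by apply: itg_ge0.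
by move: I; rewrite ler_pM2l// lt_neqAle eq_sym z0 n10.
Qed.

Let i2 : intg T (fun t => n2 (W' t)).
Proof.
apply: (intg_le _ _ iW'1).
  by apply: measurable_funTS; exact: smeas_measurable_fnrm s2 _ (smeas_embed s1 s2 X12 n2_le_n1 sW').
by move=> r _; rewrite ger0_norm//; exact: n2_le_n1.
Qed.

Lemma W_dist2 (s t : R) : 0 <= s -> s <= t -> t <= T -> n2 (W t - W s) <= itg (fun r => n2 (W' r)) s t.
Proof.
move=> s0 st tT; have ds : D1 (W s) by apply: dW; rewrite s0 (le_trans st).
have dt : D1 (W t) by apply: dW; rewrite tT (le_trans s0).
have dz := X12 (dom_sub s1 dt ds); have dh := b_dual1 dz.
have E : n2 (W t - W s) ^+ 2 = itg (fun r => b (W t - W s) (W' r)) s t.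
  rewrite n2E// -(ftcW dh s0 st tT) -(functB s1 dh dt ds)//.
have I : itg (fun r => b (W t - W s) (W' r)) s t <= n2 (W t - W s) * itg (fun r => n2 (W' r)) s t.
  rewrite -(itgZ _ s0 tT i2); apply: (itg_le s0 tT).
  - exact: smeas_intg_funct s1 _ _ _ sW' iW'1 dh.
  - exact: intgZ.
  - by move=> r _; apply: (le_trans (ler_norm _)); apply: b_CS => //; exact: X12.
rewrite -E expr2 in I; have [->|z0] := eqVneq (n2 (W t - W s)) 0; first by apply: itg_ge0.
by move: I; rewrite ler_pM2l// lt_neqAle eq_sym z0 n20.
Qed.

Let unif_itg (k : R -> R) : intg T k -> (forall t, 0 <= k t) -> forall e : R, 0 < e ->
  exists2 d : R, 0 < d & forall s t : R, 0 <= s -> s <= t -> t <= T -> t - s < d -> itg k s t < e.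
Proof.
move=> ik k0 e e0; have [d d0 Hd] := heine_fun (itg_continuous T0' ik) e0.
exists d => // s t s0 st tT tsd.
have := Hd t s; rewrite tT (le_trans s0 st) s0 (le_trans st tT) => /(_ isT isT).
rewrite ger0_norm ?subr_ge0// => /(_ tsd).
rewrite (itg_split (lexx 0) s0 st tT ik) addrAC subrr add0r; apply: le_lt_trans; exact: ler_norm.
Qed.

Let cont_fnrm (X : nspace V) (f : R -> V) : snormed X -> (forall t : R, 0 <= t <= T -> dom X (f t)) ->
  (forall e : R, 0 < e -> exists2 d : R, 0 < d & forall s t : R, 0 <= s -> s <= t -> t <= T ->
     t - s < d -> fnrm X (f t - f s) < e) -> {within `[0, T], continuous (fun t => fnrm X (f t))}.
Proof.
move=> sX df H; apply: unif_within_continuous => e e0; have [d d0 Hd] := H e e0.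
exists d => // s t s0 st tT ts; apply: le_lt_trans (Hd s t s0 st tT ts).
by apply: (ler_dist_fnrm sX); apply: df; rewrite ?s0 ?tT ?(le_trans s0)// (le_trans st).
Qed.

Let unifW (e : R) : 0 < e -> exists2 d : R, 0 < d & forall s t : R, 0 <= s -> s <= t -> t <= T ->
  t - s < d -> n1 (W t - W s) < e.
Proof.
move=> e0; have [d d0 Hd] := unif_itg iW'1 (fun t => n10 _) e0.
exists d => // s t s0 st tT ts; exact: le_lt_trans (W_dist s0 st tT) (Hd s t s0 st tT ts).
Qed.

Lemma energy_n1_continuous : {within `[0, T], continuous (fun t => n1 (W t))}.
Proof. exact: cont_fnrm s1 dW unifW. Qed.

Let cW2 : {within `[0, T], continuous (fun t => n2 (W t))}.
Proof.
apply: (cont_fnrm s2) => [t tT|e e0]; first by apply: X12; exact: dW.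
have [d d0 Hd] := unifW e0; exists d => // s t s0 st tT ts.
apply: le_lt_trans (Hd s t s0 st tT ts); apply: n2_le_n1.
by apply: (dom_sub s1); apply: dW; rewrite ?s0 ?tT ?(le_trans s0)// (le_trans st).
Qed.

Lemma energy_n2_continuous : {within `[0, T], continuous (fun t => n2 (U t))}.
Proof.
apply: (cont_fnrm s2) => // e e0; have [d d0 Hd] := unifU e0.
exists d => // s t s0 st tT ts; apply: Hd; rewrite ?s0 ?tT ?(le_trans s0)// ?(le_trans st)//.
by rewrite ger0_norm ?subr_ge0.
Qed.

Let iU2 : intg T (fun t => n2 (U t) ^+ 2).
Proof. exact: (within_integrable (within_continuousM energy_n2_continuous energy_n2_continuous)). Qed.

Let imuW : intg T (fun t => mu t * n1 (W t)) := intg_cM T0 energy_n1_continuous imu.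

Lemma energy_intg_dt : intg T (fun t => n2 (W' t) ^+ 2).
Proof.
apply: (intg_le (k2 := fun t => n1 (W' t) ^+ 2)) => //.
  apply: measurable_funX; apply: measurable_funTS.
  exact: smeas_measurable_fnrm s2 _ (smeas_embed s1 s2 X12 n2_le_n1 sW').
by move=> t _; rewrite ger0_norm ?sqr_ge0// ler_sqr ?nnegrE//; exact: n2_le_n1.
Qed.

(** The term - Lam t (W t) is the boundary term of the integration by parts of Lam(W'); the
    variation of Lam in time is controlled by [mu]. *)
Definition energy (t : R) : R := alpha / 2 * a (W t) (W t) + 2^-1 * n2 (U t) ^+ 2 - Lam t (W t)
  + itg (fun r => n2 (W' r) ^+ 2) 0 t.

(** Collects the freezing errors: n1 (W') occurs once for Lam, once for U, alpha times for W, and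
    alpha times more for the quadratic increment of W. *)
Let nu (r : R) : R := (2 + 2 * alpha) * n1 (W' r) + mu r + L * n2 (U r) + m r.

Let inu : intg T nu.
Proof.
apply: intgD => //; apply: intgD; last by apply: intgZ; exact: (within_integrable energy_n2_continuous).
by apply: intgD => //; exact: intgZ.
Qed.

(* The second equation is tested with the frozen value [U t], the first one with
   the increment of [W]; freezing costs only [e * itg nu s t]. *)
Lemma energy_local (e : R) : 0 < e -> exists2 d : R, 0 < d & forall s t : R, 0 <= s -> s <= t -> t <= T ->
  t - s < d -> D1 (U t) ->
  energy t - energy s <= itg (fun r => mu r * n1 (W r)) s t + L * itg (fun r => n2 (U r) ^+ 2) s t
    - itg (fun r => a (Ur r) (U t)) s t + e * itg nu s t.
Proof.
move=> e0.
have [d1 d10 H1] := unif_itg iW'1 (fun t => n10 _) e0.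
have [d2 d20 H2] := unif_itg imu mu0 e0.
have [d3 d30 H3] := unifU e0.
exists (Num.min d1 (Num.min d2 d3)); first by rewrite !lt_min d10 d20.
move=> s t s0 st tT; rewrite !lt_min => /and3P[ts1 ts2 ts3] dUt.
have sT : 0 <= s <= T by rewrite s0 (le_trans st).
have tT' : 0 <= t <= T by rewrite tT (le_trans s0).
have [dWs dWt] := (dW sT, dW tT'); have [dUs dUt2] := (dU sT, dU tT').
have dLs := dLam sT; have sd := snormed_dual s1.
have iU1 : intg T (fun t => n2 (U t)) := within_integrable energy_n2_continuous.
(* Lam and W are frozen at s, U at t; with a fixed functional [ftcW] integrates l1(W') exactly. *)
pose l1 : V -> R^o := Lam s - alpha *: (a (W s) : V -> R^o) - (b (U t) : V -> R^o).
have dl1 : dom (dualS X1) l1.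
  apply: (dom_sub sd); last exact: b_dual1.
  by apply: (dom_sub sd dLs); apply: (dom_scale sd); exact: a_dual.
have l1E v : l1 v = Lam s v - alpha * a (W s) v - b (U t) v by [].
have il1 : intg T (fun r => l1 (W' r)) := smeas_intg_funct s1 sW' iW'1 dl1.
have I1 : itg (fun r => n2 (W' r) ^+ 2) s t <=
    l1 (W t) - l1 (W s) + e * (2 + alpha) * itg (fun r => n1 (W' r)) s t.
  rewrite (ftcW dl1 s0 st tT) -(itgZ _ s0 tT iW'1) -(itgD s0 tT il1 (intgZ _ iW'1)).
  apply: (itg_ae_le_on s0 tT energy_intg_dt (intgD il1 (intgZ _ iW'1))).
  apply: ae_timeS eq1 => r rT EQ /andP[sr rt].
  have rT' : 0 <= r <= T by case/andP: rT => ? ?; rewrite !ltW.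
  have [s_r r_t] := (ltW sr, ltW rt); have r_T : r <= T by case/andP: rT'.
  have rs1 : r - s < d1 by lra.
  have rs2 : r - s < d2 by lra.
  have dWr := dW rT'; have dx := dW' r; have dx2 := X12 dx; have dUr2 := dU rT'.
  have n1x := n10 (W' r).
  have := EQ _ dx; rewrite -(n2E dx2) => E.
  have h1 := LamB s0 s_r r_T dx.
  have h1' : Lam r (W' r) - Lam s (W' r) <= e * n1 (W' r).
    apply: (le_trans (ler_norm _)); apply: (le_trans h1); rewrite ler_wpM2r//; apply: ltW; exact: H2.
  have h2 : a (W s) (W' r) - a (W r) (W' r) <= e * n1 (W' r).
    rewrite -opprB -(si_Bl sa dWr dWs dx).
    apply: (le_trans (ler_norm _)); rewrite normrN; apply: (le_trans (a_CS (dom_sub s1 dWr dWs) dx)).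
    rewrite ler_wpM2r//; apply: (le_trans (W_dist s0 s_r r_T)); apply: ltW; exact: H1.
  have h3 : b (U t) (W' r) - b (U r) (W' r) <= e * n1 (W' r).
    rewrite -(si_Bl sb dUt2 dUr2 dx2).
    apply: (le_trans (ler_norm _)); apply: (le_trans (b_CS (dom_sub s2 dUt2 dUr2) dx2)).
    apply: ler_pM => //; last exact: n2_le_n1.
    by apply: ltW; apply: H3 => //; rewrite ger0_norm; lra.
  have h2' := ler_wpM2l alpha0 h2; rewrite mulrBr in h2'.
  rewrite l1E (_ : e * (2 + alpha) * n1 (W' r) = 2 * (e * n1 (W' r)) + alpha * (e * n1 (W' r))); last by ring.
  have key (q y1 y2 z1 z2 x1 x2 p u : R) : q + y2 + z2 = x1 -> x1 - x2 <= p -> y1 - y2 <= u ->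
    z1 - z2 <= p -> q <= x2 - y1 - z1 + (2 * p + u) by lra.
  exact: key E h1' h2' h3.
have I3 : b (U t - U s) (U t) - b (W t - W s) (U t) <= L * itg (fun r => n2 (U r) ^+ 2) s t
    - itg (fun r => a (Ur r) (U t)) s t + e * (L * itg (fun r => n2 (U r)) s t + itg m s t).
  have [rho [irho E F]] := eq2 dUt; have := E s t s0 st tT.
  have iF : intg T (fun r => - (L * n2 (U r) ^+ 2 + e * (L * n2 (U r) + m r))).
    have := intgZ (-1) (intgD (intgZ L iU2) (intgZ e (intgD (intgZ L iU1) im))).
    by congr intg; apply/funext => r; rewrite mulN1r.
  have : itg (fun r => - (L * n2 (U r) ^+ 2 + e * (L * n2 (U r) + m r))) s t <= itg rho s t.
    apply: (itg_ae_le_on s0 tT iF irho); apply: ae_timeS F => r rT Fr /andP[sr rt].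
    apply: le_trans Fr; rewrite -opprD lerN2.
    have rT' : 0 <= r <= T by case/andP: rT => ? ?; rewrite !ltW.
    have dUr2 := dU rT'.
    have u1 : n2 (U t - U r) <= e by apply: ltW; apply: H3 => //; rewrite ger0_norm; lra.
    have u2 : n2 (U t) <= n2 (U r) + e.
      have := fnrmD s2 (dom_sub s2 dUt2 dUr2) dUr2; rewrite subrK; lra.
    have v1 : L * n2 (U r) * n2 (U t) <= L * n2 (U r) * (n2 (U r) + e) by rewrite ler_wpM2l ?mulr_ge0.
    have v2 : m r * n2 (U t - U r) <= m r * e by rewrite ler_wpM2l.
    apply: (le_trans (lerD v1 v2)); rewrite le_eqVlt; apply/orP; left; apply/eqP; ring.
  have -> : itg (fun r => - (L * n2 (U r) ^+ 2 + e * (L * n2 (U r) + m r))) s t =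
    - (L * itg (fun r => n2 (U r) ^+ 2) s t + e * (L * itg (fun r => n2 (U r)) s t + itg m s t)).
    rewrite -(itgZ L s0 tT iU1) -(itgD s0 tT (intgZ L iU1) im) -(itgZ e s0 tT (intgD (intgZ L iU1) im)).
    rewrite -(itgZ L s0 tT iU2) -(itgD s0 tT (intgZ L iU2) (intgZ e (intgD (intgZ L iU1) im))).
    rewrite -mulN1r -(itgZ (-1) s0 tT (intgD (intgZ L iU2) (intgZ e (intgD (intgZ L iU1) im)))).
    by congr itg; apply/funext => r; rewrite mulN1r.
  have key (B1 A1 R1 B2 P Q : R) : - (P + Q) <= R1 -> B1 + A1 + R1 = B2 -> B1 - B2 <= P - A1 + Q by lra.
  exact: key.
(* Convexity of the square takes the place of the chain rule for |U|^2; testing with the later value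
   U t gives the inequality the right sign. *)
have I4 : 2^-1 * n2 (U t) ^+ 2 - 2^-1 * n2 (U s) ^+ 2 <= b (U t - U s) (U t).
  have := si_ge0 sb (dom_sub s2 dUt2 dUs); rewrite (si_sqB sb dUt2 dUs).
  by rewrite (si_Bl sb dUt2 dUs dUt2) (si_sym sb dUs dUt2) !n2E//; lra.
(* With W frozen at s, the increment of a(W, W) / 2 is recovered up to this quadratic term, which is
   e times an integral. *)
have DN2 : a (W t - W s) (W t - W s) <= e * itg (fun r => n1 (W' r)) s t.
  apply: (le_trans (a_le (dom_sub s1 dWt dWs))); rewrite expr2.
  have h := W_dist s0 st tT; apply: ler_pM => //.
  by apply: (le_trans h); apply: ltW; exact: H1.
have LtW := LamB s0 st tT dWt.
(* The increment of Lam is paired with W t; moving to W r under the integral costs e because W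
   oscillates little. *)
have I5 : itg mu s t * n1 (W t) <= itg (fun r => mu r * n1 (W r)) s t + e * itg mu s t.
  rewrite mulrC -(itgZ (n1 (W t)) s0 tT imu) -(itgZ e s0 tT imu) -(itgD s0 tT imuW (intgZ e imu)).
  apply: (itg_le s0 tT (intgZ _ imu) (intgD imuW (intgZ e imu))) => r /andP[sr rt].
  rewrite mulrC (mulrC e) -mulrDr ler_wpM2l//.
  have [r_t r0] : r <= t /\ 0 <= r by split; lra.
  have rT' : 0 <= r <= T by apply/andP; split; lra.
  have := W_dist r0 r_t tT; have tr : t - r < d1 by lra.
  have := H1 r t r0 r_t tT tr.
  have := fnrmD s1 (dom_sub s1 dWt (dW rT')) (dW rT'); rewrite subrK; lra.
have nuE : e * itg nu s t = e * (2 + alpha) * itg (fun r => n1 (W' r)) s t + alpha * (e * itg (fun r => n1 (W' r)) s t)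
    + e * itg mu s t + e * (L * itg (fun r => n2 (U r)) s t + itg m s t).
  rewrite /nu (itgD s0 tT _ im); last first.
    by apply: intgD; [apply: intgD => //; exact: intgZ|exact: intgZ].
  rewrite (itgD s0 tT _ (intgZ L iU1)); last by apply: intgD => //; exact: intgZ.
  rewrite (itgD s0 tT (intgZ _ iW'1) imu) (itgZ _ s0 tT iW'1) (itgZ _ s0 tT iU1); ring.
have DN3 := ler_wpM2l alpha0 DN2; rewrite (si_sqB sa dWt dWs) in DN3.
have itW : itg (fun r => n2 (W' r) ^+ 2) 0 t - itg (fun r => n2 (W' r) ^+ 2) 0 s = itg (fun r => n2 (W' r) ^+ 2) s t.
  by rewrite (itg_split (lexx 0) s0 st tT energy_intg_dt); ring.
have LtW' : Lam s (W t) - Lam t (W t) <= itg mu s t * n1 (W t).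
  by rewrite -opprB; apply: (le_trans (ler_norm _)); rewrite normrN.
rewrite !l1E in I1; rewrite (si_Bl sb (X12 dWt) (X12 dWs) dUt2) in I3.
rewrite (si_sym sb (X12 dWt) dUt2) (si_sym sb (X12 dWs) dUt2) in I3; rewrite (si_sym sa dWt dWs) in DN3.
rewrite nuE /energy.
have eN0 : 0 <= e * itg (fun r => n1 (W' r)) s t by apply: mulr_ge0; [exact: ltW|exact: itg_ge0].
have aeN0 : 0 <= alpha * (e * itg (fun r => n1 (W' r)) s t) by rewrite mulr_ge0.
have key (I2 Lst Lss Ltt aTT aSS aST bTT bTS N bUU LU A E2 uT uS MM MW eM J2t J2s : R) :
    I2 <= Lst - alpha * aST - bTT - (Lss - alpha * aSS - bTS) + e * (2 + alpha) * N ->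
    bUU - (bTT - bTS) <= LU - A + E2 -> uT - uS <= bUU -> MM <= MW + eM ->
    alpha * (aTT - 2 * aST + aSS) <= alpha * (e * N) -> J2t - J2s = I2 -> Lst - Ltt <= MM ->
    0 <= alpha * (e * N) ->
    alpha / 2 * aTT + uT - Ltt + J2t - (alpha / 2 * aSS + uS - Lss + J2s) <=
    MW + LU - A + (e * (2 + alpha) * N + alpha * (e * N) + eM + E2).
  have -> : alpha * (aTT - 2 * aST + aSS) = alpha * aTT - 2 * (alpha * aST) + alpha * aSS by ring.
  have -> : alpha / 2 * aTT = alpha * aTT / 2 by ring.
  have -> : alpha / 2 * aSS = alpha * aSS / 2 by ring.
  move: (alpha * aST) (alpha * aSS) (alpha * aTT) (alpha * (e * N)) (e * (2 + alpha) * N) => x1 x2 x3 x4 x5 h1 h2 h3 h4 h5 h6 h7 h8; lra.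
exact: key I1 I3 I4 I5 DN3 itW LtW' aeN0.
Qed.


Lemma energy_intg_grad : intg T (fun t => a (Ur t) (Ur t)).
Proof.
apply: (intg_le (k2 := fun t => n1 (Ur t) ^+ 2)) => //; last first.
  by move=> t _; rewrite ger0_norm ?(si_ge0 sa)//; exact: a_le.
(* Measurability of the gradient term comes from that of the two norms. *)
have -> : (fun t => a (Ur t) (Ur t)) = (fun t => n1 (Ur t) ^+ 2 - n2 (Ur t) ^+ 2).
  by apply/funext => t; rewrite n1E// (n2E (X12 (dUr t))) addrC addKr.
apply: measurable_funTS; apply: measurable_funB; apply: measurable_funX.
  exact: smeas_measurable_fnrm.
exact: smeas_measurable_fnrm s2 _ (smeas_embed s1 s2 X12 n2_le_n1 sUr).
Qed.

Lemma energy_continuous : {within `[0, T], continuous energy}.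
Proof.
pose CL := lam0 + itg mu 0 T; have CL0 : 0 <= CL by rewrite addr_ge0// itg_ge0.
have LamC (s : R) v : 0 <= s <= T -> D1 v -> `|Lam s v| <= CL * n1 v.
  move=> /andP[s0 sT] dv; have h1 := LamB (lexx 0) s0 sT dv; have h2 := Lam0 dv.
  have -> : Lam s v = (Lam s v - Lam 0 v) + Lam 0 v by rewrite subrK.
  apply: (le_trans (ler_normD _ _)); rewrite /CL mulrDl addrC lerD//.
  apply: (le_trans h1); rewrite ler_wpM2r//; exact: itg_sub_le.
pose CW := n1 (W 0) + itg (fun r => n1 (W' r)) 0 T.
have CW0 : 0 <= CW by rewrite addr_ge0// itg_ge0.
have WC (t : R) : 0 <= t <= T -> n1 (W t) <= CW.
  move=> tT; have /andP[t0 tT'] := tT; have d0 : D1 (W 0) by apply: dW; rewrite lexx.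
  have := fnrmD s1 (dom_sub s1 (dW tT) d0) d0; rewrite subrK => h.
  apply: (le_trans h); rewrite addrC lerD2l; apply: (le_trans (W_dist (lexx 0) t0 tT')).
  exact: itg_sub_le.
have cLW : {within `[0, T], continuous (fun t : R => Lam t (W t) : R)}.
  apply: unif_within_continuous => e e0.
  have e1 : 0 < e / 2 / (CW + 1) by rewrite divr_gt0 ?divr_gt0// ltr_pwDr.
  have e2 : 0 < e / 2 / (CL + 1) by rewrite divr_gt0 ?divr_gt0// ltr_pwDr.
  have [d1 d10 H1] := unif_itg imu mu0 e1.
  have [d2 d20 H2] := unifW e2.
  exists (Num.min d1 d2); first by rewrite lt_min d10.
  move=> s t s0 st tT; rewrite lt_min => /andP[ts1 ts2].
  have sT : 0 <= s <= T by rewrite s0 (le_trans st).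
  have tT' : 0 <= t <= T by rewrite tT (le_trans s0).
  have -> : Lam t (W t) - Lam s (W s) = (Lam t (W t) - Lam s (W t)) + Lam s (W t - W s).
    by rewrite (functB s1 (dLam sT) (dW tT') (dW sT)) addrA subrK.
  apply: (le_lt_trans (ler_normD _ _)).
  have h1 : `|Lam t (W t) - Lam s (W t)| <= e / 2 / (CW + 1) * CW.
    apply: (le_trans (LamB s0 st tT (dW tT'))); apply: ler_pM => //; first exact: itg_ge0.
      by apply: ltW; exact: H1.
    exact: WC.
  have h2 : `|Lam s (W t - W s)| <= CL * (e / 2 / (CL + 1)).
    apply: (le_trans (LamC _ _ sT (dom_sub s1 (dW tT') (dW sT)))); rewrite ler_wpM2l//.
    by apply: ltW; exact: H2.
  have h3 : e / 2 / (CW + 1) * CW < e / 2.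
    by rewrite mulrAC ltr_pdivrMr ?ltr_pwDr// ltr_pM2l ?ltrDl// divr_gt0.
  have h4 : CL * (e / 2 / (CL + 1)) < e / 2.
    by rewrite mulrC mulrAC ltr_pdivrMr ?ltr_pwDr// ltr_pM2l ?ltrDl// divr_gt0.
  lra.
have caW : {within `[0, T], continuous (fun t : R => a (W t) (W t))}.
  have c12 : {within `[0, T], continuous (fun t : R => n1 (W t) * n1 (W t) - n2 (W t) * n2 (W t))}.
    exact: within_continuousB (within_continuousM energy_n1_continuous energy_n1_continuous) (within_continuousM cW2 cW2).
  move: c12; apply: subspace_eq_continuous => t /set_mem; rewrite /= in_itv/= => tT.
  rewrite /from_subspace -!expr2 n1E ?(n2E (X12 (dW tT))); last exact: dW.
  by rewrite addrC addKr.
have energy_n2_continuous' := within_continuousM energy_n2_continuous energy_n2_continuous.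
have H := within_continuousD (within_continuousB (within_continuousD (@within_continuousZ _ _ (alpha / 2) _ caW)
  (@within_continuousZ _ _ (2^-1) _ energy_n2_continuous')) cLW) (itg_continuous T0' energy_intg_dt).
exact: H.
Qed.

Lemma energy_le (t : R) : 0 <= t <= T ->
  energy t + 2^-1 * itg (fun r => a (Ur r) (Ur r)) 0 t <=
  energy 0 + itg (fun r => mu r * n1 (W r)) 0 t + L * itg (fun r => n2 (U r) ^+ 2) 0 t.
Proof.
move=> tT.
pose aU r := a (Ur r) (Ur r); pose mW r := mu r * n1 (W r); pose U2 r := n2 (U r) ^+ 2.
pose D (t : R) := energy t + 2^-1 * itg aU 0 t - itg mW 0 t - L * itg U2 0 t.
have cD : {within `[0, T], continuous D}.
  have H := within_continuousB (within_continuousB (within_continuousD energy_continuous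
    (@within_continuousZ _ _ (2^-1) _ (itg_continuous T0' energy_intg_grad))) (itg_continuous T0' imuW))
    (@within_continuousZ _ _ L _ (itg_continuous T0' iU2)).
  exact: H.
have nu_ge0 r : 0 <= nu r.
  by rewrite /nu !addr_ge0 ?mulr_ge0// addr_ge0// mulr_ge0.
have nu_mono (s r : R) : 0 <= s -> s <= r -> r <= T -> itg nu 0 s <= itg nu 0 r.
  by move=> s0 sr rT; rewrite (itg_split (lexx 0) s0 sr rT inu) lerDl; exact: itg_ge0.
have := @averaging R T D (itg nu 0) T0 cD (itg_continuous T0' inu) nu_mono.
suff H : forall e : R, 0 < e -> exists (k : R -> R) (p : nat -> R -> R) (C : R),
    [/\ intg T k, (forall t, 0 <= k t), itg k 0 T <= e,
        (forall n, measurable_fun (`]0, T[ : set (measurableTypeR R)) (p n)) /\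
        (forall n (t : R), 0 <= p n t <= C) /\
        ae_time T (fun t => p n t @[n --> \oo] --> 0) &
        \forall n \near \oo, ae_time T (fun t => let h := n.+1%:R^-1 in h < t ->
          D t - D (t - h) <= e * (itg nu 0 t - itg nu 0 (t - h)) + itg k (t - h) t + h * (k t + p n t))].
  move=> /(_ H t tT); rewrite /D !itgxx !mulr0 subr0 subr0 addr0 -/aU -/mW -/U2; lra.
move=> e e0; have e20 : 0 < e / 2 by rewrite divr_gt0.
have [S [sS iS eS]] := step_approx s1 T0 sUr iUr e20.
have [p [C [mp pC cp Hp]]] := step_translation s1 T0' sS.
pose q r := n1 (Ur r - step_fun S r) ^+ 2.
have q0 r : 0 <= q r by exact: sqr_ge0.
(* Ur r - Ur t is split through the step function into three parts; (x + y + z)^2 <= 3 (x^2 + y^2 +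
   z^2) and the factor 1/2 give 3/2. Approximation within e / 2 leaves the integral below e. *)
exists (fun r => 3 / 2 * q r), (fun n r => 3 / 2 * p n r), (3 / 2 * C); split.
- exact: intgZ.
- by move=> r; rewrite mulr_ge0// divr_ge0.
- by rewrite (itgZ _ (lexx 0) (lexx T) iS); move: eS; rewrite -/q; lra.
- split; last split.
  + by move=> n; apply: measurable_funM.
  + by move=> n r; have := pC n r; lra.
  + apply: ae_timeS cp => r _ c; rewrite -[X in _ --> X](mulr0 (3 / 2)); exact: cvgMr.
have [d d0 Hd] := energy_local e0.
have : \forall n \near \oo, (n.+1%:R^-1 : R) < d by exact: near_infty_natSinv_lt (PosNum d0).
apply: filterS => n nd; apply: ae_timeS UrU => {tT}t /andP[t0 tT] UrUt; set h := n.+1%:R^-1; move=> ht.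
have h0 : 0 < h by rewrite /h invr_gt0 ltr0n.
have [s sE] : exists s : R, s = t - h by eexists.
have s0 : 0 <= s by rewrite sE; lra.
have st : s <= t by rewrite sE; lra.
have ts : t - s = h by rewrite sE; ring.
have tT' := ltW tT.
have dUt : D1 (U t) by rewrite -UrUt.
have := Hd s t s0 st tT'; rewrite ts => /(_ nd dUt) El; rewrite -sE.
have [iSt St] : intg T (fun r => n1 (step_fun S r - step_fun S t) ^+ 2) /\
    itg (fun r => n1 (step_fun S r - step_fun S t) ^+ 2) s t <= h * p n t.
  by rewrite sE; apply: Hp; rewrite ltW.
have dS r : D1 (step_fun S r) := dom_step_fun s1 r sS.
have iaUt : intg T (fun r => a (Ur r) (U t)).
  have := smeas_intg_funct s1 sUr (intg_sqrt sUr iUr) (a_dual dUt).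
  by congr intg; apply/funext => r; rewrite (si_sym sa dUt).
have key : 2^-1 * itg aU s t - itg (fun r => a (Ur r) (U t)) s t <=
    itg (fun r => 3 / 2 * q r) s t + h * (3 / 2 * q t + 3 / 2 * p n t).
  pose k2 r := 3 / 2 * q r + 3 / 2 * n1 (step_fun S r - step_fun S t) ^+ 2 + 3 / 2 * q t.
  have ik2' : intg T (fun r => 3 / 2 * q r + 3 / 2 * n1 (step_fun S r - step_fun S t) ^+ 2).
    by apply: intgD; exact: intgZ.
  have ik2 : intg T k2 by apply: intgD => //; exact: intg_cst.
  have ik1 : intg T (fun r => 2^-1 * aU r - a (Ur r) (U t)) := intgB (intgZ _ energy_intg_grad) iaUt.
  apply: (@le_trans _ _ (itg k2 s t)).
    rewrite -(itgZ _ s0 tT' energy_intg_grad) -(itgB s0 tT' (intgZ _ energy_intg_grad) iaUt).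
    apply: (itg_le s0 tT' ik1 ik2) => r _.
    have dz := dom_sub s1 (dUr r) (dUr t).
    (* Expand a(x - y, x - y) and drop a(U t, U t) / 2. *)
    have h1 : 2^-1 * aU r - a (Ur r) (U t) <= 2^-1 * n1 (Ur r - Ur t) ^+ 2.
      have := a_le dz; rewrite (si_sqB sa (dUr r) (dUr t)) -UrUt /aU.
      have := si_ge0 sa (dUr t); lra.
    have h2 : n1 (Ur r - Ur t) <= n1 (Ur r - step_fun S r) + n1 (step_fun S r - step_fun S t) + n1 (Ur t - step_fun S t).
      have -> : Ur r - Ur t = (Ur r - step_fun S r) + (step_fun S r - step_fun S t) - (Ur t - step_fun S t).
        by rewrite opprB subrKA subrKA.
      apply: (le_trans (fnrmB s1 _ _)) => //.
      - by apply: (dom_add s1); exact: (dom_sub s1).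
      - exact: (dom_sub s1).
      by rewrite lerD2r; apply: (fnrmD s1); exact: (dom_sub s1).
    have key (x y z w : R) : 0 <= w -> w <= x + y + z ->
        2^-1 * w ^+ 2 <= 3 / 2 * x ^+ 2 + 3 / 2 * y ^+ 2 + 3 / 2 * z ^+ 2.
      move=> w0 wxyz; have : w ^+ 2 <= (x + y + z) ^+ 2 by rewrite ler_sqr ?nnegrE// (le_trans w0).
      have := sqr_ge0 (x - y); have := sqr_ge0 (y - z); have := sqr_ge0 (x - z); nra.
    exact: le_trans h1 (key _ _ _ _ (n10 _) h2).
  rewrite (itgD s0 tT' ik2' (intg_cst _ T0')) (itgD s0 tT' (intgZ _ iS) (intgZ _ iSt)).
  rewrite itg_cst// ts (itgZ _ s0 tT' iSt).
  move: St; set y := itg (fun r => n1 _ ^+ 2) s t => St.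
  rewrite -addrA lerD2l; move: St; nra.
have spl (k : R -> R) : intg T k -> itg k 0 t - itg k 0 s = itg k s t.
  by move=> ik; rewrite (itg_split (lexx 0) s0 st tT' ik); ring.
have key3 (Et Es At As Mt Ms Ut Us Bx K N0 : R) :
    Et - Es <= (Mt - Ms) + L * (Ut - Us) - Bx + e * N0 -> 2^-1 * (At - As) - Bx <= K ->
    Et + 2^-1 * At - Mt - L * Ut - (Es + 2^-1 * As - Ms - L * Us) <= e * N0 + K.
  rewrite mulrBr => k1 k2; lra.
have := key3 (energy t) (energy s) (itg aU 0 t) (itg aU 0 s) (itg mW 0 t) (itg mW 0 s)
  (itg U2 0 t) (itg U2 0 s) (itg (fun r => a (Ur r) (U t)) s t) _ (itg nu s t).
rewrite (spl _ energy_intg_grad) (spl _ imuW) (spl _ iU2) => /(_ _ El key).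
by rewrite -(spl _ inu) addrA.
Qed.


(** The energy contains only the gradient of W; this recovers the L2 part from the initial value and
    the velocity. *)
Lemma W_sq (t : R) : 0 <= t <= T -> n2 (W t) ^+ 2 <= 2 * n2 (W 0) ^+ 2 + 2 * T * itg (fun r => n2 (W' r) ^+ 2) 0 t.
Proof.
move=> tT; have /andP[t0 tT'] := tT.
have d0 : D2 (W 0) by apply: X12; apply: dW; rewrite lexx.
have := fnrmD s2 (dom_sub s2 (X12 (dW tT)) d0) d0; rewrite subrK => h.
have h1 := W_dist2 (lexx 0) t0 tT'; have h2 := itg_CS t0 tT' i2 energy_intg_dt.
have P0 : 0 <= itg (fun r => n2 (W' r) ^+ 2) 0 t by apply: itg_ge0 => r; exact: sqr_ge0.
have N0 : 0 <= itg (fun r => n2 (W' r)) 0 t by apply: itg_ge0.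
have h3 := ler_wpM2r P0 tT'.
move: h h1 h2 h3 N0; move: (n2 (W t - W 0)) (itg (fun r => n2 (W' r)) 0 t) => d N h h1 h2 h3 N0.
have h4 : n2 (W t) ^+ 2 <= (N + n2 (W 0)) ^+ 2.
  by rewrite ler_sqr ?nnegrE ?addr_ge0// (le_trans h)// lerD2r.
have h5 := sqr_ge0 (N - n2 (W 0)).
have e1 : (N + n2 (W 0)) ^+ 2 = 2 * N ^+ 2 + 2 * n2 (W 0) ^+ 2 - (N - n2 (W 0)) ^+ 2 by ring.
rewrite e1 in h4; move: h4 h2 h3 h5; rewrite -mulrA; move: (t * _) (T * _) => u v g1 g2 g3 g4; lra.
Qed.

End energy.

(** * The two problems and their difference *)

Section bochner_norm_bounds.
Context {R : realType} {V : lmodType R} (X : nspace V) (sX : snormed X) (T : R) (T0 : 0 < T).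

Lemma eq_fnrm0 x y : dom X x -> dom X y -> nrm X (x - y) = 0%E -> fnrm X x = fnrm X y.
Proof.
move=> dx dy e; have := ler_dist_fnrm sX dx dy.
by rewrite [X in _ <= X]/fnrm e /= normr_le0 subr_eq0 => /eqP.
Qed.

Lemma intg_ae_le (k1 k2 : R -> R) : measurable_fun (`]0, T[ : set (measurableTypeR R)) k1 ->
  ae_time T (fun t => `|k1 t| <= k2 t) -> intg T k2 -> intg T k1.
Proof.
move=> m1 k12 i2; have mT : measurable (`]0, T[%classic : set (measurableTypeR R)) by exact: measurable_itv.
apply/integrableP; split; first exact: measurable_EFin_comp.
have /integrableP[m2 lt2] := i2; apply: le_lt_trans lt2.
apply: ae_ge0_le_integral => //.
- by apply: measurableT_comp => //; exact: measurable_EFin_comp.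
- exact: measurableT_comp.
- apply: (@filterS _ (almost_everywhere leb1) _ _ _ _ k12) => t + /=.
  rewrite in_itv/= => H /H h; rewrite lee_fin; apply: (le_trans h); exact: ler_norm.
Qed.

Lemma LpT2_intg (f f' : R -> V) : smeas X f' -> ae_time T (fun t => f' t = f t) ->
  dom (LpT T X 2%:E) f -> intg T (fun t => fnrm X (f' t) ^+ 2).
Proof.
move=> sf ff' [_ _ nf]; have := LpT_intg sX (ltr0n _ 2) sf ff' nf.
by congr intg; apply/funext => t; rewrite powR_mulrn// (fnrm_ge0 sX).
Qed.

Lemma LpT1_intg (f f' : R -> V) : smeas X f' -> ae_time T (fun t => f' t = f t) ->
  dom (LpT T X 1%E) f -> intg T (fun t => fnrm X (f' t)).
Proof.
move=> sf ff' [_ _ nf]; have := LpT_intg sX ltr01 sf ff' nf.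
by congr intg; apply/funext => t; rewrite powRr1// (fnrm_ge0 sX).
Qed.

Lemma LpT2_nrm (f f' : R -> V) : smeas X f' -> ae_time T (fun t => f' t = f t) ->
  intg T (fun t => fnrm X (f' t) ^+ 2) ->
  nrm (LpT T X 2%:E) f = (Num.sqrt (itg (fun t => fnrm X (f' t) ^+ 2) 0 T))%:E.
Proof.
move=> sf ff' i2; rewrite (LpT_nrm sX (ltr0n _ 2) sf ff').
have -> : (fun t => (fnrm X (f' t) `^ 2)%:E) = (EFin \o (fun t => fnrm X (f' t) ^+ 2)).
  by apply/funext => t; rewrite /= powR_mulrn// (fnrm_ge0 sX).
rewrite -[RHS]/(sqrte (itg (fun t => fnrm X (f' t) ^+ 2) 0 T)%:E) -poweR12_sqrt; last first.
  by rewrite lee_fin itg_ge0// => t; exact: sqr_ge0.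
rewrite /itg /Rintegral fineK//; apply: integrable_fin_num => //; exact: measurable_itv.
Qed.

Lemma LpT2_le (f f' : R -> V) (K : R) : smeas X f' -> ae_time T (fun t => f' t = f t) ->
  intg T (fun t => fnrm X (f' t) ^+ 2) -> 0 <= K -> itg (fun t => fnrm X (f' t) ^+ 2) 0 T <= K ^+ 2 ->
  (nrm (LpT T X 2%:E) f <= K%:E)%E.
Proof.
move=> sf ff' i2 K0 iK; rewrite (LpT2_nrm sf ff' i2) lee_fin.
by rewrite -[leRHS](ger0_norm K0) -sqrtr_sqr; exact: ler_wsqrtr.
Qed.

Lemma LpToo_le (f : R -> V) (K : R) : 0 <= K ->
  ae_time T (fun t => (nrm X (f t) <= K%:E)%E) -> (nrm (LpT T X +oo%E) f <= K%:E)%E.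
Proof.
move=> K0 fK; rewrite /= unlock /=.
case: ifPn => [_|_]; last by rewrite lee_fin.
apply: ereal_inf_lbound; rewrite /=; apply: (@filterS _ (almost_everywhere leb1) _ _ _ _ fK) => t H.
rewrite /= patchE; case: ifPn => [|_]; last by rewrite [point]/(0%E) abse0 lee_fin.
by rewrite inE/= in_itv/= => /H h; rewrite gee0_abs// (sn_ge0 sX).
Qed.

End bochner_norm_bounds.

(** * Everywhere defined representatives of a solution *)

Section solution_data.
Context {R : realType} (Om : set (space3 R)) (oOm : open Om) (bOm : bounded_set Om)
  (T : R) (T0 : 0 < T).
Local Notation V := (space3 R -> R^o).
Local Notation V' := (V -> R^o).
Local Notation D1 := (dom (H1 Om)).
Local Notation D2 := (dom (L2 Om)).
Local Notation n1 := (fnrm (H1 Om)).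
Local Notation n2 := (fnrm (L2 Om)).
Local Notation b := (ip Om).
Local Notation a := (ip_grad Om).
Let s1 : snormed (H1 Om) := sH1 oOm bOm.
Let s2 : snormed (L2 Om) := sL2 oOm.
Let s1' : snormed (H1' Om) := snormed_dual s1.

(** [wc] is the continuous representative of w; [wt] and [ur] represent w_t and u as H1-valued
    functions; [pc] is the continuous representative of w_t in the dual, needed for its initial
    value; [wtt] and [ut] act on test vectors; [m] dominates the norm of xi in time. *)
Record solution_data (alpha beta : R) (gamma : set (R * R)) (g : R -> R) (f : R -> V')
  (w0 v0 u0 : V) (w u : R -> V) (xi : space3 R * measurableTypeR R -> R^o)
  (wc wt ur : R -> V) (pc wtt ut : R -> V') (m : R -> R) : Prop := SolutionData {
  sd_wc : forall t, D1 (wc t) ;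
  sd_w0 : n1 (wc 0 - w0) = 0 ;
  sd_w : ae_time T (fun t => D1 (w t) /\ n1 (wc t - w t) = 0) ;
  sd_wt : smeas (H1 Om) wt ;
  sd_intg_wt : intg T (fun t => n1 (wt t) ^+ 2) ;
  sd_wtE : ae_time T (fun t => wt t = tderiv T (H1 Om) w t) ;
  sd_ftc : forall l, dom (H1' Om) l -> forall s t : R, 0 <= s -> s <= t -> t <= T ->
     l (wc t) - l (wc s) = itg (fun r => l (wt r)) s t ;
  sd_p0 : forall v, D1 v -> pc 0 v = b v0 v ;
  sd_pc : ae_time T (fun t => forall v, D1 v -> pc t v = b (wt t) v) ;
  sd_wtt : forall v, D1 v -> intg T (fun r => wtt r v) /\ forall s t : R, 0 <= s -> s <= t -> t <= T ->
     pc t v - pc s v = itg (fun r => wtt r v) s t ;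
  sd_u : C0T T (L2 Om) u ;
  sd_u0 : n2 (u 0 - u0) = 0 ;
  sd_ur : smeas (H1 Om) ur ;
  sd_intg_ur : intg T (fun t => n1 (ur t) ^+ 2) ;
  sd_urE : ae_time T (fun t => ur t = u t) ;
  sd_ut : forall v, D1 v -> intg T (fun r => ut r v) /\ forall s t : R, 0 <= s -> s <= t -> t <= T ->
     b (u t) v - b (u s) v = itg (fun r => ut r v) s t ;
  sd_m : intg T m ;
  sd_xi : ae_time T (fun t => D2 (fun x => xi (x, t)) /\ n2 (fun x => xi (x, t)) <= m t) ;
  sd_gamma : ae_time T (fun t => {ae @leb3 R, forall x, Om x -> gamma (u t x, xi (x, t))}) ;
  sd_iv : forall v, D1 v -> ae_time T (fun t =>
     wtt t v + alpha * a (wt t) v + beta * a (wc t) v + ut t v = f t v) ;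
  sd_v : forall v, D1 v -> ae_time T (fun t =>
     ut t v + a (ur t) v + b (fun x => xi (x, t)) v + b (fun x => g (u t x)) v = b (wt t) v) ;
  sd_dom_w : dom (LpT T (H1 Om) 2%:E) w ;
  sd_tderiv : dom (LpT T (H1 Om) 1%E) (tderiv T (H1 Om) w) /\ is_tderiv T (H1 Om) w (tderiv T (H1 Om) w) }.

Lemma solutionP alpha beta gamma g f w0 v0 u0 w u xi :
  dom (H1 Om) w0 -> dom (L2 Om) v0 -> dom (L2 Om) u0 ->
  solution Om T alpha beta gamma g f w0 v0 u0 w u xi ->
  exists wc wt ur pc wtt ut m,
    solution_data alpha beta gamma g f w0 v0 u0 w u xi wc wt ur pc wtt ut m.
Proof.
move=> dw0 dv0 du0 [[_ Hw Hwt] [Hu cu du] [dxi gam] [iv eqv] [[wc [cw wcw wc0]] [pc [cp pcp pc0]] u0E]].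
have T0' : 0 <= T := ltW T0; have [dw [g0 [dg0 wg0]]] := Hw.
have z0T : 0 <= (0 : R) <= T by rewrite lexx.
have [dwt twt] := tderivP (ex_intro _ g0 (conj (LpT2_LpT1 s1 T0 dg0) wg0)).
set dw_ := tderiv T (H1 Om) w in Hwt iv eqv pcp dwt twt *.
have aew : ae_time T (fun t => D1 (w t)) by case: dw.
have [wt swt wtE] := smeas_of s1 (let: And3 _ x _ := dwt in x) (let: And3 x _ _ := dwt in x).
have iwt1 := LpT1_intg s1 swt wtE dwt.
(* [tderiv] is only known to be integrable; the square-integrable derivative [g0] agrees with it
   almost everywhere and passes on its integrability. *)
have eq_g0 : ae_time T (fun t => nrm (H1 Om) (g0 t - dw_ t) = 0%E).
  apply: (tderiv_unique s1 T0 (ip := fun x y => b x y + a x y) _ _ _ aew (LpT2_LpT1 s1 T0 dg0) dwt wg0 twt).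
  - move=> y dy; exact: (dom_add s1' (ip_dualH1 oOm bOm (dH1_dL2 dy)) (ip_grad_dual oOm bOm dy)).
  - by move=> y dy; rewrite H1_fnrm_sq.
  - by move=> x y dx dy; rewrite (si_sym (si_ip oOm) (dH1_dL2 dx) (dH1_dL2 dy)) (si_sym (si_ip_grad oOm bOm) dx dy).
have [g0' sg0 g0E] := smeas_of s1 (let: And3 _ x _ := dg0 in x) (let: And3 x _ _ := dg0 in x).
have iwt2 : intg T (fun t => n1 (wt t) ^+ 2).
  apply: (intg_ae_le _ _ (LpT2_intg s1 sg0 g0E dg0)).
    by apply: measurable_funX; apply: measurable_funTS; exact: smeas_measurable_fnrm.
  apply: ae_timeS2 (ae_timeS2 (fun t _ x y => conj x y) wtE g0E) eq_g0 => t _ [e1 e2]; rewrite -e1 -e2 => e.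
  have [d1 d2] : D1 (wt t) /\ D1 (g0' t) by split; [case: swt|case: sg0].
  rewrite (eq_fnrm0 s1 d2 d1 e); have key (x : R) : `|x ^+ 2| <= x ^+ 2 by rewrite ger0_norm ?sqr_ge0.
  exact: key.
have [dpt tpt] := tderivP (let: conj _ x := Hwt in x).
set wtt_ := tderiv T (H1' Om) (fun t => emb Om (dw_ t)) in iv dpt tpt.
have [wtt swtt wttE] := smeas_of s1' (let: And3 _ x _ := dpt in x) (let: And3 x _ _ := dpt in x).
have iwtt := LpT1_intg s1' swtt wttE dpt.
have [dembu [g1 [dg1 ug1]]] := Hu.
have [dut tut] := tderivP (ex_intro _ g1 (conj (LpT2_LpT1 s1' T0 dg1) ug1)).
set ut_ := tderiv T (H1' Om) (fun t => emb Om (u t)) in iv eqv dut tut.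
have [ut sut utE] := smeas_of s1' (let: And3 _ x _ := dut in x) (let: And3 x _ _ := dut in x).
have iut := LpT1_intg s1' sut utE dut.
have [ur sur urE] := smeas_of s1 (let: And3 _ x _ := du in x) (let: And3 x _ _ := du in x).
have [m [im Hm]] := L2Q_section (open_measurable_space3 oOm) T0' dxi.
have clE t : 0 <= t <= T -> clamp T t = t := @clampE R T t.
have dwc t : D1 (wc (clamp T t)) by have [] := cw _ (clamp_itv t T0').
(* Composition with [clamp] puts [wc] in H1 at all real times without altering it on [0, T]. *)
exists (wc \o clamp T), wt, ur, pc, wtt, ut, m.
have aedwt : ae_time T (fun t => D1 (dw_ t)) by case: dwt.
have wcE : ae_time T (fun t => D1 (w t) /\ n1 (wc (clamp T t) - w t) = 0).
  apply: ae_timeS2 aew wcw => t /andP[t0 tT] d e; split => //; rewrite clE ?ltW//; by rewrite /fnrm e.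
split; [by []| |by []|by []|by []|by []| | | | |by []| |by []| |by []| |by []|by []| | | |by []|by []].
- by rewrite /= clE// /fnrm wc0.
- move=> l dl s t s0 st tT; rewrite /= !clE ?s0 ?tT ?(le_trans s0)// ?(le_trans st)//.
  apply: (tderiv_integral s1 T0 twt cw aew wcw swt wtE iwt1 dl) => //.
- move=> v dv; have [dp _] := cp 0 z0T.
  have := funct_eq_fnrm0 s1' (eval_dual s1 dv) dp (ip_dualH1 oOm bOm dv0) pc0; exact.
- apply: ae_timeS2 (ae_timeS2 (fun t _ x y => conj x y) wtE aedwt) pcp => t /andP[t0 tT] [e d] p v dv.
  have tT2 : 0 <= t <= T by rewrite !ltW.
  have [dp _] := cp t tT2.
  have := funct_eq_fnrm0 s1' (eval_dual s1 dv) dp (ip_dualH1 oOm bOm (dH1_dL2 d)) p.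
  by rewrite e.
- move=> v dv; split; first exact: smeas_intg_funct s1' _ _ _ swtt iwtt (eval_dual s1 dv).
  move=> s t s0 st tT.
  apply: (tderiv_integral s1' T0 tpt cp _ pcp swtt wttE iwtt (eval_dual s1 dv)) => //.
  by apply: ae_timeS aedwt => r _ d; exact: (ip_dualH1 oOm bOm (dH1_dL2 d)).
- by rewrite /fnrm u0E.
- have H := LpT2_intg s1 sur urE du; exact: H.
- move=> v dv; split; first exact: smeas_intg_funct s1' _ _ _ sut iut (eval_dual s1 dv).
  move=> s_ t s0 st tT.
  (* As u is continuous into L2 and L2 embeds into the dual, the embedded u is its own continuous
     representative. *)
  have cembu : C0T T (H1' Om) (fun t => emb Om (u t)).
    move=> r rT; have [dr cr] := cu r rT; split; first exact: (ip_dualH1 oOm bOm dr).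
    have ct : n2 (u s - u r) @[s --> within `[0, T] (nbhs r)] --> (0 : R).
      by rewrite /fnrm; exact: (fine_cvg cr).
    have inT : \forall s \near within `[0, T] (nbhs r), 0 <= s <= T.
      apply: (filterS _ (withinT _ _)) => s; by rewrite /= in_itv.
    have bnd (s : R) : 0 <= s <= T -> dom (H1' Om) (emb Om (u s) - emb Om (u r)) /\
        fnrm (H1' Om) (emb Om (u s) - emb Om (u r)) <= n2 (u s - u r).
      move=> sT; have [ds _] := cu s sT.
      have dd := dom_sub s1' (ip_dualH1 oOm bOm ds) (ip_dualH1 oOm bOm dr); split => //.
      apply: (dual_fnrm_le s1 dd) => [|v1 dv1]; first exact: (fnrm_ge0 s2).
      rewrite -[X in `|X|]/(b (u s) v1 - b (u r) v1) -(si_Bl (si_ip oOm) ds dr (dH1_dL2 dv1)).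
      apply: (le_trans (ip_CS oOm (dom_sub s2 ds dr) (dH1_dL2 dv1))).
      by rewrite ler_wpM2l ?(fnrm_ge0 s2)//; exact: fnrm_L2_H1.
    have cf : fnrm (H1' Om) (emb Om (u s) - emb Om (u r)) @[s --> within `[0, T] (nbhs r)] --> (0 : R).
      apply: (@cvg_dist_le R R (within `[0, T] (nbhs r)) _ _ _ 0 _ ct).
      apply: (filterS _ inT) => s sT; rewrite subr0 ger0_norm ?(fnrm_ge0 s1')//; exact: (bnd s sT).2.
    have H : (EFin \o (fun s => fnrm (H1' Om) (emb Om (u s) - emb Om (u r)))) @ within `[0, T] (nbhs r) --> 0%E.
      exact: cvg_comp cf _.
    apply: cvg_trans H; apply: near_eq_cvg; apply: (filterS _ inT) => s sT.
    exact/esym/(nrmE s1' (bnd s sT).1).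
  have dembu' : ae_time T (fun t => dom (H1' Om) (emb Om (u t))).
    apply: ae_timeW => r /andP[r0 rT]; have rT2 : 0 <= r <= T by rewrite !ltW.
    exact: (cembu r rT2).1.
  apply: (tderiv_integral s1' T0 tut cembu dembu' _ sut utE iut (eval_dual s1 dv)) => //.
  apply: ae_timeS dembu' => r _ d; by rewrite subrr (nrmE s1' (sn_dom0 s1')) (fnrm0 s1').
- have := ae_leb4_section gam.
  apply: (@filterS _ (almost_everywhere leb1)) => t H tT.
  apply: (@filterS _ (almost_everywhere leb3) _ _ _ _ H) => x Hx Omx.
  by have [] := Hx (conj Omx _); rewrite //= in_itv.
- move=> v dv; have l := ip_grad_dual oOm bOm dv.
  apply: ae_timeS2 (ae_timeS2 (fun t _ x y => conj x y) (iv v dv) wcE) (ae_timeS2 (fun t _ x y => conj x y) wtE (ae_timeS2 (fun t _ x y => conj x y) wttE utE)).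
  move=> t tT [E [d e]] [e1 [e2 e3]].
  have e4 : a (w t) v = a (wc (clamp T t)) v.
    have sg := si_ip_grad oOm bOm.
    rewrite (si_sym sg d dv) (si_sym sg (dwc t) dv); apply/esym.
    apply: (funct_eq_fnrm0 s1 l (dwc t) d); rewrite (nrmE s1) ?e//; exact: (dom_sub s1 (dwc t) d).
  by rewrite e1 e2 e3 /= -e4.
- move=> v dv.
  apply: ae_timeS2 (ae_timeS2 (fun t _ x y => conj x y) (eqv v dv) wtE) (ae_timeS2 (fun t _ x y => conj x y) urE utE).
  by move=> t tT [E e1] [e2 e3]; rewrite e1 e2 e3.
Qed.

End solution_data.

Lemma primitive_continuous (R : realType) (T : R) (h k : R -> R) : 0 <= T -> intg T k ->
  (forall s t : R, 0 <= s -> s <= t -> t <= T -> h t - h s = itg k s t) ->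
  {within `[0, T], continuous h}.
Proof.
move=> T0 ik H; have c0 : {within `[0, T], continuous (fun=> h 0)} by move=> x; exact: cvg_cst.
have := within_continuousD c0 (itg_continuous T0 ik).
apply: subspace_eq_continuous => t /set_mem; rewrite /= in_itv/= => /andP[t0 tT].
by rewrite /from_subspace -(H 0 t (lexx 0) t0 tT) addrC subrK.
Qed.

Lemma C0T_unif (R : realType) (V : lmodType R) (X : nspace V) (T : R) (u : R -> V) : snormed X ->
  C0T T X u -> forall e : R, 0 < e -> exists2 d : R, 0 < d & forall s t : R, 0 <= s <= T -> 0 <= t <= T ->
     `|s - t| < d -> fnrm X (u s - u t) < e.
Proof.
move=> sX cu; have du t : 0 <= t <= T -> dom X (u t) by move=> tT; have [] := cu t tT.
apply: (heine (phi := fun s t => fnrm X (u s - u t))).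
  move=> x y z xT yT zT; rewrite -(subrKA (u y)).
  by apply: (fnrmD sX); apply: (dom_sub sX); exact: du.
move=> t tT e e0; have [_ ct] := cu t tT.
have {}ct : fnrm X (u s - u t) @[s --> within `[0, T] (nbhs t)] --> (0 : R).
  by rewrite /fnrm; exact: (fine_cvg ct).
have /cvgrPdist_lt/(_ e e0) := ct.
move=> [d /= d0 Hd]; exists d => // s sT sd.
have := Hd s; rewrite /= distrC in_itv/= => /(_ sd sT).
rewrite sub0r normrN ger0_norm ?(fnrm_ge0 sX)// => H; split => //.
by rewrite (fnrmBC sX (du _ tT) (du _ sT)).
Qed.

Lemma itg_ae_eq (R : realType) (T : R) (k1 k2 : R -> R) (s t : R) : 0 <= s -> t <= T -> intg T k1 -> intg T k2 ->
  ae_time T (fun x => k1 x = k2 x) -> itg k1 s t = itg k2 s t.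
Proof.
move=> s0 tT i1 i2 k12; apply/eqP; rewrite eq_le; apply/andP; split.
  by apply: (itg_ae_le s0 tT i1 i2); apply: ae_timeS k12 => x _ ->.
by apply: (itg_ae_le s0 tT i2 i1); apply: ae_timeS k12 => x _ ->.
Qed.

(** * The difference of the two solutions *)

Section difference.
Context {R : realType} (Om : set (space3 R)) (oOm : open Om) (bOm : bounded_set Om)
  (T : R) (T0 : 0 < T).
Local Notation V := (space3 R -> R^o).
Local Notation V' := (V -> R^o).
Local Notation D1 := (dom (H1 Om)).
Local Notation D2 := (dom (L2 Om)).
Local Notation n1 := (fnrm (H1 Om)).
Local Notation n2 := (fnrm (L2 Om)).
Local Notation b := (ip Om).
Local Notation a := (ip_grad Om).
Let s1 : snormed (H1 Om) := sH1 oOm bOm.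
Let s2 : snormed (L2 Om) := sL2 oOm.
Let s1' : snormed (H1' Om) := snormed_dual s1.
Let sb : semi_inner D2 b := si_ip oOm.
Let sa : semi_inner D1 a := si_ip_grad oOm bOm.
Let X12 x : D1 x -> D2 x := @dH1_dL2 R Om x.
Let n2E x : D2 x -> n2 x ^+ 2 = b x x := @L2_fnrmE R Om oOm x.
Let n1E x : D1 x -> n1 x ^+ 2 = b x x + a x x := @H1_fnrm_sq R Om oOm bOm x.
Let T0' : 0 <= T := ltW T0.
Let n10 x : 0 <= n1 x := fnrm_ge0 s1 x.
Let n20 x : 0 <= n2 x := fnrm_ge0 s2 x.

Lemma ip_ge0_ae (f h : V) : D2 f -> D2 h -> {ae @leb3 R, forall x, Om x -> 0 <= (f x : R) * h x} -> 0 <= b f h.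
Proof.
move=> df dh fh; have mOm := open_measurable_space3 oOm.
have i := L2_integrableM mOm df dh; have mi := measurable_int _ i.
have -> : b f h = fine (\int[@leb3 R]_(x in Om) `|((f x : R) * h x)%:E|)%E.
  rewrite /ip /Rintegral; congr fine; apply: ae_eq_integral => //.
    exact: measurableT_comp.
  by apply: (@filterS _ (almost_everywhere leb3) _ _ _ _ fh) => x H /H h0; rewrite gee0_abs ?lee_fin.
by rewrite fine_ge0// integral_ge0.
Qed.

(** The abstract energy inequality for the difference. In m1 only beta |w|, with w independent of
    beta, joins the source; the remainder beta |W| of beta grad w_beta is left to Gronwall's
    lemma. *)
Lemma difference_energy (alpha beta L lam0 : R) (gamma : set (R * R)) (g : R -> R) (f fB : R -> V')
  (w0 v0 u0 w0B v0B u0B : V) (w u wB uB : R -> V) (xi xiB : space3 R * measurableTypeR R -> R^o)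
  (wc wt ur wcB wtB urB : R -> V) (pc wtt ut pcB wttB utB : R -> V') (m mB : R -> R)
  (F1 : R -> V') (F2 : R -> V) :
  0 <= alpha -> 0 <= beta -> 0 <= L -> 0 <= lam0 ->
  monotone_graph gamma -> lipschitz g -> (forall x y : R, `|g x - g y| <= L * `|x - y|) ->
  D2 v0 -> D2 v0B ->
  solution_data Om T alpha 0 gamma g f w0 v0 u0 w u xi wc wt ur pc wtt ut m ->
  solution_data Om T alpha beta gamma g fB w0B v0B u0B wB uB xiB wcB wtB urB pcB wttB utB mB ->
  smeas (H1' Om) F1 -> intg T (fun t => fnrm (H1' Om) (F1 t)) ->
  smeas (L2 Om) F2 -> intg T (fun t => n2 (F2 t)) ->
  (forall v, D1 v -> ae_time T (fun t => fB t v - f t v = F1 t v + b (F2 t) v)) ->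
  let W t := wcB t - wc t in let W' t := wtB t - wt t in
  let U t := uB t - u t in let Ur t := urB t - ur t in
  let m1 t := fnrm (H1' Om) (F1 t) + n2 (F2 t) + beta * n1 (wc t) in
  (forall v, D1 v -> `|b v0B v - b v0 v + alpha * a (W 0) v + b (U 0) v| <= lam0 * n1 v) ->
  [/\ {within `[0, T], continuous (fun t => n1 (W t))} /\ {within `[0, T], continuous (fun t => n2 (U t))},
     [/\ intg T (fun t => n2 (W' t) ^+ 2), intg T (fun t => a (Ur t) (Ur t)) & intg T m1],
     forall t : R, 0 <= t <= T -> n2 (W t) ^+ 2 <= 2 * n2 (W 0) ^+ 2 + 2 * T * itg (fun r => n2 (W' r) ^+ 2) 0 t &
     exists (Lx : R -> R) (E0 : R), [/\
       E0 <= alpha / 2 * n1 (W 0) ^+ 2 + 2^-1 * n2 (U 0) ^+ 2 + lam0 * n1 (W 0),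
       forall t : R, 0 <= t <= T ->
         alpha / 2 * (n1 (W t) ^+ 2 - n2 (W t) ^+ 2) + 2^-1 * n2 (U t) ^+ 2 - Lx t
           + itg (fun r => n2 (W' r) ^+ 2) 0 t + 2^-1 * itg (fun r => a (Ur r) (Ur r)) 0 t <=
         E0 + itg (fun r => (m1 r + beta * n1 (W r)) * n1 (W r)) 0 t + L * itg (fun r => n2 (U r) ^+ 2) 0 t &
       forall t : R, 0 <= t <= T -> Lx t <= (lam0 + itg (fun r => m1 r + beta * n1 (W r)) 0 t) * n1 (W t)]].
Proof.
move=> al0 be0 L0 lam00 mg lg HL dv0 dv0B S SB sF1 iF1 sF2 iF2 HF W W' U Ur m1 Hlam.
have [z0 zT] : 0 <= (0 : R) /\ 0 <= (0 : R) <= T by rewrite !lexx.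
have dW t : D1 (W t) := dom_sub s1 (sd_wc SB t) (sd_wc S t).
have dWT (t : R) : 0 <= t <= T -> D1 (W t) by move=> _; exact: dW.
have sW' : smeas (H1 Om) W' := smeasB s1 (sd_wt SB) (sd_wt S).
have sUr : smeas (H1 Om) Ur := smeasB s1 (sd_ur SB) (sd_ur S).
have intg_sqB (p q : R -> V) : smeas (H1 Om) p -> smeas (H1 Om) q ->
    intg T (fun t => n1 (p t) ^+ 2) -> intg T (fun t => n1 (q t) ^+ 2) -> intg T (fun t => n1 (p t - q t) ^+ 2).
  move=> sp sq ip iq; have [dp dq] : (forall t, D1 (p t)) /\ (forall t, D1 (q t)) by split; [case: sp|case: sq].
  apply: (intg_le _ _ (intgD (intgZ 2 ip) (intgZ 2 iq))).
    by apply: measurable_funX; apply: measurable_funTS; exact: smeas_measurable_fnrm s1 _ (smeasB s1 sp sq).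
  move=> t _; rewrite ger0_norm ?sqr_ge0//; have := fnrmB s1 (dp t) (dq t).
  move: (n10 (p t - q t)); move: (n1 _) (n1 (p t)) (n1 (q t)) => x y z x0 xyz.
  have : x ^+ 2 <= (y + z) ^+ 2 by rewrite ler_sqr ?nnegrE// (le_trans x0).
  have := sqr_ge0 (y - z); nra.
have iW' : intg T (fun t => n1 (W' t) ^+ 2) := intg_sqB _ _ (sd_wt SB) (sd_wt S) (sd_intg_wt SB) (sd_intg_wt S).
have iUr : intg T (fun t => n1 (Ur t) ^+ 2) := intg_sqB _ _ (sd_ur SB) (sd_ur S) (sd_intg_ur SB) (sd_intg_ur S).
have intg_rt (p : R -> V) : smeas (H1 Om) p -> intg T (fun t => n1 (p t) ^+ 2) -> intg T (fun t => n1 (p t)).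
  move=> sp ip; apply: (intg_le (k2 := fun t => 1 + n1 (p t) ^+ 2)).
  - by apply: measurable_funTS; exact: smeas_measurable_fnrm.
  - move=> t _; rewrite ger0_norm//; move: (n10 (p t)); move: (n1 _) => x x0.
    have := sqr_ge0 (x - 1); nra.
  - by apply: intgD => //; exact: intg_cst.
have iW'1 := intg_rt _ sW' iW'; have iUr1 := intg_rt _ sUr iUr.
have iwtB1 := intg_rt _ (sd_wt SB) (sd_intg_wt SB).
have dwt t : D1 (wt t) by case: (sd_wt S).
have dwtB t : D1 (wtB t) by case: (sd_wt SB).
have ftc l : dom (H1' Om) l -> forall s t : R, 0 <= s -> s <= t -> t <= T ->
    l (W t) - l (W s) = itg (fun r => l (W' r)) s t.
  move=> dl s t s0 st tT.
  have i1 := smeas_intg_funct s1 (sd_wt SB) iwtB1 dl.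
  have i2 := smeas_intg_funct s1 (sd_wt S) (intg_rt _ (sd_wt S) (sd_intg_wt S)) dl.
  have -> : (fun r => l (W' r)) = (fun r => l (wtB r) - l (wt r)).
    by apply/funext => r; rewrite (functB s1 dl).
  rewrite (itgB s0 tT i1 i2) -(sd_ftc SB dl s0 st tT) -(sd_ftc S dl s0 st tT).
  rewrite (functB s1 dl (sd_wc SB t) (sd_wc S t)) (functB s1 dl (sd_wc SB s) (sd_wc S s)).
  have key (k_p k_q k_r k_s : R) : k_p - k_q - (k_r - k_s) = k_p - k_r - (k_q - k_s) by ring.
  exact: key.
have dU (t : R) : 0 <= t <= T -> D2 (U t).
  by move=> tT; apply: (dom_sub s2); [have [] := sd_u SB tT|have [] := sd_u S tT].
have unifU (e : R) : 0 < e -> exists2 d : R, 0 < d & forall s t : R, 0 <= s <= T -> 0 <= t <= T ->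
     `|s - t| < d -> n2 (U s - U t) < e.
  move=> e0; have e20 : 0 < e / 2 by rewrite divr_gt0.
  have [d1 d10 H1] := C0T_unif s2 (sd_u SB) e20; have [d2 d20 H2] := C0T_unif s2 (sd_u S) e20.
  exists (Num.min d1 d2); first by rewrite lt_min d10.
  move=> s t sT tT; rewrite lt_min => /andP[st1 st2].
  have [[ds dt] [dsB dtB]] : (D2 (u s) /\ D2 (u t)) /\ (D2 (uB s) /\ D2 (uB t)).
    by split; split; [have [] := sd_u S sT|have [] := sd_u S tT|have [] := sd_u SB sT|have [] := sd_u SB tT].
  have -> : U s - U t = (uB s - uB t) - (u s - u t) by rewrite /U opprD addrACA -opprD.
  apply: (le_lt_trans (fnrmB s2 (dom_sub s2 dsB dtB) (dom_sub s2 ds dt))).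
  by have := H1 s t sT tT st1; have := H2 s t sT tT st2; lra.
have UrU : ae_time T (fun t => Ur t = U t).
  by apply: ae_timeS2 (sd_urE SB) (sd_urE S) => t _ e1 e2; rewrite /Ur e1 e2.
have cwc : {within `[0, T], continuous (fun t => n1 (wc t))}.
  exact (energy_n1_continuous s1 sb sa X12 n1E T0 (fun t _ => sd_wc S t) (sd_wt S) (sd_intg_wt S) (sd_ftc S)).
have cW : {within `[0, T], continuous (fun t => n1 (W t))}.
  exact (energy_n1_continuous s1 sb sa X12 n1E T0 dWT sW' iW' ftc).
have iwc : intg T (fun t => n1 (wc t)) := within_integrable cwc.
have iW : intg T (fun t => n1 (W t)) := within_integrable cW.
have im1 : intg T m1 := intgD (intgD iF1 iF2) (intgZ beta iwc).
pose mu t := m1 t + beta * n1 (W t).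
have imu : intg T mu := intgD im1 (intgZ beta iW).
have m10 t : 0 <= m1 t by rewrite /m1 !addr_ge0 ?mulr_ge0// (fnrm_ge0 s1').
have mu0 t : 0 <= mu t by rewrite /mu addr_ge0// mulr_ge0.
(* The density in time of Lambda, with grad w_beta unsplit; the split w_beta = w + W is made only in
   the norm bound [Kb]. *)
pose K v r : R := F1 r v + b (F2 r) v - beta * a (wcB r) v.
have dF1 t : dom (H1' Om) (F1 t) by case: sF1.
have dF2 t : D2 (F2 t) by case: sF2.
have iK v : D1 v -> intg T (K v).
  move=> dv; have la := ip_grad_dual oOm bOm dv.
  apply: intgB; first apply: intgD.
  - exact: smeas_intg_funct s1' _ _ _ sF1 iF1 (eval_dual s1 dv).
  - have -> : (fun r => b (F2 r) v) = (fun r => b v (F2 r)) by apply/funext => r; rewrite (si_sym sb (dF2 r) (X12 dv)).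
    exact: smeas_intg_funct s2 _ _ _ sF2 iF2 (ip_dualL2 oOm (X12 dv)).
  - apply: intgZ; have -> : (fun r => a (wcB r) v) = (fun r => a v (wcB r)).
      by apply/funext => r; rewrite (si_sym sa (sd_wc SB r) dv).
    exact: (within_integrable (primitive_continuous T0' (smeas_intg_funct s1 (sd_wt SB) iwtB1 la) (sd_ftc SB la))).
have Kb v r : D1 v -> `|K v r| <= mu r * n1 v.
  move=> dv; have h1 := dual_le s1 (dF1 r) dv.
  have h2 : `|b (F2 r) v| <= n2 (F2 r) * n1 v.
    apply: (le_trans (ip_CS oOm (dF2 r) (X12 dv))); rewrite ler_wpM2l//; exact: fnrm_L2_H1.
  have h3 : `|a (wcB r) v| <= (n1 (wc r) + n1 (W r)) * n1 v.
    have h5 := fnrmD s1 (dW r) (sd_wc S r); rewrite [X in n1 X](subrK (wc r) (wcB r)) addrC in h5.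
    exact (le_trans (ip_grad_CS oOm bOm (sd_wc SB r) dv) (ler_wpM2r (n10 v) h5)).
  have h4 : `|beta * a (wcB r) v| <= beta * ((n1 (wc r) + n1 (W r)) * n1 v).
    by rewrite normrM ger0_norm// ler_wpM2l.
  rewrite /K /mu /m1; apply: (le_trans (ler_normB _ _)); apply: (le_trans (lerD (ler_normD _ _) (lexx _))).
  apply: (le_trans (lerD (lerD h1 h2) h4)); rewrite le_eqVlt; apply/orP; left; apply/eqP.
  have key (k_p k_q k_r k_s k_t k_u : R) : k_p * k_s + k_q * k_s + k_t * ((k_r + k_u) * k_s) = (k_p + k_q + k_t * k_r + k_t * k_u) * k_s by ring.
  exact: key.
have Klin c x y r : D1 x -> D1 y -> K (c *: x + y) r = c * K x r + K y r.
  move=> dx dy; rewrite /K (functP (dF1 r) c dx dy) (functP (ip_dualH1 oOm bOm (dF2 r)) c dx dy).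
  rewrite (functP (ip_grad_dual oOm bOm (sd_wc SB r)) c dx dy).
  have key (k_p k_q k_r k_s k_t k_u : R) : c * k_p + k_q + (c * k_r + k_s) - beta * (c * k_t + k_u) = c * (k_p + k_r - beta * k_t) + (k_q + k_s - beta * k_u) by ring.
  exact: key.
pose Lam t v : R^o := (b v0B v - b v0 v + alpha * a (W 0) v + b (U 0) v) + itg (K v) 0 t.
have LamB (s t : R) : 0 <= s -> s <= t -> t <= T -> forall v, D1 v -> `|Lam t v - Lam s v| <= itg mu s t * n1 v.
  move=> s0_ st tT v dv.
  have -> : Lam t v - Lam s v = itg (K v) s t.
    rewrite /Lam (itg_split z0 s0_ st tT (iK v dv)).
    have key (k_p k_q k_r : R) : k_p + (k_q + k_r) - (k_p + k_q) = k_r by ring.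
    exact: key.
  rewrite mulrC -(itgZ (n1 v) s0_ tT imu); apply: (itg_abs_le s0_ tT (iK v dv) (intgZ _ imu)).
  by apply: ae_timeW => r _; rewrite mulrC; exact: Kb.
have Lam0 v : D1 v -> `|Lam 0 v| <= lam0 * n1 v.
  by move=> dv; rewrite /Lam itgxx addr0; exact: Hlam.
have LamC (t : R) v : 0 <= t <= T -> D1 v -> `|Lam t v| <= (lam0 + itg mu 0 t) * n1 v.
  move=> /andP[t0 tT] dv; have h1 := LamB 0 t z0 t0 tT v dv; have h2 := Lam0 v dv.
  rewrite -[X in `|X|](subrK (Lam 0 v)); apply: (le_trans (ler_normD _ _)).
  by rewrite mulrDl addrC; exact: lerD.
have dLam (t : R) : 0 <= t <= T -> dom (dualS (H1 Om)) (Lam t).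
  move=> tT; have /andP[t0 tT'] := tT; split=> [c x y dx dy|].
    have -> : Lam t (c *: x + y) = (b v0B (c *: x + y) - b v0 (c *: x + y) + alpha * a (W 0) (c *: x + y) + b (U 0) (c *: x + y))
        + itg (fun r => c * K x r + K y r) 0 t.
      by congr (_ + itg _ _ _); apply/funext => r; exact: Klin.
    rewrite (itgD z0 tT' (intgZ c (iK x dx)) (iK y dy)) (itgZ c z0 tT' (iK x dx)).
    rewrite (functP (ip_dualH1 oOm bOm dv0B) c dx dy) (functP (ip_dualH1 oOm bOm dv0) c dx dy).
    rewrite (functP (ip_dualH1 oOm bOm (dU 0 zT)) c dx dy) (functP (ip_grad_dual oOm bOm (dW 0)) c dx dy).
    have key (k_p1 k_q1 k_p2 k_q2 k_p3 k_q3 k_p4 k_q4 k_p5 k_q5 : R) : c * k_p1 + k_q1 - (c * k_p2 + k_q2) + alpha * (c * k_p3 + k_q3) + (c * k_p4 + k_q4) + (c * k_p5 + k_q5)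
      = c * (k_p1 - k_p2 + alpha * k_p3 + k_p4 + k_p5) + (k_q1 - k_q2 + alpha * k_q3 + k_q4 + k_q5) by ring.
    exact: key.
  by exists (lam0 + itg mu 0 t) => x dx; rewrite (nrmE s1 dx) -EFinM lee_fin; exact: LamC.
(* Valid at every t and for every v: [pc] is continuous in the dual, so all terms are initial values
   plus integrals. *)
have eq1v v (t : R) : D1 v -> 0 <= t <= T -> pcB t v - pc t v + alpha * a (W t) v + b (U t) v = Lam t v.
  move=> dv tT; have /andP[t0 tT'] := tT; have la := ip_grad_dual oOm bOm dv.
  have [i1 /(_ 0 t z0 t0 tT') e1] := sd_wtt S dv; have [i1B /(_ 0 t z0 t0 tT') e1B] := sd_wtt SB dv.
  have [i2 /(_ 0 t z0 t0 tT') e2] := sd_ut S dv; have [i2B /(_ 0 t z0 t0 tT') e2B] := sd_ut SB dv.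
  have i3 := smeas_intg_funct s1 sW' iW'1 la.
  have := ftc _ la 0 t z0 t0 tT'; rewrite (si_sym sa dv (dW t)) (si_sym sa dv (dW 0)) => e3.
  have E : itg (K v) 0 t = itg (fun r => (wttB r v - wtt r v) + alpha * a v (W' r) + (utB r v - ut r v)) 0 t.
    apply: (itg_ae_eq z0 tT' (iK v dv) (intgD (intgD (intgB i1B i1) (intgZ alpha i3)) (intgB i2B i2))).
    apply: ae_timeS2 (ae_timeS2 (fun t _ x y => conj x y) (sd_iv S dv) (sd_iv SB dv)) (HF v dv) => r _ [h1 h2].
    rewrite -h1 -h2 /K => h3; rewrite -h3 (si_sym sa dv (dom_sub s1 (dwtB r) (dwt r))) (si_Bl sa (dwtB r) (dwt r) dv).
    move: (a (wc r) v) (a (wtB r) v) (a (wt r) v) (a (wcB r) v) (wttB r v) (wtt r v) (utB r v) (ut r v) => c1 c2 c3 c4 c5 c6 c7 c8.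
    ring.
  rewrite /Lam E (itgD z0 tT' (intgD (intgB i1B i1) (intgZ alpha i3)) (intgB i2B i2)) (itgD z0 tT' (intgB i1B i1) (intgZ alpha i3)).
  rewrite (itgB z0 tT' i1B i1) (itgB z0 tT' i2B i2) (itgZ alpha z0 tT' i3) -e1 -e1B -e2 -e2B -e3.
  rewrite (sd_p0 S dv) (sd_p0 SB dv).
  have dux s : 0 <= s <= T -> b (U s) v = b (uB s) v - b (u s) v.
    move=> sT; rewrite (si_Bl sb _ _ (X12 dv))//; [by have [] := sd_u SB sT|by have [] := sd_u S sT].
  rewrite !dux//.
  move: (pcB t v) (pc t v) (b v0B v) (b v0 v) (a (W t) v) (a (W 0) v) (b (uB t) v) (b (u t) v) (b (uB 0) v) (b (u 0) v).
  move=> c1 c2 c3 c4 c5 c6 c7 c8 c9 c10; ring.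
have eq1 : ae_time T (fun t => forall v, D1 v -> b (W' t) v + alpha * a (W t) v + b (U t) v = Lam t v).
  apply: ae_timeS2 (sd_pc S) (sd_pc SB) => t /andP[t0 tT] h1 h2 v dv.
  have tT' : 0 <= t <= T by rewrite !ltW.
  by rewrite -(eq1v v t dv tT') (h1 v dv) (h2 v dv) (si_Bl sb (X12 (dwtB t)) (X12 (dwt t)) (X12 dv)).
pose M r := `|m r| + `|mB r|.
have iM : intg T M.
  by apply: intgD; [exact: integrable_norm (sd_m S)|exact: integrable_norm (sd_m SB)].
have M0 r : 0 <= M r by rewrite addr_ge0.
have eq2 v : D1 v -> exists rho : R -> R, [/\ intg T rho,
     forall s t : R, 0 <= s -> s <= t -> t <= T ->
       b (U t - U s) v + itg (fun r => a (Ur r) v) s t + itg rho s t = b (W t - W s) v &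
     ae_time T (fun r => - (L * n2 (U r) * n2 v) - M r * n2 (v - U r) <= rho r)].
  move=> dv; have dv2 := X12 dv.
  have la := ip_grad_dual oOm bOm dv; have lb := ip_dualH1 oOm bOm dv2.
  have [i2 e2] := sd_ut S dv; have [i2B e2B] := sd_ut SB dv.
  have ib : intg T (fun r => b (W' r) v).
    have -> : (fun r => b (W' r) v) = (fun r => b v (W' r)).
      by apply/funext => r; rewrite (si_sym sb dv2 (X12 (dom_sub s1 (dwtB r) (dwt r)))).
    exact (smeas_intg_funct s1 sW' iW'1 lb).
  have dUr r : D1 (Ur r) by case: sUr.
  have ia : intg T (fun r => a (Ur r) v).
    have -> : (fun r => a (Ur r) v) = (fun r => a v (Ur r)) by apply/funext => r; rewrite (si_sym sa dv (dUr r)).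
    exact (smeas_intg_funct s1 sUr iUr1 la).
  (* [rho] is defined from the other terms of the equation, whose integrability in time is known; it
     equals the pairing with the differences of xi and g(u) almost everywhere. *)
  exists (fun r => b (W' r) v - (utB r v - ut r v) - a (Ur r) v); split.
  - exact (intgB (intgB ib (intgB i2B i2)) ia).
  - move=> s t s0_ st tT; have sT : 0 <= s <= T by rewrite s0_ (le_trans st).
    have tT' : 0 <= t <= T by rewrite tT (le_trans s0_).
    rewrite (itgB s0_ tT (intgB ib (intgB i2B i2)) ia) (itgB s0_ tT ib (intgB i2B i2)) (itgB s0_ tT i2B i2).
    rewrite -(e2 s t s0_ st tT) -(e2B s t s0_ st tT).
    have E : itg (fun r => b (W' r) v) s t = b (W t - W s) v.
      rewrite (si_Bl sb (X12 (dW t)) (X12 (dW s)) dv2) (si_sym sb (X12 (dW t)) dv2) (si_sym sb (X12 (dW s)) dv2).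
      rewrite (ftc _ lb s t s0_ st tT); congr (itg _ s t); apply/funext => r.
      by rewrite (si_sym sb dv2 (X12 (dom_sub s1 (dwtB r) (dwt r)))).
    have [[ds dt] [dsB dtB]] : (D2 (u s) /\ D2 (u t)) /\ (D2 (uB s) /\ D2 (uB t)).
      by split; split; [have [] := sd_u S sT|have [] := sd_u S tT'|have [] := sd_u SB sT|have [] := sd_u SB tT'].
    rewrite E (si_Bl sb (dU _ tT') (dU _ sT) dv2) (si_Bl sb dtB dt dv2) (si_Bl sb dsB ds dv2).
    have key (c1 c2 c3 c4 c5 c6 : R) : c1 - c2 - (c3 - c4) + c5 + (c6 - (c1 - c3 - (c2 - c4)) - c5) = c6 by ring.
    exact: key.
  have A1 := ae_timeS2 (fun t _ x y => conj x y) (sd_v S dv) (sd_v SB dv).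
  have A2 := ae_timeS2 (fun t _ x y => conj x y) (sd_xi S) (sd_xi SB).
  have A3 := ae_timeS2 (fun t _ x y => conj x y) (sd_gamma S) (sd_gamma SB).
  have A4 := ae_timeS2 (fun t _ x y => conj x y) (sd_urE S) (sd_urE SB).
  apply: ae_timeS2 (ae_timeS2 (fun t _ x y => conj x y) A1 A2) (ae_timeS2 (fun t _ x y => conj x y) A3 A4).
  move=> r /andP[r0 rT] [[h1 h1B] [[dxi nxi] [dxiB nxiB]]] [[ga gaB] [ue ueB]].
  have rT' : 0 <= r <= T by rewrite !ltW.
  have [du duB] : D2 (u r) /\ D2 (uB r) by split; [have [] := sd_u S rT'|have [] := sd_u SB rT'].
  have [dg dgB] := (lipschitz_L2 oOm bOm lg du, lipschitz_L2 oOm bOm lg duB).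
  have [dur durB] : D1 (ur r) /\ D1 (urB r) by split; [case: (sd_ur S)|case: (sd_ur SB)].
  pose Xi : V := (fun x => xiB (x, r)) - (fun x => xi (x, r)).
  pose G : V := (fun x => g (uB r x)) - (fun x => g (u r x)).
  have dXi : D2 Xi := dom_sub s2 dxiB dxi.
  have dG : D2 G := dom_sub s2 dgB dg.
  have E : b (W' r) v - (utB r v - ut r v) - a (Ur r) v = b Xi v + b G v.
    rewrite /W' (si_Bl sb (X12 (dwtB r)) (X12 (dwt r)) dv2) -h1 -h1B /Ur (si_Bl sa durB dur dv).
    rewrite /Xi (si_Bl sb dxiB dxi dv2) /G (si_Bl sb dgB dg dv2).
    move: (utB r v) (ut r v) (a (urB r) v) (a (ur r) v) => c1 c2 c3 c4.
    move: (b _ v) (b _ v) (b _ v) (b _ v) => c5 c6 c7 c8; ring.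
  rewrite E; have dUr2 := dU r rT'.
  have k1 : - (L * n2 (U r) * n2 v) <= b G v.
    rewrite lerNl; apply: (le_trans (ler_norm _)); rewrite normrN; apply: (le_trans (ip_CS oOm dG dv2)).
    by rewrite ler_wpM2r//; exact: fnrm_lipschitz.
  have k2 : 0 <= b Xi (U r).
    apply: (ip_ge0_ae dXi dUr2); apply: (@filterS2 _ (almost_everywhere leb3) _ _ _ _ _ ga gaB) => x h h' Omx.
    exact: (mg (uB r x, xiB (x, r)) (u r x, xi (x, r)) (h' Omx) (h Omx)).
  have k3 : - (M r * n2 (v - U r)) <= b Xi (v - U r).
    rewrite lerNl; apply: (le_trans (ler_norm _)); rewrite normrN.
    apply: (le_trans (ip_CS oOm dXi (dom_sub s2 dv2 dUr2))); rewrite ler_wpM2r//.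
    apply: (le_trans (fnrmB s2 dxiB dxi)); rewrite addrC /M.
    by apply: lerD; [apply: (le_trans nxi)|apply: (le_trans nxiB)]; exact: ler_norm.
  have k4 : b Xi v = b Xi (U r) + b Xi (v - U r).
    by rewrite (si_Br sb dv2 dUr2 dXi) addrC subrK.
  have k5 : b Xi (v - U r) <= b Xi (U r) + b Xi (v - U r) by rewrite lerDr.
  rewrite k4 [leRHS]addrC; exact (lerD k1 (le_trans k3 k5)).
have EL (t : R) (tT : 0 <= t <= T) := energy_le s1 s2 sb sa X12 n2E n1E T0 al0 L0 dWT sW' iW' ftc dU unifU
  sUr iUr UrU mu0 imu M0 iM dLam lam00 Lam0 LamB eq1 eq2 tT.
split.
- by split; [exact: cW|exact (energy_n2_continuous s2 dU unifU)].
- split; [|exact (energy_intg_grad s1 s2 sb sa X12 n2E n1E sUr iUr)|exact: im1].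
  exact (energy_intg_dt s1 s2 sa X12 n2E n1E sW' iW').
- by move=> t tT; exact (W_sq s1 s2 sb sa X12 n2E n1E T0 dWT sW' iW' ftc tT).
exists (fun t => Lam t (W t)), (energy (L2 Om) a alpha W W' U Lam 0); split.
- rewrite /energy itgxx addr0.
  have h1 : alpha / 2 * a (W 0) (W 0) <= alpha / 2 * n1 (W 0) ^+ 2.
    by rewrite ler_wpM2l ?divr_ge0//; exact: (ip_grad_le_H1 oOm bOm (dW 0)).
  have := Lam0 _ (dW 0); rewrite ler_norml => /andP[h2 _].
  rewrite lerNl in h2; exact (lerD (lerD h1 (lexx _)) h2).
- move=> t tT; have := EL t tT; rewrite /energy.
  have -> : n1 (W t) ^+ 2 - n2 (W t) ^+ 2 = a (W t) (W t).
    by rewrite (n1E (dW t)) (n2E (X12 (dW t))) [X in X - _]addrC addrK.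
  exact: id.
- by move=> t tT; apply: (le_trans (ler_norm _)); exact: LamC.
Qed.

End difference.

(** * The error estimate *)

Lemma sqrte_sqD_le (R : realType) (x y : \bar R) (p q : R) : (0 <= x)%E -> (0 <= y)%E ->
  (x <= p%:E)%E -> (y <= q%:E)%E -> (sqrte (x ^+ 2 + y ^+ 2) <= (p + q)%:E)%E.
Proof.
case: x => [x| |] //; case: y => [y| |] //; rewrite !lee_fin => x0 y0 xp yq.
have pq0 : 0 <= p + q by lra.
rewrite -[leRHS](ger0_norm pq0) -sqrtr_sqr; apply: ler_wsqrtr; nra.
Qed.

Lemma fnrm_eqB (R : realType) (V : lmodType R) (X : nspace V) (x1 y1 x2 y2 : V) : snormed X ->
  dom X x1 -> dom X y1 -> dom X x2 -> dom X y2 -> fnrm X (x1 - y1) = 0 -> fnrm X (x2 - y2) = 0 ->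
  fnrm X (x1 - x2) = fnrm X (y1 - y2).
Proof.
move=> sX d1 e1 d2 e2 h1 h2.
have := ler_dist_fnrm sX (dom_sub sX d1 d2) (dom_sub sX e1 e2).
have -> : x1 - x2 - (y1 - y2) = (x1 - y1) - (x2 - y2) by rewrite opprD addrACA -opprD.
move=> /le_trans/(_ (fnrmB sX (dom_sub sX d1 e1) (dom_sub sX d2 e2))).
by rewrite h1 h2 addr0 normr_le0 subr_eq0 => /eqP.
Qed.

Section error.
Context {R : realType} (Om : set (space3 R)) (oOm : open Om) (bOm : bounded_set Om)
  (T : R) (T0 : 0 < T).
Local Notation V := (space3 R -> R^o).
Local Notation V' := (V -> R^o).
Local Notation D1 := (dom (H1 Om)).
Local Notation D2 := (dom (L2 Om)).
Local Notation n1 := (fnrm (H1 Om)).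
Local Notation n2 := (fnrm (L2 Om)).
Local Notation b := (ip Om).
Local Notation a := (ip_grad Om).
Let s1 : snormed (H1 Om) := sH1 oOm bOm.
Let s2 : snormed (L2 Om) := sL2 oOm.
Let s1' : snormed (H1' Om) := snormed_dual s1.
Let sb : semi_inner D2 b := si_ip oOm.
Let X12 x : D1 x -> D2 x := @dH1_dL2 R Om x.
Let X12n x : D1 x -> n2 x <= n1 x := @fnrm_L2_H1 R Om oOm bOm x.
Let sa : semi_inner D1 a := si_ip_grad oOm bOm.
Let n2E x : D2 x -> n2 x ^+ 2 = b x x := @L2_fnrmE R Om oOm x.
Let n1E x : D1 x -> n1 x ^+ 2 = b x x + a x x := @H1_fnrm_sq R Om oOm bOm x.
Let T0' : 0 <= T := ltW T0.
Let z0 : 0 <= (0 : R) := lexx 0.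
Let n10 x : 0 <= n1 x := fnrm_ge0 s1 x.
Let n20 x : 0 <= n2 x := fnrm_ge0 s2 x.

Let icst (k : R) : intg T (fun=> k).
Proof. exact: intg_cst. Qed.

(** The norm of the sum space is an infimum; the strict bound yields an actual decomposition below
    K. Cauchy-Schwarz in time turns the L2 part into an L1 bound at the cost of sqrt T. *)
Lemma source_split (f fB : R -> V') (K : R) : (nrm (source_space Om T) (fB - f)%R < K%:E)%E ->
  exists (F1 : R -> V') (F2 : R -> V),
  [/\ smeas (H1' Om) F1 /\ intg T (fun t => fnrm (H1' Om) (F1 t)),
      smeas (L2 Om) F2 /\ intg T (fun t => n2 (F2 t)),
      (forall v, D1 v -> ae_time T (fun t => fB t v - f t v = F1 t v + b (F2 t) v)) &
      itg (fun t => fnrm (H1' Om) (F1 t)) 0 T + itg (fun t => n2 (F2 t)) 0 T <= (Num.sqrt T + 1) * K].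
Proof.
move=> /ereal_inf_lt[_ [G1 [G2 [dG1 dG2 e ->]]] lt].
have dG11 := LpT2_LpT1 s1' T0 dG1.
have [F1 sF1 E1] := smeas_of s1' (let: And3 _ x _ := dG1 in x) (let: And3 x _ _ := dG1 in x).
have [F2 sF2 E2] := smeas_of s2 (let: And3 _ x _ := dG2 in x) (let: And3 x _ _ := dG2 in x).
have i1 := LpT1_intg s1' sF1 E1 dG11; have i12 := LpT2_intg s1' sF1 E1 dG1.
have i2 := LpT1_intg s2 sF2 E2 dG2.
have J0 : 0 <= itg (fun t => n2 (F2 t)) 0 T by exact: itg_ge0.
exists F1, F2; split; [by split|by split| |].
- move=> v dv; apply: ae_timeS2 E1 E2 => t _ e1 e2.
  have h : (fB - f) t v = (G1 + (fun t => emb Om (G2 t))) t v by rewrite e.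
  rewrite e1 e2; exact: h.
have n1e := LpT2_nrm s1' sF1 E1 i12.
have n2e : nrm (LpT T (L2 Om) 1%E) G2 = (itg (fun t => n2 (F2 t)) 0 T)%:E.
  rewrite (LpT_nrm s2 ltr01 sF2 E2) invr1.
  have -> : (fun t => (n2 (F2 t) `^ 1)%:E) = (EFin \o (fun t => n2 (F2 t))).
    by apply/funext => t; rewrite /= powRr1.
  rewrite poweRe1; last by apply: integral_ge0 => t _; rewrite lee_fin.
  rewrite /itg /Rintegral fineK//; apply: integrable_fin_num => //; exact: measurable_itv.
move: lt; rewrite n1e n2e -EFinD lte_fin.
have := itg_CS T0' (lexx T) i1 i12.
have I0 : 0 <= itg (fun t => fnrm (H1' Om) (F1 t)) 0 T by apply: itg_ge0 => t; exact: (fnrm_ge0 s1').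
move: I0 J0; move: (itg _ 0 T) (itg _ 0 T) (itg _ 0 T) => I2 J I I0 J0 CS lt.
have IS : I <= Num.sqrt T * Num.sqrt I2.
  by rewrite -sqrtrM// -[leLHS](ger0_norm I0) -sqrtr_sqr; exact: ler_wsqrtr.
have s0 := sqrtr_ge0 T; rewrite mulrDl mul1r.
apply: lerD; last by have := sqrtr_ge0 I2; lra.
by apply: (le_trans IS); rewrite ler_wpM2l//; lra.
Qed.

Lemma initial_bound (alpha : R) (v0 v0B W0 U0 : V) : 0 <= alpha -> D2 v0 -> D2 v0B -> D1 W0 -> D2 U0 ->
  forall v, D1 v -> `|b v0B v - b v0 v + alpha * a W0 v + b U0 v| <=
    (fnrm (H1' Om) (emb Om (v0B - v0)) + alpha * n1 W0 + n2 U0) * n1 v.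
Proof.
move=> al0 dv0 dv0B dW dU v dv.
have h1 : `|b v0B v - b v0 v| <= fnrm (H1' Om) (emb Om (v0B - v0)) * n1 v.
  rewrite -(si_Bl sb dv0B dv0 (X12 dv)).
  exact (dual_le s1 (ip_dualH1 oOm bOm (dom_sub s2 dv0B dv0)) dv).
have h2 : `|alpha * a W0 v| <= alpha * n1 W0 * n1 v.
  by rewrite normrM ger0_norm// -mulrA ler_wpM2l// ip_grad_CS.
have h3 : `|b U0 v| <= n2 U0 * n1 v.
  by apply: (le_trans (ip_CS oOm dU (X12 dv))); rewrite ler_wpM2l//; exact: X12n.
rewrite !mulrDl; apply: (le_trans (ler_normD _ _)); apply: lerD => //.
by apply: (le_trans (ler_normD _ _)); exact: lerD.
Qed.

(** * From bounds in time to the norms of the statement *)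

Section norms.
Context (alpha beta : R) (gamma : set (R * R)) (g : R -> R) (f fB : R -> V')
  (w0 v0 u0 w0B v0B u0B : V) (w u wB uB : R -> V) (xi xiB : space3 R * measurableTypeR R -> R^o)
  (wc wt ur wcB wtB urB : R -> V) (pc wtt ut pcB wttB utB : R -> V') (m mB : R -> R)
  (S : solution_data Om T alpha 0 gamma g f w0 v0 u0 w u xi wc wt ur pc wtt ut m)
  (SB : solution_data Om T alpha beta gamma g fB w0B v0B u0B wB uB xiB wcB wtB urB pcB wttB utB mB)
  (K : R) (K0 : 0 <= K).

Let dwt t : D1 (wt t). Proof. by case: (sd_wt S). Qed.
Let dwtB t : D1 (wtB t). Proof. by case: (sd_wt SB). Qed.
Let ae2 (P Q : R -> Prop) : ae_time T P -> ae_time T Q -> ae_time T (fun t => P t /\ Q t) :=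
  ae_timeS2 (fun t _ x y => conj x y).

Lemma intg_sd_wc : intg T (fun t => n1 (wc t)).
Proof.
exact (within_integrable (energy_n1_continuous s1 sb sa X12 n1E T0 (fun t _ => sd_wc S t) (sd_wt S) (sd_intg_wt S) (sd_ftc S))).
Qed.

(** The norm refers to the derivative of w_beta - w chosen in L2, whereas [wtB] and [wt] represent
    derivatives chosen in H1. Embedding and uniqueness identify them almost everywhere. *)
Lemma velocity_norm_le : (forall t : R, 0 <= t <= T -> n2 (wcB t - wc t) <= K) ->
  intg T (fun t => n2 (wtB t - wt t) ^+ 2) -> itg (fun t => n2 (wtB t - wt t) ^+ 2) 0 T <= K ^+ 2 ->
  (nrm (H1T T (L2 Om)) (wB - w)%R <= (Num.sqrt T * K + K)%:E)%E.
Proof.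
move=> HK iW' itW'.
have intg_rep (p : R -> V) (k : R -> R) : smeas (L2 Om) p -> ae_time T (fun t => n2 (p t) ^+ 2 <= k t) ->
    intg T k -> intg T (fun t => n2 (p t) ^+ 2).
  move=> sp pk; apply: intg_ae_le; last by apply: ae_timeS pk => t _; rewrite ger0_norm// sqr_ge0.
  by apply: measurable_funX; apply: measurable_funTS; exact: smeas_measurable_fnrm s2 _ sp.
have nrm0 (p : R) (f_ : R -> V) : (0 <= nrm (LpT T (L2 Om) 2%:E) f_)%E by exact: Lnorm_ge0.
have dW := sd_dom_w S; have dWB := sd_dom_w SB.
have [w' sw' ew'] := smeas_of s1 (let: And3 _ x _ := dW in x) (let: And3 x _ _ := dW in x).
have [wB' swB' ewB'] := smeas_of s1 (let: And3 _ x _ := dWB in x) (let: And3 x _ _ := dWB in x).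
apply: (sqrte_sqD_le (nrm0 0 _) (nrm0 0 _)).
  have sd := smeas_embed s1 s2 X12 X12n (smeasB s1 swB' sw').
  have bd : ae_time T (fun t => n2 (wB' t - w' t) ^+ 2 <= K ^+ 2).
    apply: ae_timeS2 (ae2 ew' ewB') (ae2 (sd_w S) (sd_w SB)) => t /andP[t0 tT] [-> ->] [[d e] [dB eB]].
    have tT' : 0 <= t <= T by rewrite !ltW.
    have c0 x : D1 x -> n1 x = 0 -> n2 x = 0.
      by move=> dx x0; apply/eqP; rewrite eq_le (fnrm_ge0 s2) andbT -x0; exact: X12n.
    have dc := sd_wc S t; have dcB := sd_wc SB t.
    rewrite -(fnrm_eqB s2 (X12 dcB) (X12 dB) (X12 dc) (X12 d) (c0 _ (dom_sub s1 dcB dB) eB) (c0 _ (dom_sub s1 dc d) e)).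
    by rewrite ler_sqr ?nnegrE//; exact: HK.
  have ib := intg_rep _ _ sd bd (icst _).
  apply: (LpT2_le s2 sd _ ib); last 1 first.
  - apply: (le_trans (itg_ae_le z0 (lexx T) ib (icst _) bd)).
    by rewrite itg_cst// subr0 exprMn sqr_sqrtr// mulrC.
  - by apply: ae_timeS2 ew' ewB' => t _ e1 e2; rewrite e1 e2.
  - by rewrite mulr_ge0// sqrtr_ge0.
have [dt tdw] := sd_tderiv S; have [dtB tdwB] := sd_tderiv SB.
have aeD (f_ : R -> V) p : dom (LpT T (H1 Om) p) f_ -> ae_time T (fun t => D1 (f_ t)) by case.
pose g2 t := tderiv T (H1 Om) wB t - tderiv T (H1 Om) w t.
have aeB (f1 f2 : R -> V) : ae_time T (fun t => D1 (f1 t)) -> ae_time T (fun t => D1 (f2 t)) ->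
    ae_time T (fun t => D1 (f1 t - f2 t)).
  by apply: ae_timeS2 => t _; exact: dom_sub.
have tg2 : is_tderiv T (L2 Om) (fun t => wB t - w t) g2.
  apply: (is_tderiv_embed s1 s2 X12 X12n (aeB _ _ (aeD _ _ dWB) (aeD _ _ dW)) (aeB _ _ (aeD _ _ dtB) (aeD _ _ dt))).
  exact: (is_tderivB s1 (aeD _ _ dWB) (aeD _ _ dtB) (aeD _ _ dW) (aeD _ _ dt) tdwB tdw).
have sW' := smeas_embed s1 s2 X12 X12n (smeasB s1 (sd_wt SB) (sd_wt S)).
have W'E : ae_time T (fun t => wtB t - wt t = g2 t).
  by apply: ae_timeS2 (sd_wtE SB) (sd_wtE S) => t _ e1 e2; rewrite e1 e2.
have dg2 : dom (LpT T (L2 Om) 1%E) g2.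
  apply: (LpT2_LpT1 s2 T0); apply: (LpT_dom s2 (ltr0n _ 2) sW' W'E).
  have -> : (fun t => n2 (wtB t - wt t) `^ 2) = (fun t => n2 (wtB t - wt t) ^+ 2).
    by apply/funext => t; rewrite powR_mulrn.
  exact: iW'.
have [dg1 tg1] := tderivP (ex_intro _ g2 (conj dg2 tg2)).
have U := tderiv_unique s2 T0 (fun y dy => ip_dualL2 oOm dy) (fun y dy => esym (n2E dy)) (si_sym sb)
  (ae_timeS (fun t _ => @X12 _) (aeB _ _ (aeD _ _ dWB) (aeD _ _ dW))) dg1 dg2 tg1 tg2.
have [h sh eh] := smeas_of s2 (let: And3 _ x _ := dg1 in x) (let: And3 x _ _ := dg1 in x).
have dh t : D2 (h t) by case: sh.
have bd : ae_time T (fun t => n2 (h t) ^+ 2 <= n2 (wtB t - wt t) ^+ 2).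
  apply: ae_timeS2 (ae2 U eh) W'E => t _ [e1 e2] e3.
  have dW' := X12 (dom_sub s1 (dwtB t) (dwt t)).
  by rewrite (eq_fnrm0 s2 (dh t) dW')// e2 e3.
have ib := intg_rep _ _ sh bd iW'.
apply: (LpT2_le s2 sh eh ib K0); apply: le_trans itW'.
exact: (itg_ae_le z0 (lexx T) ib iW' bd).
Qed.

(** The constant adds sqrt T + 1 for the norm of H^1(0,T;L2), 1 for each of the two supremum norms,
    and sqrt(T + 1) for L^2(0,T;H1), where |U|^2 contributes T K^2 and the gradient K^2. *)
Lemma error_norms : (forall t : R, 0 <= t <= T -> n1 (wcB t - wc t) <= K) ->
  (forall t : R, 0 <= t <= T -> n2 (uB t - u t) <= K) ->
  intg T (fun t => n2 (wtB t - wt t) ^+ 2) -> itg (fun t => n2 (wtB t - wt t) ^+ 2) 0 T <= K ^+ 2 ->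
  intg T (fun t => a (urB t - ur t) (urB t - ur t)) ->
  itg (fun t => a (urB t - ur t) (urB t - ur t)) 0 T <= K ^+ 2 ->
  (nrm (capS (H1T T (L2 Om)) (LpT T (H1 Om) +oo)) (wB - w)%R
     + nrm (capS (LpT T (L2 Om) +oo) (LpT T (H1 Om) 2%:E)) (uB - u)%R
     <= ((Num.sqrt T + Num.sqrt (T + 1) + 3) * K)%:E)%E.
Proof.
move=> HW HU iW' itW' iUr itUr.
have e1 : (nrm (H1T T (L2 Om)) (wB - w)%R <= (Num.sqrt T * K + K)%:E)%E.
  apply: velocity_norm_le => // t tT; apply: (le_trans _ (HW t tT)).
  exact: (X12n (dom_sub s1 (sd_wc SB t) (sd_wc S t))).
have e2 : (nrm (LpT T (H1 Om) +oo) (wB - w)%R <= K%:E)%E.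
  apply: (LpToo_le s1 K0); apply: ae_timeS2 (sd_w S) (sd_w SB) => t /andP[t0 tT] [d e] [dB eB].
  have tT' : 0 <= t <= T by rewrite !ltW.
  have E := fnrm_eqB s1 (sd_wc SB t) dB (sd_wc S t) d eB e.
  have H := HW t tT'; rewrite E in H.
  by rewrite -lee_fin -(nrmE s1 (dom_sub s1 dB d)) in H.
have e3 : (nrm (LpT T (L2 Om) +oo) (uB - u)%R <= K%:E)%E.
  apply: (LpToo_le s2 K0); apply: ae_timeW => t /andP[t0 tT].
  have tT' : 0 <= t <= T by rewrite !ltW.
  have H := HU t tT'; have [d _] := sd_u S tT'; have [dB _] := sd_u SB tT'.
  by rewrite -lee_fin -(nrmE s2 (dom_sub s2 dB d)) in H.
have e4 : (nrm (LpT T (H1 Om) 2%:E) (uB - u)%R <= (Num.sqrt (T + 1) * K)%:E)%E.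
  have T1 : 0 <= T + 1 by rewrite addr_ge0.
  have sUr := smeasB s1 (sd_ur SB) (sd_ur S); have dUr t : D1 (urB t - ur t) by case: sUr.
  have bd : ae_time T (fun t => n1 (urB t - ur t) ^+ 2 <= K ^+ 2 + a (urB t - ur t) (urB t - ur t)).
    apply: ae_timeS2 (sd_urE S) (sd_urE SB) => t /andP[t0 tT] eS eB.
    have tT' : 0 <= t <= T by rewrite !ltW.
    rewrite (n1E (dUr t)) -(n2E (X12 (dUr t))) lerD2r ler_sqr ?nnegrE// eS eB; exact: HU.
  have ic := intgD (icst (K ^+ 2)) iUr.
  have ib : intg T (fun t => n1 (urB t - ur t) ^+ 2).
    apply: (intg_ae_le _ _ ic); last by apply: ae_timeS bd => t _; rewrite ger0_norm// sqr_ge0.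
    by apply: measurable_funX; apply: measurable_funTS; exact: smeas_measurable_fnrm s1 _ sUr.
  apply: (LpT2_le s1 sUr _ ib).
  - by apply: ae_timeS2 (sd_urE S) (sd_urE SB) => t _ eS eB; rewrite eS eB.
  - by rewrite mulr_ge0// sqrtr_ge0.
  apply: (le_trans (itg_ae_le z0 (lexx T) ib ic bd)).
  rewrite (itgD z0 (lexx T) (icst (K ^+ 2)) iUr) itg_cst// subr0 exprMn sqr_sqrtr// mulrDl mul1r mulrC.
  by rewrite lerD2l.
have -> : (Num.sqrt T + Num.sqrt (T + 1) + 3) * K = Num.sqrt T * K + K + K + (K + Num.sqrt (T + 1) * K).
  by move: (Num.sqrt T) (Num.sqrt (T + 1)) => p q; clear; ring.
rewrite EFinD [in leRHS]EFinD [X in (_ <= _ + X)%E]EFinD.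
exact: leeD (leeD e1 e2) (leeD e3 e4).
Qed.

End norms.
End error.

Lemma sum3_le (R : realFieldType) (x y z p q : R) : 0 <= x -> 0 <= y -> 0 <= z -> x + y + z <= p -> p <= q ->
  [/\ 0 <= x <= q, 0 <= y <= q & 0 <= z <= q].
Proof. by move=> x0 y0 z0 xyz pq; split; apply/andP; split; lra. Qed.

Lemma sum4_le (R : realType) (x y p q C beta : R) : 0 <= x -> 0 <= y -> 0 <= p -> 0 <= q -> 0 <= C -> 0 <= beta ->
  x ^+ 2 + y ^+ 2 + p + q <= C * beta ^+ 2 ->
  [/\ x <= Num.sqrt C * beta, y <= Num.sqrt C * beta, p <= (Num.sqrt C * beta) ^+ 2 & q <= (Num.sqrt C * beta) ^+ 2].
Proof.
move=> x0 y0 p0 q0 C0 b0; have -> : C * beta ^+ 2 = (Num.sqrt C * beta) ^+ 2 by rewrite exprMn sqr_sqrtr.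
have K0 : 0 <= Num.sqrt C * beta by rewrite mulr_ge0// sqrtr_ge0.
move: K0; move: (Num.sqrt C * beta) => K K0 H; have x20 := sqr_ge0 x; have y20 := sqr_ge0 y.
by split; [rewrite -(ler_sqr (x:=x)) ?nnegrE//|rewrite -(ler_sqr (x:=y)) ?nnegrE//| |]; lra.
Qed.

(** d1, d2 and d3 are the errors of w_0 in H1, v_0 in the dual and u_0 in L2. The first bound is for
    Lambda at time 0, the second for the initial energy, where 3 + 2 alpha exceeds 5/2 + 3 alpha /
    2. *)
Lemma initial_energy_rate (R : realType) (alpha r d1 d2 d3 : R) : 0 <= alpha ->
  0 <= d1 <= r -> 0 <= d2 <= r -> 0 <= d3 <= r ->
  d2 + alpha * d1 + d3 <= (2 + alpha) * r /\
  alpha / 2 * d1 ^+ 2 + 2^-1 * d3 ^+ 2 + (d2 + alpha * d1 + d3) * d1 <= (3 + 2 * alpha) * r ^+ 2.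
Proof.
move=> al0 /andP[d10 d1r] /andP[d20 d2r] /andP[d30 d3r].
have l1 : alpha * d1 <= alpha * r by rewrite ler_wpM2l.
have l2 : d2 + alpha * d1 + d3 <= (2 + alpha) * r by lra.
have r0 : 0 <= r := le_trans d10 d1r.
have h0 : 0 <= d2 + alpha * d1 + d3 by rewrite !addr_ge0// mulr_ge0.
split => //; have h1 : d1 ^+ 2 <= r ^+ 2 by rewrite ler_sqr ?nnegrE.
have h3 : d3 ^+ 2 <= r ^+ 2 by rewrite ler_sqr ?nnegrE.
have h4 : (d2 + alpha * d1 + d3) * d1 <= (2 + alpha) * r * r by exact: ler_pM.
have h5 : alpha * d1 ^+ 2 <= alpha * r ^+ 2 by rewrite ler_wpM2l.
have h6 : 0 <= alpha * r ^+ 2 by rewrite mulr_ge0// sqr_ge0.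
have h7 := sqr_ge0 r.
have e : (2 + alpha) * r * r = 2 * r ^+ 2 + alpha * r ^+ 2 by ring.
rewrite e in h4; lra.
Qed.

(** One k for all smallness conditions of [energy_gronwall]: with s = sqrt T, (s + 1)(cc + 1) comes
    from the source splitting, J from beta grad w, and cc + cc^2 covers initial errors that enter
    linearly and quadratically. *)
Lemma rate_constant (R : realType) (s cc J alpha beta : R) : 0 <= s -> 0 <= cc -> 0 <= J -> 0 <= alpha -> 0 <= beta ->
  let k := (s + 1) * (cc + 1) + J + (3 + 2 * alpha) * (cc + cc ^+ 2) in
  [/\ 0 <= k, (s + 1) * ((cc + 1) * beta) + beta * J <= k * beta, (2 + alpha) * (cc * beta) <= k * beta,
      (3 + 2 * alpha) * (cc * beta) ^+ 2 <= k * beta ^+ 2 & cc * beta <= k * beta].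
Proof.
move=> s0 c0 J0 al0 b0 k.
have h1 : 0 <= (s + 1) * (cc + 1) by rewrite mulr_ge0// addr_ge0.
have h2 : 0 <= alpha * cc by rewrite mulr_ge0.
have h3 : 0 <= (3 + 2 * alpha) * cc ^+ 2 by rewrite mulr_ge0 ?sqr_ge0// addr_ge0// mulr_ge0.
have kE : k = (s + 1) * (cc + 1) + J + (3 * cc + 2 * (alpha * cc)) + (3 + 2 * alpha) * cc ^+ 2 by rewrite /k; ring.
have [l1 l2 l3 l4] : [/\ (s + 1) * (cc + 1) + J <= k, (2 + alpha) * cc <= k, (3 + 2 * alpha) * cc ^+ 2 <= k & cc <= k].
  by rewrite kE mulrDl; split; lra.
have k0 : 0 <= k := le_trans c0 l4.
split=> //; try exact: ler_wpM2r.
- have -> : (s + 1) * ((cc + 1) * beta) + beta * J = ((s + 1) * (cc + 1) + J) * beta by ring.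
  exact: ler_wpM2r.
- by rewrite mulrA; exact: ler_wpM2r.
- by rewrite exprMn mulrA; apply: ler_wpM2r => //; exact: sqr_ge0.
Qed.

Theorem theorem3p3 (R : realType) (Om : set (space3 R)) (T alpha : R)
  (B : set R) (gamma : set (R * R)) (phi : R -> \bar R) (g : R -> R)
  (f : R -> (space3 R -> R^o) -> R^o) (w0 v0 u0 : space3 R -> R^o)
  (fB : R -> R -> (space3 R -> R^o) -> R^o)
  (w0B v0B u0B : R -> space3 R -> R^o)
  (c : R)
  (w u : R -> space3 R -> R^o)
  (xi : space3 R * measurableTypeR R -> R^o)
  (wB uB : R -> R -> space3 R -> R^o)
  (xiB : R -> space3 R * measurableTypeR R -> R^o) :
  bounded_smooth_domain Om ->
  0 < T ->
  0 < alpha ->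
  (forall beta, B beta -> 0 < beta) ->
  bounded_set B ->
  limit_point B 0 ->
  maximal_monotone gamma ->
  gamma (0, 0) ->
  (forall r, (0 <= phi r)%E) ->
  convex_ereal phi ->
  lower_semicontinuous phi ->
  phi 0 = 0%E ->
  subdifferential phi = gamma ->
  lipschitz g ->
  dom (source_space Om T) f ->
  dom (H1 Om) w0 ->
  dom (L2 Om) v0 ->
  dom (L2 Om) u0 ->
  leb3.-integrable Om (phi \o u0) ->
  (forall beta, B beta ->
     [/\ dom (source_space Om T) (fB beta), dom (H1 Om) (w0B beta),
         dom (L2 Om) (v0B beta), dom (L2 Om) (u0B beta) &
         leb3.-integrable Om (phi \o u0B beta)]) ->
  weak_cvg (source_space Om T) (within B 0^'+) fB f ->
  weak_cvg (H1 Om) (within B 0^'+) w0B w0 ->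
  weak_cvg (L2 Om) (within B 0^'+) v0B v0 ->
  weak_cvg (L2 Om) (within B 0^'+) u0B u0 ->
  (forall beta, B beta ->
     (nrm (source_space Om T) (fB beta - f)%R <= (c * beta)%:E)%E) ->
  (forall beta, B beta ->
     (nrm (H1 Om) (w0B beta - w0)%R
      + nrm (H1' Om) (emb Om (v0B beta - v0)%R)
      + nrm (L2 Om) (u0B beta - u0)%R <= (c * beta)%:E)%E) ->
  (forall beta, B beta ->
     solution Om T alpha beta gamma g (fB beta) (w0B beta) (v0B beta)
       (u0B beta) (wB beta) (uB beta) (xiB beta)) ->
  solution Om T alpha 0 gamma g f w0 v0 u0 w u xi ->
  exists C : R, forall beta, B beta ->
    (nrm (capS (H1T T (L2 Om)) (LpT T (H1 Om) +oo)) (wB beta - w)%R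
     + nrm (capS (LpT T (L2 Om) +oo) (LpT T (H1 Om) 2%:E)) (uB beta - u)%R
     <= (C * beta)%:E)%E.
Proof.
move=> [oOm _ _ bOm _] T0 al0 Bpos bB _ [mg _] _ _ _ _ _ _ lg _ dw0 dv0 du0 _ dB _ _ _ _ Hf Hd HSB HS.
have [s1 s2] : snormed (H1 Om) /\ snormed (L2 Om) by split; [exact (sH1 oOm bOm)|exact (sL2 oOm)].
have s1' : snormed (H1' Om) := snormed_dual s1.
have al0' := ltW al0; have zT : 0 <= (0 : R) <= T by rewrite lexx ltW.
have [L L0 HL] := lipschitz_le lg.
have [wc [wt [ur [pc [wtt [ut [m S]]]]]]] := solutionP oOm bOm T0 dw0 dv0 du0 HS.
(* Boundedness of the parameter set: the Gronwall constant depends on beta only through this upper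
   bound. *)
have [B0 B00 HB0] : exists2 B0 : R, 0 <= B0 & forall beta, B beta -> beta <= B0.
  case: bB => M [_ HM]; exists (`|M| + 1); first by rewrite addr_ge0.
  move=> beta Bb; apply: (le_trans (ler_norm _)); apply: (HM _ _ _ Bb).
  by rewrite (le_lt_trans (ler_norm _))// ltrDl.
have iwc := intg_sd_wc oOm bOm T0 S.
pose J := itg (fun t => fnrm (H1 Om) (wc t)) 0 T.
have J0 : 0 <= J by apply: itg_ge0 => t; exact: (fnrm_ge0 s1).
have kP (beta : R) := @rate_constant R (Num.sqrt T) `|c| J alpha beta (sqrtr_ge0 T) (normr_ge0 c) J0 al0'.
have [k0 _ _ _ _] := kP 0 (lexx 0).
have [C C0 HC] := energy_gronwall T0 al0 L0 k0 B00.
(* The energy is bounded by C beta^2, so each norm is at most sqrt C times beta; the other factor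
   comes from [error_norms]. *)
exists ((Num.sqrt T + Num.sqrt (T + 1) + 3) * Num.sqrt C) => beta Bb.
have b0 := Bpos _ Bb; have b0' := ltW b0.
have [_ k1 k2 k3 k4] := kP beta b0'.
have bB0 : 0 < beta <= B0 by rewrite b0 HB0.
have [_ dw0B dv0B du0B _] := dB _ Bb.
have [wcB [wtB [urB [pcB [wttB [utB [mB SB]]]]]]] := solutionP oOm bOm T0 dw0B dv0B du0B (HSB _ Bb).
(* Enlarging c to |c| + 1 makes the bound strict, as [source_split] requires, and covers every sign
   of c. *)
have lt : (nrm (source_space Om T) (fB beta - f)%R < ((`|c| + 1) * beta)%:E)%E.
  apply: (le_lt_trans (Hf _ Bb)); rewrite lte_fin ltr_pM2r//.
  by apply: (le_lt_trans (ler_norm c)); rewrite ltrDl.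
have [F1 [F2 [[sF1 iF1] [sF2 iF2] HF itF]]] := source_split oOm bOm T0 lt.
have [du0' _] := sd_u S zT; have [du0B' _] := sd_u SB zT.
have dW t : dom (H1 Om) (wcB t - wc t) := dom_sub s1 (sd_wc SB t) (sd_wc S t).
have dUr t : dom (H1 Om) (urB t - ur t).
  by apply: (dom_sub s1); [case: (sd_ur SB)|case: (sd_ur S)].
have E1 := fnrm_eqB s1 (sd_wc SB 0) dw0B (sd_wc S 0) dw0 (sd_w0 SB) (sd_w0 S).
have E3 := fnrm_eqB s2 du0B' du0B du0' du0 (sd_u0 SB) (sd_u0 S).
have Hd' := Hd _ Bb; have dd := dom_sub s2 dv0B dv0.
rewrite (nrmE s1 (dom_sub s1 dw0B dw0)) (nrmE s1' (ip_dualH1 oOm bOm dd)) (nrmE s2 (dom_sub s2 du0B du0)) in Hd'.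
rewrite -E1 -E3 -!EFinD lee_fin in Hd'.
have cb : c * beta <= `|c| * beta := ler_wpM2r b0' (ler_norm c).
have [d1 d2 d3] := sum3_le (fnrm_ge0 s1 _) (fnrm_ge0 s1' _) (fnrm_ge0 s2 _) Hd' cb.
have [r1 r2] := initial_energy_rate al0' d1 d2 d3.
pose lam0 := fnrm (H1' Om) (emb Om (v0B beta - v0)) + alpha * fnrm (H1 Om) (wcB 0 - wc 0) + fnrm (L2 Om) (uB beta 0 - u 0).
have lam00 : 0 <= lam0.
  exact (addr_ge0 (addr_ge0 (fnrm_ge0 s1' _) (mulr_ge0 al0' (fnrm_ge0 s1 _))) (fnrm_ge0 s2 _)).
have Hlam := initial_bound oOm bOm al0' dv0 dv0B (dW 0) (dom_sub s2 du0B' du0').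
have [[cW cU] [ip_ iq im] Wsq [Lx [E0 [HE0 EN HLx]]]] :=
  difference_energy oOm bOm T0 al0' b0' L0 lam00 mg lg HL dv0 dv0B S SB sF1 iF1 sF2 iF2 HF Hlam.
have n2n1 x : dom (H1 Om) x -> 0 <= fnrm (L2 Om) x <= fnrm (H1 Om) x.
  by move=> dx; apply/andP; split; [exact: (fnrm_ge0 s2)|exact: (fnrm_L2_H1 oOm bOm dx)].
have iqn t : 0 <= ip_grad Om (urB t - ur t) (urB t - ur t) := si_ge0 (si_ip_grad oOm bOm) (dUr t).
have m10 t : 0 <= fnrm (H1' Om) (F1 t) + fnrm (L2 Om) (F2 t) + beta * fnrm (H1 Om) (wc t).
  apply: addr_ge0; last exact (mulr_ge0 b0' (fnrm_ge0 s1 _)).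
  by apply: addr_ge0; [exact: (fnrm_ge0 s1')|exact: (fnrm_ge0 s2)].
have itm : itg (fun t => fnrm (H1' Om) (F1 t) + fnrm (L2 Om) (F2 t) + beta * fnrm (H1 Om) (wc t)) 0 T <=
    ((Num.sqrt T + 1) * (`|c| + 1) + J + (3 + 2 * alpha) * (`|c| + `|c| ^+ 2)) * beta.
  rewrite (itgD (lexx 0) (lexx T) (intgD iF1 iF2) (intgZ beta iwc)) (itgD (lexx 0) (lexx T) iF1 iF2).
  rewrite (itgZ beta (lexx 0) (lexx T) iwc); apply: le_trans k1.
  exact: lerD itF (lexx _).
have W0 : fnrm (L2 Om) (wcB 0 - wc 0) <= `|c| * beta.
  by have /andP[_ h] := d1; apply: le_trans h; have /andP[] := n2n1 _ (dW 0).
have EST := HC beta E0 lam0 _ (fun t => fnrm (L2 Om) (wcB t - wc t)) (fun t => fnrm (L2 Om) (uB beta t - u t))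
  (fun t => fnrm (L2 Om) (wtB t - wt t) ^+ 2) _ _ Lx bB0 lam00 (fun t => n2n1 _ (dW t)) (fun t => sqr_ge0 _) iqn m10 ip_ iq im cW cU EN HLx Wsq itm
  (le_trans r1 k2) (le_trans HE0 (le_trans r2 k3)) (le_trans W0 k4).
have TT : 0 <= T <= T by rewrite lexx ltW.
have K0 : 0 <= Num.sqrt C * beta by rewrite mulr_ge0// sqrtr_ge0.
have P (t : R) (tT : 0 <= t <= T) := sum4_le (fnrm_ge0 s1 _) (fnrm_ge0 s2 _) (itg_ge0 0 t (fun r => sqr_ge0 (fnrm (L2 Om) (wtB r - wt r))))
  (itg_ge0 0 t iqn) C0 b0' (EST t tT).
have [_ _ ipT iqT] := P T TT.
rewrite -mulrA; apply: (error_norms oOm bOm T0 S SB K0 _ _ ip_ ipT iq iqT).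
- by move=> t tT; have [h _ _ _] := P t tT.
- by move=> t tT; have [_ h _ _] := P t tT.
Qed.
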